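(* Let $(M_i)_{i\in I}$ be a family of weakly exact $\sigma$-finite von Neumann algebras such that each $M_i$ contains a copy of a fixed von Neumann subalgebra $(B,\varphi)$, where $\varphi$ is a faithful normal state on $B$. Assume that each $M_i$ admits a faithful normal conditional expectation $E_i\colon M_i\to B$. Then the amalgamated free product von Neumann algebra $\overline{*}_{B}(M_i,E_i)_{i\in I}$ is weakly exact.
   Context: For C$^*$-algebras, $\odot$ denotes the algebraic tensor product and $\otimes$ the minimal tensor product. All inclusions $B\subset M_i$ are unital. Weak exactness. A von Neumann algebra $M$ is weakly exact (in the sense of Kirchberg) if for every unital C$^*$-algebra $C$ with a closed two-sided ideal $J$ and every representation $\pi\colon M\otimes C\to\mathbb{B}(\mathcal{K})$ with $M\otimes J\subset\ker\pi$ such that $\pi|_{M\otimes\mathbb{C}}$ is ultraweakly continuous on $M$, the induced representation $\widetilde\pi\colon M\odot (C/J)\to\mathbb{B}(\mathcal{K})$ is continuous with respect to the minimal tensor norm. Amalgamated free product. $(M,E)=\overline{*}_{B}(M_i,E_i)_{i\in I}$ is the (unique up to canonical isomorphism) pair consisting of a von Neumann algebra $M$ with faithful normal unital $*$-homomorphisms $\lambda_i\colon M_i\to M$ all agreeing on $B$ (so that $B$ is viewed as a subalgebra of $M$) and a faithful normal conditional expectation $E\colon M\to B$ such that $M$ is generated as a von Neumann algebra by $\bigcup_i\lambda_i(M_i)$, $E\circ\lambda_i=E_i$ for every $i$, and $E(\lambda_{i_1}(x_1)\cdots\lambda_{i_n}(x_n))=0$ whenever $n\geq 1$, $x_k\in\ker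 E_{i_k}$ and $i_1\neq i_2\neq\cdots\neq i_n$ (consecutive indices distinct). It is realized on the Hilbert space $L^2B\oplus\bigoplus_{n\geq1}\bigoplus_{i_1\neq\cdots\neq i_n}L^2M_{i_1}^{o}\otimes_B\cdots\otimes_B L^2M_{i_n}^{o}$, where $L^2M_i^{o}=L^2M_i\ominus L^2B$ and $\otimes_B$ is the relative tensor product, and does not depend on the choice of $\varphi$. *)

(* Defs.v *)
From HB Require Import structures.
From mathcomp Require Import all_boot all_order all_algebra.
From mathcomp Require Import all_classical all_reals.
From mathcomp Require Import topology normedtype sequences.
From mathcomp Require Import sesquilinear complex.

Set Implicit Arguments.
Unset Strict Implicit.
Unset Printing Implicit Defensive.

Import Order.TTheory GRing.Theory Num.Theory numFieldNormedType.Exports.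

Local Open Scope classical_set_scope.
Local Open Scope complex_scope.
Local Open Scope ring_scope.

(* The library puts the norm topology of a numFieldType F on the alias F^o and
   not on the concrete carrier R[i]. *)
HB.instance Definition _ (R : realType) := NormedModule.copy R[i] R[i]^o.

(* The norm of a normed module over R[i] is R[i]-valued (real and nonnegative).
   The inner product is linear in its first argument. *)
HB.mixin Record isHilbert (R : realType) H of CompleteNormedModule R[i] H := {
  hdot : {dot H for Num.conj};
  hdot_norm : forall x : H, hdot x x = `|x| ^+ 2
}.

#[short(type="hilbertType")]
HB.structure Definition Hilbert (R : realType) :=
  {H of CompleteNormedModule R[i] H & isHilbert R H}.

Reserved Notation "x ** y" (at level 40, left associativity).

(* Unital C*-algebras; the zero algebra is allowed. The product is a field of
   the mixin because Hierarchy Builder has no join of normed Z-modules and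
   rings below numDomainType, where the norm is multiplicative. *)
HB.mixin Record isCStar (R : realType) A of CompleteNormedModule R[i] A := {
  cmul : A -> A -> A;
  cone : A;
  star : A -> A;
  cmulA : associative cmul;
  cmul1r : left_id cone cmul;
  cmulr1 : right_id cone cmul;
  cmulDl : left_distributive cmul +%R;
  cmulDr : right_distributive cmul +%R;
  cmulZl : forall (c : R[i]) (x y : A), cmul (c *: x) y = c *: cmul x y;
  cmulZr : forall (c : R[i]) (x y : A), cmul x (c *: y) = c *: cmul x y;
  starD : {morph star : x y / x + y};
  starZ : forall (c : R[i]) (x : A), star (c *: x) = c^* *: star x;
  starM : forall x y : A, star (cmul x y) = cmul (star y) (star x);
  starK : involutive star;
  cnormM : forall x y : A, `|cmul x y| <= `|x| * `|y|;
  cnorm_star : forall x : A, `|cmul (star x) x| = `|x| ^+ 2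
}.

#[short(type="cstarType")]
HB.structure Definition CStar (R : realType) :=
  {A of CompleteNormedModule R[i] A & isCStar R A}.

Notation "x ** y" := (cmul x y) : ring_scope.

Section BoundedOperators.
Variables (R : realType) (H : hilbertType R).

Definition bounded_op (T : H -> H) : Prop := linear T /\ continuous T.

Definition commutant (S : set (H -> H)) : set (H -> H) :=
  [set T | bounded_op T /\ forall s, S s -> T \o s = s \o T].

Definition bicommutant (S : set (H -> H)) : set (H -> H) :=
  commutant (commutant S).

Definition square_summable (xi : nat -> H) : Prop :=
  cvgn (series (fun n => `|xi n| ^+ 2)).

Definition vector_functional (xi eta : nat -> H) (T : H -> H) : R[i] :=
  limn (series (fun n => hdot (T (xi n)) (eta n))).

(* The ultraweak topology of B(H) is the initial topology for the functionals
   T |-> sum_n <T xi_n, eta_n> with xi and eta square summable. *)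
Definition uw_cvg (F : set_system (H -> H)) (T : H -> H) : Prop :=
  forall xi eta, square_summable xi -> square_summable eta ->
    vector_functional xi eta @ F --> vector_functional xi eta T.

End BoundedOperators.

Section Representations.
Variables (R : realType) (A : cstarType R).

(* *-homomorphism A -> B(H), possibly degenerate. *)
Definition is_rep (H : hilbertType R) (pi : A -> H -> H) : Prop :=
  [/\ forall a, bounded_op (pi a),
      forall c a b v, pi (c *: a + b) v = c *: pi a v + pi b v,
      forall a b v, pi (a ** b) v = pi a (pi b v) &
      forall a v w, hdot (pi (star a) v) w = hdot v (pi a w)].

Definition is_faithful_rep (H : hilbertType R) (pi : A -> H -> H) : Prop :=
  is_rep pi /\ injective pi.

Definition star_hom (D : cstarType R) (f : A -> D) : Prop :=
  [/\ linear f, {morph f : a b / a ** b} & {morph f : a / star a}].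

Definition closed_ideal (J : set A) : Prop :=
  [/\ J 0, forall x y, J x -> J y -> J (x + y),
      forall a x, J x -> J (a ** x) /\ J (x ** a) & closed J].

(* q exhibits Q as the quotient C*-algebra A/J. *)
Definition is_quotient (J : set A) (Q : cstarType R) (q : A -> Q) : Prop :=
  [/\ star_hom q, forall y, exists x, q x = y & forall x, q x = 0 <-> J x].

End Representations.

Section Tensor.
Variable R : realType.

(* Linear span of {tens u v | u : U, S v}, for tens bilinear and S stable
   under scalars. *)
Definition tensor_span (U V W : lmodType R[i]) (tens : U -> V -> W)
    (S : set V) : set W :=
  [set w | exists2 s : seq (U * V), (forall p, p \in s -> S p.2) &
                                    w = \sum_(p <- s) tens p.1 p.2].

Definition is_hilbert_tensor (H L P : hilbertType R) (tens : H -> L -> P)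
    : Prop :=
  [/\ forall l, linear (tens^~ l),
      forall h, linear (tens h),
      forall h h' l l',
        hdot (tens h l) (tens h' l') = hdot h h' * hdot l l' &
      closure (tensor_span tens setT) = setT].

(* T, with tens a d = a (x) d, is the minimal (spatial) tensor product of A
   and D: for faithful representations sigma of A on H and rho of D on L,
   theta identifies T with the norm closure in B(H (x) L) of the span of the
   operators sigma a (x) rho d. An injective *-homomorphism of C*-algebras is
   isometric. *)
Definition is_min_tensor (A D T : cstarType R) (tens : A -> D -> T) : Prop :=
  exists (H L P : hilbertType R) (htens : H -> L -> P)
         (sigma : A -> H -> H) (rho : D -> L -> L) (theta : T -> P -> P),
    [/\ is_hilbert_tensor htens,
        is_faithful_rep sigma, is_faithful_rep rho, is_faithful_rep theta &
        (forall a d h l,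
          theta (tens a d) (htens h l) = htens (sigma a h) (rho d l)) /\
        closure (tensor_span tens setT) = setT].

End Tensor.

(* A von Neumann algebra on vn_space, with vn_rep the inclusion in
   B(vn_space). *)
Record vonNeumann (R : realType) := VonNeumann {
  vn_alg :> cstarType R;
  vn_space : hilbertType R;
  vn_rep : vn_alg -> vn_space -> vn_space;
  vn_rep_faithful : is_faithful_rep vn_rep;
  vn_rep_unital : vn_rep cone = id;
  vn_bicommutant : bicommutant (range vn_rep) = range vn_rep
}.

Section VonNeumann.
Variable R : realType.
Implicit Types M N B : vonNeumann R.

Definition vn_uw_cvg M (F : set_system M) (x : M) : Prop :=
  uw_cvg (@vn_rep R M @ F) (vn_rep x).

Definition uw_continuous_op M (K : hilbertType R) (f : M -> K -> K) : Prop :=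
  forall (F : set_system M) (x : M), Filter F ->
    vn_uw_cvg F x -> uw_cvg (f @ F) (f x).

Definition uw_continuous M N (f : M -> N) : Prop :=
  uw_continuous_op (fun x => vn_rep (f x)).

Definition uw_continuous_functional M (f : M -> R[i]) : Prop :=
  forall (F : set_system M) (x : M), Filter F ->
    vn_uw_cvg F x -> f @ F --> f x.

(* Faithful normal unital *-homomorphism: N as a unital von Neumann
   subalgebra of M. *)
Definition vn_embedding N M (f : N -> M) : Prop :=
  [/\ star_hom f, f cone = cone, injective f & uw_continuous f].

Definition faithful_normal_state M (phi : M -> R[i]) : Prop :=
  [/\ linear phi, phi cone = 1,
      forall x, 0 <= phi (star x ** x),
      forall x, phi (star x ** x) = 0 -> x = 0 &
      uw_continuous_functional phi].

Definition conditional_expectation B M (iota : B -> M) (E : M -> B) : Prop :=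
  [/\ linear E, forall b, E (iota b) = b,
      forall b b' x, E (iota b ** x ** iota b') = b ** E x ** b' &
      forall x, exists y, E (star x ** x) = star y ** y].

Definition faithful_normal_cond_exp B M (iota : B -> M) (E : M -> B) : Prop :=
  [/\ conditional_expectation iota E,
      forall x, E (star x ** x) = 0 -> x = 0 & uw_continuous E].

Definition projection M (p : M) : Prop := star p = p /\ p ** p = p.

Definition sigma_finite_vn M : Prop :=
  forall P : set M,
    (forall p, P p -> projection p /\ p <> 0) ->
    (forall p p', P p -> P p' -> p <> p' -> p ** p' = 0) ->
    countable P.

(* (T, tens) and (T', tens') are the minimal tensor products of M with C and
   with Q = C/J. Elements of the algebraic tensor product of M and C/J are the
   sums over s of m (x) y with (m, y) in s; the induced representation sends
   such a sum to the sum of the pit m y, where pit m (c + J) = pi (m (x) c),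
   and its continuity is expressed by an operator norm bound. *)
Definition weakly_exact M : Prop :=
  forall (C Q : cstarType R) (J : set C) (q : C -> Q),
    closed_ideal J -> is_quotient J q ->
  forall (T : cstarType R) (tens : M -> C -> T), is_min_tensor tens ->
  forall (T' : cstarType R) (tens' : M -> Q -> T'), is_min_tensor tens' ->
  forall (K : hilbertType R) (pi : T -> K -> K), is_rep pi ->
    closure (tensor_span tens J) `<=` [set t | forall v, pi t v = 0] ->
    uw_continuous_op (fun m => pi (tens m cone)) ->
  forall pit : M -> Q -> K -> K,
    (forall m c, pit m (q c) = pi (tens m c)) ->
  exists k : R, forall (s : seq (M * Q)) (v : K),
    `|\sum_(p <- s) pit p.1 p.2 v| <=
      k%:C * `|\sum_(p <- s) tens' p.1 p.2| * `|v|.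

(* (N, EN) is the amalgamated free product over B of the (M i, E i), with
   canonical embeddings lambda i; iotaN is the common restriction of the
   lambda i to B. *)
Definition is_amalgamated_free_product (I : Type) B (M : I -> vonNeumann R)
    (iota : forall i, B -> M i) (E : forall i, M i -> B)
    N (iotaN : B -> N) (lambda : forall i, M i -> N) (EN : N -> B) : Prop :=
  [/\ (forall i, vn_embedding (lambda i)) /\
        (forall i b, lambda i (iota i b) = iotaN b),
      faithful_normal_cond_exp iotaN EN,
      range (@vn_rep R N) =
        bicommutant (\bigcup_i range (fun x => vn_rep (lambda i x))),
      forall i x, EN (lambda i x) = E i x &
      forall (n : nat) (w : 'I_n -> I) (x : forall k, M (w k)),
        (0 < n)%N ->
        (forall k l : 'I_n, l = k.+1 :> nat -> w k <> w l) ->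
        (forall k, E (w k) (x k) = 0) ->
        EN (\big[cmul/cone]_(k < n) lambda (w k) (x k)) = 0].

End VonNeumann.

(* Main.v *)
From HB Require Import structures.
Require Import Defs.
From mathcomp Require Import all_boot all_order all_algebra.
From mathcomp Require Import all_classical all_reals.
From mathcomp Require Import topology normedtype sequences.
From mathcomp Require Import sesquilinear complex.
From mathcomp Require Import ring lra.

Set Implicit Arguments.
Unset Strict Implicit.
Unset Printing Implicit Defensive.

Import Order.TTheory GRing.Theory Num.Theory numFieldNormedType.Exports.

Local Open Scope classical_set_scope.
Local Open Scope complex_scope.
Local Open Scope ring_scope.

(** A Toeplitz module is a Hilbert space with representations of the [M i] that agree on [B] and projections [e i]
    such that [e i * m * e i = E i m * e i] and [1 - e i <= e j] for [i <> j]; the basic example is [L^2] of the free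
    product [N], induced from [B]. To a Toeplitz module [Z] we associate the direct sum [nn Z] of the [N]-modules that
    are induced from [Z] by the conditional expectations of [N] onto [B] and onto the [M l]. For [0 < s < 1] there is
    an isometry [V : Z -> nn Z] such that [V^* w V = s ^ |w| w] for every reduced word [w].

    Let [v] be a vector of the given module [K]. By Hahn-Banach the vector state of [v] extends from the tensor
    product of [N] and [C] to all operators on [L^2 N (x) L], and its GNS space contains a Toeplitz module whose
    vectors are normal for each [M l] and satisfy the minimal norm estimate for [M l] and [Q], by weak exactness of
    [M l]. The estimate passes to [N] and [Q] on [nn Z], because conditional expectations are contractive for minimal
    norms. Matrix coefficients of [V v] in [nn Z] and of vectors [V x] in [nn (L^2 N)] agree on reduced words, hence
    on [N], being normal, and the latter tend to those of [v] in [K] as [s] tends to 1. *)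

(** * Norms and Hilbert spaces *)

(** The module [K] carries no projections [e i], and without them the estimates for the single [M l]
    do not combine. The extension of the vector state provides the [e i], but it need not be normal,
    so that [N] need not act normally on the vectors which the [e i] generate. The [M l] still act
    well there: a vector [z] with [e l z = z] sees [M l] through the expectation onto [B] alone, so
    regularity passes from one index to the others. A normal action of [N] is then restored by the
    induced module [nn Z], at the price that [V] does not intertwine but damps words by [s ^ |w|].
    The condition [s < 1] makes the recursion that defines [V] contractive, which gives existence,
    uniqueness and hence commutation with [Q]. As the vectors from the GNS space and from [L^2 N]
    are damped by the same factor, they are compared for each fixed [s] through normal functionals
    of [N], and the limit [s -> 1] is taken on [L^2 N] only, where an honest intertwiner exists. *)

Section Norms.
Variable R : realType.
Local Notation C := R[i].

(** Norms take values in [R[i]]; the real part is kept so that inequalities live in the ordered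
    field [R], where [lra] and [nra] apply. *)
Definition nm (V : normedZmodType C) (x : V) : R := complex.Re `|x|.

Lemma nmE (V : normedZmodType C) (x : V) : `|x| = (nm x)%:C.
Proof. by rewrite /nm RRe_real // ger0_real. Qed.

Lemma nm_ge0 (V : normedZmodType C) (x : V) : 0 <= nm x.
Proof. by rewrite -ler0c -nmE. Qed.

Lemma nm0_eq0 (V : normedZmodType C) (x : V) : nm x = 0 -> x = 0.
Proof. by move=> h; apply/normr0_eq0; rewrite nmE h. Qed.

Lemma nm0 (V : normedZmodType C) : nm (0 : V) = 0.
Proof. by apply: complexI; rewrite -nmE normr0. Qed.

Lemma nmN (V : normedZmodType C) (x : V) : nm (- x) = nm x.
Proof. by rewrite /nm normrN. Qed.

Lemma nmD (V : normedZmodType C) (x y : V) : nm (x + y) <= nm x + nm y.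
Proof. by rewrite -lecR rmorphD /= -!nmE ler_normD. Qed.

Lemma nmBC (V : normedZmodType C) (x y : V) : nm (x - y) = nm (y - x).
Proof. by rewrite -nmN opprB. Qed.

Lemma nmB (V : normedZmodType C) (x y : V) : nm (x - y) <= nm x + nm y.
Proof. by rewrite -[nm y]nmN nmD. Qed.

Lemma nm_tri (V : normedZmodType C) (z x y : V) :
  nm (x - y) <= nm (x - z) + nm (z - y).
Proof. by have := nmD (x - z) (z - y); rewrite addrA subrK. Qed.

Lemma nmZ (V : normedModType C) (c : C) (x : V) : nm (c *: x) = nm c * nm x.
Proof. by apply: complexI; rewrite rmorphM /= -!nmE normrZ. Qed.

Lemma nmM (c d : C) : nm (c * d) = nm c * nm d.
Proof. by apply: complexI; rewrite rmorphM /= -!nmE normrM. Qed.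

Lemma nmJ (c : C) : nm c^* = nm c.
Proof. by apply: complexI; rewrite -!nmE norm_conjC. Qed.

Lemma nmR (r : R) : nm r%:C = `|r|.
Proof. by apply: complexI; rewrite -nmE normc_def /= expr0n addr0 sqrtr_sqr. Qed.

Lemma nmR0 (r : R) : 0 <= r -> nm r%:C = r.
Proof. by move=> h; rewrite nmR ger0_norm. Qed.

Lemma nm_Re (c : C) : `|complex.Re c| <= nm c.
Proof. by rewrite -lecR -nmE normc_ge_Re. Qed.

Lemma Re_nm (c : C) : complex.Re c <= nm c.
Proof. exact: le_trans (ler_norm _) (nm_Re c). Qed.

Lemma nm_Im (c : C) : `|complex.Im c| <= nm c.
Proof.
have := nm_Re (c * 'i); rewrite nmM ReiNIm normrN => /le_trans; apply.
by rewrite -[X in _ <= X]mulr1 ler_wpM2l ?nm_ge0 //= /nm normc_def /= !(expr0n, expr1n) add0r sqrtr1.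
Qed.

Lemma nm_ReIm (c : C) : nm c <= `|complex.Re c| + `|complex.Im c|.
Proof.
rewrite {1}(complexE c) (le_trans (nmD _ _)) // nmM nmR nmR lerD2l.
by rewrite /nm normc_def /= !(expr0n, expr1n) add0r sqrtr1 mul1r.
Qed.

Definition nlim (V : normedZmodType C) (u : nat -> V) (l : V) : Prop :=
  forall e : R, 0 < e -> exists N, forall n, (N <= n)%N -> nm (u n - l) < e.

Definition ncauchy (V : normedZmodType C) (u : nat -> V) : Prop :=
  forall e : R, 0 < e ->
    exists N, forall m n, (N <= m)%N -> (N <= n)%N -> nm (u m - u n) < e.

Lemma nm_small (V : normedZmodType C) (x : V) :
  (forall e : R, 0 < e -> nm x < e) -> x = 0.
Proof.
move=> h; apply: nm0_eq0; apply/eqP; rewrite eq_le nm_ge0 andbT.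
by rewrite leNgt; apply/negP => /h; rewrite ltxx.
Qed.

Lemma nlim_uniq (V : normedZmodType C) (u : nat -> V) l l' :
  nlim u l -> nlim u l' -> l = l'.
Proof.
move=> h h'; apply/eqP; rewrite -subr_eq0; apply/eqP/nm_small => e e0.
have e2 : 0 < e / 2 by lra.
have [N hN] := h _ e2; have [N' hN'] := h' _ e2.
have := hN _ (leq_maxl N N'); have := hN' _ (leq_maxr N N') => h1 h2.
have := nm_tri (u (maxn N N')) l l'; rewrite (nmBC l (u _)); lra.
Qed.

Lemma nlim_cauchy (V : normedZmodType C) (u : nat -> V) l : nlim u l -> ncauchy u.
Proof.
move=> h e e0; have [N hN] := h (e / 2) ltac:(lra).
exists N => m n /hN hm /hN; rewrite nmBC => hn.
by have := nm_tri l (u m) (u n); lra.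
Qed.

Lemma nlimD (V : normedZmodType C) (u v : nat -> V) l m :
  nlim u l -> nlim v m -> nlim (fun n => u n + v n) (l + m).
Proof.
move=> h h' e e0; have e2 : 0 < e / 2 by lra.
have [N hN] := h _ e2; have [N' hN'] := h' _ e2.
exists (maxn N N') => n; rewrite geq_max => /andP[/hN h1 /hN' h2].
by rewrite opprD addrACA; have := nmD (u n - l) (v n - m); lra.
Qed.

Lemma nlim_cst (V : normedZmodType C) (l : V) : nlim (fun=> l) l.
Proof. by move=> e e0; exists 0 => n _; rewrite subrr nm0. Qed.

Lemma nlim_map (V W : normedZmodType C) (f : V -> W) (k : R) (u : nat -> V) l :
  (forall x y, nm (f x - f y) <= k * nm (x - y)) ->
  nlim u l -> nlim (f \o u) (f l).
Proof.
move=> hf h e e0.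
have [N hN] := h (e / (`|k| + 1)) ltac:(apply: divr_gt0 => //; have := normr_ge0 k; lra).
exists N => n /hN hn /=; apply: le_lt_trans (hf _ _) _.
have k1 : 0 < `|k| + 1 by have := normr_ge0 k; lra.
move: hn; rewrite ltr_pdivlMr // mulrC; apply: le_lt_trans.
apply: ler_wpM2r; first exact: nm_ge0.
by have := ler_norm k; lra.
Qed.

Lemma nlim_le (V : normedZmodType C) (u : nat -> V) l (k : R) :
  nlim u l -> (forall n, nm (u n) <= k) -> nm l <= k.
Proof.
move=> h hk; rewrite leNgt; apply/negP => lk.
have [N hN] := h (nm l - k) ltac:(lra).
have := hN N (leqnn N); have := hk N; rewrite nmBC.
by have := nmD (l - u N) (u N); rewrite subrK; lra.
Qed.

Lemma nlim_cvg (V : normedModType C) (u : nat -> V) l : nlim u l <-> u @ \oo --> l.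
Proof.
split=> [h|/cvgrPdistC_lt h e e0].
  apply/cvgrPdistC_lt => e e0.
  have er : e \is Num.real by rewrite gtr0_real.
  have eE : e = (complex.Re e)%:C by rewrite RRe_real.
  have [|N hN] := h (complex.Re e); first by rewrite -ltcR -eE.
  by exists N => // n /= /hN; rewrite nmE eE ltcR.
have [|N _ hN] := h e%:C; first by rewrite ltcR.
by exists N => n /hN /=; rewrite nmE ltcR.
Qed.

Lemma complete_nlim (V : completeNormedModType C) (u : nat -> V) :
  ncauchy u -> exists l, nlim u l.
Proof.
move=> h; have /cauchy_cvgP /cvg_ex[l ul] : cauchy (u @ \oo).
  apply/cauchyP => e e0.
  have er : e \is Num.real by rewrite gtr0_real.
  have eE : e = (complex.Re e)%:C by rewrite RRe_real.
  have [|N hN] := h (complex.Re e); first by rewrite -ltcR -eE.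
  exists (u N); exists N => // n /= Nn.
  by rewrite -ball_normE /= nmE eE ltcR hN.
by exists l; apply/nlim_cvg.
Qed.

Lemma real_cauchy_cvg (u : nat -> R) :
  (forall e : R, 0 < e ->
    exists N, forall m n, (N <= m)%N -> (N <= n)%N -> `|u m - u n| < e) ->
  exists l : R, forall e : R, 0 < e ->
    exists N, forall n, (N <= n)%N -> `|u n - l| < e.
Proof.
move=> h; have /cauchy_cvgP /cvg_ex[l /cvgrPdistC_lt ul] : cauchy (u @ \oo).
  apply/cauchyP => e e0; have [N hN] := h e e0.
  by exists (u N); exists N => // n /= Nn; rewrite /ball /= hN.
by exists l => e /ul[N _ hN]; exists N => n /hN.
Qed.

Lemma complex_nlim (u : nat -> C) : ncauchy u -> exists l, nlim u l.
Proof.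
move=> h.
have [|a ha] := @real_cauchy_cvg (fun n => complex.Re (u n)).
  move=> e /h[N hN]; exists N => m n hm hn.
  by apply: le_lt_trans (hN m n hm hn); rewrite -raddfB nm_Re.
have [|b hb] := @real_cauchy_cvg (fun n => complex.Im (u n)).
  move=> e /h[N hN]; exists N => m n hm hn.
  by apply: le_lt_trans (hN m n hm hn); rewrite -raddfB nm_Im.
exists (a +i* b) => e e0; have e2 : 0 < e / 2 by lra.
have [N hN] := ha _ e2; have [N' hN'] := hb _ e2.
exists (maxn N N') => n; rewrite geq_max => /andP[/hN h1 /hN' h2].
by have := nm_ReIm (u n - (a +i* b)); rewrite !raddfB /=; lra.
Qed.

Lemma closure_nm (V : normedModType C) (S : set V) x :
  closure S x <-> forall e : R, 0 < e -> exists2 y, S y & nm (x - y) < e.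
Proof.
split=> [h e e0|h B /nbhs_normP[e /= e0 eB]].
  have [|y [Sy yB]] := h (ball x e%:C); first by apply: nbhsx_ballx; rewrite ltcR.
  by exists y => //; move: yB; rewrite -ball_normE /= nmE ltcR.
have er : e \is Num.real by rewrite gtr0_real.
have eE : e = (complex.Re e)%:C by rewrite RRe_real.
have [|y Sy xy] := h (complex.Re e); first by rewrite -ltcR -eE.
by exists y; split=> //; apply: eB; rewrite /= nmE eE ltcR.
Qed.

Definition bop (V W : normedModType C) (f : V -> W) : Prop :=
  linear f /\ exists k : R, forall v, nm (f v) <= k * nm v.

Lemma bop_ge0 (V W : normedModType C) (f : V -> W) : bop f ->
  exists2 k : R, 0 < k & forall v, nm (f v) <= k * nm v.
Proof.
move=> [_ [k hk]]; exists (`|k| + 1); first by have := normr_ge0 k; lra.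
move=> v; apply: le_trans (hk v) _; apply: ler_wpM2r; first exact: nm_ge0.
by have := ler_norm k; lra.
Qed.

Lemma lin0 (V W : lmodType C) (f : V -> W) : linear f -> f 0 = 0.
Proof. by move=> h; have := h 1 0 0; rewrite !scale1r addr0 -{1}[f 0]addr0 => /addrI. Qed.

Lemma linD (V W : lmodType C) (f : V -> W) x y : linear f -> f (x + y) = f x + f y.
Proof. by move=> h; have := h 1 x y; rewrite !scale1r. Qed.

Lemma linZ (V W : lmodType C) (f : V -> W) c x : linear f -> f (c *: x) = c *: f x.
Proof. by move=> h; have := h c x 0; rewrite !addr0 lin0 // addr0. Qed.

Lemma linN (V W : lmodType C) (f : V -> W) x : linear f -> f (- x) = - f x.
Proof. by move=> h; rewrite -scaleN1r linZ // scaleN1r. Qed.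

Lemma linB (V W : lmodType C) (f : V -> W) x y : linear f -> f (x - y) = f x - f y.
Proof. by move=> h; rewrite linD // linN. Qed.

Lemma linS (V W : lmodType C) (f : V -> W) (I : Type) (s : seq I) (F : I -> V) :
  linear f -> f (\sum_(i <- s) F i) = \sum_(i <- s) f (F i).
Proof.
move=> h; elim: s => [|i s IH]; first by rewrite !big_nil lin0.
by rewrite !big_cons linD // IH.
Qed.

Lemma bop_continuous (V W : normedModType C) (f : V -> W) :
  linear f -> (continuous f <-> exists k : R, forall v, nm (f v) <= k * nm v).
Proof.
move=> lf; split=> [cf|[k hk] x].
  have /cvgrPdistC_lt/(_ 1 ltr01) := cf 0; rewrite lin0 //.
  case/nbhs_normP => e /= e0 he.
  have er : e \is Num.real by rewrite gtr0_real.
  have eE : e = (complex.Re e)%:C by rewrite RRe_real.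
  set r := complex.Re e in eE; have r0 : 0 < r by rewrite -ltcR -eE.
  exists (2 / r) => v; have [->|v0] := eqVneq v 0; first by rewrite lin0 // !nm0 mulr0.
  have nv : 0 < nm v.
    by rewrite lt_neqAle nm_ge0 andbT eq_sym; apply: contra v0 => /eqP/nm0_eq0->.
  (* The rescaled vector has norm [r / 2], hence lies in the ball on which [f] has norm below 1. *)
  have := he ((r / (2 * nm v))%:C *: v).
  rewrite /= distrC !subr0 !nmE eE ltcR linZ // !nmZ nmR0; last first.
    by apply: divr_ge0; [exact: ltW|apply: mulr_ge0; lra].
  have -> : (1 : C) = (1 : R)%:C by [].
  rewrite ltcR.
  have -> : r / (2 * nm v) * nm v = r / 2.
    by field; rewrite gt_eqF.
  move=> /(_ ltac:(lra)) h; apply: ltW.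
  rewrite -ltr_pdivrMl ?divr_gt0 // invf_div.
  apply: le_lt_trans (_ : (r / (2 * nm v) * nm (f v)) * nm v < _).
    by rewrite le_eqVlt; apply/orP; left; apply/eqP; field; rewrite gt_eqF.
  by rewrite -[ltRHS]mul1r ltr_pM2r.
apply/(@cvgrPdistC_lt _ _ _ (nbhs x)) => e e0.
have er : e \is Num.real by rewrite gtr0_real.
have eE : e = (complex.Re e)%:C by rewrite RRe_real.
set r := complex.Re e in eE; have r0 : 0 < r by rewrite -ltcR -eE.
have k1 : 0 < `|k| + 1 by have := normr_ge0 k; lra.
apply/nbhs_normP; exists (r / (`|k| + 1))%:C; first by rewrite /= ltcR divr_gt0.
move=> y /=; rewrite distrC nmE ltcR ltr_pdivlMr // mulrC => hy.
rewrite -linB // nmE eE ltcR; apply: le_lt_trans (hk _) _; apply: le_lt_trans hy.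
apply: ler_wpM2r; first exact: nm_ge0.
by have := ler_norm k; lra.
Qed.

End Norms.

Section Hilbert.
Variable R : realType.
Local Notation C := R[i].
Implicit Types H K : hilbertType R.

Lemma hdotDl H (x y z : H) : hdot (x + y) z = hdot x z + hdot y z.
Proof. exact: linearDl. Qed.
Lemma hdotDr H (x y z : H) : hdot z (x + y) = hdot z x + hdot z y.
Proof. exact: linearDr. Qed.
Lemma hdotNl H (x z : H) : hdot (- x) z = - hdot x z.
Proof. exact: linearNl. Qed.
Lemma hdotNr H (x z : H) : hdot z (- x) = - hdot z x.
Proof. exact: linearNr. Qed.
Lemma hdotBl H (x y z : H) : hdot (x - y) z = hdot x z - hdot y z.
Proof. exact: linearBl. Qed.
Lemma hdotBr H (x y z : H) : hdot z (x - y) = hdot z x - hdot z y.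
Proof. exact: linearBr. Qed.
Lemma hdot0l H (z : H) : hdot 0 z = 0. Proof. exact: linear0l. Qed.
Lemma hdot0r H (z : H) : hdot z 0 = 0. Proof. exact: linear0r. Qed.
Lemma hdotZl H c (x z : H) : hdot (c *: x) z = c * hdot x z.
Proof. by rewrite linearZl_LR. Qed.
Lemma hdotZr H c (x z : H) : hdot z (c *: x) = c^* * hdot z x.
Proof. by rewrite linearZr_LR. Qed.
Lemma hdotC H (x y : H) : hdot x y = (hdot y x)^*.
Proof. by rewrite hermC /= expr0 mul1r. Qed.
Lemma hdot_suml H (I : Type) (s : seq I) (F : I -> H) z :
  hdot (\sum_(i <- s) F i) z = \sum_(i <- s) hdot (F i) z.
Proof. exact: linear_sumlz. Qed.
Lemma hdot_sumr H (I : Type) (s : seq I) (F : I -> H) z :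
  hdot z (\sum_(i <- s) F i) = \sum_(i <- s) hdot z (F i).
Proof. exact: linear_sumr. Qed.

Lemma hdotxx H (x : H) : hdot x x = (nm x ^+ 2)%:C.
Proof. by rewrite hdot_norm nmE rmorphXn. Qed.

Lemma hdot_eq0 H (x : H) : hdot x x = 0 -> x = 0.
Proof. by rewrite hdotxx => /complexI/eqP; rewrite sqrf_eq0 => /eqP/nm0_eq0. Qed.

Lemma hdot_ext H (x y : H) : (forall z, hdot x z = hdot y z) -> x = y.
Proof.
by move=> h; apply/eqP; rewrite -subr_eq0; apply/eqP/hdot_eq0; rewrite hdotBl h subrr.
Qed.

Ltac hvec := apply: hdot_ext => ?; rewrite ?(hdotBl, hdotDl, hdotNl, hdotZl, hdot0l); ring.

Lemma hdot_extr H (x y : H) : (forall z, hdot z x = hdot z y) -> x = y.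
Proof. by move=> h; apply: hdot_ext => z; rewrite hdotC h -hdotC. Qed.

Lemma mulJc (z : C) : z^* * z = (nm z ^+ 2)%:C.
Proof. by rewrite rmorphXn /= -nmE normCK mulrC. Qed.

Lemma ReJ (z : C) : complex.Re z^* = complex.Re z.
Proof. by case: z. Qed.

Lemma Re_real_mul (r : R) (z : C) : complex.Re (r%:C * z) = r * complex.Re z.
Proof. by case: z => a b /=; rewrite mul0r subr0. Qed.

(** Cauchy-Schwarz for a positive semidefinite form: [A], [B], [z] stand for <x, x>, <y, y>, <x, y>,
    and the hypothesis is positivity at x + c^* y. Being about numbers, it serves Hilbert spaces,
    kernels and inner products under construction alike. *)
Lemma cs_abs (A B : R) (z : C) : 0 <= B ->
  (forall c : C, 0 <= A + nm c ^+ 2 * B + 2 * complex.Re (c * z)) ->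
  nm z ^+ 2 <= A * B.
Proof.
move=> B0 h; have {}h (t : R) : 0 <= A + t ^+ 2 * nm z ^+ 2 * B - 2 * (t * nm z ^+ 2).
  have := h ((- t)%:C * z^*).
  by rewrite nmM nmJ nmR normrN -mulrA mulJc -rmorphM /= mulNr mulrN exprMn real_normK ?num_real.
(* The value [t = 1 / B] is optimal; if [B = 0], a large [t] forces [z = 0]. *)
have := h B^-1; have [B00|Bn] := eqVneq B 0; last first.
  have Bp : 0 < B by lra.
  have -> : A + B^-1 ^+ 2 * nm z ^+ 2 * B - 2 * (B^-1 * nm z ^+ 2) = A - nm z ^+ 2 / B.
    by field.
  by rewrite subr_ge0 ler_pdivrMr.
move=> _; rewrite B00 mulr0; have [->|zn] := eqVneq (nm z) 0; first by rewrite expr0n.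
have := h ((`|A| + 1) / nm z ^+ 2); rewrite B00 mulr0 addr0 divfK ?expf_neq0 //.
by have := ler_norm A; have := normr_ge0 A; lra.
Qed.

Lemma nmsqD H (x y : H) :
  nm (x + y) ^+ 2 = nm x ^+ 2 + nm y ^+ 2 + 2 * complex.Re (hdot x y).
Proof.
have e (u : H) : nm u ^+ 2 = complex.Re (hdot u u) by rewrite hdotxx.
by rewrite !e hdotDl !hdotDr !raddfD /= (hdotC y x) ReJ; ring.
Qed.

Lemma nmsqB H (x y : H) :
  nm (x - y) ^+ 2 = nm x ^+ 2 + nm y ^+ 2 - 2 * complex.Re (hdot x y).
Proof. by rewrite nmsqD nmN hdotNr raddfN /= mulrN. Qed.

Lemma hdot_nm H (x y : H) : nm (hdot x y) <= nm x * nm y.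
Proof.
rewrite -ler_sqr ?nnegrE ?nm_ge0 ?mulr_ge0 ?nm_ge0 // exprMn.
apply: cs_abs => [|c]; first exact: sqr_ge0.
have := sqr_ge0 (nm (x + c^* *: y)); rewrite nmsqD hdotZr nmZ nmJ exprMn.
by rewrite (_ : c^*^* = c) // conjCK.
Qed.

Lemma Re_hdot_le H (x y : H) : complex.Re (hdot x y) <= nm x * nm y.
Proof. exact: le_trans (Re_nm _) (hdot_nm x y). Qed.

Lemma nm_sq_le H (x : H) (k : R) : 0 <= k -> nm x ^+ 2 <= k * nm x -> nm x <= k.
Proof.
move=> k0; have [->|x0] := eqVneq (nm x) 0; first by [].
by rewrite expr2 ler_pM2r // lt_neqAle eq_sym x0 nm_ge0.
Qed.

Lemma parallelogram H (x y : H) :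
  nm (x - y) ^+ 2 = 2 * nm x ^+ 2 + 2 * nm y ^+ 2 - nm (x + y) ^+ 2.
Proof. by rewrite nmsqB nmsqD; ring. Qed.

Lemma nlim_hdotl H (u : nat -> H) l y : nlim u l -> nlim (fun n => hdot (u n) y) (hdot l y).
Proof.
apply: (@nlim_map _ _ _ (fun x => hdot x y) (nm y)) => a b.
by rewrite -hdotBl mulrC hdot_nm.
Qed.

Inductive span (V : lmodType C) (S : set V) : V -> Prop :=
| span0 : span S 0
| spanD c s v : S s -> span S v -> span S (c *: s + v).

Lemma span_in (V : lmodType C) (S : set V) s : S s -> span S s.
Proof. by move=> h; rewrite -[s]scale1r -[_ *: s]addr0; apply: spanD => //; exact: span0. Qed.

Lemma span_add (V : lmodType C) (S : set V) x y : span S x -> span S y -> span S (x + y).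
Proof.
elim=> [|c s v Ss _ IH] hy; first by rewrite add0r.
by rewrite -addrA; apply: spanD => //; exact: IH.
Qed.

Lemma span_scale (V : lmodType C) (S : set V) c x : span S x -> span S (c *: x).
Proof.
elim=> [|d s v Ss _ IH]; first by rewrite scaler0; exact: span0.
by rewrite scalerDr scalerA; exact: spanD.
Qed.

Definition perp H (S : set H) : set H := [set w | forall s, S s -> hdot s w = 0].

(** The double orthocomplement, which is the closed linear span by [span_approx]. In this form
    membership is checked by testing against [perp S]. *)
Definition cspan H (S : set H) : set H :=
  [set v | forall w, perp S w -> hdot v w = 0].

Lemma cspan_in H (S : set H) s : S s -> cspan S s.
Proof. by move=> Ss w; apply. Qed.

Lemma cspan0 H (S : set H) : cspan S 0.
Proof. by move=> w _; rewrite hdot0l. Qed.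

Lemma cspanP H (S : set H) c x y : cspan S x -> cspan S y -> cspan S (c *: x + y).
Proof. by move=> hx hy w hw; rewrite hdotDl hdotZl hx // hy // mulr0 addr0. Qed.

Lemma span_cspan H (S : set H) v : span S v -> cspan S v.
Proof. elim=> [|c s w Ss _ IH]; [exact: cspan0|apply: cspanP => //; exact: cspan_in]. Qed.

Lemma cspan_lim H (S : set H) (u : nat -> H) l :
  (forall n, cspan S (u n)) -> nlim u l -> cspan S l.
Proof.
move=> h hu w hw; apply: (nlim_uniq (nlim_hdotl w hu)).
have -> : (fun n => hdot (u n) w) = fun=> 0 by apply/funext => n; exact: h.
exact: nlim_cst.
Qed.

Definition iv (n : nat) : R := n.+1%:R^-1.

Lemma iv_gt0 n : 0 < iv n. Proof. by rewrite invr_gt0. Qed.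

Lemma inv_small (e : R) : 0 < e -> exists N, forall n, (N <= n)%N -> iv n < e.
Proof.
move=> e0; exists (Num.bound e^-1) => n hn; rewrite /iv.
rewrite -[e]invrK ltf_pV2 ?posrE ?invr_gt0 //.
apply: lt_le_trans (archi_boundP _) _; first by rewrite invr_ge0 ltW.
by rewrite ler_nat (leq_trans hn).
Qed.

(** A sequence in the span whose squared distances to [v] tend to the infimum [d] is Cauchy by the
    parallelogram law, because midpoints stay in the span. *)
Lemma proj_ex H (S : set H) (v : H) :
  exists p, (forall e : R, 0 < e -> exists2 u, span S u & nm (p - u) < e) /\
            perp S (v - p).
Proof.
pose A := [set r : R | exists2 u, span S u & r = nm (v - u) ^+ 2].
have A0 : A !=set0 by exists (nm (v - 0) ^+ 2), 0 => //; exact: span0.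
have Alb : has_lbound A by exists 0 => r [u _ ->]; exact: sqr_ge0.
set d := inf A.
have dle u : span S u -> d <= nm (v - u) ^+ 2.
  by move=> hu; apply: ge_inf => //; exists u.
have /choice[u hu] : forall n : nat, exists u, span S u /\ nm (v - u) ^+ 2 < d + iv n.
  move=> n; have [_ [u su ->] h] := @inf_adherent _ A (iv n) (iv_gt0 n) (conj A0 Alb).
  by exists u.
have uE m n : nm (u m - u n) ^+ 2 <= 2 * (iv m + iv n).
  have -> : u m - u n = (v - u n) - (v - u m) by rewrite opprB [RHS]addrC addrA subrK.
  rewrite parallelogram.
  have -> : v - u n + (v - u m) = 2%:R *: (v - 2^-1 *: (u m + u n)).
    rewrite scalerBr scalerA divff ?pnatr_eq0 // scale1r scaler_nat mulr2n.
    by rewrite addrACA -opprD [u n + _]addrC.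
  rewrite nmZ exprMn.
  have -> : nm (2%:R : C) = 2 by have := @nmR R 2; rewrite ger0_norm // rmorph_nat.
  have hs : span S (2^-1 *: (u m + u n)).
    by apply: span_scale; apply: span_add; [case: (hu m)|case: (hu n)].
  have := dle _ hs; case: (hu m) (hu n) => _ h1 [_ h2].
  rewrite (_ : 2 ^+ 2 = 4); last by ring.
  lra.
have [p up] : exists p, nlim u p.
  apply: complete_nlim => e e0.
  have [|N hN] := @inv_small (e ^+ 2 / 4).
    by apply: divr_gt0 => //; exact: exprn_gt0.
  exists N => m n /hN hm /hN hn; rewrite -ltr_sqr ?nnegrE ?nm_ge0 ?ltW //.
  apply: le_lt_trans (uE m n) _.
  lra.
exists p; split.
  move=> e e0; have [N hN] := up _ e0; exists (u N); first by case: (hu N).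
  by rewrite nmBC hN.
move=> s Ss; set w := v - p.
(* The vector [p] is only a limit of vectors of the span, so minimality is tested on [u n] for large
   [n]. *)
have key (c : C) : nm w <= nm (w + c *: s).
  rewrite leNgt; apply/negP => hlt; set dl := nm w - nm (w + c *: s).
  have dl0 : 0 < dl by rewrite subr_gt0.
  have [|N hN] := up (dl / 4); first by lra.
  (* A slack of [dl ^ 2 / 2] is enough: [(|w| - dl / 4) ^ 2] exceeds [(|w| - 3 dl / 4) ^ 2] by at
     least that much, as [dl <= |w|]. *)
  have [|N' hN'] := @inv_small (dl ^+ 2 / 2); first by apply: divr_gt0 => //; exact: exprn_gt0.
  have {hN}h1 := hN _ (leq_maxl N N'); have {hN'}h2 := hN' _ (leq_maxr N N').
  set n := maxn N N' in h1 h2; have [Sn hn] := hu n.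
  have hd : d <= nm (v - u n + c *: s) ^+ 2.
    rewrite (_ : v - u n + c *: s = v - (- c *: s + u n)); last first.
      by rewrite opprD scaleNr opprK addrCA addrC.
    by apply: dle; apply: spanD.
  have h3 : nm w - dl / 4 <= nm (v - u n).
    by have := nm_tri (u n) v p; rewrite -/w; lra.
  have h4 : nm (v - u n + c *: s) <= nm (w + c *: s) + dl / 4.
    have -> : v - u n + c *: s = w + c *: s + (p - u n).
      by rewrite /w [RHS]addrAC [v - p + _]addrA subrK.
    by have := nmD (w + c *: s) (p - u n); rewrite (nmBC p); lra.
  have w0 := nm_ge0 (w + c *: s); have v0 := nm_ge0 (v - u n + c *: s).
  have e1 : nm (w + c *: s) = nm w - dl by rewrite /dl; lra.
  have : (nm w - dl / 4) ^+ 2 <= nm (v - u n) ^+ 2 by rewrite ler_sqr ?nnegrE ?nm_ge0 //; lra.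
  have : nm (v - u n + c *: s) ^+ 2 <= (nm w - 3 / 4 * dl) ^+ 2.
    by rewrite ler_sqr ?nnegrE //; lra.
  nra.
have : nm (hdot s w) ^+ 2 <= 0 * nm s ^+ 2.
  apply: cs_abs => [|c]; first exact: sqr_ge0.
  have := key c; rewrite -ler_sqr ?nnegrE ?nm_ge0 // (nmsqD w) (hdotC w) ReJ hdotZl nmZ exprMn.
  lra.
rewrite mul0r => h; apply: nm0_eq0; apply/eqP; rewrite -sqrf_eq0 eq_le h /=.
exact: sqr_ge0.
Qed.

Lemma proj_ex' H (S : set H) (v : H) : exists p, cspan S p /\ perp S (v - p).
Proof.
have [p [h1 h2]] := proj_ex S v; exists p; split=> // w hw.
apply: nm_small => e e0; have [|u Su hu] := h1 (e / (nm w + 1)).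
  by apply: divr_gt0 => //; have := nm_ge0 w; lra.
have -> : hdot p w = hdot (p - u) w by rewrite hdotBl (span_cspan Su hw) subr0.
apply: le_lt_trans (hdot_nm _ _) _.
have w1 : 0 < nm w + 1 by have := nm_ge0 w; lra.
move: hu; rewrite ltr_pdivlMr //; apply: le_lt_trans; rewrite ler_wpM2l ?nm_ge0 //; lra.
Qed.

Definition proj H (S : set H) (v : H) : H := projT1 (cid (proj_ex' S v)).

Lemma proj_in H (S : set H) v : cspan S (proj S v).
Proof. by rewrite /proj; case: cid => p []. Qed.

Lemma proj_perp H (S : set H) v : perp S (v - proj S v).
Proof. by rewrite /proj; case: cid => p []. Qed.

Arguments proj_in : clear implicits.
Arguments proj_in {H} S v.
Arguments proj_perp : clear implicits.
Arguments proj_perp {H} S v.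

Lemma proj_uniq H (S : set H) v p : cspan S p -> perp S (v - p) -> proj S v = p.
Proof.
move=> hp hv; apply/eqP; rewrite -subr_eq0; apply/eqP/hdot_eq0.
have h : cspan S (proj S v - p).
  by rewrite addrC -scaleN1r; apply: cspanP => //; exact: proj_in.
apply: h => s Ss.
have -> : proj S v - p = (v - p) - (v - proj S v) by rewrite opprB [RHS]addrC addrA subrK.
by rewrite hdotBr hv // proj_perp // subr0.
Qed.

Lemma proj_id H (S : set H) v : cspan S v -> proj S v = v.
Proof. by move=> h; apply: proj_uniq => // s _; rewrite subrr hdot0r. Qed.

Lemma proj_lin H (S : set H) : linear (proj S).
Proof.
move=> c x y; apply: proj_uniq; first by apply: cspanP; exact: proj_in.
move=> s Ss; have -> : c *: x + y - (c *: proj S x + proj S y) =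
   c *: (x - proj S x) + (y - proj S y) by rewrite scalerBr opprD addrACA.
by rewrite hdotDr hdotZr !proj_perp // mulr0 addr0.
Qed.

Lemma proj_hdot H (S : set H) x y : hdot (proj S x) y = hdot x (proj S y).
Proof.
have h u v : hdot (proj S u) (v - proj S v) = 0.
  by apply: (proj_in S u); exact: (proj_perp S).
have := h x y; rewrite hdotBr => /eqP; rewrite subr_eq0 => /eqP ->.
have := h y x; rewrite hdotBr => /eqP; rewrite subr_eq0 => /eqP.
by rewrite hdotC => /(congr1 Num.conj); rewrite conjCK -hdotC => ->.
Qed.

Lemma proj_nm H (S : set H) x : nm (proj S x) <= nm x.
Proof.
apply: nm_sq_le; first exact: nm_ge0.
have := hdot_nm x (proj S x); rewrite -{1}(proj_id (proj_in S x)).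
by rewrite -proj_hdot hdotxx nmR0 ?sqr_ge0.
Qed.

Lemma proj_perp0 H (S : set H) x : perp S x -> proj S x = 0.
Proof. by move=> h; apply: proj_uniq; [exact: cspan0|rewrite subr0]. Qed.

Lemma span_approx H (S : set H) v (e : R) : cspan S v -> 0 < e ->
  exists2 u, span S u & nm (v - u) < e.
Proof.
move=> hv e0; have [p [h1 h2]] := proj_ex S v.
have [u Su hu] := h1 _ e0; exists u => //; suff -> : v = p by [].
have pS : cspan S p.
  move=> w hw; apply: nm_small => d d0; have [|x Sx hx] := h1 (d / (nm w + 1)).
    by apply: divr_gt0 => //; have := nm_ge0 w; lra.
  have -> : hdot p w = hdot (p - x) w by rewrite hdotBl (span_cspan Sx hw) subr0.
  apply: le_lt_trans (hdot_nm _ _) _.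
  have w1 : 0 < nm w + 1 by have := nm_ge0 w; lra.
  move: hx; rewrite ltr_pdivlMr //; apply: le_lt_trans; rewrite ler_wpM2l ?nm_ge0 //; lra.
apply/eqP; rewrite -subr_eq0; apply/eqP/hdot_eq0.
have h : cspan S (v - p) by rewrite addrC -scaleN1r; apply: cspanP.
exact: h.
Qed.

Definition total H (S : set H) : Prop := forall w, perp S w -> w = 0.

Lemma total_cspan H (S : set H) v : total S -> cspan S v.
Proof. by move=> h w /h ->; rewrite hdot0r. Qed.

Lemma riesz H (f : H -> C) (k : R) : linear f -> (forall x, nm (f x) <= k * nm x) ->
  exists z, forall x, f x = hdot x z.
Proof.
move=> lf hk; have [h|/existsNP[x0 /eqP fx0]] := pselect (forall x, f x = 0).
  by exists 0 => x; rewrite h hdot0r.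
pose S := [set x | f x = 0].
have Sc x : cspan S x -> f x = 0.
  move=> hx; apply: nm_small => e e0.
  have k1 : 0 < `|k| + 1 by have := normr_ge0 k; lra.
  have [|u Su hu] := span_approx hx (_ : 0 < e / (`|k| + 1)); first exact: divr_gt0.
  have fu : f u = 0.
    by elim: Su => [|c s v Ss _ fv]; rewrite ?lin0 // linD // linZ // Ss fv scaler0 addr0.
  have -> : f x = f (x - u) by rewrite linB // fu subr0.
  apply: le_lt_trans (hk _) _; move: hu; rewrite ltr_pdivlMr // mulrC; apply: le_lt_trans.
  by rewrite ler_wpM2r ?nm_ge0 //; have := ler_norm k; lra.
pose u := x0 - proj S x0.
have fu : f u = f x0 by rewrite linB // (Sc _ (proj_in _ _)) subr0.
have uS : perp S u by exact: (proj_perp S).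
have uu : hdot u u != 0.
  apply/eqP => /hdot_eq0 u0; move: fx0; rewrite -fu u0 lin0 // eqxx //.
exists (((f u)^* / hdot u u) *: u) => x.
have : S (x - (f x / f u) *: u).
  by rewrite /S /= linB // linZ // -[_ *: _]/(_ * _) divfK ?subrr // fu.
move/uS; rewrite hdotBl hdotZl hdotZr => /eqP; rewrite subr_eq0 => /eqP ->.
rewrite rmorphM fmorphV /= conjCK -(hdotC u u).
by field; rewrite fu fx0 uu.
Qed.

Lemma adj_ex H K (f : H -> K) : bop f ->
  exists g : K -> H, bop g /\ forall x y, hdot (f x) y = hdot x (g y).
Proof.
move=> /[dup] bf [lf _]; have [k k0 hk] := bop_ge0 bf.
have /choice[g hg] : forall y, exists z, forall x, hdot (f x) y = hdot x z.
  move=> y; apply: (@riesz _ _ (k * nm y)).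
    by move=> c u v; rewrite lf hdotDl hdotZl.
  move=> x; apply: le_trans (hdot_nm _ _) _.
  by rewrite mulrAC ler_wpM2r ?nm_ge0.
exists g; split; last by move=> x y; exact: hg.
split.
  move=> c x y; apply: hdot_extr => z.
  by rewrite -hg hdotDr hdotZr !hg hdotDr hdotZr.
exists k => y; apply: nm_sq_le; first by rewrite mulr_ge0 ?nm_ge0 ?ltW.
have <- : nm (hdot (g y) (g y)) = nm (g y) ^+ 2 by rewrite hdotxx nmR0 ?sqr_ge0.
rewrite -hg; apply: le_trans (hdot_nm _ _) _.
by rewrite mulrAC ler_wpM2r ?nm_ge0.
Qed.

(** Total by the default value 0 at unbounded [f], so that its properties carry the hypothesis
    [bop f]. *)
Definition adj H K (f : H -> K) : K -> H :=
  if pselect (bop f) is left h then projT1 (cid (adj_ex h)) else fun=> 0.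

Lemma bop_adj H K (f : H -> K) : bop f -> bop (adj f).
Proof. by rewrite /adj; case: pselect => // h _; case: cid => g []. Qed.

Lemma adjP H K (f : H -> K) x y : bop f -> hdot (f x) y = hdot x (adj f y).
Proof. by rewrite /adj; case: pselect => // h _; case: cid => g []. Qed.

Lemma adjPr H K (f : H -> K) x y : bop f -> hdot y (f x) = hdot (adj f y) x.
Proof. by move=> h; rewrite hdotC adjP // -hdotC. Qed.

End Hilbert.

(** * Hilbert spaces built from inner products *)

Section SeqComplete.
Variable R : realType.
Local Notation C := R[i].

(** A Cauchy filter contains balls of radius [iv n]; their centres form a Cauchy sequence with the
    same limit. *)
Lemma seq_complete (V : normedModType C) :
  (forall u : nat -> V, ncauchy u -> exists l, nlim u l) ->
  forall F : set_system V, ProperFilter F -> cauchy F -> cvg F.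
Proof.
move=> h F PF /cauchyP cF.
have /choice[f hf] : forall n, exists x : V, F (ball x (iv R n)%:C).
  by move=> n; have := cF (iv R n)%:C; rewrite ltcR iv_gt0 => /(_ isT).
have hm m n : nm (f m - f n) <= iv R m + iv R n.
  have [x [/= hx hy]] := filter_ex (filterI (hf m) (hf n)).
  move: hx hy; rewrite -!ball_normE /= !nmE !ltcR => hx hy.
  by have := nm_tri x (f m) (f n); rewrite (nmBC x); lra.
have [l hl] : exists l, nlim f l.
  apply: h => e e0; have [|N hN] := @inv_small R (e / 2); first by lra.
  by exists N => m n /hN h1 /hN h2; have := hm m n; lra.
apply/cvg_ex; exists l => /= A /nbhs_normP[e /= e0 eA].
have er : e \is Num.real by rewrite gtr0_real.
have eE : e = (complex.Re e)%:C by rewrite RRe_real.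
set r := complex.Re e in eE; have r0 : 0 < r by rewrite -ltcR -eE.
have [|N hN] := hl (r / 2); first by lra.
have [|N' hN'] := @inv_small R (r / 2); first by lra.
have {hN}h1 := hN _ (leq_maxl N N'); have {hN'}h2 := hN' _ (leq_maxr N N').
apply: filterS (hf (maxn N N')) => x; rewrite -ball_normE /= nmE ltcR => hx.
apply: eA; rewrite /= nmE eE ltcR.
by have := nm_tri (f (maxn N N')) l x; rewrite (nmBC l (f _)); lra.
Qed.

End SeqComplete.

(** Hermitian symmetry makes [d x x] real, which allows positivity and completeness to be stated
    with the real parts of squared norms. *)
Record inner_axioms (R : realType) (V : lmodType R[i]) (d : V -> V -> R[i]) : Prop :=
  InnerAxioms {
    inner_lin : forall z, scalar (d^~ z);
    inner_herm : forall x y, d x y = (d y x)^*;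
    inner_ge0 : forall x, 0 <= complex.Re (d x x);
    inner_eq0 : forall x, complex.Re (d x x) = 0 -> x = 0;
    inner_compl : forall u : nat -> V,
      (forall e : R, 0 < e -> exists N, forall m n, (N <= m)%N -> (N <= n)%N ->
         complex.Re (d (u m - u n) (u m - u n)) < e) ->
      exists l, forall e : R, 0 < e -> exists N, forall n, (N <= n)%N ->
         complex.Re (d (u n - l) (u n - l)) < e }.

Section MkHilbert.
Variables (R : realType) (V : lmodType R[i]) (d : V -> V -> R[i]) (ax : inner_axioms d).
Local Notation C := R[i].

(** The alias mentions the proof [ax], which lets the norm defined by [d] be attached to it as a
    canonical structure. *)
Definition innerT of inner_axioms d : Type := V.
Local Notation T := (innerT ax).

HB.instance Definition _ := GRing.Lmodule.copy T V.

Let dD x y z : d (x + y) z = d x z + d y z.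
Proof. by have := inner_lin ax z 1 x y; rewrite !scale1r mul1r. Qed.

Let dZ c x z : d (c *: x) z = c * d x z.
Proof. 
have d0 : d 0 z = 0 by apply: (@addrI _ (d 0 z)); rewrite -dD !addr0.
by have := inner_lin ax z c x 0; rewrite !addr0 d0 addr0.
Qed.

Let dDr x y z : d z (x + y) = d z x + d z y.
Proof. by rewrite (inner_herm ax) dD rmorphD /= -!(inner_herm ax). Qed.

Let dZr c x z : d z (c *: x) = c^* * d z x.
Proof. by rewrite (inner_herm ax) dZ rmorphM /= -(inner_herm ax). Qed.

Let dxx x : d x x = (complex.Re (d x x))%:C.
Proof.
have := inner_herm ax x x; case: (d x x) => a b /= [] /eqP.
rewrite -addr_eq0 -mulr2n mulrn_eq0 /= => /eqP ->; by [].
Qed.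

Let nr (x : V) : R := Num.sqrt (complex.Re (d x x)).

Let nr2 x : nr x ^+ 2 = complex.Re (d x x).
Proof. by rewrite sqr_sqrtr // (inner_ge0 ax). Qed.

Let nrZ c x : (nr (c *: x))%:C = `|c| * (nr x)%:C.
Proof.
rewrite nmE -rmorphM /=; congr (_%:C).
rewrite /nr dZ dZr mulrA (mulrC c) mulJc Re_real_mul sqrtrM ?sqr_ge0 //.
by rewrite sqrtr_sqr ger0_norm ?nm_ge0.
Qed.

Let cs x y : nm (d x y) ^+ 2 <= nr x ^+ 2 * nr y ^+ 2.
Proof.
apply: cs_abs => [|c]; first exact: sqr_ge0.
have := inner_ge0 ax (x + c^* *: y).
have -> : d (x + c^* *: y) (x + c^* *: y) =
    d x x + c * d x y + (c * d x y)^* + (nm c ^+ 2)%:C * d y y.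
  rewrite dD !dDr !dZ !dZr !conjCK rmorphM /= -(inner_herm ax y x) -mulJc; ring.
by rewrite !raddfD /= ReJ Re_real_mul -!nr2; lra.
Qed.

Let nrD x y : nr (x + y) <= nr x + nr y.
Proof.
have n0 u : 0 <= nr u by exact: sqrtr_ge0.
rewrite -ler_sqr ?nnegrE ?addr_ge0 // sqrrD nr2 dD !dDr !raddfD /= (inner_herm ax y x) ReJ -!nr2.
have := Re_nm (d x y); have : nm (d x y) <= nr x * nr y.
  by rewrite -ler_sqr ?nnegrE ?mulr_ge0 ?nm_ge0 // exprMn cs.
by rewrite mulr2n; lra.
Qed.

HB.instance Definition _ := @Lmodule_isNormed.Build C T (fun x => (nr x)%:C)
  (fun x y => etrans (congr1 _ (esym (rmorphD _ _ _))) (etrans (lecR _ _) (nrD x y)))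
  nrZ
  (fun x h => inner_eq0 ax (etrans (esym (nr2 x)) (etrans (congr1 (fun r => r ^+ 2) (complexI h)) (expr0n _ 2)))).

Let nmT (x : T) : nm x = nr x. Proof. by []. Qed.

Let compl (F : set_system T) : ProperFilter F -> cauchy F -> cvg F.
Proof.
apply: seq_complete => u hu.
have [|l hl] := inner_compl ax (u := u).
  move=> e e0; have [|N hN] := hu (Num.sqrt e); first by rewrite sqrtr_gt0.
  exists N => m n hm hn; have := hN m n hm hn.
  rewrite nmT -ltr_sqr ?nnegrE ?sqrtr_ge0 // nr2 sqr_sqrtr //; exact: ltW.
exists l => e e0; have [|N hN] := hl (e ^+ 2); first exact: exprn_gt0.
exists N => n /hN; rewrite nmT -nr2 ltr_sqr ?nnegrE ?sqrtr_ge0 //; exact: ltW.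
Qed.

HB.instance Definition _ := Uniform_isComplete.Build T compl.

Definition inner_dot : T -> T -> C := d.

HB.instance Definition _ := @bilinear_isBilinear.Build C T T C *%R (Num.conj \; *%R) inner_dot
  (pair (fun z c x y => inner_lin ax z c x y)
    (fun z c x y => etrans (dDr _ _ _) (congr1 (fun w => w + _) (dZr c x z)))).

HB.instance Definition _ := @isHermitianSesquilinear.Build C T false Num.conj inner_dot
  (fun x y => etrans (inner_herm ax x y) (esym (mul1r _))).

Let dot_gt0 (u : T) : u != 0 -> 0 < inner_dot u u.
Proof.
move=> u0; rewrite /inner_dot dxx ltcR lt_neqAle (inner_ge0 ax) andbT eq_sym.
by apply: contra u0 => /eqP/(inner_eq0 ax) ->.
Qed.

HB.instance Definition _ := @isDotProduct.Build C T inner_dot dot_gt0.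

Let dot_norm (x : T) : inner_dot x x = `|x| ^+ 2.
Proof. by rewrite nmE -rmorphXn /= nmT nr2 /inner_dot -dxx. Qed.

HB.instance Definition _ := @isHilbert.Build R T inner_dot dot_norm.

Definition mkHilbert : hilbertType R := T.

Lemma mkHilbert_dot (x y : mkHilbert) : hdot x y = d x y.
Proof. by []. Qed.

End MkHilbert.

(** * Positive definite kernels and lifting of operators *)

Section Kernel.
Variables (R : realType) (X : Type) (k : X -> X -> R[i]).
Local Notation C := R[i].
Implicit Types L : seq (C * X).

Definition kform L L' : C := \sum_(p <- L) \sum_(r <- L') p.1 * r.1^* * k p.2 r.2.

Definition psd_kernel : Prop :=
  (forall x y, k x y = (k y x)^*) /\ forall L, 0 <= complex.Re (kform L L).

Hypothesis kP : psd_kernel.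

Let sc (c : C) L : seq (C * X) := [seq (c * p.1, p.2) | p <- L].

Let qDl L1 L2 L : kform (L1 ++ L2) L = kform L1 L + kform L2 L.
Proof. by rewrite /kform big_cat. Qed.

Let qZl c L L' : kform (sc c L) L' = c * kform L L'.
Proof.
rewrite /kform big_map mulr_sumr; apply: eq_bigr => p _.
by rewrite mulr_sumr; apply: eq_bigr => r _; rewrite !mulrA.
Qed.

Let qC L L' : kform L L' = (kform L' L)^*.
Proof.
rewrite /kform exchange_big rmorph_sum; apply: eq_bigr => p _.
rewrite rmorph_sum; apply: eq_bigr => r _.
by rewrite !rmorphM /= conjCK -(kP.1) [r.1 * _]mulrC.
Qed.

Let qDr L1 L2 L : kform L (L1 ++ L2) = kform L L1 + kform L L2.
Proof. by rewrite qC qDl rmorphD /= -!qC. Qed.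

Let qZr c L L' : kform L' (sc c L) = c^* * kform L' L.
Proof. by rewrite qC qZl rmorphM /= -qC. Qed.

Let N L : R := Num.sqrt (complex.Re (kform L L)).

Let N0 L : 0 <= N L. Proof. exact: sqrtr_ge0. Qed.

Let N2 L : N L ^+ 2 = complex.Re (kform L L).
Proof. by rewrite sqr_sqrtr // kP.2. Qed.

Let cs L L' : nm (kform L L') <= N L * N L'.
Proof.
rewrite -ler_sqr ?nnegrE ?nm_ge0 ?mulr_ge0 // exprMn; apply: cs_abs => [|c]; first exact: sqr_ge0.
have := kP.2 (L ++ sc c^* L').
rewrite qDl !qDr !qZl !qZr conjCK !raddfD /= (qC L' L) -rmorphM /= ReJ.
by rewrite mulrA mulJc Re_real_mul -!N2; lra.
Qed.

Let dl L L' := L ++ sc (-1) L'.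

Let ND L L' : N (L ++ L') <= N L + N L'.
Proof.
rewrite -ler_sqr ?nnegrE ?addr_ge0 // sqrrD N2 qDl !qDr !raddfD /= (qC L' L) ReJ -!N2.
by have := Re_nm (kform L L'); have := cs L L'; rewrite mulr2n; lra.
Qed.

Let NZ c L : N (sc c L) = nm c * N L.
Proof.
by rewrite /N qZl qZr mulrA (mulrC c) mulJc Re_real_mul sqrtrM ?sqr_ge0 // sqrtr_sqr ger0_norm // nm_ge0.
Qed.

Let qcauchy (u : nat -> seq (C * X)) :=
  forall e : R, 0 < e -> exists n0, forall m n, (n0 <= m)%N -> (n0 <= n)%N -> N (dl (u m) (u n)) < e.

(** A vector [v] of the completed span of [X] is encoded by the function [y |-> <v, y>], a limit
    along a sequence of combinations that is Cauchy for the form. Vectors of norm 0 give the zero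
    function, so no quotient is formed. *)
Let repr (u : nat -> seq (C * X)) (f : X -> C) :=
  qcauchy u /\ forall y, nlim (fun n => kform (u n) [:: (1, y)]) (f y).

Definition kpred : {pred (X -> C)} := fun f => `[< exists u, repr u f >].

Let kform1 L L' : kform L L' = \sum_(r <- L') r.1^* * kform L [:: (1, r.2)].
Proof.
rewrite /kform exchange_big; apply: eq_bigr => r _.
rewrite mulr_sumr; apply: eq_bigr => p _.
by rewrite big_seq1 /= rmorph1 mulr1 mulrCA !mulrA.
Qed.

Let repr_lin c u v f g : repr u f -> repr v g ->
  repr (fun n => sc c (u n) ++ v n) (c *: f + g).
Proof.
move=> [cu uf] [cv vg]; split.
  move=> e e0; have k1 : 0 < nm c + 1 by have := nm_ge0 c; lra.
  have [|n1 h1] := cu (e / 2 / (nm c + 1)); first by apply: divr_gt0; lra.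
  have [|n2 h2] := cv (e / 2); first by lra.
  exists (maxn n1 n2) => m n; rewrite !geq_max => /andP[a1 a2] /andP[b1 b2].
  have -> : N (dl (sc c (u m) ++ v m) (sc c (u n) ++ v n)) =
            N (sc c (dl (u m) (u n)) ++ dl (v m) (v n)).
    congr Num.sqrt; congr complex.Re.
    by rewrite /dl !(qDl, qDr, qZl, qZr); ring.
  apply: le_lt_trans (ND _ _) _; rewrite NZ.
  have := h1 _ _ a1 b1; rewrite ltr_pdivlMr // => {}h1; have := h2 _ _ a2 b2.
  have := N0 (dl (u m) (u n)); nra.
move=> y; rewrite (_ : (fun _ => _) = fun n => c * kform (u n) [:: (1, y)] + kform (v n) [:: (1, y)]); last first.
  by apply/funext => n; rewrite qDl qZl.
apply: nlimD (vg y); apply: (@nlim_map _ _ _ (fun z => c * z) (nm c)) (uf y) => a b.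
by rewrite -mulrBr nmM.
Qed.

Lemma kpred_submod : submod_closed kpred.
Proof.
split; first apply/asboolP.
  exists (fun=> [::]); split.
    move=> e e0; exists 0 => m n _ _.
    by rewrite /N /dl /= /kform !big_nil sqrtr0.
  by move=> y; rewrite (_ : (fun=> _) = fun=> 0); [exact: nlim_cst|
     apply/funext => n; rewrite /kform big_nil].
move=> c f g /asboolP[u hu] /asboolP[v hv]; apply/asboolP.
by eexists; exact: repr_lin hu hv.
Qed.

HB.instance Definition _ := GRing.isSubmodClosed.Build C (X -> C) kpred kpred_submod.

Record kfun := Kfun { kf :> X -> C; kfP : kf \in kpred }.
HB.instance Definition _ := [isSub for kf].
HB.instance Definition _ := [Choice of kfun by <:].
HB.instance Definition _ := [SubChoice_isSubLmodule of kfun by <:].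

Let rp (f : kfun) : nat -> seq (C * X) := projT1 (cid (asboolP _ (kfP f))).

Let rpP f : repr (rp f) f.
Proof. by rewrite /rp; case: cid. Qed.

Let bnd u : qcauchy u -> exists M n0, forall n, (n0 <= n)%N -> N (u n) <= M.
Proof.
move=> /(_ 1 ltr01)[n0 h]; exists (N (u n0) + 1), n0 => n hn.
have -> : N (u n) = N (u n0 ++ dl (u n) (u n0)).
  by congr Num.sqrt; congr complex.Re; rewrite /dl !(qDl, qDr, qZl, qZr); ring.
by apply: le_trans (ND _ _) _; rewrite lerD2l ltW // h.
Qed.

Let nlim_kform (w : nat -> seq (C * X)) f L :
  (forall y, nlim (fun n => kform (w n) [:: (1, y)]) (f y)) ->
  nlim (fun n => kform (w n) L) (\sum_(r <- L) r.1^* * f r.2).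
Proof.
move=> h; rewrite (_ : (fun n => _) = fun n => \sum_(r <- L) r.1^* * kform (w n) [:: (1, r.2)]); last first.
  by apply/funext => n; rewrite kform1.
elim: L => [|r L IH]; first by under eq_fun do rewrite big_nil; rewrite big_nil; exact: nlim_cst.
under eq_fun do rewrite big_cons; rewrite big_cons; apply: nlimD IH.
apply: (@nlim_map _ _ _ (fun z => r.1^* * z) (nm r.1)) (h r.2) => a b.
by rewrite -mulrBr nmM nmJ.
Qed.

(** The difference [w n] represents 0, so its pairing with a fixed [w n1] tends to 0, while its
    pairing with [w n - w n1] is small by the Cauchy property. This makes the inner product of
    functions independent of the sequences. *)
Let null u u' f : repr u f -> repr u' f ->
  forall e : R, 0 < e -> exists n0, forall n, (n0 <= n)%N -> N (dl (u n) (u' n)) < e.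
Proof.
move=> hu hu' e e0; have [cw w0] := repr_lin (-1) hu' hu.
rewrite scaleN1r addNr in w0.
set w := fun n => _ in cw w0.
have Nw n : N (dl (u n) (u' n)) = N (w n).
  by congr Num.sqrt; congr complex.Re; rewrite /dl /w !(qDl, qDr, qZl, qZr); ring.
have [M [n0 hM]] := bnd cw.
have M0 : 0 <= M by apply: le_trans (hM n0 (leqnn _)).
have [|n1 h1] := cw (e ^+ 2 / 2 / (M + 1)); first by rewrite !divr_gt0 ?exprn_gt0 //; lra.
have := @nlim_kform w _ (w n1) w0; rewrite big1 => [|r _]; last by rewrite mulr0.
move=> /(_ (e ^+ 2 / 2))[|n2 h2]; first by rewrite divr_gt0 ?exprn_gt0.
exists (maxn n0 (maxn n1 n2)) => n; rewrite !geq_max => /and3P[a0 a1 a2].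
rewrite Nw -ltr_sqr ?nnegrE ?N0 ?(ltW e0) // N2.
have -> : kform (w n) (w n) = kform (w n) (dl (w n) (w n1)) + kform (w n) (w n1).
  by rewrite /dl qDr qZr rmorphN rmorph1; ring.
rewrite raddfD /=.
have b1 := le_trans (Re_nm _) (cs (w n) (dl (w n) (w n1))).
have := h2 _ a2; rewrite subr0 => /(le_lt_trans (Re_nm _)) b2.
have := h1 _ _ a1 (leqnn n1); rewrite ltr_pdivlMr; last by lra.
have := hM _ a0; have := N0 (w n); have := N0 (dl (w n) (w n1)); nra.
Qed.

Let prodlt (x y M b : R) : 0 <= x -> 0 <= y -> y <= M -> x * (M + 1) < b -> x * y < b.
Proof. by move=> *; nra. Qed.

Let kd_ex u v f g : repr u f -> repr v g -> exists l, nlim (fun n => kform (u n) (v n)) l.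
Proof.
move=> [cu _] [cv _]; apply: complex_nlim => e e0.
have [M [n0 hM]] := bnd cu; have [M' [n0' hM']] := bnd cv.
have M0 : 0 <= M by apply: le_trans (hM n0 (leqnn _)).
have M0' : 0 <= M' by apply: le_trans (hM' n0' (leqnn _)).
have [|n1 h1] := cu (e / 2 / (M' + 1)); first by rewrite !divr_gt0 //; lra.
have [|n2 h2] := cv (e / 2 / (M + 1)); first by rewrite !divr_gt0 //; lra.
exists (maxn (maxn n0 n0') (maxn n1 n2)) => m n.
rewrite !geq_max => /andP[/andP[a0 a0'] /andP[a1 a2]] /andP[/andP[b0 b0'] /andP[b1 b2]].
have -> : kform (u m) (v m) - kform (u n) (v n) =
    kform (dl (u m) (u n)) (v m) + kform (u n) (dl (v m) (v n)).
  by rewrite /dl qDl qDr qZr qZl rmorphN rmorph1; ring.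
apply: le_lt_trans (nmD _ _) _.
have := h1 _ _ a1 b1; rewrite ltr_pdivlMr; last by lra.
move=> /(prodlt (N0 _) (N0 (v m)) (hM' _ a0')) d1.
have := h2 _ _ a2 b2; rewrite ltr_pdivlMr; last by lra.
move=> /(prodlt (N0 _) (N0 (u n)) (hM _ b0)); rewrite mulrC => d2.
have := cs (dl (u m) (u n)) (v m); have := cs (u n) (dl (v m) (v n)); lra.
Qed.

Let kd (f g : kfun) : C := projT1 (cid (kd_ex (rpP f) (rpP g))).

Let kd_repr u v (f g : kfun) : repr u f -> repr v g -> nlim (fun n => kform (u n) (v n)) (kd f g).
Proof.
move=> hu hv; have [l hl] := kd_ex hu hv; suff -> : kd f g = l by [].
have hk : nlim (fun n => kform (rp f n) (rp g n)) (kd f g) by rewrite /kd; case: cid.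
apply/eqP; rewrite -subr_eq0; apply/eqP/nm_small => e e0.
have [M [n0 hM]] := bnd (rpP f).1; have [M' [n0' hM']] := bnd hv.1.
have M0 : 0 <= M by apply: le_trans (hM n0 (leqnn _)).
have M0' : 0 <= M' by apply: le_trans (hM' n0' (leqnn _)).
have [|n1 h1] := null (rpP f) hu (e := e / 4 / (M' + 1)); first by rewrite !divr_gt0 //; lra.
have [|n2 h2] := null (rpP g) hv (e := e / 4 / (M + 1)); first by rewrite !divr_gt0 //; lra.
have [|n3 h3] := hl (e / 4); first by lra.
have [|n4 h4] := hk (e / 4); first by lra.
pose n := maxn (maxn (maxn n0 n0') (maxn n1 n2)) (maxn n3 n4).
have := leqnn n; rewrite {1}/n !geq_max => /andP[/andP[/andP[a0 a0'] /andP[a1 a2]] /andP[a3 a4]].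
have E : kform (rp f n) (rp g n) - kform (u n) (v n) =
    kform (dl (rp f n) (u n)) (v n) + kform (rp f n) (dl (rp g n) (v n)).
  by rewrite /dl qDl qDr qZr qZl rmorphN rmorph1; ring.
have t1 := nm_tri (kform (rp f n) (rp g n)) (kd f g) l.
have t2 := nm_tri (kform (u n) (v n)) (kform (rp f n) (rp g n)) l.
have := nmD (kform (dl (rp f n) (u n)) (v n)) (kform (rp f n) (dl (rp g n) (v n))).
rewrite -E; rewrite (nmBC (kd f g) (kform _ _)) in t1.
have := h1 _ a1; rewrite ltr_pdivlMr; last by lra.
move=> /(prodlt (N0 _) (N0 (v n)) (hM' _ a0')) b1.
have := h2 _ a2; rewrite ltr_pdivlMr; last by lra.
move=> /(prodlt (N0 _) (N0 (rp f n)) (hM _ a0)); rewrite mulrC => b2.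
have := h3 _ a3; have := h4 _ a4.
have := cs (dl (rp f n) (u n)) (v n); have := cs (rp f n) (dl (rp g n) (v n)).
lra.
Qed.

Let kd_lin z : scalar (kd^~ z).
Proof.
move=> c f g.
have h : repr (fun n => sc c (rp f n) ++ rp g n) (c *: f + g : kfun).
  exact: repr_lin (rpP f) (rpP g).
apply: (nlim_uniq (kd_repr h (rpP z))).
rewrite (_ : (fun _ => _) = fun n => c * kform (rp f n) (rp z n) + kform (rp g n) (rp z n)); last first.
  by apply/funext => n; rewrite qDl qZl.
apply: nlimD (kd_repr (rpP _) (rpP _)).
apply: (@nlim_map _ _ _ (fun z => c * z) (nm c)) (kd_repr (rpP _) (rpP _)) => a b.
by rewrite -mulrBr nmM.
Qed.

Let kd_herm f g : kd f g = (kd g f)^*.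
Proof.
apply: (nlim_uniq (kd_repr (rpP f) (rpP g))).
rewrite (_ : (fun _ => _) = fun n => (kform (rp g n) (rp f n))^*); last first.
  by apply/funext => n; rewrite qC.
apply: (@nlim_map _ _ _ (fun z => z^*) 1) (kd_repr (rpP _) (rpP _)) => a b.
by rewrite -rmorphB nmJ mul1r.
Qed.

Let nlim_Re_le (u : nat -> C) l (b : R) :
  nlim u l -> (exists n0, forall n, (n0 <= n)%N -> complex.Re (u n) <= b) -> complex.Re l <= b.
Proof.
move=> h [n0 hb]; rewrite leNgt; apply/negP => lb.
have [|n1 h1] := h (complex.Re l - b); first by lra.
have := h1 _ (leq_maxr n0 n1); have := hb _ (leq_maxl n0 n1).
by have := Re_nm (l - u (maxn n0 n1)); rewrite (nmBC l) raddfB /=; lra.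
Qed.

Let kd_ge0 f : 0 <= complex.Re (kd f f).
Proof.
have := @nlim_Re_le _ _ 0 (@nlim_map _ _ _ (fun z : C => - z) 1 _ _ _ (kd_repr (rpP f) (rpP f))).
rewrite raddfN /= oppr_le0; apply=> [a b|]; first by rewrite -opprD nmN mul1r.
by exists 0 => n _; rewrite raddfN /= oppr_le0 kP.2.
Qed.

Let kdDl f g z : kd (f + g) z = kd f z + kd g z.
Proof. by have := kd_lin z 1 f g; rewrite !scale1r mul1r. Qed.

Let kdZl c f z : kd (c *: f) z = c * kd f z.
Proof.
have d0 : kd 0 z = 0 by apply: (@addrI _ (kd 0 z)); rewrite -kdDl !addr0.
by have := kd_lin z c f 0; rewrite !addr0 d0 addr0.
Qed.

Let kdDr f g z : kd z (f + g) = kd z f + kd z g.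
Proof. by rewrite kd_herm kdDl rmorphD /= -!kd_herm. Qed.

Let kdZr c f z : kd z (c *: f) = c^* * kd z f.
Proof. by rewrite kd_herm kdZl rmorphM /= -kd_herm. Qed.

Let kdNl f z : kd (- f) z = - kd f z.
Proof. by rewrite -scaleN1r kdZl mulN1r. Qed.

Let kdNr f z : kd z (- f) = - kd z f.
Proof. by rewrite kd_herm kdNl rmorphN /= -kd_herm. Qed.

Let repr_list L : repr (fun=> L) (fun y => kform L [:: (1, y)]).
Proof.
split=> [e e0|y]; last exact: nlim_cst.
exists 0 => m n _ _; rewrite /N (_ : kform _ _ = 0) ?sqrtr0 //.
by rewrite /dl !(qDl, qDr, qZl, qZr) rmorphN rmorph1; ring.
Qed.

Let inj_pred L : (fun y => kform L [:: (1, y)]) \in kpred.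
Proof. by apply/asboolP; exists (fun=> L); exact: repr_list. Qed.

Let inj L : kfun := Kfun (inj_pred L).

Let injP L : repr (fun=> L) (inj L). Proof. exact: repr_list. Qed.

Let kd_inj L L' : kd (inj L) (inj L') = kform L L'.
Proof. by apply: (nlim_uniq (kd_repr (injP L) (injP L'))); exact: nlim_cst. Qed.

Let kd_eval f y : kd f (inj [:: (1, y)]) = f y.
Proof. by apply: (nlim_uniq (kd_repr (rpP f) (injP _))); exact: (rpP f).2. Qed.

Let e (f : kfun) : R := complex.Re (kd f f).

Let eB f g : e (f - g) <= 2 * e f + 2 * e g.
Proof.
have : 0 <= e (f + g) by exact: kd_ge0.
by rewrite /e !kdDl !kdDr !kdNl !kdNr opprK !raddfD !raddfN /=; lra.
Qed.

Let kd_cs f g : nm (kd f g) ^+ 2 <= e f * e g.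
Proof.
apply: cs_abs => [|c]; first exact: kd_ge0.
have := kd_ge0 (f + c^* *: g).
rewrite kdDl !kdDr !kdZl !kdZr conjCK (kd_herm g f) -rmorphM /= !raddfD /= ReJ.
by rewrite mulrA mulJc Re_real_mul -/(e f) -/(e g); lra.
Qed.

Let kd_eq0 f : complex.Re (kd f f) = 0 -> f = 0.
Proof.
move=> h; apply/val_inj/funext => y /=; rewrite -kd_eval.
have := kd_cs f (inj [:: (1, y)]); rewrite /e h mul0r => h2.
by apply: nm0_eq0; apply/eqP; rewrite -sqrf_eq0 eq_le h2 sqr_ge0.
Qed.

Let e_dl u (f : kfun) L (b : R) : repr u f ->
  (exists n0, forall n, (n0 <= n)%N -> N (dl (u n) L) <= b) -> e (f - inj L) <= b ^+ 2.
Proof.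
move=> hu [n0 h].
have hr : repr (fun n => sc (-1) L ++ u n) (f - inj L).
  have -> : f - inj L = -1 *: inj L + f by rewrite scaleN1r addrC.
  exact: repr_lin (injP L) hu.
apply: nlim_Re_le (kd_repr hr hr) _; exists n0 => n /h hn.
have b0 : 0 <= b by apply: le_trans hn.
rewrite -N2 ler_sqr ?nnegrE //; apply: le_trans hn.
rewrite le_eqVlt; apply/orP; left; apply/eqP; congr Num.sqrt; congr complex.Re.
by rewrite /dl !(qDl, qDr, qZl, qZr); ring.
Qed.

Let approx f (b : R) : 0 < b -> exists L, e (f - inj L) < b.
Proof.
move=> b0; have s0 : 0 < Num.sqrt (b / 2) by rewrite sqrtr_gt0; lra.
have [n0 h] := (rpP f).1 _ s0; exists (rp f n0).
apply: le_lt_trans (@e_dl _ _ _ (Num.sqrt (b / 2)) (rpP f) _) _.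
  by exists n0 => n hn; rewrite ltW // h.
by rewrite sqr_sqrtr; lra.
Qed.

(** Each [u n] is replaced by a combination [w n] at squared distance below [iv n]; the sequence [w]
    is itself Cauchy and represents the limit. *)
Let kd_compl (u : nat -> kfun) :
  (forall b : R, 0 < b -> exists N, forall m n, (N <= m)%N -> (N <= n)%N ->
     complex.Re (kd (u m - u n) (u m - u n)) < b) ->
  exists l, forall b : R, 0 < b -> exists N, forall n, (N <= n)%N ->
     complex.Re (kd (u n - l) (u n - l)) < b.
Proof.
move=> hc.
have /choice[w hw] : forall n, exists L, e (u n - inj L) < iv R n.
  by move=> n; apply: approx; exact: iv_gt0.
have Ndl m n : N (dl (w m) (w n)) ^+ 2 <= 4 * (iv R m + iv R n) + 4 * e (u m - u n).
  have -> : N (dl (w m) (w n)) ^+ 2 = e (inj (w m) - inj (w n)).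
    rewrite N2 /e !kdDl !kdDr !kdNl !kdNr !kd_inj /dl !(qDl, qDr, qZl, qZr).
    by rewrite rmorphN rmorph1; congr complex.Re; ring.
  have -> : inj (w m) - inj (w n) = (u n - inj (w n)) - (u n - u m + (u m - inj (w m))).
    by rewrite addrA subrK opprB [RHS]addrC addrA subrK.
  apply: le_trans (eB _ _) _.
  have := eB (u n - u m) (- (u m - inj (w m))); rewrite opprK.
  have eN x : e (- x) = e x by rewrite /e kdNl kdNr opprK.
  rewrite eN -(eN (u n - u m)) opprB; have := hw m; have := hw n.
  have := kd_ge0 (u m - u n); rewrite -/(e _); have := iv_gt0 R m; have := iv_gt0 R n; lra.
have cw : qcauchy w.
  move=> b b0; have b1 : 0 < b ^+ 2 / 16 by rewrite divr_gt0 // exprn_gt0.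
  have [n1 h1] := hc _ b1; have [n2 h2] := inv_small b1.
  exists (maxn n1 n2) => m n; rewrite !geq_max => /andP[a1 a2] /andP[c1 c2].
  rewrite -ltr_sqr ?nnegrE ?N0 ?(ltW b0) //; apply: le_lt_trans (Ndl m n) _.
  by have := h1 _ _ a1 c1; rewrite -/(e _); have := h2 _ a2; have := h2 _ c2; lra.
have /choice[l hl] : forall y, exists z, nlim (fun n => kform (w n) [:: (1, y)]) z.
  move=> y; apply: complex_nlim => b b0.
  have n1 : 0 < N [:: (1, y)] + 1 by have := N0 [:: (1, y)]; lra.
  have [|n0 h0] := cw (b / (N [:: (1, y)] + 1)); first exact: divr_gt0.
  exists n0 => m n hm hn.
  have -> : kform (w m) [:: (1, y)] - kform (w n) [:: (1, y)] = kform (dl (w m) (w n)) [:: (1, y)].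
    by rewrite /dl qDl qZl; ring.
  apply: le_lt_trans (cs _ _) _; have := h0 _ _ hm hn; rewrite ltr_pdivlMr //.
  by have := N0 (dl (w m) (w n)); nra.
have lk : l \in kpred by apply/asboolP; exists w.
exists (Kfun lk) => b b0.
have b1 : 0 < b / 8 by lra.
have [n1 h1] := inv_small b1.
have s0 : 0 < Num.sqrt (b / 8) by rewrite sqrtr_gt0.
have [n2 h2] := cw _ s0.
exists (maxn n1 n2) => n; rewrite geq_max => /andP[a1 a2].
have -> : u n - Kfun lk = (u n - inj (w n)) - (Kfun lk - inj (w n)).
  by rewrite opprB addrA subrK.
apply: le_lt_trans (eB _ _) _.
have : e (Kfun lk - inj (w n)) <= Num.sqrt (b / 8) ^+ 2.
  apply: (@e_dl w) => //; exists n2 => m hm; exact/ltW/h2.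
rewrite sqr_sqrtr; last by lra.
by have := hw n; have := h1 _ a1; lra.
Qed.

Let kax : inner_axioms kd := InnerAxioms kd_lin kd_herm kd_ge0 kd_eq0 kd_compl.

(** The common source of the tensor products, induced modules, closed subspaces and GNS spaces
    below. *)
Lemma kernel_space : exists (H : hilbertType R) (phi : X -> H),
  (forall x y, hdot (phi x) (phi y) = k x y) /\ total (range phi).
Proof.
exists (mkHilbert kax), (fun x => inj [:: (1, x)]); split=> [x y|f hf].
  by rewrite mkHilbert_dot kd_inj /kform !big_seq1 /= rmorph1 !mul1r.
apply/val_inj/funext => y; have := hf (inj [:: (1, y)]) (ex_intro2 _ _ y I erefl).
rewrite mkHilbert_dot (_ : kd _ f = (f y)^*); first by move=> /eqP; rewrite conjC_eq0 => /eqP.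
by rewrite kd_herm kd_eval.
Qed.

End Kernel.

Section Lift.
Variable R : realType.
Local Notation C := R[i].
Implicit Types H K : hilbertType R.

Definition lc (X : Type) (V : lmodType C) (f : X -> V) (L : seq (C * X)) : V :=
  \sum_(p <- L) p.1 *: f p.2.

Lemma lc_cat X (V : lmodType C) (f : X -> V) L L' : lc f (L ++ L') = lc f L + lc f L'.
Proof. by rewrite /lc big_cat. Qed.

Lemma lc_scale X (V : lmodType C) (f : X -> V) c L :
  lc f [seq (c * p.1, p.2) | p <- L] = c *: lc f L.
Proof. by rewrite /lc big_map scaler_sumr; apply: eq_bigr => p _; rewrite scalerA. Qed.

Lemma lc_lin X (V W : lmodType C) (f : X -> V) (T : V -> W) L :
  linear T -> T (lc f L) = lc (T \o f) L.
Proof. by move=> lT; rewrite /lc linS //; apply: eq_bigr => p _; rewrite linZ. Qed.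

Lemma span_lc X (V : lmodType C) (f : X -> V) v :
  span (range f) v -> exists L, v = lc f L.
Proof.
elim=> [|c s w [x _ <-] _ [L ->]]; first by exists [::]; rewrite /lc big_nil.
by exists ((c, x) :: L); rewrite /lc big_cons.
Qed.

Lemma lc_hdot X Y H (f : X -> H) (g : Y -> H) L L' :
  hdot (lc f L) (lc g L') = \sum_(p <- L) \sum_(r <- L') p.1 * r.1^* * hdot (f p.2) (g r.2).
Proof.
rewrite /lc hdot_suml; apply: eq_bigr => p _; rewrite hdotZl hdot_sumr mulr_sumr.
by apply: eq_bigr => r _; rewrite hdotZr mulrA.
Qed.

Lemma approx_lc X H (f : X -> H) v (e : R) : total (range f) -> 0 < e ->
  exists L, nm (v - lc f L) < e.
Proof.
move=> tf e0; have [u /span_lc[L ->] h] := span_approx (@total_cspan _ _ _ v tf) e0.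
by exists L.
Qed.

Lemma bop_ext H K (S : set H) (T T' : H -> K) : bop T -> bop T' -> total S ->
  (forall s, S s -> T s = T' s) -> forall v, T v = T' v.
Proof.
move=> bT bT' tS h v; apply: hdot_ext => w; rewrite !adjP //.
suff -> : adj T w = adj T' w by [].
apply/eqP; rewrite -subr_eq0; apply/eqP/tS => s Ss.
by rewrite hdotBr -!adjP // h // subrr.
Qed.

Lemma nlim_sub_map (V W : normedZmodType C) (u : nat -> V) (w : nat -> W) (k : R) :
  ncauchy u -> (forall m n, nm (w m - w n) <= k * nm (u m - u n)) -> ncauchy w.
Proof.
move=> cu h e e0; have k1 : 0 < `|k| + 1 by have := normr_ge0 k; lra.
have [|N hN] := cu (e / (`|k| + 1)); first exact: divr_gt0.
exists N => m n hm hn; apply: le_lt_trans (h m n) _.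
have := hN m n hm hn; rewrite ltr_pdivlMr // mulrC; apply: le_lt_trans.
by apply: ler_wpM2r; [exact: nm_ge0|have := ler_norm k; lra].
Qed.

(** The family [f] may be linearly dependent; the bound on combinations makes the map well defined
    as well as bounded. *)
Lemma lift X H K (f : X -> H) (g : X -> K) (k : R) : total (range f) ->
  (forall L, nm (lc g L) <= k * nm (lc f L)) ->
  exists T : H -> K, [/\ linear T, forall v, nm (T v) <= k * nm v & forall x, T (f x) = g x].
Proof.
move=> tf hk.
have /choice[A hA] : forall v, exists A : nat -> seq (C * X), nlim (fun n => lc f (A n)) v.
  move=> v; have /choice[A hA] : forall n, exists L, nm (v - lc f L) < iv R n.
    by move=> n; apply: approx_lc => //; exact: iv_gt0.
  exists A => e e0; have [N hN] := inv_small e0; exists N => n /hN h.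
  by rewrite nmBC; apply: lt_trans h.
have hB L L' : nm (lc g L - lc g L') <= k * nm (lc f L - lc f L').
  have e (V : lmodType C) (h : X -> V) : lc h L - lc h L' = lc h (L ++ [seq (-1 * p.1, p.2) | p <- L']).
    by rewrite lc_cat lc_scale scaleN1r.
  by rewrite !e.
have ex v : exists l, nlim (fun n => lc g (A v n)) l.
  apply: complete_nlim; apply: (@nlim_sub_map _ _ (fun n => lc f (A v n)) _ k).
    exact: nlim_cauchy (hA v).
  by move=> m n; exact: hB.
pose T v := projT1 (cid (ex v)).
have TP v : nlim (fun n => lc g (A v n)) (T v) by rewrite /T; case: cid.
have Tu v (B : nat -> seq (C * X)) : nlim (fun n => lc f (B n)) v -> nlim (fun n => lc g (B n)) (T v).
  move=> hB' e e0; have k1 : 0 < `|k| + 1 by have := normr_ge0 k; lra.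
  have [|N1 h1] := TP v (e / 2); first by lra.
  have [|N2 h2] := hA v (e / 4 / (`|k| + 1)); first by rewrite !divr_gt0.
  have [|N3 h3] := hB' (e / 4 / (`|k| + 1)); first by rewrite !divr_gt0.
  exists (maxn N1 (maxn N2 N3)) => n; rewrite !geq_max => /and3P[a1 a2 a3].
  have := h2 _ a2; have := h3 _ a3; rewrite !ltr_pdivlMr // => b3 b2; have b1 := h1 _ a1.
  have t1 := nm_tri (lc g (A v n)) (lc g (B n)) (T v).
  have t2 := nm_tri v (lc f (B n)) (lc f (A v n)); rewrite (nmBC v (lc f _)) in t2.
  have := hB (B n) (A v n); have := ler_norm k; have := normr_ge0 k.
  have := nm_ge0 (lc f (B n) - lc f (A v n)); nra.
exists T; split.
- move=> c x y; apply: nlim_uniq (Tu _ (fun n => [seq (c * p.1, p.2) | p <- A x n] ++ A y n) _) _.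
    rewrite (_ : (fun n => _) = fun n => c *: lc f (A x n) + lc f (A y n)); last first.
      by apply/funext => n; rewrite lc_cat lc_scale.
    apply: nlimD (hA y); apply: (@nlim_map _ _ _ (fun z => c *: z) (nm c)) (hA x) => a b.
    by rewrite -scalerBr nmZ.
  rewrite (_ : (fun n => _) = fun n => c *: lc g (A x n) + lc g (A y n)); last first.
    by apply/funext => n; rewrite lc_cat lc_scale.
  apply: nlimD (TP y); apply: (@nlim_map _ _ _ (fun z => c *: z) (nm c)) (TP x) => a b.
  by rewrite -scalerBr nmZ.
- move=> v; rewrite leNgt; apply/negP => hlt.
  set d := nm (T v) - k * nm v; have d0 : 0 < d by rewrite subr_gt0.
  have k1 : 0 < `|k| + 1 by have := normr_ge0 k; lra.
  have [|N1 h1] := TP v (d / 2); first by lra.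
  have [|N2 h2] := hA v (d / 2 / (`|k| + 1)); first by rewrite !divr_gt0.
  have b1 := h1 _ (leq_maxl N1 N2); have := h2 _ (leq_maxr N1 N2); rewrite ltr_pdivlMr // => b2.
  set n := maxn N1 N2 in b1 b2.
  have t1 := nmB (lc g (A v n)) (lc g (A v n) - T v); rewrite opprB addrC subrK in t1.
  have t2 := nmD (lc f (A v n) - v) v; rewrite subrK in t2.
  have t3 := nmD (v - lc f (A v n)) (lc f (A v n)); rewrite subrK nmBC in t3.
  have h := hk (A v n).
  have [k0|k0] := leP 0 k.
    by rewrite ger0_norm // in b2; rewrite /d in b1 b2; nra.
  by rewrite ltr0_norm // in b2; rewrite /d in b1 b2; nra.
- move=> x; have h := Tu (f x) (fun=> [:: (1, x)]).
  apply: (nlim_uniq (h _)); first by move=> e e0; exists 0 => n _; rewrite /lc big_seq1 scale1r subrr nm0.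
  by move=> e e0; exists 0 => n _; rewrite /lc big_seq1 scale1r subrr nm0.
Qed.

Lemma isom_hdot H K (T : H -> K) : linear T -> (forall v, nm (T v) = nm v) ->
  forall v w, hdot (T v) (T w) = hdot v w.
Proof.
move=> lT h.
have re v w : complex.Re (hdot (T v) (T w)) = complex.Re (hdot v w).
  by have := nmsqD (T v) (T w); rewrite -linD // !h nmsqD; lra.
move=> v w; rewrite (complexE (hdot (T v) _)) (complexE (hdot v _)) re; congr (_ + 'i * _%:C).
have := re ('i *: v) w; rewrite linZ // !hdotZl ![_ * hdot _ _]mulrC !ReiNIm.
exact: oppr_inj.
Qed.

Lemma lift_isom X H K (f : X -> H) (g : X -> K) : total (range f) ->
  (forall x y, hdot (g x) (g y) = hdot (f x) (f y)) ->
  exists T : H -> K, [/\ linear T, forall v, nm (T v) = nm v & forall x, T (f x) = g x].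
Proof.
move=> tf h.
have e L : nm (lc g L) = nm (lc f L).
  apply/eqP; rewrite -(@eqrXn2 _ 2) ?nm_ge0 //; apply/eqP/complexI.
  rewrite -!hdotxx !lc_hdot; apply: eq_bigr => p _; apply: eq_bigr => r _.
  by rewrite h.
have [|T [lT bT Tf]] := @lift X H K f g 1 tf; first by move=> L; rewrite e mul1r.
exists T; split=> // v; apply/eqP; rewrite eq_le -{1}[nm v]mul1r bT /= leNgt; apply/negP => hlt.
have [|L hL] := @approx_lc _ _ f v ((nm v - nm (T v)) / 2) tf; first by rewrite divr_gt0 ?subr_gt0.
have := nmB (T v) (T (v - lc f L)); rewrite -linB // opprB addrC subrK (lc_lin _ _ lT).
have -> : lc (T \o f) L = lc g L by apply: eq_bigr => p _; rewrite /= Tf.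
rewrite e; have := bT (v - lc f L); rewrite mul1r.
have := nmD (v - lc f L) (lc f L); rewrite subrK; lra.
Qed.

Lemma log_convex_le (a : nat -> R) (r A : R) : 0 <= r ->
  (forall n, 0 <= a n) -> (forall n, a n ^+ 2 <= a n.*2 * a 0) ->
  (forall n, a n <= A * r ^+ n) -> a 1 <= r * a 0.
Proof.
move=> r0 a0 ac ab; have [z|z] := eqVneq (a 0) 0.
  have h : a 1 ^+ 2 = 0 by apply/le_anti; rewrite sqr_ge0 andbT -(mulr0 (a 1.*2)) -z ac.
  by rewrite z mulr0; move/eqP: h; rewrite sqrf_eq0 => /eqP ->.
have p0 : 0 < a 0 by rewrite lt_neqAle eq_sym z a0.
have step k : a 1 ^+ (2 ^ k) * a 0 <= a (2 ^ k)%N * a 0 ^+ (2 ^ k).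
  elim: k => [|k IH]; first by rewrite !expn0 !expr1.
  rewrite expnS mul2n -addnn !exprD -(ler_pM2r p0).
  have := ac (2 ^ k)%N; rewrite -addnn; move: IH (a0 (2 ^ k)%N).
  have : 0 <= a 1 ^+ (2 ^ k) by exact: exprn_ge0.
  have : 0 <= a 0 ^+ (2 ^ k) by exact: exprn_ge0.
  move: (a 1 ^+ _) (a 0 ^+ _) (a (2 ^ k)%N) (a (2 ^ k + 2 ^ k)%N) => x y z' w y0 x0 h1 z0 h2.
  apply: le_trans (_ : (x * a 0) ^+ 2 <= _); first by rewrite le_eqVlt; apply/orP; left; apply/eqP; ring.
  apply: le_trans (_ : (z' * y) ^+ 2 <= _); first by rewrite ler_sqr ?nnegrE ?mulr_ge0.
  have -> : w * (y * y) * a 0 = w * a 0 * y ^+ 2 by ring.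
  by rewrite exprMn ler_wpM2r ?sqr_ge0.
rewrite leNgt; apply/negP => hlt.
have [rz|rn] := eqVneq r 0.
  have := ac 1; have := ab 2; rewrite rz expr0n mulr0 => h; have := a0 2.
  move=> h' h3; have a2 : a 2 = 0 by lra.
  by move: h3; rewrite (_ : 1.*2 = 2)%N // a2 mul0r => h3; move: hlt; rewrite rz mul0r; nra.
have rp : 0 < r by rewrite lt_neqAle eq_sym rn r0.
set t := a 1 / (r * a 0).
have t1 : 1 < t by rewrite ltr_pdivlMr ?mul1r // mulr_gt0.
have ra : r * a 0 != 0 by rewrite gt_eqF // mulr_gt0.
have tk k : t ^+ (2 ^ k) * a 0 <= A.
  have := step k; have := ab (2 ^ k)%N.
  move=> h h'; have {}h' : a 1 ^+ (2 ^ k) * a 0 <= A * r ^+ (2 ^ k) * a 0 ^+ (2 ^ k).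
    by apply: le_trans h' _; apply: ler_wpM2r h; exact: exprn_ge0.
  have q : 0 < (r * a 0) ^+ (2 ^ k) by rewrite exprn_gt0 // mulr_gt0.
  by rewrite -(ler_pM2r q) mulrAC -exprMn divfK // exprMn mulrA.
(* As [t > 1], Bernoulli's inequality makes the powers of [t] exceed every bound, against [tk]. *)
have bern n : 1 + n%:R * (t - 1) <= t ^+ n.
  elim: n => [|n IH]; first by rewrite mul0r addr0.
  rewrite exprS; apply: le_trans (_ : t * (1 + n%:R * (t - 1)) <= _); last first.
    by apply: ler_wpM2l => //; lra.
  rewrite -natr1; have : 0 <= n%:R * (t - 1) ^+ 2 by rewrite mulr_ge0 // sqr_ge0.
  nra.
have A0 : 0 <= A by apply: le_trans (tk 0); rewrite mulr_ge0 // exprn_ge0 //; lra.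
have d0 : 0 < (t - 1) * a 0 by rewrite mulr_gt0 // subr_gt0.
pose n := Num.bound (A / ((t - 1) * a 0)).
have hn : A < n%:R * ((t - 1) * a 0).
  by rewrite -ltr_pdivrMr //; apply: archi_boundP; rewrite divr_ge0 // ltW.
have := tk n; have := bern (2 ^ n)%N.
have : (n%:R : R) <= (2 ^ n)%:R by rewrite ler_nat ltnW // ltn_expl.
move: (t ^+ (2 ^ n)) => T h1 h2 h3.
have := ler_wpM2r (ltW p0) h2.
have := ler_wpM2r (ltW d0) h1.
nra.
Qed.

(* With [s] in the role of [T* T], the norm of [T] is found from the growth of the powers of [s] on a total set. *)
Lemma power_trick X H K (f : X -> H) (g : X -> K) (s : X -> X) (r : R) : 0 <= r ->
  (forall x y, hdot (g x) (g y) = hdot (f (s x)) (f y)) ->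
  (forall x, exists A, forall n, nm (f (iter n s x)) <= A * r ^+ n) ->
  forall L, nm (lc g L) ^+ 2 <= r * nm (lc f L) ^+ 2.
Proof.
move=> r0 hg gr L.
have sym x y : hdot (f (s x)) (f y) = hdot (f x) (f (s y)).
  by rewrite -hg (hdotC (g x)) hg -hdotC.
pose w n := lc (fun x => f (iter n s x)) L.
have wS m n : hdot (w m.+1) (w n) = hdot (w m) (w n.+1).
  by rewrite !lc_hdot; apply: eq_bigr => p _; apply: eq_bigr => q _; rewrite sym.
have w2 n m : hdot (w (m + n)%N) (w 0) = hdot (w m) (w n).
  elim: n m => [|n IH] m; first by rewrite addn0.
  by rewrite addnS -addSn IH wS.
have gw : hdot (lc g L) (lc g L) = hdot (w 1) (w 0).
  by rewrite !lc_hdot; apply: eq_bigr => p _; apply: eq_bigr => q _; rewrite hg.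
have [A hA] : exists A, forall n, nm (w n) <= A * r ^+ n.
  rewrite {wS w2 gw}/w; elim: L => [|p L' [A hA]].
    by exists 0 => n; rewrite /lc big_nil nm0 mul0r.
  have [B hB] := gr p.2; exists (nm p.1 * B + A) => n.
  rewrite /lc big_cons mulrDl; apply: le_trans (nmD _ _) _; apply: lerD (hA n).
  by rewrite nmZ -mulrA ler_wpM2l ?nm_ge0.
have h := @log_convex_le (fun n => nm (w n)) r A r0 (fun n => nm_ge0 _) _ hA.
have -> : nm (lc g L) ^+ 2 = complex.Re (hdot (w 1) (w 0)) by rewrite -gw hdotxx.
apply: le_trans (Re_hdot_le _ _) _.
rewrite expr2 mulrA ler_wpM2r ?nm_ge0 //; apply: h => n.
by have := hdot_nm (w n.*2) (w 0); rewrite -addnn w2 hdotxx nmR0 ?sqr_ge0.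
Qed.

(** Positivity of the product kernel goes by induction on the length of the list: splitting every
    second component along that of the head, [z], leaves a product of two squared norms and a list
    in which the head has vanished. *)
Lemma hilbert_tensor_ex H K : exists (P : hilbertType R) (t : H -> K -> P),
  (forall x y x' y', hdot (t x y) (t x' y') = hdot x x' * hdot y y') /\
  total (range (fun p => t p.1 p.2)).
Proof.
have pk : psd_kernel (fun p q : H * K => hdot p.1 q.1 * hdot p.2 q.2).
  split=> [x y|L]; first by rewrite (hdotC x.1) (hdotC x.2) rmorphM.
  have [n] := ubnP (size L); elim: n L => // n IH [|p L]; first by rewrite /kform big_nil.
  rewrite ltnS => hs.
  pose z := p.2.2.
  (* [Q v] is the coefficient of [v] along [z]; for [z = 0] the division by 0 returns 0. *)
  have [Q [lQ hQ]] : exists Q : K -> C, scalar Q /\ forall v, hdot (v - Q v *: z) z = 0.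
    exists (fun v => hdot v z / hdot z z); split.
      by move=> c x y; rewrite hdotDl hdotZl mulrDl mulrA.
    move=> v; rewrite hdotBl hdotZl; have [->|z0] := eqVneq z 0.
      by rewrite !hdot0r mulr0 subrr.
    by rewrite divfK ?subrr //; apply: contra z0 => /eqP/hdot_eq0 ->.
  pose L1 := [seq (r.1 * Q r.2.2, r.2.1) | r <- p :: L].
  pose L2 := [seq (r.1, (r.2.1, r.2.2 - Q r.2.2 *: z)) | r <- L].
  have -> : kform (fun p q : H * K => hdot p.1 q.1 * hdot p.2 q.2) (p :: L) (p :: L) =
      hdot (lc id L1) (lc id L1) * hdot z z +
      kform (fun p q : H * K => hdot p.1 q.1 * hdot p.2 q.2) L2 L2.
    have z0 : z - Q z *: z = 0.
      by apply: hdot_eq0; rewrite hdotBr hdotZr !hQ mulr0 subrr.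
    have -> : kform (fun p q : H * K => hdot p.1 q.1 * hdot p.2 q.2) L2 L2 =
       \sum_(r <- p :: L) \sum_(q <- p :: L) r.1 * q.1^* *
         (hdot r.2.1 q.2.1 * hdot (r.2.2 - Q r.2.2 *: z) (q.2.2 - Q q.2.2 *: z)).
      rewrite big_cons [X in _ = X + _]big1 ?add0r => [|r _]; last first.
        by rewrite z0 hdot0l !mulr0.
      rewrite /kform !big_map; apply: eq_bigr => r _; rewrite big_cons big_map /=.
      by rewrite z0 hdot0r !mulr0 add0r.
    rewrite lc_hdot /L1 big_map mulr_suml /kform -big_split; apply: eq_bigr => r _.
    rewrite big_map mulr_suml -big_split; apply: eq_bigr => q _ /=.
    have -> : hdot r.2.2 q.2.2 = Q r.2.2 * (Q q.2.2)^* * hdot z z +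
        hdot (r.2.2 - Q r.2.2 *: z) (q.2.2 - Q q.2.2 *: z).
      rewrite [in RHS]hdotBr hdotZr hQ mulr0 subr0.
      have := hQ q.2.2; rewrite hdotC => /(congr1 Num.conj); rewrite conjCK conjC0.
      rewrite hdotBr hdotZr => /eqP; rewrite subr_eq0 => /eqP h.
      by rewrite hdotBl hdotZl h -mulrA; ring.
    by rewrite rmorphM /=; ring.
  rewrite raddfD /= addr_ge0 //; last by apply: IH; rewrite size_map.
  by rewrite !hdotxx -rmorphM /= mulr_ge0 ?sqr_ge0.
have [P [t [ht tt]]] := kernel_space pk.
exists P, (fun x y => t (x, y)); split=> [x y x' y'|]; first by rewrite ht.
move=> w hw; apply: tt => _ [[x y] _ <-]; apply: hw; by exists (x, y).
Qed.

End Lift.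

Record cstar_axioms (R : realType) (V : lmodType R[i]) (nr : V -> R)
    (mul : V -> V -> V) (one : V) (st : V -> V) : Prop := CStarAxioms {
  ca_nrD : forall x y, nr (x + y) <= nr x + nr y;
  ca_nrZ : forall c x, nr (c *: x) = nm c * nr x;
  ca_nr0 : forall x, nr x = 0 -> x = 0;
  ca_compl : forall u : nat -> V,
    (forall e : R, 0 < e -> exists N, forall m n, (N <= m)%N -> (N <= n)%N ->
       nr (u m - u n) < e) ->
    exists l, forall e : R, 0 < e -> exists N, forall n, (N <= n)%N -> nr (u n - l) < e;
  ca_A : associative mul;
  ca_1r : left_id one mul;
  ca_r1 : right_id one mul;
  ca_Dl : left_distributive mul +%R;
  ca_Dr : right_distributive mul +%R;
  ca_Zl : forall c x y, mul (c *: x) y = c *: mul x y;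
  ca_Zr : forall c x y, mul x (c *: y) = c *: mul x y;
  ca_sD : {morph st : x y / x + y};
  ca_sZ : forall (c : R[i]) x, st (c *: x) = c^* *: st x;
  ca_sM : forall x y, st (mul x y) = mul (st y) (st x);
  ca_sK : involutive st;
  ca_nrM : forall x y, nr (mul x y) <= nr x * nr y;
  ca_nrS : forall x, nr (mul (st x) x) = nr x ^+ 2 }.

(** * C*-algebras and their representations *)

Section MkCStar.
Variables (R : realType) (V : lmodType R[i]) (nr : V -> R).
Variables (mul : V -> V -> V) (one : V) (st : V -> V) (ax : cstar_axioms nr mul one st).
Local Notation C := R[i].

Definition cstarT of cstar_axioms nr mul one st : Type := V.
Local Notation T := (cstarT ax).

HB.instance Definition _ := GRing.Lmodule.copy T V.

Let nrN x : nr (- x) = nr x.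
Proof. by rewrite -scaleN1r (ca_nrZ ax) nmN (_ : nm (1 : C) = 1) ?mul1r // -[1 : C]/(1%:C) nmR0. Qed.

Let nr_ge0 x : 0 <= nr x.
Proof.
have := ca_nrD ax x (- x); rewrite nrN subrr.
have -> : nr 0 = 0 by rewrite -(scale0r (0 : V)) (ca_nrZ ax) nm0 mul0r.
lra.
Qed.

HB.instance Definition _ := @Lmodule_isNormed.Build C T (fun x => (nr x)%:C)
  (fun x y => etrans (congr1 _ (esym (rmorphD _ _ _))) (etrans (lecR _ _) (ca_nrD ax x y)))
  (fun c x => etrans (congr1 (fun r => r%:C) (ca_nrZ ax c x))
     (etrans (rmorphM _ _ _) (congr1 (fun z => z * (nr x)%:C) (esym (nmE c)))))
  (fun x h => ca_nr0 ax (complexI h)).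

Let nmT (x : T) : nm x = nr x. Proof. by []. Qed.

Let compl (F : set_system T) : ProperFilter F -> cauchy F -> cvg F.
Proof.
apply: seq_complete => u hu; have [l hl] := ca_compl ax hu; by exists l.
Qed.

HB.instance Definition _ := Uniform_isComplete.Build T compl.

Let nM (x y : T) : `|(mul x y : T)| <= `|x| * `|y|.
Proof. by rewrite !nmE -rmorphM lecR; exact: ca_nrM ax x y. Qed.

Let nS (x : T) : `|(mul (st x) x : T)| = `|x| ^+ 2.
Proof. by rewrite !nmE -rmorphXn; congr (_%:C); exact: ca_nrS ax x. Qed.

HB.instance Definition _ := @isCStar.Build R T mul one st
  (ca_A ax) (ca_1r ax) (ca_r1 ax) (ca_Dl ax) (ca_Dr ax) (ca_Zl ax) (ca_Zr ax)
  (ca_sD ax) (ca_sZ ax) (ca_sM ax) (ca_sK ax) nM nS.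

Definition mkCStar : cstarType R := T.

End MkCStar.

Section BH.
Variables (R : realType) (H : hilbertType R).
Local Notation C := R[i].

Lemma bop_id : bop (@id H).
Proof. by split=> //; exists 1 => v; rewrite mul1r. Qed.

Lemma bop_comp (V W U : normedModType C) (f : W -> U) (g : V -> W) : bop f -> bop g -> bop (f \o g).
Proof.
move=> /[dup] -[lf _] /bop_ge0[k k0 hk] [lg [l hl]]; split; first by move=> c x y /=; rewrite lg lf.
exists (k * l) => v /=; apply: le_trans (hk _) _; rewrite -mulrA ler_wpM2l //; exact: ltW.
Qed.

Lemma bop_comb (V W : normedModType C) c (f g : V -> W) : bop f -> bop g -> bop (fun v => c *: f v + g v).
Proof.
move=> [lf [k hk]] [lg [l hl]]; split.
  move=> d x y; rewrite lf lg !scalerDr !scalerA addrACA; congr (_ + _ + (_ + _)).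
  by rewrite mulrC.
exists (nm c * k + l) => v; apply: le_trans (nmD _ _) _; rewrite nmZ mulrDl -mulrA.
by rewrite lerD // ler_wpM2l ?nm_ge0.
Qed.

Lemma bop0 (V W : normedModType C) : bop (fun _ : V => 0 : W).
Proof. by split; [move=> c x y; rewrite scaler0 addr0|exists 0 => v; rewrite nm0 mul0r]. Qed.

Lemma bop_uadj (K : hilbertType R) (f : H -> K) (g : K -> H) : bop f ->
  (forall x y, hdot (f x) y = hdot x (g y)) -> adj f = g.
Proof.
by move=> bf h; apply/funext => y; apply: hdot_extr => x; rewrite -adjP // h.
Qed.

Definition bpred : {pred (H -> H)} := fun f => `[< bop f >].

Lemma bpred_submod : submod_closed bpred.
Proof.
split; first by apply/asboolP; exact: bop0.
by move=> c f g /asboolP hf /asboolP hg; apply/asboolP; exact: bop_comb.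
Qed.

HB.instance Definition _ := GRing.isSubmodClosed.Build C (H -> H) bpred bpred_submod.

Record bopT := BopT { bf :> H -> H; bfP : bf \in bpred }.
HB.instance Definition _ := [isSub for bf].
HB.instance Definition _ := [Choice of bopT by <:].
HB.instance Definition _ := [SubChoice_isSubLmodule of bopT by <:].

Definition mkb (f : H -> H) (h : bop f) : bopT := BopT (asboolT h).

Lemma bopP (f : bopT) : bop f. Proof. exact: asboolP _ (bfP f). Qed.

Definition onorm (f : bopT) : R := sup [set nm (f v) | v in [set v : H | nm v <= 1]].

Let onorm_has (f : bopT) : has_sup [set nm (f v) | v in [set v : H | nm v <= 1]].
Proof.
split; first by exists (nm (f 0)), 0 => //=; rewrite nm0.
have [k k0 hk] := bop_ge0 (bopP f); exists k => _ [v /= v1 <-].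
by apply: le_trans (hk v) _; rewrite -[leRHS]mulr1 ler_wpM2l // ltW.
Qed.

Lemma onorm_ge0 (f : bopT) : 0 <= onorm f.
Proof.
apply: (le_trans (nm_ge0 (f 0))); apply: ub_le_sup; first exact: (onorm_has f).2.
by exists 0 => //=; rewrite nm0.
Qed.

Lemma onorm_le (f : bopT) v : nm (f v) <= onorm f * nm v.
Proof.
have lf := (bopP f).1.
have [->|v0] := eqVneq v 0; first by rewrite lin0 // !nm0 mulr0.
have nv : 0 < nm v.
  by rewrite lt_neqAle nm_ge0 andbT eq_sym; apply: contra v0 => /eqP/nm0_eq0->.
have : nm (f ((nm v)^-1%:C *: v)) <= onorm f.
  apply: ub_le_sup; first exact: (onorm_has f).2.
  by exists ((nm v)^-1%:C *: v) => //=; rewrite nmZ nmR0 ?invr_ge0 ?nm_ge0 // mulVf // gt_eqF.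
by rewrite linZ // nmZ nmR0 ?invr_ge0 ?nm_ge0 // mulrC ler_pdivrMr.
Qed.

Lemma le_onorm (f : bopT) k : 0 <= k -> (forall v, nm (f v) <= k * nm v) -> onorm f <= k.
Proof.
move=> k0 h; apply: ge_sup; first exact: (onorm_has f).1.
by move=> _ [v /= v1 <-]; apply: le_trans (h v) _; rewrite -[leRHS]mulr1 ler_wpM2l.
Qed.

Lemma bopT_ext (f g : bopT) : (forall v, f v = g v) -> f = g.
Proof. by move=> h; apply/val_inj/funext. Qed.

Definition bmul (f g : bopT) := mkb (bop_comp (bopP f) (bopP g)).
Definition bstar (f : bopT) := mkb (bop_adj (bopP f)).

Lemma bstarP (f : bopT) x y : hdot (f x) y = hdot x (bstar f y).
Proof. exact: adjP (bopP f). Qed.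

Lemma bstarPr (f : bopT) x y : hdot y (f x) = hdot (bstar f y) x.
Proof. by rewrite hdotC bstarP -hdotC. Qed.

Let baddE (f g : bopT) v : (f + g) v = f v + g v. Proof. by []. Qed.
Let bscaleE c (f : bopT) v : (c *: f) v = c *: f v. Proof. by []. Qed.

Let b_nr0 f : onorm f = 0 -> f = 0.
Proof.
by move=> h; apply: bopT_ext => v; apply: nm0_eq0; apply/eqP; rewrite eq_le nm_ge0 andbT -(mul0r (nm v)) -h onorm_le.
Qed.

Let b_nrZ c f : onorm (c *: f) = nm c * onorm f.
Proof.
apply/eqP; rewrite eq_le; apply/andP; split.
  apply: le_onorm; first by rewrite mulr_ge0 ?nm_ge0 ?onorm_ge0.
  by move=> v; rewrite bscaleE nmZ -mulrA ler_wpM2l ?nm_ge0 ?onorm_le.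
have [->|c0] := eqVneq c 0; first by rewrite nm0 mul0r onorm_ge0.
have nc : 0 < nm c.
  by rewrite lt_neqAle nm_ge0 andbT eq_sym; apply: contra c0 => /eqP/nm0_eq0->.
rewrite -ler_pdivlMl //; apply: le_onorm; first by rewrite mulr_ge0 ?onorm_ge0 // invr_ge0 ltW.
move=> v; rewrite -mulrA ler_pdivlMl // -nmZ; exact: (onorm_le (c *: f) v).
Qed.

Let b_nrD f g : onorm (f + g) <= onorm f + onorm g.
Proof.
apply: le_onorm; first by rewrite addr_ge0 ?onorm_ge0.
by move=> v; rewrite baddE (le_trans (nmD _ _)) // mulrDl lerD ?onorm_le.
Qed.

Let b_compl (u : nat -> bopT) :
  (forall e : R, 0 < e -> exists N, forall m n, (N <= m)%N -> (N <= n)%N ->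
     onorm (u m - u n) < e) ->
  exists l, forall e : R, 0 < e -> exists N, forall n, (N <= n)%N -> onorm (u n - l) < e.
Proof.
move=> hu.
have cu v : ncauchy (fun n => u n v).
  move=> e e0; have v1 : 0 < nm v + 1 by have := nm_ge0 v; lra.
  have [|N hN] := hu (e / (nm v + 1)); first exact: divr_gt0.
  exists N => m n hm hn; apply: le_lt_trans (onorm_le (u m - u n) v) _.
  have := hN m n hm hn; rewrite ltr_pdivlMr //; apply: le_lt_trans.
  by rewrite ler_wpM2l ?onorm_ge0 //; lra.
have /choice[l hl] v := complete_nlim (cu v).
have ll : linear l.
  move=> c x y; apply: nlim_uniq (hl _) _.
  under eq_fun do rewrite (bopP _).1; apply: nlimD (hl y).
  apply: (@nlim_map _ _ _ (fun z => c *: z) (nm c)) (hl x) => a b.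
  by rewrite -scalerBr nmZ.
have near e : 0 < e -> exists N, forall n, (N <= n)%N -> forall v, nm (u n v - l v) <= e * nm v.
  move=> e0; have [N hN] := hu e e0; exists N => n hn v.
  have h : nlim (fun m => u n v - u m v) (u n v - l v).
    apply: (@nlim_map _ _ _ (fun z => u n v - z) 1) (hl v) => a b.
    by rewrite mul1r (nmBC a) opprB addrC subrKA.
  have h' k : nlim (fun m => u n v - u (m + k)%N v) (u n v - l v).
    by move=> d /h[M hM]; exists M => m hm; apply: hM; rewrite (leq_trans hm) // leq_addr.
  apply: nlim_le (h' N) _ => m; apply: le_trans (onorm_le (u n - u _) v) _.
  by rewrite ler_wpM2r ?nm_ge0 // ltW // hN // leq_addl.
have bl : bop l.
  split=> //; have [N hN] := near 1 ltr01; exists (1 + onorm (u N)) => v.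
  rewrite mulrDl; have := nmB (u N v) (u N v - l v); rewrite opprB addrC subrK.
  by have := hN N (leqnn N) v; have := onorm_le (u N) v; lra.
exists (mkb bl) => e e0; have [|N hN] := near (e / 2); first by lra.
exists N => n /hN h; apply: le_lt_trans (_ : e / 2 < e); last by lra.
by apply: le_onorm; [lra|exact: h].
Qed.

Let b_nrS f : onorm (bmul (bstar f) f) = onorm f ^+ 2.
Proof.
have s g : onorm (bstar g) <= onorm g.
  apply: le_onorm; first exact: onorm_ge0.
  move=> v; apply: nm_sq_le; first by rewrite mulr_ge0 ?onorm_ge0 ?nm_ge0.
  have <- : complex.Re (hdot (bstar g v) (bstar g v)) = nm (bstar g v) ^+ 2 by rewrite hdotxx.
  rewrite -bstarP; apply: le_trans (Re_hdot_le _ _) _.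
  by rewrite mulrAC ler_wpM2r ?nm_ge0 // onorm_le.
apply/eqP; rewrite eq_le; apply/andP; split.
  apply: le_onorm => [|v]; first exact: sqr_ge0.
  apply: le_trans (onorm_le (bstar f) (f v)) _; rewrite expr2 -mulrA; apply: ler_pM; rewrite ?onorm_ge0 ?nm_ge0 ?s //.
  exact: onorm_le.
set k := onorm (bmul _ _); have k0 : 0 <= k by exact: onorm_ge0.
rewrite -[k]sqr_sqrtr // ler_sqr ?nnegrE ?sqrtr_ge0 ?onorm_ge0 //.
apply: le_onorm => [|v]; first exact: sqrtr_ge0.
rewrite -ler_sqr ?nnegrE ?mulr_ge0 ?sqrtr_ge0 ?nm_ge0 // exprMn sqr_sqrtr //.
have -> : nm (f v) ^+ 2 = complex.Re (hdot (f v) (f v)) by rewrite hdotxx.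
rewrite bstarPr; apply: le_trans (Re_hdot_le _ _) _; rewrite expr2 mulrA ler_wpM2r ?nm_ge0 //.
exact: (onorm_le (bmul (bstar f) f)).
Qed.

Let b_nrM f g : onorm (bmul f g) <= onorm f * onorm g.
Proof.
apply: le_onorm => [|v]; first by rewrite mulr_ge0 ?onorm_ge0.
by apply: le_trans (onorm_le f _) _; rewrite -mulrA ler_wpM2l ?onorm_ge0 ?onorm_le.
Qed.

Let b_s (f g : bopT) : (forall x y, hdot (f x) y = hdot x (g y)) -> bstar f = g.
Proof. by move=> h; apply: bopT_ext => v; rewrite /= (bop_uadj (bopP f) h). Qed.

Let b_ax : cstar_axioms onorm bmul (mkb bop_id) bstar.
Proof.
split=> //.
- by move=> f g h; apply: bopT_ext.
- by move=> f; apply: bopT_ext.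
- by move=> f; apply: bopT_ext.
- by move=> f g h; apply: bopT_ext.
- by move=> f g h; apply: bopT_ext => v; rewrite baddE /= linD //; exact: (bopP f).1.
- by move=> c f g; apply: bopT_ext.
- by move=> c f g; apply: bopT_ext => v; rewrite bscaleE /= linZ //; exact: (bopP f).1.
- by move=> f g; apply: b_s => x y; rewrite !baddE hdotDl hdotDr !bstarP.
- by move=> c f; apply: b_s => x y; rewrite !bscaleE hdotZl hdotZr bstarP conjCK.
- by move=> f g; apply: b_s => x y; rewrite /= !bstarP.
- by move=> f; apply: b_s => x y; rewrite bstarPr.
Qed.

Definition BH : cstarType R := mkCStar b_ax.

Lemma BH_le (f : BH) v : nm ((f : bopT) v) <= nm f * nm v.
Proof. exact: onorm_le. Qed.

End BH.

Section SubCStar.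
Variables (R : realType) (A : cstarType R) (S : set A).
Local Notation C := R[i].
Hypotheses (S1 : S cone) (SD : forall c x y, S x -> S y -> S (c *: x + y)).
Hypotheses (SM : forall x y, S x -> S y -> S (x ** y)) (Ss : forall x, S x -> S (star x)).
Hypothesis Sc : forall x, (forall e : R, 0 < e -> exists2 y, S y & nm (x - y) < e) -> S x.

Let S0 : S 0.
Proof. by have := SD (-1) S1 S1; rewrite scaleN1r addNr. Qed.

Definition spred : {pred A} := fun x => `[< S x >].

Lemma spred_submod : submod_closed spred.
Proof.
split; first exact/asboolP.
by move=> c f g /asboolP hf /asboolP hg; apply/asboolP; exact: SD.
Qed.

HB.instance Definition _ := GRing.isSubmodClosed.Build C A spred spred_submod.

Record subT := SubT { sv :> A; svP : sv \in spred }.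
HB.instance Definition _ := [isSub for sv].
HB.instance Definition _ := [Choice of subT by <:].
HB.instance Definition _ := [SubChoice_isSubLmodule of subT by <:].

Let mks x (h : S x) : subT := SubT (asboolT h).
Let sP (x : subT) : S x. Proof. exact: asboolP _ (svP x). Qed.
Let ext (x y : subT) : sv x = sv y -> x = y. Proof. exact: val_inj. Qed.

Let sax : @cstar_axioms R subT (fun x => nm (sv x))
  (fun x y => mks (SM (sP x) (sP y))) (mks S1) (fun x => mks (Ss (sP x))).
Proof.
split.
- by move=> x y; exact: nmD.
- by move=> c x; exact: nmZ.
- by move=> x /nm0_eq0 h; exact: ext.
- move=> u /(@complete_nlim R A (fun n => sv (u n)))[l hl].
  have Sl : S l.
    apply: Sc => e /hl[N hN]; exists (sv (u N)); first exact: sP.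
    by rewrite (nmBC l); exact: (hN N (leqnn N)).
  by exists (mks Sl).
- by move=> x y z; apply: ext; exact: cmulA.
- by move=> x; apply: ext; exact: cmul1r.
- by move=> x; apply: ext; exact: cmulr1.
- by move=> x y z; apply: ext; exact: cmulDl.
- by move=> x y z; apply: ext; exact: cmulDr.
- by move=> c x y; apply: ext; exact: cmulZl.
- by move=> c x y; apply: ext; exact: cmulZr.
- by move=> x y; apply: ext; exact: starD.
- by move=> c x; apply: ext; exact: starZ.
- by move=> x y; apply: ext; exact: starM.
- by move=> x; apply: ext; exact: starK.
- by move=> x y /=; rewrite -lecR rmorphM /= -!nmE cnormM.
- by move=> x /=; apply: complexI; rewrite rmorphXn /= -!nmE cnorm_star.
Qed.

Lemma sub_cstar : exists (B : cstarType R) (j : B -> A),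
  [/\ star_hom j, j cone = cone, forall x, nm (j x) = nm x & forall x, S x <-> exists y, j y = x].
Proof.
exists (mkCStar sax), sv; split; [by split|by []|by []|].
by move=> x; split=> [h|[y <-]]; [exists (mks h)|exact: sP].
Qed.

End SubCStar.

Section CStarBasics.
Variables (R : realType).
Local Notation C := R[i].
Implicit Types A : cstarType R.

Lemma nmCM A (x y : A) : nm (x ** y) <= nm x * nm y.
Proof. by rewrite -lecR rmorphM /= -!nmE cnormM. Qed.

Lemma nmCS A (x : A) : nm (star x ** x) = nm x ^+ 2.
Proof. by apply: complexI; rewrite rmorphXn /= -!nmE cnorm_star. Qed.

Lemma cmul0l A (x : A) : 0 ** x = 0.
Proof. by rewrite -(scale0r (0 : A)) cmulZl !scale0r. Qed.
Lemma cmul0r A (x : A) : x ** 0 = 0.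
Proof. by rewrite -(scale0r (0 : A)) cmulZr !scale0r. Qed.
Lemma cmulNl A (x y : A) : (- x) ** y = - (x ** y).
Proof. by rewrite -scaleN1r cmulZl scaleN1r. Qed.
Lemma cmulNr A (x y : A) : x ** (- y) = - (x ** y).
Proof. by rewrite -scaleN1r cmulZr scaleN1r. Qed.
Lemma cmulBl A (x y z : A) : (x - y) ** z = x ** z - y ** z.
Proof. by rewrite cmulDl cmulNl. Qed.
Lemma cmulBr A (x y z : A) : z ** (x - y) = z ** x - z ** y.
Proof. by rewrite cmulDr cmulNr. Qed.
Lemma star0 A : star (0 : A) = 0.
Proof. by rewrite -(scale0r (0 : A)) starZ conjC0 !scale0r. Qed.
Lemma starN A (x : A) : star (- x) = - star x.
Proof. by rewrite -scaleN1r starZ rmorphN rmorph1 scaleN1r. Qed.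
Lemma starB A (x y : A) : star (x - y) = star x - star y.
Proof. by rewrite starD starN. Qed.
Lemma star1 A : star (cone : A) = cone.
Proof. by rewrite -[star cone]cmulr1 -{2}[cone]starK -starM cmulr1 starK. Qed.

Lemma nm_star A (x : A) : nm (star x) = nm x.
Proof.
have h (y : A) : nm y <= nm (star y).
  have [->|y0] := eqVneq y 0; first by rewrite nm0 nm_ge0.
  have ny : 0 < nm y.
    by rewrite lt_neqAle nm_ge0 andbT eq_sym; apply: contra y0 => /eqP/nm0_eq0->.
  by rewrite -(ler_pM2r ny) -expr2 -nmCS nmCM.
by apply/eqP; rewrite eq_le {1}(le_trans (h _)) ?starK ?h.
Qed.

Lemma nm_one A : nm (cone : A) <= 1.
Proof.
have := nmCS (cone : A); rewrite star1 cmulr1 => h.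
have [h0|h1] := eqVneq (nm (cone : A)) 0; first by rewrite h0.
have : nm (cone : A) * (nm (cone : A) - 1) = 0 by rewrite mulrBr -expr2 -h mulr1 subrr.
by move=> /eqP; rewrite mulf_eq0 (negPf h1) subr_eq0 => /eqP ->.
Qed.

Lemma cmul_sumr A (I : Type) (s : seq I) (F : I -> A) x : x ** (\sum_(i <- s) F i) = \sum_(i <- s) x ** F i.
Proof. by elim: s => [|i s IH]; rewrite ?big_nil ?cmul0r // !big_cons cmulDr IH. Qed.
Lemma cmul_suml A (I : Type) (s : seq I) (F : I -> A) x : (\sum_(i <- s) F i) ** x = \sum_(i <- s) F i ** x.
Proof. by elim: s => [|i s IH]; rewrite ?big_nil ?cmul0l // !big_cons cmulDl IH. Qed.
Lemma star_sum A (I : Type) (s : seq I) (F : I -> A) : star (\sum_(i <- s) F i) = \sum_(i <- s) star (F i).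
Proof. by elim: s => [|i s IH]; rewrite ?big_nil ?star0 // !big_cons starD IH. Qed.

Lemma nlim_mull A (u : nat -> A) l x : nlim u l -> nlim (fun n => x ** u n) (x ** l).
Proof. by apply: (@nlim_map _ _ _ (fun y => x ** y) (nm x)) => a b; rewrite -cmulBr nmCM. Qed.
Lemma nlim_mulr A (u : nat -> A) l x : nlim u l -> nlim (fun n => u n ** x) (l ** x).
Proof. by apply: (@nlim_map _ _ _ (fun y => y ** x) (nm x)) => a b; rewrite -cmulBl mulrC nmCM. Qed.
Lemma nlim_star A (u : nat -> A) l : nlim u l -> nlim (fun n => star (u n)) (star l).
Proof. by apply: (@nlim_map _ _ _ (@star R A) 1) => a b; rewrite -starB nm_star mul1r. Qed.

(* The iteration [y := (w + y^2) / 2] converges to [1 - sqrt (1 - w)]; its increments are dominated by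
   those of the scalar iteration with [w = 1]. *)
Fixpoint sqit A (w : A) n : A :=
  if n is n'.+1 then 2^-1%:C *: (w + sqit w n' ** sqit w n') else 0.

Fixpoint tqit n : R := if n is n'.+1 then (1 + tqit n' ^+ 2) / 2 else 0.

Lemma tqit_bnd n : 0 <= tqit n <= 1.
Proof. by elim: n => [|n /andP[h0 h1]] /=; [lra|rewrite expr2; nra]. Qed.

Lemma tqit_cauchy (e : R) : 0 < e -> exists N, forall m, (N <= m)%N -> tqit m - tqit N < e.
Proof.
move=> e0; have h0 := tqit_bnd.
have hs : has_sup [set tqit n | n in setT].
  split; first by exists (tqit 0), 0.
  by exists 1 => _ [n _ <-]; case/andP: (h0 n).
have [_ [N _ <-] hN] := sup_adherent e0 hs.
exists N => m _; have : tqit m <= sup [set tqit n | n in setT].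
  by apply: ub_le_sup; [exact: hs.2|exists m].
lra.
Qed.

(** All functional calculus below is derived from this square root of [cone - w]. Commutation with
    the elements that commute with [w] holds for the iterates and passes to the limit. *)
Lemma cstar_sqrt A (w : A) : star w = w -> nm w <= 1 ->
  exists y : A, [/\ star y = y, (cone - y) ** (cone - y) = cone - w, nm y <= 1 &
    forall z, z ** w = w ** z -> z ** y = y ** z].
Proof.
move=> ws w1; pose u := sqit w.
have hc (r : R) : (r%:C)^* = r%:C by rewrite conj_Creal //; apply/complex_realP; exists r.
have us n : star (u n) = u n.
  by elim: n => [|n IH]; rewrite /u /= ?star0 // starZ starD starM ws IH hc.
have uc z n : z ** w = w ** z -> z ** u n = u n ** z.
  move=> zw; elim: n => [|n IH]; rewrite /u /= ?cmul0r ?cmul0l // cmulZr cmulZl cmulDr cmulDl zw.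
  by congr (_ *: (_ + _)); rewrite -/(u n) cmulA IH -!cmulA IH.
have un n : nm (u n) <= tqit n.
  elim: n => [|n IH]; first by rewrite /u /= nm0.
  rewrite /u /= nmZ nmR0 ?invr_ge0 // mulrC ler_wpM2r ?invr_ge0 //.
  apply: le_trans (nmD _ _) _; apply: lerD => //; apply: le_trans (nmCM _ _) _.
  by rewrite expr2 ler_pM ?nm_ge0.
have inc n : nm (u n.+1 - u n) <= tqit n.+1 - tqit n.
  elim: n => [|n IH].
    by rewrite /u /= cmul0r addr0 subr0 nmZ nmR0 ?invr_ge0 // expr0n /=; lra.
  (* The iterates commute, so the difference of their squares factors. *)
  have -> : u n.+2 - u n.+1 = 2^-1%:C *: ((u n.+1 - u n) ** (u n.+1 + u n)).
    have cc : u n.+1 ** u n = u n ** u n.+1 by apply: (uc (u n.+1) n); rewrite (uc w n.+1).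
    have -> : u n.+2 - u n.+1 = 2^-1%:C *: (w + u n.+1 ** u n.+1) - 2^-1%:C *: (w + u n ** u n) by [].
    rewrite -scalerBr opprD addrACA subrr add0r cmulBl !cmulDr -cc.
    by rewrite opprD addrA addrK.
  rewrite nmZ nmR0 ?invr_ge0 //.
  have -> : tqit n.+2 - tqit n.+1 = 2^-1 * ((tqit n.+1 - tqit n) * (tqit n.+1 + tqit n)).
    by rewrite /=; field.
  rewrite ler_wpM2l ?invr_ge0 //; apply: le_trans (nmCM _ _) _.
  by rewrite ler_pM ?nm_ge0 // (le_trans (nmD _ _)) // lerD.
have inck n k : nm (u (k + n)%N - u n) <= tqit (k + n) - tqit n.
  elim: k => [|k IH]; first by rewrite add0n !subrr nm0.
  have := nm_tri (u (k + n)%N) (u (k + n).+1) (u n); have := inc (k + n)%N.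
  by rewrite addSn; lra.
have [y hy] : exists y, nlim u y.
  apply: complete_nlim => e e0; have [|N hN] := @tqit_cauchy (e / 2); first by lra.
  exists N => m n hm hn; have := inck N (m - N)%N; have := inck N (n - N)%N; rewrite !subnK //.
  have := hN m hm; have := hN n hn; have := nm_tri (u N) (u m) (u n); rewrite (nmBC (u N) (u n)); lra.
exists y; split.
- by apply: nlim_uniq (nlim_star hy) _; under eq_fun do rewrite us.
- have e : y = 2^-1%:C *: (w + y ** y).
    have h1 : nlim (fun n => u n.+1) y by move=> e /hy[N hN]; exists N => n hn; apply: hN; exact: leqW.
    apply: nlim_uniq h1 _.
    apply: (@nlim_map _ _ _ (fun x => 2^-1%:C *: (w + x)) 1 (fun n => u n ** u n) (y ** y)) => [a b|].
      by rewrite -scalerBr opprD addrACA subrr add0r nmZ nmR0 ?invr_ge0 // ler_wpM2r ?nm_ge0 // ; lra.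
    move=> e e0; have [|N hN] := hy (e / 2); first by lra.
    exists N => n hn; have := hN n hn.
    have -> : u n ** u n - y ** y = (u n - y) ** u n + y ** (u n - y).
      by rewrite cmulBl cmulBr addrA subrK.
    have ny : nm y <= 1 by apply: nlim_le hy _ => k; have := un k; case/andP: (tqit_bnd k); lra.
    have nu : nm (u n) <= 1 by have := un n; case/andP: (tqit_bnd n); lra.
    have := nmD ((u n - y) ** u n) (y ** (u n - y)).
    by have := nmCM (u n - y) (u n); have := nmCM y (u n - y); have := nm_ge0 (u n - y); nra.
  have {}e : w = 2%:C *: y - y ** y.
    rewrite {1}e scalerA -rmorphM /= mulfV ?pnatr_eq0 //. by rewrite scale1r addrK.
  have -> : w = y + y - y ** y.
    by rewrite {1}e (_ : 2%:C = 1 + 1 :> C) ?scalerDl ?scale1r // -rmorphD.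
  by rewrite cmulBl !cmulBr !cmul1r cmulr1 -[LHS]addrA -opprD addrA.
- by apply: nlim_le hy _ => k; have := un k; case/andP: (tqit_bnd k); lra.
- move=> z zw; apply: nlim_uniq (nlim_mull _ hy) _.
  by under eq_fun do rewrite uc //; exact: nlim_mulr.
Qed.

End CStarBasics.

Section Reps.
Variables (R : realType).
Local Notation C := R[i].
Implicit Types (A : cstarType R) (H : hilbertType R).

Lemma rep_bop A H (pi : A -> H -> H) a : is_rep pi -> bop (pi a).
Proof. by case=> h _ _ _; have [la ca] := h a; split=> //; apply/bop_continuous. Qed.
Lemma rep_lin A H (pi : A -> H -> H) a : is_rep pi -> linear (pi a).
Proof. by move=> h; case: (rep_bop a h). Qed.
Lemma repL A H (pi : A -> H -> H) v : is_rep pi -> linear (pi^~ v).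
Proof. by case=> _ h _ _ c a b; exact: h. Qed.
Lemma repD A H (pi : A -> H -> H) a b v : is_rep pi -> pi (a + b) v = pi a v + pi b v.
Proof. by move=> h; rewrite (linD _ _ (repL v h)). Qed.
Lemma repB A H (pi : A -> H -> H) a b v : is_rep pi -> pi (a - b) v = pi a v - pi b v.
Proof. by move=> h; rewrite (linB _ _ (repL v h)). Qed.
Lemma repZ A H (pi : A -> H -> H) c a v : is_rep pi -> pi (c *: a) v = c *: pi a v.
Proof. by move=> h; rewrite (linZ _ _ (repL v h)). Qed.
Lemma rep0 A H (pi : A -> H -> H) v : is_rep pi -> pi 0 v = 0.
Proof. by move=> h; rewrite (lin0 (repL v h)). Qed.
Lemma rep_sum A H (pi : A -> H -> H) (I : Type) (s : seq I) (F : I -> A) v : is_rep pi ->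
  pi (\sum_(i <- s) F i) v = \sum_(i <- s) pi (F i) v.
Proof. by move=> h; rewrite (linS _ _ (repL v h)). Qed.
Lemma repM A H (pi : A -> H -> H) a b v : is_rep pi -> pi (a ** b) v = pi a (pi b v).
Proof. by case. Qed.
Lemma rep_star A H (pi : A -> H -> H) a v w : is_rep pi -> hdot (pi a v) w = hdot v (pi (star a) w).
Proof. by case=> _ _ _ h; rewrite -h starK. Qed.
Lemma rep_starl A H (pi : A -> H -> H) a v w : is_rep pi -> hdot (pi (star a) v) w = hdot v (pi a w).
Proof. by case. Qed.
Lemma is_repP A H (pi : A -> H -> H) :
  (forall a, bop (pi a)) -> (forall v, linear (pi^~ v)) ->
  (forall a b v, pi (a ** b) v = pi a (pi b v)) ->
  (forall a v w, hdot (pi (star a) v) w = hdot v (pi a w)) -> is_rep pi.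
Proof.
move=> h1 h2 h3 h4; split=> //; last by move=> c a b v; exact: h2.
by move=> a; have [la ba] := h1 a; split=> //; apply/bop_continuous.
Qed.

Lemma rep_nm1 A H (pi : A -> H -> H) v : is_rep pi -> nm (pi cone v) <= nm v.
Proof.
move=> h; apply: nm_sq_le; first exact: nm_ge0.
have <- : complex.Re (hdot (pi cone v) (pi cone v)) = nm (pi cone v) ^+ 2 by rewrite hdotxx.
rewrite (rep_star _ _ _ h) star1 -(repM _ _ _ h) cmulr1 mulrC mulrC; exact: Re_hdot_le.
Qed.

(** For [|b| <= 1] the element [cone - star b ** b] is the square of a self-adjoint element, hence
    acts positively. A representation may be degenerate, which is why [rep_nm1] handles the unit. *)
Lemma rep_contr A H (pi : A -> H -> H) a v : is_rep pi -> nm (pi a v) <= nm a * nm v.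
Proof.
move=> h; have base b : nm b <= 1 -> nm (pi b v) <= nm v.
  move=> b1; have [||y [ys ye _ _]] := @cstar_sqrt R A (star b ** b); first by rewrite starM starK.
    by rewrite nmCS expr_le1 // nm_ge0.
  have e : (nm (pi (cone - y) v) ^+ 2)%:C = hdot (pi (cone - star b ** b) v) v.
    rewrite -hdotxx -ye (repM _ _ _ h) [RHS](rep_star _ _ _ h) starB star1 ys //.
  have e1 : nm (pi (cone - y) v) ^+ 2 = complex.Re (hdot (pi cone v) v) - nm (pi b v) ^+ 2.
    have -> : nm (pi (cone - y) v) ^+ 2 = complex.Re (hdot (pi (cone - star b ** b) v) v) by rewrite -e.
    by rewrite (repB _ _ _ h) hdotBl (repM _ _ _ h) (rep_starl _ _ _ h) hdotxx raddfB.
  have := Re_hdot_le (pi cone v) v; have := rep_nm1 v h; have := sqr_ge0 (nm (pi (cone - y) v)).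
  move=> h1 h2 h3; rewrite -ler_sqr ?nnegrE ?nm_ge0 //; have := nm_ge0 v.
  have := ler_wpM2r (nm_ge0 v) h2; rewrite -expr2; lra.
have [a0|a0] := eqVneq (nm a) 0.
  by rewrite (nm0_eq0 a0) (rep0 _ h) !nm0 mul0r.
have na : 0 < nm a by rewrite lt_neqAle nm_ge0 eq_sym a0.
have := base ((nm a)^-1%:C *: a); rewrite (repZ _ _ _ h) !nmZ nmR0 ?invr_ge0 ?nm_ge0 // mulVf //.
by move=> /(_ (lexx _)); rewrite mulrC ler_pdivrMr // mulrC.
Qed.

Lemma conjR (r : R) : (r%:C)^* = r%:C :> C.
Proof. by rewrite conj_Creal //; apply/complex_realP; exists r. Qed.

Lemma conji : ('i : C)^* = - 'i. Proof. exact: conjCi. Qed.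

Lemma half2 : 2^-1%:C * 2%:R = 1 :> C.
Proof.
have -> : 2%:R = 2%:C :> C by rewrite rmorph_nat.
by rewrite -rmorphM mulVf ?pnatr_eq0 // rmorph1.
Qed.

Lemma halfD (V : lmodType C) (x : V) : 2^-1%:C *: (x + x) = x.
Proof. by rewrite -mulr2n -(scaler_nat 2 x) scalerA half2 scale1r. Qed.

(** [h] is the square root of the absolute value of [x]. Roots are available for [cone - w] only, so
    the absolute value of [x'] is obtained as the root of [cone - z ** z], where [z] is the root of
    [cone - x' ** x']. *)
Lemma cstar_abs A (x : A) : star x = x -> nm x <= 1 ->
  exists h : A, [/\ star h = h, (h ** h) ** (h ** h) = x ** x &
    forall z, z ** x = x ** z -> z ** h = h ** z].
Proof.
move=> xs x1; pose t := 2^-1%:C : C; pose x' := t *: x.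
have x's : star x' = x' by rewrite /x' starZ xs conjR.
have cx z : z ** x = x ** z -> z ** x' = x' ** z by rewrite /x' cmulZl cmulZr => ->.
have hx' : nm x' <= 2^-1 by rewrite /x' nmZ nmR0 ?invr_ge0 // -[leRHS]mulr1 ler_wpM2l ?invr_ge0.
have xx : x' ** x' = (t * t) *: (x ** x) by rewrite /x' cmulZl cmulZr scalerA.
clearbody x'.
have [||y1 [y1s y1e _ y1c]] := @cstar_sqrt R A (x' ** x'); first by rewrite starM x's.
  by apply: le_trans (nmCM _ _) _; have := nm_ge0 x'; nra.
pose z := cone - y1.
have zs : star z = z by rewrite /z starB star1 y1s.
have zc w : w ** x' = x' ** w -> w ** z = z ** w.
  move=> wx; rewrite /z cmulBl cmulBr cmul1r cmulr1 y1c // cmulA wx -cmulA wx cmulA //.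
have xz : x' ** z = z ** x' by exact: zc.
have {}y1e : z ** z = cone - x' ** x' by exact: y1e.
clearbody z.
(* Since [star u ** u = cone], the element [u] and its imaginary part [z] have norm at most 1. *)
pose u := x' + 'i *: z.
have us : star u = x' - 'i *: z by rewrite /u starD x's starZ zs conji scaleNr.
have u1 : nm u <= 1.
  have : nm u ^+ 2 <= 1.
    rewrite -nmCS us /u cmulBl !cmulDr !cmulZl !cmulZr scalerA xz -expr2 sqrCi scaleN1r.
    rewrite opprB [z ** z - _]addrC addrA addrK y1e addrC subrK; exact: nm_one.
  by rewrite expr_le1 // nm_ge0.
have z1 : nm z <= 1.
  have -> : z = (- 'i * t) *: (u - star u).
    rewrite us /u opprB addrC addrA subrK -scalerA halfD scalerA mulNr -expr2 sqrCi.
    by rewrite opprK scale1r.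
  have ni : nm ('i : C) = 1.
    by apply: complexI; rewrite -nmE normCi.
  rewrite nmZ nmM nmN ni mul1r nmR0 ?invr_ge0 //.
  have := nmB u (star u); rewrite nm_star; lra.
have [||y2 [y2s y2e y21 y2c]] := @cstar_sqrt R A (z ** z); first by rewrite starM zs.
  by apply: le_trans (nmCM _ _) _; have := nm_ge0 z; nra.
have [||y3 [y3s y3e _ y3c]] := @cstar_sqrt R A y2 => //.
pose r := (Num.sqrt 2)%:C : C.
have rr : r * r = 2%:C by rewrite /r -rmorphM /= -expr2 sqr_sqrtr.
exists (r *: (cone - y3)); split.
- by rewrite starZ conjR starB star1 y3s.
- have -> : (r *: (cone - y3)) ** (r *: (cone - y3)) = 2%:C *: (cone - y2).
    by rewrite cmulZl cmulZr scalerA y3e rr.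
  rewrite cmulZl cmulZr y2e y1e opprB addrC subrK xx !scalerA.
  have t2 : 2%:C * t = 1 by rewrite /t -rmorphM mulfV ?pnatr_eq0 // rmorph1.
  by rewrite (_ : _ * _ = (2%:C * t) * (2%:C * t)); [rewrite t2 mulr1 scale1r|ring].
- move=> w wx; have wz : w ** z = z ** w by apply: zc; exact: cx.
  have wy : w ** y3 = y3 ** w by apply: y3c; apply: y2c; rewrite cmulA wz -cmulA wz cmulA.
  by rewrite cmulZl cmulZr cmulBl cmulBr cmul1r cmulr1 wy.
Qed.

(** With [m = h ** h], the absolute value of [x], and [D = m - x], one has [m ** D = - x ** D].
    Positivity of [x] turns this into [h ** D = 0], from which [D = 0] and [x = h ** h]. *)
Lemma pos_sqrt A H (pi : A -> H -> H) (a : A) : is_faithful_rep pi -> star a = a ->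
  (forall v, 0 <= complex.Re (hdot (pi a v) v)) ->
  exists h, [/\ star h = h, a = h ** h & forall z, z ** a = a ** z -> z ** h = h ** z].
Proof.
move=> [hp inj] as_ pos.
have [a0|a0] := eqVneq (nm a) 0.
  by exists 0; rewrite star0 cmul0l (nm0_eq0 a0); split=> // z; rewrite cmul0l cmul0r.
have na : 0 < nm a by rewrite lt_neqAle nm_ge0 eq_sym a0.
pose x := (nm a)^-1%:C *: a.
have ax : a = (nm a)%:C *: x by rewrite scalerA -rmorphM /= mulfV // scale1r.
have xs : star x = x by rewrite /x starZ conjR as_.
have [|h [hs h4 hc]] := cstar_abs xs; first by rewrite nmZ nmR0 ?invr_ge0 ?nm_ge0 // mulVf.
have xp v : 0 <= complex.Re (hdot (pi x v) v).
  by rewrite (repZ _ _ _ hp) hdotZl Re_real_mul mulr_ge0 // invr_ge0 nm_ge0.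
pose m := h ** h; pose D := m - x.
have xh : x ** h = h ** x by exact: hc.
have xm : x ** m = m ** x by rewrite /m cmulA xh -cmulA xh cmulA.
have mD : m ** D = - (x ** D).
  by rewrite /D !cmulBr /m h4 xm opprB.
have Ds : star D = D by rewrite /D starB starM hs xs.
have hD : h ** D = 0.
  apply: inj; apply/funext => v; rewrite (rep0 _ hp); apply/nm0_eq0/eqP.
  rewrite -sqrf_eq0 eq_le sqr_ge0 andbT.
  have -> : nm (pi (h ** D) v) ^+ 2 = complex.Re (hdot (pi (m ** D) v) (pi D v)).
    rewrite /m -cmulA (repM _ (h ** D) _ hp) (rep_star h _ _ hp) hs -(repM _ _ _ hp).
    by rewrite hdotxx.
  rewrite mD -scaleN1r (repZ _ _ _ hp) scaleN1r hdotNl raddfN /= (repM _ _ _ hp) oppr_le0; exact: xp.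
have D0 : D = 0.
  have mD0 : m ** D = 0 by rewrite /m -cmulA hD cmul0r.
  have : D ** D = 0 by rewrite {1}/D cmulBl -[x ** D]opprK -mD mD0 oppr0 subr0.
  move=> DD; apply: nm0_eq0; apply/eqP; rewrite -sqrf_eq0 -nmCS Ds DD nm0 //.
have xE : x = m by apply/esym/eqP; rewrite -subr_eq0 -/D D0.
pose r := (Num.sqrt (nm a))%:C : C.
have rr : r * r = (nm a)%:C by rewrite /r -rmorphM /= -expr2 sqr_sqrtr // nm_ge0.
exists (r *: h); split; first by rewrite starZ conjR hs.
  by rewrite cmulZl cmulZr scalerA rr -/m -xE -ax.
by move=> z za; rewrite cmulZl cmulZr hc // /x cmulZl cmulZr za.
Qed.

(** For self-adjoint [a], the elements [c - a] and [c + a] have commuting square roots [h] and [k];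
    then [u = a + i h k] satisfies [star u ** u = c ^ 2], and [a] is its real part. The general case
    follows from that of [star a ** a]. *)
Lemma rep_isom A H (pi : A -> H -> H) (a : A) (c : R) : is_faithful_rep pi -> 0 <= c ->
  (forall v, nm (pi a v) <= c * nm v) -> nm a <= c.
Proof.
move=> /[dup] fp [hp inj]; move: a c.
have sa (a : A) c : star a = a -> 0 <= c -> (forall v, nm (pi a v) <= c * nm v) -> nm a <= c.
  move=> as_ c0 hc; pose p := pi cone.
  have pE v : hdot (pi a v) v = hdot (pi a (p v)) (p v).
    by rewrite /p -(repM _ _ _ hp) cmulr1 -(rep_starl _ _ _ hp) star1 -(repM _ _ _ hp) cmul1r.
  have p2 v : complex.Re (hdot (p v) v) = nm (p v) ^+ 2.
    by rewrite /p -[cone in LHS]cmulr1 (repM _ _ _ hp) (rep_star _ _ _ hp) star1 hdotxx.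
  have bnd v : `|complex.Re (hdot (pi a v) v)| <= c * nm (p v) ^+ 2.
    rewrite pE; apply: le_trans (nm_Re _) _; apply: le_trans (hdot_nm _ _) _.
    by rewrite expr2 mulrA ler_wpM2r ?nm_ge0.
  have cE (e : C) v : hdot (pi (e *: cone) v) v = e * hdot (p v) v by rewrite (repZ _ _ _ hp) hdotZl.
  have sc : star (c%:C *: cone) = c%:C *: cone :> A by rewrite starZ conjR star1.
  have [||h [hs hE hcm]] := @pos_sqrt A H pi (c%:C *: cone - a) fp.
  - by rewrite starB as_ sc.
  - move=> v; rewrite (repB _ _ _ hp) hdotBl cE raddfB /= Re_real_mul p2 subr_ge0.
    exact: le_trans (ler_norm _) (bnd v).
  have [||k [ks kE kcm]] := @pos_sqrt A H pi (c%:C *: cone + a) fp.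
  - by rewrite starD as_ sc.
  - move=> v; rewrite (repD _ _ _ hp) hdotDl cE raddfD /= Re_real_mul p2.
    by have := bnd v; rewrite ler_norml => /andP[h1 _]; lra.
  have ha : a ** h = h ** a by apply: hcm; rewrite cmulBl cmulBr cmulZl cmulZr cmul1r cmulr1.
  have ka : a ** k = k ** a by apply: kcm; rewrite cmulDl cmulDr cmulZl cmulZr cmul1r cmulr1.
  have hk : h ** k = k ** h by apply: kcm; rewrite cmulDl cmulDr cmulZl cmulZr cmul1r cmulr1 ha.
  pose u := a + 'i *: (h ** k).
  have us : star u = a - 'i *: (h ** k) by rewrite /u starD starZ starM hs ks as_ conji scaleNr hk.
  have hkk : (h ** k) ** (h ** k) = (c%:C *: cone - a) ** (c%:C *: cone + a).
    by rewrite hE kE -!cmulA; congr (h ** _); rewrite !cmulA hk.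
  have u1 : nm u <= c.
    rewrite -ler_sqr ?nnegrE ?nm_ge0 // -nmCS us /u cmulBl !cmulDr !cmulZl !cmulZr scalerA.
    have -> : h ** k ** a = a ** (h ** k) by rewrite -cmulA -ka cmulA -ha -cmulA.
    rewrite -expr2 sqrCi scaleN1r opprB [h ** k ** (h ** k) - _]addrC addrA addrK hkk.
    rewrite (_ : a ** a + (c%:C *: cone - a) ** (c%:C *: cone + a) = (c * c)%:C *: cone).
      by rewrite nmZ nmR0 ?mulr_ge0 // -expr2 -[leRHS]mulr1 ler_wpM2l ?sqr_ge0 ?nm_one.
    rewrite cmulBl !cmulDr !cmulZl !cmulZr cmul1r cmulr1 cmul1r scalerA -rmorphM opprD.
    by rewrite !addrA addrK addrAC subrr add0r.
  have -> : a = 2^-1%:C *: (u + star u).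
    by rewrite us /u addrACA subrr addr0 halfD.
  rewrite nmZ nmR0 ?invr_ge0 //; have := nmD u (star u); rewrite nm_star; lra.
move=> a c c0 hc.
have hc' v : nm (pi (star a) v) <= c * nm v.
  apply: nm_sq_le; first by rewrite mulr_ge0 ?nm_ge0.
  have <- : complex.Re (hdot (pi (star a) v) (pi (star a) v)) = nm (pi (star a) v) ^+ 2 by rewrite hdotxx.
  rewrite (rep_starl _ _ _ hp); apply: le_trans (Re_hdot_le _ _) _.
  by rewrite mulrC mulrAC ler_wpM2r ?nm_ge0.
rewrite -ler_sqr ?nnegrE ?nm_ge0 // -nmCS; apply: sa; rewrite ?sqr_ge0 ?starM ?starK //.
move=> v; rewrite (repM _ _ _ hp); apply: le_trans (hc' _) _.
by rewrite expr2 -mulrA ler_wpM2l.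
Qed.

End Reps.

Section RepExt.
Variable R : realType.
Local Notation C := R[i].
Implicit Types (A D T : cstarType R) (H K L P : hilbertType R).

Lemma Re_hdotxx H (v : H) : complex.Re (hdot v v) = nm v ^+ 2.
Proof. by rewrite hdotxx. Qed.

(* A *-action that is only defined on a total set is automatically bounded, since positive
   functionals on a C*-algebra are. *)
Lemma rep_ext A P (X : Type) (f : X -> P) (s : A -> X -> X) : total (range f) ->
  (forall x, linear (fun a => f (s a x))) ->
  (forall a b x, f (s (a ** b) x) = f (s a (s b x))) ->
  (forall a x y, hdot (f (s a x)) (f y) = hdot (f x) (f (s (star a) y))) ->
  exists pi : A -> P -> P, is_rep pi /\ forall a x, pi a (f x) = f (s a x).
Proof.
move=> tf sl sm sa.
have ft v w : (forall y, hdot v (f y) = hdot w (f y)) -> v = w.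
  move=> h; apply/eqP; rewrite -subr_eq0; apply/eqP/tf => _ [y _ <-].
  by rewrite hdotC hdotBl h subrr conjC0.
have sf a x y : f x = f y -> f (s a x) = f (s a y).
  by move=> e; apply: ft => z; rewrite !sa e.
have pos b x : 0 <= complex.Re (hdot (f (s (star b ** b) x)) (f x)).
  by rewrite sm sa starK Re_hdotxx sqr_ge0.
have one_le b x : star b = b -> nm b <= 1 ->
    complex.Re (hdot (f (s b x)) (f x)) <= complex.Re (hdot (f (s cone x)) (f x)).
  move=> bs b1; have [y [ys ye _ _]] := cstar_sqrt bs b1.
  have := pos (cone - y) x; rewrite starB star1 ys ye.
  by rewrite (linB _ _ (sl x)) hdotBl raddfB subr_ge0.
(* The functional [b |-> <s b x, x>] is positive, so its value at [star b ** b] is at most [|b| ^ 2]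
   times its value at [cone]. *)
have bnd x : exists A0 : R, forall b, nm (f (s b x)) <= A0 * nm b.
  exists (Num.sqrt (complex.Re (hdot (f (s cone x)) (f x)))) => b.
  set d := complex.Re _; have d0 : 0 <= d by have := pos cone x; rewrite star1 cmulr1.
  have [b0|b0] := eqVneq (nm b) 0.
    by rewrite (nm0_eq0 b0) (lin0 (sl x)) !nm0 mulr0.
  have nb : 0 < nm b by rewrite lt_neqAle nm_ge0 eq_sym b0.
  rewrite -ler_sqr ?nnegrE ?mulr_ge0 ?sqrtr_ge0 ?nm_ge0 // exprMn sqr_sqrtr //.
  rewrite -Re_hdotxx -[in X in hdot _ (f (s X _))](starK b) -sa -sm.
  have := @one_le ((nm b ^+ 2)^-1%:C *: (star b ** b)) x.
  rewrite starZ conjR starM starK nmZ nmCS nmR0 ?invr_ge0 ?sqr_ge0 // mulVf ?expf_neq0 //.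
  move=> /(_ erefl (lexx _)); rewrite (linZ _ _ (sl x)) hdotZl Re_real_mul -/d.
  by rewrite mulrC ler_pdivrMr ?exprn_gt0 // starK sm.
have ext a : exists T : P -> P, bop T /\ forall x, T (f x) = f (s a x).
  pose b := star a ** a.
  (* Iterates of [s b] are the action of powers of [b], whose norms give the growth condition of
     [power_trick]. *)
  have pw x n : exists2 y, nm y <= nm b ^+ n.+1 & f (iter n.+1 (s b) x) = f (s y x).
    elim: n => [|n [y h1 h2]]; first by exists b => //; rewrite expr1.
    exists (b ** y); first by rewrite exprS (le_trans (nmCM _ _)) // ler_wpM2l ?nm_ge0.
    by rewrite sm; exact: sf.
  have pt (L : seq (C * X)) : nm (lc (fun x => f (s a x)) L) ^+ 2 <= nm b * nm (lc f L) ^+ 2.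
    apply: (power_trick (s := s b)) (nm_ge0 _) _ _ L => [x y|x].
      by rewrite /b sm [RHS]sa starK.
    have [A0 hA] := bnd x; exists (`|A0| + nm (f x)) => -[|n].
      by rewrite expr0 mulr1 /= lerDr normr_ge0.
    have [y hy ->] := pw x n; apply: le_trans (hA y) _.
    have {}hy : nm y <= nm b ^+ n.+1 := hy.
    apply: le_trans (_ : `|A0| * nm y <= _); first by rewrite ler_wpM2r ?nm_ge0 // ler_norm.
    by rewrite ler_pM ?nm_ge0 ?normr_ge0 // lerDl nm_ge0.
  have [|T [lT bT Tf]] := @lift _ _ _ _ f (fun x => f (s a x)) (nm a) tf.
    move=> L; rewrite -ler_sqr ?nnegrE ?mulr_ge0 ?nm_ge0 // exprMn -nmCS; exact: pt.
  by exists T; split=> //; split=> //; exists (nm a).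
have /choice[pi hpi] := ext; exists pi; split; last by move=> a x; case: (hpi a).
have bp a : bop (pi a) by case: (hpi a).
have tE a : forall x, pi a (f x) = f (s a x) by case: (hpi a).
have pE a b : (forall x, f (s a x) = f (s b x)) -> forall v, pi a v = pi b v.
  by move=> h; apply: (bop_ext (bp a) (bp b) tf) => _ [x _ <-]; rewrite !tE.
apply: is_repP => // [v c a b|a b v|a v w].
- apply: (bop_ext (bp _) (bop_comb c (bp a) (bp b)) tf) => _ [x _ <-].
  by rewrite !tE; exact: sl.
- apply: (bop_ext (bp _) (bop_comp (bp a) (bp b)) tf) => _ [x _ <-].
  by rewrite /= !tE sm.
- have -> : pi (star a) = adj (pi a); last by rewrite -adjPr.
  apply/funext => u; apply: (bop_ext (bp _) (bop_adj (bp a)) tf) => _ [x _ <-].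
  by rewrite tE; apply: ft => y; rewrite sa starK -adjPr // tE.
Qed.

End RepExt.

(** * Minimal tensor norms *)

Section Lists.
Variable R : realType.
Local Notation C := R[i].
Implicit Types (A D T : cstarType R) (H K L P : hilbertType R).

(** A list of pairs stands for an element of the algebraic tensor product of [A] and [D]: [lact] is
    its action through commuting representations, [tsum] its image in a completed tensor product,
    [lmul] and [lstar] are its operations. *)
Definition lact A D (V : lmodType C) (al : A -> V -> V) (be : D -> V -> V) (X : seq (A * D)) (v : V) : V :=
  \sum_(p <- X) al p.1 (be p.2 v).
Definition lmul A D (X Y : seq (A * D)) := [seq (x.1 ** y.1, x.2 ** y.2) | x <- X, y <- Y].
Definition lstar A D (X : seq (A * D)) := [seq (star x.1, star x.2) | x <- X].
Definition tsum A D T (tens : A -> D -> T) (X : seq (A * D)) := \sum_(p <- X) tens p.1 p.2.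
(** The exponent is [n.+1]: the power 0 would be the unit, which may act as a proper projection. *)
Definition lpow A D (Y : seq (A * D)) n := iter n (lmul Y) Y.

Lemma lact_bop A D K (al : A -> K -> K) (be : D -> K -> K) X : is_rep al -> is_rep be ->
  bop (lact al be X).
Proof.
move=> ra rb; elim: X => [|p X IH].
  by rewrite (_ : lact _ _ _ = fun=> 0); [exact: bop0|apply/funext => v; rewrite /lact big_nil].
rewrite (_ : lact _ _ _ = fun v => 1 *: al p.1 (be p.2 v) + lact al be X v); last first.
  by apply/funext => v; rewrite /lact big_cons scale1r.
by apply: bop_comb IH; apply: bop_comp; exact: rep_bop.
Qed.

Lemma big_allpairs_ (V : zmodType) A D (F : A * D -> V) (X Y : seq (A * D)) :
  \sum_(p <- lmul X Y) F p = \sum_(x <- X) \sum_(y <- Y) F (x.1 ** y.1, x.2 ** y.2).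
Proof. by rewrite /lmul big_allpairs_dep. Qed.

Lemma lact_mul A D K (al : A -> K -> K) (be : D -> K -> K) X Y v : is_rep al -> is_rep be ->
  (forall a d w, al a (be d w) = be d (al a w)) ->
  lact al be (lmul X Y) v = lact al be X (lact al be Y v).
Proof.
move=> ra rb com; rewrite /lact big_allpairs_; apply: eq_bigr => x _.
rewrite (linS _ _ (rep_lin _ rb)) (linS _ _ (rep_lin _ ra)); apply: eq_bigr => y _ /=.
by rewrite (repM _ _ _ ra) (repM _ _ _ rb) com com.
Qed.

Lemma lact_star A D K (al : A -> K -> K) (be : D -> K -> K) X v w : is_rep al -> is_rep be ->
  (forall a d w, al a (be d w) = be d (al a w)) ->
  hdot (lact al be (lstar X) v) w = hdot v (lact al be X w).
Proof.
move=> ra rb com; rewrite /lact /lstar big_map hdot_suml hdot_sumr; apply: eq_bigr => x _ /=.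
by rewrite (rep_starl _ _ _ ra) (rep_starl _ _ _ rb) com.
Qed.

Lemma nice1 K (X X' : K -> K) k (c A0 : R) : 0 <= c ->
  (forall u w, hdot (X u) w = hdot u (X' w)) ->
  (forall n, nm (iter n (X' \o X) k) <= A0 * (c ^+ 2) ^+ n) -> nm (X k) <= c * nm k.
Proof.
move=> c0 adjX hA; rewrite -ler_sqr ?nnegrE ?mulr_ge0 ?nm_ge0 // exprMn.
have sa u w : hdot (X' (X u)) w = hdot u (X' (X w)).
  by rewrite hdotC -adjX hdotC conjCK adjX.
have h2 n m : hdot (iter (m + n) (X' \o X) k) k = hdot (iter m (X' \o X) k) (iter n (X' \o X) k).
  elim: n m => [|n IH] m; first by rewrite addn0.
  by rewrite addnS -addSn IH iterS /= sa.
have /= h := @log_convex_le R (fun n => nm (iter n (X' \o X) k)) (c ^+ 2) A0 (sqr_ge0 _) (fun n => nm_ge0 _) _ hA.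
have {}h : nm (X' (X k)) <= c ^+ 2 * nm k.
  apply: h => n; by have := hdot_nm (iter n.*2 (X' \o X) k) k; rewrite -addnn h2 hdotxx nmR0 ?sqr_ge0.
rewrite -Re_hdotxx adjX hdotC ReJ; apply: le_trans (Re_hdot_le _ _) _.
by rewrite expr2 [nm k ^+ 2]expr2 mulrA -expr2; apply: ler_wpM2r; rewrite ?nm_ge0.
Qed.

(** The constant [A0] may vary with the vector, which makes the growth condition stable under linear
    combinations. It disappears in [nice1], and continuity of [X] passes from the span to its
    closure. *)
Lemma bound_total K (X X' : K -> K) (S : set K) (c : R) : 0 <= c -> bop X -> bop X' ->
  (forall u w, hdot (X u) w = hdot u (X' w)) -> total S ->
  (forall k, S k -> exists A0 : R, forall n, nm (iter n (X' \o X) k) <= A0 * (c ^+ 2) ^+ n) ->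
  forall k, nm (X k) <= c * nm k.
Proof.
move=> c0 bX bX' adjX tS hS k; pose Y := X' \o X.
have lY n : linear (iter n Y).
  elim: n => [|n IH] // a x y; rewrite !iterS IH /Y /=.
  by rewrite (bX.1) (bX'.1).
have sp v : span S v -> nm (X v) <= c * nm v.
  move=> Sv; have [A hA] : exists A0 : R, forall n, nm (iter n Y v) <= A0 * (c ^+ 2) ^+ n.
    elim: Sv => [|a s w Ss _ [A hA]]; first by exists 0 => n; rewrite lin0 // nm0 mul0r.
    have [B hB] := hS s Ss; exists (nm a * B + A) => n.
    rewrite (lY n) mulrDl; apply: le_trans (nmD _ _) _; apply: lerD (hA n).
    by rewrite nmZ -mulrA ler_wpM2l ?nm_ge0.
  exact: nice1 c0 adjX hA.
have [b b0 hb] := bop_ge0 bX.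
rewrite leNgt; apply/negP => hlt; set d := nm (X k) - c * nm k.
have d0 : 0 < d by rewrite subr_gt0.
have [|u Su hu] := span_approx (@total_cspan _ _ _ k tS) (_ : 0 < d / (b + c + 1)).
  by apply: divr_gt0 => //; lra.
move: hu; rewrite ltr_pdivlMr; last by lra.
have := sp u Su; have := nmD (X (k - u)) (X u); rewrite -(linD _ _ bX.1) subrK.
have := hb (k - u); have := nmD (u - k) k; rewrite subrK (nmBC u).
have := nm_ge0 (k - u); rewrite /d; nra.
Qed.

Lemma iter_lact A D K (al : A -> K -> K) (be : D -> K -> K) X n v : is_rep al -> is_rep be ->
  (forall a d w, al a (be d w) = be d (al a w)) ->
  iter n.+1 (lact al be (lstar X) \o lact al be X) v = lact al be (lpow (lmul (lstar X) X) n) v.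
Proof.
move=> ra rb com; elim: n => [|n IH]; first by rewrite /= lact_mul.
by rewrite iterS IH /lpow iterS !lact_mul //=.
Qed.

(** The device behind the minimal norm estimates below: a crude bound, with a constant that depends
    on the vector, applied to the powers of [lstar X] times [X], improves to the constant 1. *)
Lemma lact_bound A D K (al : A -> K -> K) (be : D -> K -> K) (S : set K) (c : R) X :
  is_rep al -> is_rep be -> (forall a d w, al a (be d w) = be d (al a w)) ->
  0 <= c -> total S ->
  (forall k, S k -> exists A0 : R, forall n, nm (lact al be (lpow (lmul (lstar X) X) n) k) <= A0 * (c ^+ 2) ^+ n.+1) ->
  forall k, nm (lact al be X k) <= c * nm k.
Proof.
move=> ra rb com c0 tS h.
apply: (@bound_total K _ (lact al be (lstar X)) S) => //; try exact: lact_bop.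
  by move=> u w; rewrite [RHS]hdotC lact_star // -hdotC.
move=> k Sk; have [A0 hA] := h k Sk; exists (nm k + A0 * (c ^+ 2) ^+ 0 + `|A0|) => -[|n].
  by rewrite expr0 !mulr1 /=; have := ler_norm A0; have := ler_norm (- A0); rewrite normrN; lra.
rewrite iter_lact //; apply: le_trans (hA n) _; apply: ler_wpM2r; first by rewrite exprn_ge0 // sqr_ge0.
by rewrite expr0 mulr1; have := nm_ge0 k; have := normr_ge0 A0; lra.
Qed.

End Lists.

Section HTens.
Variable R : realType.
Local Notation C := R[i].
Implicit Types (A D T : cstarType R) (H K L P : hilbertType R).

Definition htens H L P (t : H -> L -> P) : Prop :=
  (forall h l h' l', hdot (t h l) (t h' l') = hdot h h' * hdot l l') /\
  total (range (fun p => t p.1 p.2)).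

Lemma htens_of H L P (t : H -> L -> P) : is_hilbert_tensor t -> htens t.
Proof.
case=> l1 l2 g cl; split=> // w hw; apply: nm0_eq0; apply/eqP; rewrite eq_le nm_ge0 andbT.
apply/ler_addgt0Pr => e e0; rewrite add0r.
have : closure (tensor_span t setT) w by rewrite cl.
move/closure_nm => /(_ e e0)[u [s _ ->] /ltW h]; apply: le_trans h.
set v := \sum_(p <- s) _; have vw : hdot v w = 0.
  by rewrite /v hdot_suml big1 // => p _; apply: hw; exists p.
rewrite -ler_sqr ?nnegrE ?nm_ge0 // nmsqB (hdotC w) vw conjC0 /= mulr0 subr0.
by rewrite lerDl sqr_ge0.
Qed.

Lemma total_ext P (X : Type) (f : X -> P) : total (range f) ->
  forall v w, (forall y, hdot v (f y) = hdot w (f y)) -> v = w.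
Proof.
move=> tf v w h; apply/eqP; rewrite -subr_eq0; apply/eqP/tf => _ [y _ <-].
by rewrite hdotC hdotBl h subrr conjC0.
Qed.

Lemma htens_linl H L P (t : H -> L -> P) l : htens t -> linear (t^~ l).
Proof.
move=> [g tf] c x y; apply: (total_ext tf) => p.
by rewrite hdotDl hdotZl !g hdotDl hdotZl mulrDl mulrA.
Qed.

Lemma htens_linr H L P (t : H -> L -> P) h : htens t -> linear (t h).
Proof.
move=> [g tf] c x y; apply: (total_ext tf) => p.
by rewrite hdotDl hdotZl !g hdotDl hdotZl mulrDr mulrCA.
Qed.

Lemma htens_repl A H L P (t : H -> L -> P) (sg : A -> H -> H) : htens t -> is_rep sg ->
  exists al : A -> P -> P, is_rep al /\ forall a h l, al a (t h l) = t (sg a h) l.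
Proof.
move=> ht rs; have [|||al [ral e]] := @rep_ext R A P _ (fun p => t p.1 p.2) (fun a p => (sg a p.1, p.2)) ht.2.
- by move=> x c a b /=; rewrite (repL x.1 rs) (htens_linl _ ht).
- by move=> a b x /=; rewrite (repM _ _ _ rs).
- by move=> a x y /=; rewrite !ht.1 (rep_star _ _ _ rs).
by exists al; split=> // a h l; exact: (e a (h, l)).
Qed.

Lemma htens_repr A H L P (t : H -> L -> P) (sg : A -> L -> L) : htens t -> is_rep sg ->
  exists al : A -> P -> P, is_rep al /\ forall a h l, al a (t h l) = t h (sg a l).
Proof.
move=> ht rs; have [|||al [ral e]] := @rep_ext R A P _ (fun p => t p.1 p.2) (fun a p => (p.1, sg a p.2)) ht.2.
- by move=> x c a b /=; rewrite (repL x.2 rs) (htens_linr _ ht).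
- by move=> a b x /=; rewrite (repM _ _ _ rs).
- by move=> a x y /=; rewrite !ht.1 (rep_star _ _ _ rs).
by exists al; split=> // a h l; exact: (e a (h, l)).
Qed.

(* [al] and [be] are the representations [sg (x) 1] and [1 (x) rho] of [A] and [D] on [P]. *)
Definition tact A D H L P (t : H -> L -> P) (sg : A -> H -> H) (rho : D -> L -> L)
    (al : A -> P -> P) (be : D -> P -> P) : Prop :=
  [/\ htens t, is_rep sg, is_rep rho, is_rep al /\ is_rep be &
      (forall a h l, al a (t h l) = t (sg a h) l) /\ (forall d h l, be d (t h l) = t h (rho d l))].

Lemma tact_ex A D H L P (t : H -> L -> P) (sg : A -> H -> H) (rho : D -> L -> L) :
  htens t -> is_rep sg -> is_rep rho -> exists al be, tact t sg rho al be.
Proof.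
move=> ht rs rr; have [al [ra ea]] := htens_repl ht rs; have [be [rb eb]] := htens_repr ht rr.
by exists al, be.
Qed.

Lemma tact_com A D H L P (t : H -> L -> P) (sg : A -> H -> H) (rho : D -> L -> L) al be :
  tact t sg rho al be -> forall a d v, al a (be d v) = be d (al a v).
Proof.
move=> [ht rs rr [ra rb] [ea eb]] a d.
apply: (bop_ext (bop_comp (rep_bop a ra) (rep_bop d rb)) (bop_comp (rep_bop d rb) (rep_bop a ra)) ht.2).
by move=> _ [p _ <-] /=; rewrite eb !ea eb.
Qed.

(** The slice map: identity on [A], vector functional of [l] on [D]. *)
Definition slice A D L (rho : D -> L -> L) (l : L) (X : seq (A * D)) : A :=
  \sum_(p <- X) hdot (rho p.2 l) l *: p.1.

Lemma slice_dot A D H L P (t : H -> L -> P) (sg : A -> H -> H) (rho : D -> L -> L) al be X h h' l :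
  tact t sg rho al be -> hdot (lact al be X (t h l)) (t h' l) = hdot (sg (slice rho l X) h) h'.
Proof.
move=> [ht rs rr [ra rb] [ea eb]].
rewrite /lact /slice (rep_sum _ _ _ rs) !hdot_suml; apply: eq_bigr => p _.
by rewrite eb ea ht.1 (repZ _ _ _ rs) hdotZl mulrC.
Qed.

Lemma slice_bound A D H L P (t : H -> L -> P) (sg : A -> H -> H) (rho : D -> L -> L) al be X l (c : R) :
  tact t sg rho al be -> injective sg -> 0 <= c ->
  (forall v, nm (lact al be X v) <= c * nm v) -> nm (slice rho l X) <= c * nm l ^+ 2.
Proof.
move=> ta inj c0 hc; have [ht rs rr [ra rb] [ea eb]] := ta.
have nt h : nm (t h l) = nm h * nm l.
  apply/eqP; rewrite -(@eqrXn2 _ 2) ?mulr_ge0 ?nm_ge0 // -Re_hdotxx ht.1 !hdotxx -rmorphM /=.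
  by rewrite exprMn.
apply: (rep_isom (conj rs inj)); first by rewrite mulr_ge0 ?sqr_ge0.
move=> h; set g := sg _ h; apply: nm_sq_le; first by rewrite !mulr_ge0 ?sqr_ge0 ?nm_ge0.
rewrite -Re_hdotxx -(slice_dot _ _ _ _ ta); apply: le_trans (Re_hdot_le _ _) _.
apply: le_trans (ler_wpM2r (nm_ge0 _) (hc _)) _; rewrite !nt.
by rewrite le_eqVlt; apply/orP; left; apply/eqP; ring.
Qed.

Lemma lact_lstar_bound A D K (al : A -> K -> K) (be : D -> K -> K) X (c : R) :
  is_rep al -> is_rep be -> (forall a d w, al a (be d w) = be d (al a w)) -> 0 <= c ->
  (forall v, nm (lact al be X v) <= c * nm v) -> forall v, nm (lact al be (lstar X) v) <= c * nm v.
Proof.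
move=> ra rb com c0 hc v; apply: nm_sq_le; first by rewrite mulr_ge0 ?nm_ge0.
rewrite -Re_hdotxx lact_star //; apply: le_trans (Re_hdot_le _ _) _.
by rewrite mulrC mulrAC ler_wpM2r ?nm_ge0.
Qed.

Lemma lact_lpow_bound A D K (al : A -> K -> K) (be : D -> K -> K) X (c : R) n :
  is_rep al -> is_rep be -> (forall a d w, al a (be d w) = be d (al a w)) -> 0 <= c ->
  (forall v, nm (lact al be X v) <= c * nm v) ->
  forall v, nm (lact al be (lpow (lmul (lstar X) X) n) v) <= (c ^+ 2) ^+ n.+1 * nm v.
Proof.
move=> ra rb com c0 hc; elim: n => [|n IH] v.
  rewrite /lpow /= lact_mul // expr1 expr2 -mulrA.
  by apply: le_trans (lact_lstar_bound ra rb com c0 hc _) _; rewrite ler_wpM2l.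
rewrite /lpow iterS !lact_mul //.
have -> : (c ^+ 2) ^+ n.+2 * nm v = c * (c * ((c ^+ 2) ^+ n.+1 * nm v)).
  by rewrite exprS; move: ((c ^+ 2) ^+ n.+1) => b; ring.
apply: le_trans (lact_lstar_bound ra rb com c0 hc _) _; rewrite ler_wpM2l //.
by apply: le_trans (hc _) _; rewrite ler_wpM2l //; exact: IH.
Qed.

(* The minimal norm does not depend on the faithful representation. *)
Lemma tact_transfer A D H1 H2 L P1 P2 (t1 : H1 -> L -> P1) (t2 : H2 -> L -> P2)
    (sg1 : A -> H1 -> H1) (sg2 : A -> H2 -> H2) (rho : D -> L -> L) al1 be1 al2 be2 X (c : R) :
  tact t1 sg1 rho al1 be1 -> tact t2 sg2 rho al2 be2 -> injective sg1 -> 0 <= c ->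
  (forall v, nm (lact al1 be1 X v) <= c * nm v) -> forall v, nm (lact al2 be2 X v) <= c * nm v.
Proof.
move=> ta1 ta2 inj c0 hc.
have [ht1 rs1 rr [ra1 rb1] _] := ta1; have [ht2 rs2 _ [ra2 rb2] _] := ta2.
have com1 := tact_com ta1; have com2 := tact_com ta2.
apply: (lact_bound ra2 rb2 com2 c0 ht2.2) => _ [[h l] _ <-] /=.
(* On an elementary tensor, the squared norm of [Z] is a coefficient of the slice of [lstar Z] times
   [Z], and the norm of that slice is computed in the faithful [sg1]. *)
exists (nm l * nm h) => n; set Z := lpow _ n; set b := (c ^+ 2) ^+ n.+1.
have b0 : 0 <= b by rewrite exprn_ge0 // sqr_ge0.
have hZ v : nm (lact al1 be1 Z v) <= b * nm v by exact: lact_lpow_bound.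
have hZZ v : nm (lact al1 be1 (lmul (lstar Z) Z) v) <= b ^+ 2 * nm v.
  by have := lact_lpow_bound 0 ra1 rb1 com1 b0 hZ v; rewrite expr1.
have b2 : 0 <= b ^+ 2 by exact: sqr_ge0.
have h1 := slice_bound l ta1 inj b2 hZZ.
rewrite -ler_sqr ?nnegrE ?mulr_ge0 ?nm_ge0 // -Re_hdotxx -lact_star // -lact_mul //.
rewrite (slice_dot _ _ _ _ ta2); apply: le_trans (Re_hdot_le _ _) _.
apply: le_trans (ler_wpM2r (nm_ge0 _) (rep_contr _ _ rs2)) _.
rewrite -[leLHS]mulrA; apply: le_trans (ler_wpM2r _ h1) _; first by rewrite mulr_ge0 ?nm_ge0.
by rewrite le_eqVlt; apply/orP; left; apply/eqP; ring.
Qed.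

(** What is used of a minimal tensor product: [md_nm] and [md_eq] move norms and equalities to a
    concrete tensor product of Hilbert spaces. *)
Record mtdata A D T (tens : A -> D -> T) : Type := MTData {
  md_H : hilbertType R; md_L : hilbertType R; md_P : hilbertType R;
  md_t : md_H -> md_L -> md_P;
  md_sg : A -> md_H -> md_H; md_rho : D -> md_L -> md_L;
  md_al : A -> md_P -> md_P; md_be : D -> md_P -> md_P;
  md_tact : tact md_t md_sg md_rho md_al md_be;
  md_isg : injective md_sg;
  md_nm : forall X (c : R), 0 <= c -> nm (tsum tens X) <= c <-> forall v, nm (lact md_al md_be X v) <= c * nm v;
  md_eq : forall X Y, (forall v, lact md_al md_be X v = lact md_al md_be Y v) -> tsum tens X = tsum tens Y;
  md_mul : forall X Y, tsum tens (lmul X Y) = tsum tens X ** tsum tens Y;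
  md_star : forall X, tsum tens (lstar X) = star (tsum tens X);
  md_linl : forall d, linear (tens^~ d); md_linr : forall a, linear (tens a);
  md_one : tens cone cone = cone }.

Arguments md_t {A D T tens} m.
Arguments md_sg {A D T tens} m.
Arguments md_rho {A D T tens} m.
Arguments md_al {A D T tens} m.
Arguments md_be {A D T tens} m.
Arguments md_tact {A D T tens} m.
Arguments md_nm {A D T tens} m.
Arguments md_eq {A D T tens} m.
Arguments md_mul {A D T tens} m.
Arguments md_star {A D T tens} m.
Arguments md_linl {A D T tens} m.
Arguments md_linr {A D T tens} m.
Arguments md_one {A D T tens} m.
Arguments md_isg {A D T tens} m.

Lemma min_tensor_data A D T (tens : A -> D -> T) : is_min_tensor tens -> inhabited (mtdata tens).
Proof.
case=> H [L [P [t [sg [rho [th [ht0 [rs is_] [rr ir] [rt it] [e cl]]]]]]]].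
have ht := htens_of ht0.
have [al [be ta]] := tact_ex ht rs rr; have [_ _ _ [ra rb] [ea eb]] := ta.
have com := tact_com ta.
have eth a d v : th (tens a d) v = al a (be d v).
  apply: (bop_ext (rep_bop _ rt) (bop_comp (rep_bop a ra) (rep_bop d rb)) ht.2).
  by move=> _ [p _ <-] /=; rewrite e eb ea.
have ethX X v : th (tsum tens X) v = lact al be X v.
  by rewrite /tsum (rep_sum _ _ _ rt); apply: eq_bigr => p _; rewrite eth.
have thI x y : (forall v, th x v = th y v) -> x = y by move=> h; apply/it/funext.
have mM X Y : tsum tens (lmul X Y) = tsum tens X ** tsum tens Y.
  by apply: thI => v; rewrite (repM _ _ _ rt) !ethX lact_mul.
have mS X : tsum tens (lstar X) = star (tsum tens X).
  by apply: thI => v; apply: hdot_ext => w; rewrite (rep_starl _ _ _ rt) !ethX lact_star.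
have t1 X : tsum tens [:: X] = tens X.1 X.2 by rewrite /tsum big_seq1.
have m1 : tens cone cone = cone.
  (* [T] has its own unit; [tens cone cone] agrees with it because it is neutral on a dense
     subspace. *)
  have unit y : tens cone cone ** y = y.
    apply/eqP; rewrite -subr_eq0; apply/eqP/nm_small => d d0.
    have : closure (tensor_span tens setT) y by rewrite cl.
    move/closure_nm => /(_ (d / 2 / (nm (tens cone cone) + 1))).
    have k1 : 0 < nm (tens cone cone) + 1 by have := nm_ge0 (tens cone cone); lra.
    case=> [|_ [X _ ->] hX]; first by rewrite !divr_gt0.
    have uX : tens cone cone ** tsum tens X = tsum tens X.
      rewrite -(t1 (cone, cone)) -mM /tsum big_allpairs_ big_seq1.
      by apply: eq_bigr => p _; rewrite !cmul1r.
    have -> : tens cone cone ** y - y = tens cone cone ** (y - tsum tens X) - (y - tsum tens X).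
      by rewrite cmulBr uX opprB addrA subrK.
    apply: le_lt_trans (nmB _ _) _; apply: le_lt_trans (lerD (nmCM _ _) (lexx _)) _.
    move: hX; rewrite -/(tsum tens X) ltr_pdivlMr //; lra.
  by rewrite -[RHS]unit cmulr1.
apply: inhabits; apply: (MTData ta is_) => //.
- move=> X c c0; split=> [h v|h].
    by rewrite -ethX; apply: le_trans (rep_contr _ _ rt) _; rewrite ler_wpM2r ?nm_ge0.
  by apply: (rep_isom (conj rt it) c0) => v; rewrite ethX.
- by move=> X Y h; apply: thI => v; rewrite !ethX.
- move=> d c a b; apply: thI => v; rewrite eth (repD _ _ _ rt) (repZ _ _ _ rt) !eth.
  exact: (repL _ ra).
- move=> a c d d'; apply: thI => v; rewrite eth (repD _ _ _ rt) (repZ _ _ _ rt) !eth.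
  by rewrite (repL _ rb) (rep_lin _ ra).
Qed.

Lemma tsum1 A D T (tens : A -> D -> T) a d : tsum tens [:: (a, d)] = tens a d.
Proof. by rewrite /tsum big_seq1. Qed.

Lemma md_nmP A D T (tens : A -> D -> T) (m : mtdata tens) X v :
  nm (lact (md_al m) (md_be m) X v) <= nm (tsum tens X) * nm v.
Proof. by have [h _] := md_nm m X _ (nm_ge0 (tsum tens X)); exact: h. Qed.

Lemma md_mul1 A D T (tens : A -> D -> T) (m : mtdata tens) a d a' d' :
  tens a d ** tens a' d' = tens (a ** a') (d ** d').
Proof. by rewrite -!(@tsum1 _ _ _ tens) -(md_mul m). Qed.

Lemma md_star1 A D T (tens : A -> D -> T) (m : mtdata tens) a d :
  star (tens a d) = tens (star a) (star d).
Proof. by rewrite -!(@tsum1 _ _ _ tens) -(md_star m). Qed.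

End HTens.

Arguments md_t {R A D T tens} m.
Arguments md_sg {R A D T tens} m.
Arguments md_rho {R A D T tens} m.
Arguments md_al {R A D T tens} m.
Arguments md_be {R A D T tens} m.
Arguments md_tact {R A D T tens} m.
Arguments md_nm {R A D T tens} m.
Arguments md_eq {R A D T tens} m.
Arguments md_mul {R A D T tens} m.
Arguments md_star {R A D T tens} m.
Arguments md_linl {R A D T tens} m.
Arguments md_linr {R A D T tens} m.
Arguments md_one {R A D T tens} m.
Arguments md_isg {R A D T tens} m.

Arguments proj_in : clear implicits.
Arguments proj_in {R H} S v.
Arguments proj_perp : clear implicits.
Arguments proj_perp {R H} S v.
Arguments cspan_in : clear implicits.
Arguments cspan_in {R H} S s.
Arguments span_cspan : clear implicits.
Arguments span_cspan {R H} S v.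
Arguments total_cspan : clear implicits.
Arguments total_cspan {R H} S v.
Arguments proj_id : clear implicits.
Arguments proj_id {R H} S v.
(** * Conditional expectations and induced modules *)

Section CondExp.
Variable R : realType.
Local Notation C := R[i].
Implicit Types (A D T : cstarType R) (H K L Z W : hilbertType R) (N P : vonNeumann R).

Lemma nlim_hdot2 H (u w : nat -> H) l m : nlim u l -> nlim w m ->
  nlim (fun n => hdot (u n) (w n)) (hdot l m).
Proof.
move=> hu hw; have h1 : nlim (fun n => hdot (u n - l) (w n)) 0.
  move=> e e0; have [N1 h1] := hw 1 ltr01.
  have k1 : 0 < nm m + 1 by have := nm_ge0 m; lra.
  have [|N2 h2] := hu (e / (nm m + 1)); first exact: divr_gt0.
  exists (maxn N1 N2) => n; rewrite geq_max => /andP[a1 a2]; rewrite subr0.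
  apply: le_lt_trans (hdot_nm _ _) _; have := h2 _ a2; rewrite ltr_pdivlMr //.
  have := h1 _ a1; have := nmD (w n - m) m; rewrite subrK.
  have := nm_ge0 (u n - l); have := nm_ge0 (w n); nra.
have h2 : nlim (fun n => hdot l (w n)) (hdot l m).
  apply: (@nlim_map _ _ _ (fun x => hdot l x) (nm l)) hw => a b.
  by rewrite -hdotBr hdot_nm.
have := nlimD h1 h2; rewrite add0r; under eq_fun do rewrite hdotBl subrK; exact.
Qed.

Lemma nlim_sum (V : normedModType C) (I : Type) (s : seq I) (F : I -> nat -> V) (G : I -> V) :
  (forall i, nlim (F i) (G i)) -> nlim (fun n => \sum_(i <- s) F i n) (\sum_(i <- s) G i).
Proof.
move=> h; elim: s => [|i s IH].
  by rewrite big_nil; under eq_fun do rewrite big_nil; exact: nlim_cst.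
by rewrite big_cons; under eq_fun do rewrite big_cons; exact: nlimD.
Qed.

Lemma nlim_scale (V : normedModType C) (c : C) (u : nat -> V) l : nlim u l -> nlim (fun n => c *: u n) (c *: l).
Proof. by apply: (@nlim_map _ _ _ (fun z => c *: z) (nm c)) => a b; rewrite -scalerBr nmZ. Qed.

Lemma nlim_Re_ge0 (u : nat -> C) l : nlim u l -> (forall n, 0 <= complex.Re (u n)) -> 0 <= complex.Re l.
Proof.
move=> hu h; rewrite leNgt; apply/negP => lt0.
have [|n hn] := hu (- complex.Re l); first by lra.
have := hn n (leqnn n); have := h n; have := Re_nm (u n - l); rewrite raddfB /=; lra.
Qed.

(** Positivity is the only assumption on [E] that involves the star. Expanding the square of
    [cone + c *: x] writes [c^* *: star x + c *: x] by elements of the form [star y ** y]; the cases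
    [c = 1] and [c = 'i] give the claim. *)
Lemma ce_star P N (iota : P -> N) (E : N -> P) x : conditional_expectation iota E ->
  E (star x) = star (E x).
Proof.
case=> lE _ _ pE.
have sa y : star (E (star y ** y)) = E (star y ** y).
  by have [z ->] := pE y; rewrite starM starK.
have sD c y : star (E (c^* *: star y + c *: y)) = E (c^* *: star y + c *: y).
  have e : c^* *: star y + c *: y = star (cone + c *: y) ** (cone + c *: y) - star cone ** cone - star (c *: y) ** (c *: y).
    rewrite -starZ starD star1 cmulDl !cmulDr !cmul1r !cmulr1; move: (c *: y) => w.
    by rewrite [RHS]addrAC addrA addrK -[cone + w + _]addrA [cone + _]addrC addrK addrC.
  by rewrite e !(linB _ _ lE) !starB !sa.
have h1 := sD 1 x; have h2 := sD 'i x.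
rewrite !(linD _ _ lE) !(linZ _ _ lE) !starD !starZ !conjC1 !scale1r in h1.
rewrite !(linD _ _ lE) !(linZ _ _ lE) !starD !starZ conjCK conji in h2.
have {}h2 := congr1 (fun v => - 'i *: v) h2; rewrite !scalerDr !scalerA in h2.
have i1 : - 'i * 'i = 1 :> C by rewrite mulNr -expr2 sqrCi opprK.
have i2 : - 'i * - 'i = -1 :> C by rewrite mulrNN -expr2 sqrCi.
rewrite i1 i2 !scale1r !scaleN1r in h2.
rewrite -[LHS]halfD -[RHS]halfD; congr (_ *: _).
have e1 (u v : P) : u + v - (u - v) = v + v by rewrite opprB addrC addrA subrK.
by rewrite -(e1 (E x)) -[RHS](e1 (star (E (star x)))) h1 h2 [E (star x) + _]addrC [- _ + _]addrC.
Qed.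

(** Complete positivity, by induction on the list. Vectors are split along the cyclic subspace of
    the vector [z] of the head: in the remainder the head vanishes, and in the cyclic part vectors
    are limits of vectors [be a z]. *)
Lemma ce_psd P N (iota : P -> N) (E : N -> P) Z (be : P -> Z -> Z) :
  star_hom iota -> conditional_expectation iota E -> is_rep be ->
  psd_kernel (fun p q : N * Z => hdot (be (E (star q.1 ** p.1)) p.2) q.2).
Proof.
move=> [li mi si] /[dup] ce [lE _ bE pE] rb.
split=> [p q|L].
  rewrite [RHS](_ : _ = hdot p.2 (be (E (star p.1 ** q.1)) q.2)); last by rewrite -hdotC.
  by rewrite (rep_star _ _ _ rb) -(ce_star _ ce) starM starK.
have [n] := ubnP (size L); elim: n L => // n IH [|p L]; first by rewrite /kform big_nil.
rewrite ltnS => hs; set k := fun _ _ => _.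
pose z := p.2.2; pose S := range (be^~ z); pose pr := proj S.
have Si a : cspan S (be a z) by apply: cspan_in; exists a.
have prc a v : pr (be a v) = be a (pr v).
  apply: proj_uniq.
    move=> w hw; rewrite (rep_star _ _ _ rb).
    have hp : perp S (be (star a) w).
      by move=> _ [b _ <-]; rewrite -(rep_star _ _ _ rb) -(repM _ _ _ rb) hw //; exists (a ** b).
    exact: (proj_in S v) hp.
  move=> _ [b _ <-]; rewrite -(linB _ _ (rep_lin a rb)) -(rep_starl _ _ _ rb) -(repM _ _ _ rb).
  by rewrite (proj_perp S v) //; exists (star a ** b).
have dec a v w : hdot (be a v) w = hdot (be a (pr v)) (pr w) + hdot (be a (v - pr v)) (w - pr w).
  have o x y : hdot (pr x) (y - pr y) = 0.
    by apply: (proj_in S x); exact: proj_perp.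
  have e1 x y : hdot (pr x) y = hdot (pr x) (pr y).
    by apply/eqP; rewrite -subr_eq0 -hdotBr; apply/eqP/o.
  have e2 x y : hdot y (pr x) = hdot (pr y) (pr x) by rewrite hdotC e1 -hdotC.
  rewrite (linB _ _ (rep_lin a rb)) -prc hdotBl !hdotBr (e1 (be a v) w) (e2 w (be a v)); ring.
pose q v := v - pr v.
pose L2 := [seq (r.1, (r.2.1, q r.2.2)) | r <- L].
pose L1 := [seq (r.1, (r.2.1, pr r.2.2)) | r <- p :: L].
have qz a : be a (q z) = 0.
  by rewrite /q (linB _ _ (rep_lin a rb)) -prc /pr (proj_id _ _ (Si a)) subrr.
have -> : kform k (p :: L) (p :: L) = kform k L1 L1 + kform k L2 L2.
  have -> : kform k L2 L2 = kform k [seq (r.1, (r.2.1, q r.2.2)) | r <- p :: L] [seq (r.1, (r.2.1, q r.2.2)) | r <- p :: L].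
    rewrite /kform map_cons big_cons [X in _ = X + _]big1 ?add0r => [|r _]; last first.
      by rewrite /k /= qz hdot0l mulr0.
    apply: eq_bigr => r _; rewrite big_cons.
    by rewrite /k /= (rep_star _ _ _ rb) qz hdot0r mulr0 add0r.
  rewrite /kform !big_map -big_split; apply: eq_bigr => r _.
  rewrite !big_map -big_split; apply: eq_bigr => t _.
  by rewrite /k /= dec mulrDr.
rewrite raddfD /= addr_ge0 //; last by apply: IH; rewrite size_map.
have /choice[u hu] : forall v, exists a : nat -> P, nlim (fun n => be (a n) z) (pr v).
  move=> v; have /choice[a ha] : forall n, exists a, nm (pr v - be a z) < iv R n.
    move=> m; have [w Sw hw] := span_approx (proj_in S v) (iv_gt0 R m).
    suff [a ea] : exists a, w = be a z by exists a; rewrite -ea.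
    elim: Sw => [|c s w' [a _ <-] _ [b ->]]; first by exists 0; rewrite (rep0 _ rb).
    by exists (c *: a + b); rewrite (repL _ rb).
  exists a => e /inv_small[m hm]; exists m => m' /hm; rewrite nmBC; exact: lt_trans.
apply: (@nlim_Re_ge0 (fun m => kform k [seq (r.1, (r.2.1, be (u r.2.2 m) z)) | r <- p :: L]
    [seq (r.1, (r.2.1, be (u r.2.2 m) z)) | r <- p :: L])).
  rewrite /kform !big_map; under eq_fun do rewrite big_map.
  apply: nlim_sum => r; rewrite !big_map; under eq_fun do rewrite big_map.
  apply: nlim_sum => t; apply: nlim_scale; apply: nlim_hdot2; last exact: hu.
  have [b _ hb] := bop_ge0 (rep_bop (E (star t.2.1 ** r.2.1)) rb).
  apply: (@nlim_map _ _ _ (be (E (star t.2.1 ** r.2.1))) b _ (pr r.2.2)) => [x y|]; last exact: hu.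
  by rewrite -(linB _ _ (rep_lin _ rb)).
(* Moving the approximating elements of [P] into [N] through [iota] collects the whole form into the
   value of [E] at one square. *)
move=> m; pose y := \sum_(r <- p :: L) r.1 *: (r.2.1 ** iota (u r.2.2 m)).
have [w hw] := pE y.
rewrite (_ : kform k _ _ = hdot (be (E (star y ** y)) z) z); last first.
  rewrite /y star_sum cmul_suml (linS _ _ lE) (rep_sum _ _ _ rb) hdot_suml.
  rewrite /kform exchange_big big_map; apply: eq_bigr => t _.
  rewrite cmul_sumr (linS _ _ lE) (rep_sum _ _ _ rb) hdot_suml big_map; apply: eq_bigr => r _.
  rewrite /k /= starZ cmulZl cmulZr !(linZ _ _ lE) !(repZ _ _ _ rb) !hdotZl mulrCA mulrA; congr (_ * _).
  rewrite -(rep_starl _ _ _ rb) -!(repM _ _ _ rb) starM -si.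
  have -> : iota (star (u t.2.2 m)) ** star t.2.1 ** (r.2.1 ** iota (u r.2.2 m)) =
     iota (star (u t.2.2 m)) ** (star t.2.1 ** r.2.1) ** iota (u r.2.2 m) by rewrite !cmulA.
  by rewrite bE -?cmulA.
by rewrite hw (repM _ _ _ rb) (rep_starl _ _ _ rb) Re_hdotxx sqr_ge0.
Qed.

(* The direct sum over [o] of the spaces [N (x) Z] separated for the [Z]-valued maps [Eh o]. *)
Record indmod (O : Type) A Z (Eh : O -> A -> Z -> Z) : Type := IndMod {
  im_W : hilbertType R; im_br : O -> A -> Z -> im_W; im_al : A -> im_W -> im_W;
  im_dot : forall o x z x' z', hdot (im_br o x z) (im_br o x' z') = hdot (Eh o (star x' ** x) z) z';
  im_dot0 : forall o o' x z x' z', o <> o' -> hdot (im_br o x z) (im_br o' x' z') = 0;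
  im_total : total (range (fun p : O * A * Z => im_br p.1.1 p.1.2 p.2));
  im_rep : is_rep im_al;
  im_alE : forall n o x z, im_al n (im_br o x z) = im_br o (n ** x) z }.
Arguments im_W {O A Z Eh} i.
Arguments im_br {O A Z Eh} i.
Arguments im_al {O A Z Eh} i.
Arguments im_rep {O A Z Eh} i.
Arguments im_total {O A Z Eh} i.

Definition cpmap A Z (Eh : A -> Z -> Z) : Prop :=
  [/\ forall z, linear (Eh^~ z), forall x, linear (Eh x) &
      psd_kernel (fun p q : A * Z => hdot (Eh (star q.1 ** p.1) p.2) q.2)].

(** The kernel vanishes between different indices; for its positivity, the entries with the index of
    the head are split off and the others form a shorter list. *)
Lemma indmod_ex (O : Type) A Z (Eh : O -> A -> Z -> Z) : (forall o, cpmap (Eh o)) -> inhabited (indmod Eh).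
Proof.
move=> cp; pose X := (O * A * Z)%type.
pose k (p q : X) : C := if pselect (p.1.1 = q.1.1) then hdot (Eh p.1.1 (star q.1.2 ** p.1.2) p.2) q.2 else 0.
have kh p q : k p q = (k q p)^*.
  rewrite /k; case: pselect => [e|ne]; case: pselect => [e'|ne'] //=; rewrite ?conjC0 //.
  - by have [_ _ [h _]] := cp p.1.1; rewrite e'; exact: (h (p.1.2, p.2) (q.1.2, q.2)).
  - by case: ne'.
  - by case: ne.
have kp : psd_kernel k.
  split=> // L; have [n] := ubnP (size L); elim: n L => // n IH [|p L]; first by rewrite /kform big_nil.
  rewrite ltnS => hs; set o := p.1; pose P1 := fun r : C * X => `[< r.2.1.1 = p.2.1.1 >].
  have -> LL : kform k LL LL = kform k (seq.filter P1 LL) (seq.filter P1 LL) +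
      kform k (seq.filter (predC P1) LL) (seq.filter (predC P1) LL).
    rewrite /kform !big_filter (bigID P1) /=; congr (_ + _); apply: eq_bigr => r /asboolP hr.
      rewrite big_filter [LHS](bigID P1) /= [X in _ + X]big1 ?addr0 // => t /asboolP ht.
      by rewrite /k; case: pselect => [e|ne]; rewrite ?mulr0 //; case: ht; rewrite -e.
    rewrite big_filter [LHS](bigID P1) /= big1 ?add0r // => t /asboolP ht.
    by rewrite /k; case: pselect => [e|ne]; rewrite ?mulr0 //; case: hr; rewrite e.
  rewrite raddfD; apply: addr_ge0.
    have [_ _ [_ h]] := cp p.2.1.1; have := h [seq (r.1, (r.2.1.2, r.2.2)) | r <- seq.filter P1 (p :: L)].
    congr (0 <= complex.Re _); rewrite /kform !big_map !big_filter; apply: eq_bigr => r /asboolP hr.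
    rewrite big_map !big_filter; apply: eq_bigr => t /asboolP ht.
    by rewrite /k hr ht; case: pselect.
  apply: IH; rewrite /= /P1 asboolT //=; apply: leq_trans hs; rewrite ltnS size_filter; exact: count_size.
have [W [br [hbr tW]]] := kernel_space kp.
have [|||al [ra ea]] := @rep_ext R A W X br (fun n p => ((p.1.1, n ** p.1.2), p.2)) tW.
- move=> x c a b; apply: (total_ext tW) => y; rewrite hdotDl hdotZl !hbr /k /=.
  case: pselect => [e|ne]; last by rewrite mulr0 addr0.
  have [lz _ _] := cp x.1.1.
  by rewrite cmulDl cmulZl cmulDr cmulZr (lz x.2) hdotDl hdotZl.
- by move=> a b x; rewrite /= cmulA.
- by move=> a x y; rewrite !hbr /k /= starM starK cmulA.
apply: inhabits; apply: (@IndMod O A Z Eh W (fun o x z => br ((o, x), z)) al _ _ _ ra).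
- by move=> o x z x' z'; rewrite hbr /k /=; case: pselect.
- by move=> o o' x z x' z' ne; rewrite hbr /k /=; case: pselect.
- by move=> w hw; apply: tW => _ [[[o x] z] _ <-]; apply: hw; exists ((o, x), z).
- by move=> n o x z; exact: ea.
Qed.

Lemma indmod_right (O : Type) A D Z (Eh : O -> A -> Z -> Z) (m : indmod Eh) (rho : D -> Z -> Z) :
  (forall o, cpmap (Eh o)) -> is_rep rho -> (forall o x d z, Eh o x (rho d z) = rho d (Eh o x z)) ->
  exists be : D -> im_W m -> im_W m, [/\ is_rep be, forall d o x z, be d (im_br m o x z) = im_br m o x (rho d z) &
    forall a d w, im_al m a (be d w) = be d (im_al m a w)].
Proof.
move=> cp rr com.
have [|||be [rb eb]] := @rep_ext R D (im_W m) _ (fun p : O * A * Z => im_br m p.1.1 p.1.2 p.2)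
   (fun d p => (p.1, rho d p.2)) (im_total m).
- move=> p c a b; apply: (total_ext (im_total m)) => -[[o x] z] /=.
  have [e|ne] := pselect (p.1.1 = o); last by rewrite hdotDl hdotZl !im_dot0 // mulr0 addr0.
  have [_ lx _] := cp o.
  by rewrite -e hdotDl hdotZl !im_dot e (repL _ rr) (lx _) hdotDl hdotZl.
- by move=> a b x; rewrite /= (repM _ _ _ rr).
- move=> a [[o x] z] [[o' x'] z'] /=.
  have [<-|ne] := pselect (o = o'); last by rewrite !im_dot0.
  by rewrite !im_dot com (rep_star _ _ _ rr).
have eb' d o x z : be d (im_br m o x z) = im_br m o x (rho d z) by exact: (eb d (o, x, z)).
exists be; split=> // a d.
apply: (bop_ext (bop_comp (rep_bop a (im_rep m)) (rep_bop d rb)) (bop_comp (rep_bop d rb) (rep_bop a (im_rep m))) (im_total m)).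
by move=> _ [[[o x] z] _ <-] /=; rewrite eb' !im_alE eb'.
Qed.

Lemma nm_lpow A D T (tens : A -> D -> T) (m : mtdata tens) X n :
  nm (tsum tens (lpow (lmul (lstar X) X) n)) <= (nm (tsum tens X) ^+ 2) ^+ n.+1.
Proof.
have h : nm (tsum tens (lmul (lstar X) X)) = nm (tsum tens X) ^+ 2.
  by rewrite (md_mul m) (md_star m) nmCS.
elim: n => [|n IH]; first by rewrite /lpow /= h expr1.
rewrite /lpow iterS (md_mul m) exprS; apply: le_trans (nmCM _ _) _.
by rewrite h ler_wpM2l ?sqr_ge0.
Qed.

Lemma tsum_conj A D T (tens : A -> D -> T) (m : mtdata tens) (x : A) (X : seq (A * D)) :
  nm (tsum tens [seq (star x ** p.1 ** x, p.2) | p <- X]) <= nm (tens x cone) ^+ 2 * nm (tsum tens X).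
Proof.
have -> : tsum tens [seq (star x ** p.1 ** x, p.2) | p <- X] = star (tens x cone) ** tsum tens X ** tens x cone.
  rewrite /tsum big_map cmul_sumr cmul_suml; apply: eq_bigr => p _.
  by rewrite (md_star1 m) !(md_mul1 m) star1 cmul1r cmulr1.
apply: le_trans (nmCM _ _) _; apply: le_trans (ler_wpM2r (nm_ge0 _) (nmCM _ _)) _.
by rewrite nm_star mulrAC -expr2.
Qed.

(** The coefficient of the vector of [x] and [z] at a list is that of [z] at the conjugate of the
    list by [x], whose norm is controlled by [tsum_conj]; [lact_bound] then removes the
    constants. *)
Lemma indmod_nice (O : Type) A D T (tens : A -> D -> T) Z (Eh : O -> A -> Z -> Z) (m : indmod Eh)
    (rho : D -> Z -> Z) (be : D -> im_W m -> im_W m) :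
  is_min_tensor tens -> is_rep be -> (forall d o x z, be d (im_br m o x z) = im_br m o x (rho d z)) ->
  (forall a d w, im_al m a (be d w) = be d (im_al m a w)) ->
  (forall o z, exists A0 : R, forall X : seq (A * D),
     complex.Re (\sum_(p <- X) hdot (Eh o p.1 (rho p.2 z)) z) <= A0 * nm (tsum tens X)) ->
  forall X w, nm (lact (im_al m) be X w) <= nm (tsum tens X) * nm w.
Proof.
move=> mt rb eb com hA X; have [d] := min_tensor_data mt.
apply: (lact_bound (im_rep m) rb com (nm_ge0 _) (im_total m)) => _ [[[o x] z] _ <-] /=.
have [A0 h] := hA o z; exists (Num.sqrt (`|A0| * nm (tens x cone) ^+ 2)) => n.
set Y := lpow _ n; set b := (nm _ ^+ 2) ^+ _.
have b0 : 0 <= b by rewrite exprn_ge0 // sqr_ge0.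
have hY : nm (tsum tens Y) <= b by exact: nm_lpow.
have c0 : 0 <= `|A0| * nm (tens x cone) ^+ 2 by rewrite mulr_ge0 ?sqr_ge0.
rewrite -ler_sqr ?nnegrE ?mulr_ge0 ?nm_ge0 ?sqrtr_ge0 // exprMn sqr_sqrtr //.
rewrite -Re_hdotxx -lact_star -?lact_mul //; try exact: im_rep.
have -> : hdot (lact (im_al m) be (lmul (lstar Y) Y) (im_br m o x z)) (im_br m o x z) =
   \sum_(p <- [seq (star x ** p.1 ** x, p.2) | p <- lmul (lstar Y) Y]) hdot (Eh o p.1 (rho p.2 z)) z.
  rewrite /lact hdot_suml big_map; apply: eq_bigr => p _.
  by rewrite eb im_alE im_dot cmulA.
apply: le_trans (h _) _; apply: le_trans (ler_wpM2r (nm_ge0 _) (ler_norm _)) _.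
apply: le_trans (ler_wpM2l (normr_ge0 _) (tsum_conj d _ _)) _.
rewrite mulrA ler_wpM2l // (md_mul d) (md_star d) nmCS ler_sqr ?nnegrE ?nm_ge0 //.
Qed.

Lemma comp_rep (P N : cstarType R) Z (iota : P -> N) (be : N -> Z -> Z) : star_hom iota -> is_rep be -> is_rep (be \o iota).
Proof.
move=> [li mi si] rb; apply: is_repP => [a|v c a b|a b v|a v w] /=.
- exact: rep_bop.
- by rewrite li (repL _ rb).
- by rewrite mi (repM _ _ _ rb).
- by rewrite si (rep_starl _ _ _ rb).
Qed.

Lemma ce_cpmap P N (iota : P -> N) (E : N -> P) Z (be : P -> Z -> Z) :
  star_hom iota -> conditional_expectation iota E -> is_rep be -> cpmap (fun x => be (E x)).
Proof.
move=> si ce rb; split; last exact: ce_psd si ce rb.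
  by move=> z c a b; have [lE _ _ _] := ce; rewrite lE (repL _ rb).
by move=> x; exact: rep_lin.
Qed.

Lemma ce_one P N (iota : P -> N) (E : N -> P) : conditional_expectation iota E -> iota cone = cone -> E cone = cone.
Proof. by case=> _ h _ _ e; rewrite -e h. Qed.

(** Stinespring: [E] is the compression, by [h |-> 1 (x) h], of the action of [N] on the module
    induced along [E] from the restriction of a faithful representation. This is tensored with
    [md_L], where [tact_transfer] bounds the induced action by the minimal norm. *)
Lemma ce_tens P N D T (tens : N -> D -> T) (iota : P -> N) (E : N -> P) :
  is_min_tensor tens -> star_hom iota -> iota cone = cone -> conditional_expectation iota E ->
  forall X, nm (tsum tens [seq (iota (E p.1), p.2) | p <- X]) <= nm (tsum tens X).
Proof.
move=> mt si i1 ce X; have [d] := min_tensor_data mt.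
have [ht rs rr [ra rb] [ea eb]] := md_tact d.
have rbe := comp_rep si rs.
have cp (o : unit) := ce_cpmap si ce rbe.
have [m] := indmod_ex cp.
have [P' [t' [g' tt']]] := hilbert_tensor_ex (im_W m) (md_L d).
have [al2 [be2 ta2]] := tact_ex (conj g' tt') (im_rep m) rr.
have [_ _ _ [ra2 rb2] [ea2 eb2]] := ta2.
have com2 := tact_com ta2.
have bnd := tact_transfer (md_tact d) ta2 (@md_isg _ _ _ _ _ d) (nm_ge0 _) (@md_nmP R N D T tens d X).
have [|j [lj bj je]] := @lift _ _ _ _ (fun p => md_t d p.1 p.2) (fun p => t' (im_br m tt cone p.1) p.2) 1 ht.2.
  move=> L; rewrite mul1r -ler_sqr ?nnegrE ?nm_ge0 // -!Re_hdotxx.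
  set v := lc (fun p => md_t d p.1 p.2) L.
  have -> : hdot (lc (fun p => t' (im_br m tt cone p.1) p.2) L) (lc (fun p => t' (im_br m tt cone p.1) p.2) L) =
     hdot (md_al d cone v) v.
    rewrite /v (lc_lin _ _ (rep_lin _ ra)) !lc_hdot; apply: eq_bigr => p _; apply: eq_bigr => q _.
    by rewrite g' im_dot star1 cmulr1 (ce_one ce i1) /= i1 ea ht.1.
  apply: le_trans (Re_hdot_le _ _) _; rewrite Re_hdotxx expr2 ler_wpM2r ?nm_ge0 //.
  exact: rep_nm1.
have bbj : bop j by split=> //; exists 1.
apply/(md_nm d _ _ (nm_ge0 _)) => v.
have -> : lact (md_al d) (md_be d) [seq (iota (E p.1), p.2) | p <- X] v = adj j (lact al2 be2 X (j v)).
  have b1 := lact_bop [seq (iota (E p.1), p.2) | p <- X] ra rb.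
  have b2 := bop_comp (bop_adj bbj) (bop_comp (lact_bop X ra2 rb2) bbj).
  apply: (bop_ext b1 b2 ht.2) => _ [[h l] _ <-] /=; apply: (total_ext ht.2) => -[h' l'] /=.
  rewrite -adjPr // (je (h, l)) (je (h', l')) /= /lact big_map !hdot_suml; apply: eq_bigr => p _ /=.
  by rewrite eb ea ht.1 eb2 ea2 g' im_alE im_dot star1 cmul1r cmulr1.
apply: nm_sq_le; first by rewrite mulr_ge0 ?nm_ge0.
set y := adj j _; rewrite -Re_hdotxx -adjPr //; apply: le_trans (Re_hdot_le _ _) _.
have := bj y; have := bj v; rewrite !mul1r => b1 b2.
apply: le_trans (ler_pM (nm_ge0 _) (nm_ge0 _) (bnd _) b2) _.
by rewrite ler_wpM2r ?nm_ge0 // ler_wpM2l ?nm_ge0.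
Qed.

End CondExp.

Arguments im_W {R O A Z Eh} i.
Arguments im_br {R O A Z Eh} i.
Arguments im_al {R O A Z Eh} i.
Arguments im_rep {R O A Z Eh} i.
Arguments im_total {R O A Z Eh} i.

(** * Minimal tensor products and weak exactness over subalgebras *)

Section SubTensor.
Variable R : realType.
Local Notation C := R[i].
Implicit Types (A D T : cstarType R) (H K L P : hilbertType R).

Lemma star_homS A D (f : A -> D) (I : Type) (s : seq I) (F : I -> A) : star_hom f ->
  f (\sum_(i <- s) F i) = \sum_(i <- s) f (F i).
Proof. by case=> lf _ _; rewrite linS. Qed.

(** Injectivity of the minimal norm: [T0] is the closed span of the [tens (lam a) d] in [T], with
    restricted representations. *)
Lemma min_tensor_sub A0 A D T (tens : A -> D -> T) (lam : A0 -> A) :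
  is_min_tensor tens -> star_hom lam -> lam cone = cone -> injective lam ->
  exists (T0 : cstarType R) (tens0 : A0 -> D -> T0) (j : T0 -> T),
    [/\ is_min_tensor tens0, star_hom j, forall x, nm (j x) = nm x &
        forall a d, j (tens0 a d) = tens (lam a) d].
Proof.
move=> mt sl l1 il; have [m] := min_tensor_data mt; have [ll lm ls] := sl.
pose f (X : seq (A0 * D)) : T := tsum tens [seq (lam p.1, p.2) | p <- X].
pose S : set T := [set x | forall e : R, 0 < e -> exists X, nm (x - f X) < e].
have Sf X : S (f X) by move=> e e0; exists X; rewrite subrr nm0.
have f1 a d : f [:: (a, d)] = tens (lam a) d by rewrite /f /tsum big_seq1.
have fD X Y : f (X ++ Y) = f X + f Y by rewrite /f /tsum map_cat big_cat.
have fZ c X : f [seq (c *: p.1, p.2) | p <- X] = c *: f X.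
  rewrite /f /tsum -map_comp !big_map scaler_sumr; apply: eq_bigr => p _ /=.
  by rewrite (linZ _ _ ll) (linZ _ _ (md_linl m _)).
have fM X Y : f (lmul X Y) = f X ** f Y.
  rewrite /f -(md_mul m) /tsum big_map !big_allpairs_ big_map; apply: eq_bigr => p _.
  by rewrite big_map; apply: eq_bigr => q _; rewrite /= lm.
have fS X : f (lstar X) = star (f X).
  rewrite /f -(md_star m) /tsum /lstar -!map_comp !big_map; apply: eq_bigr => p _.
  by rewrite /= ls.
have [|||||T0 [j [sj j1 jn jS]]] := @sub_cstar R T S.
- by rewrite -(md_one m) -l1 -f1; exact: Sf.
- move=> c x y Sx Sy e e0; have c1 : 0 < nm c + 1 by have := nm_ge0 c; lra.
  have [|X hX] := Sx (e / 2 / (nm c + 1)); first by rewrite !divr_gt0.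
  have [|Y hY] := Sy (e / 2); first by lra.
  exists ([seq (c *: p.1, p.2) | p <- X] ++ Y); rewrite fD fZ opprD addrACA -scalerBr.
  apply: le_lt_trans (nmD _ _) _; rewrite nmZ; move: hX; rewrite ltr_pdivlMr //.
  have := nm_ge0 (x - f X); nra.
- move=> x y Sx Sy e e0; have y1 : 0 < nm y + 1 by have := nm_ge0 y; lra.
  have [|X hX] := Sx (e / 2 / (nm y + 1)); first by rewrite !divr_gt0.
  have x1 : 0 < nm (f X) + 1 by have := nm_ge0 (f X); lra.
  have [|Y hY] := Sy (e / 2 / (nm (f X) + 1)); first by rewrite !divr_gt0.
  exists (lmul X Y); rewrite fM.
  have -> : x ** y - f X ** f Y = (x - f X) ** y + f X ** (y - f Y).
    by rewrite cmulBl cmulBr addrA subrK.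
  apply: le_lt_trans (nmD _ _) _; apply: le_lt_trans (lerD (nmCM _ _) (nmCM _ _)) _.
  move: hX hY; rewrite !ltr_pdivlMr //.
  by have := nm_ge0 (x - f X); have := nm_ge0 (y - f Y); nra.
- move=> x Sx e e0; have [X hX] := Sx e e0; exists (lstar X); by rewrite fS -starB nm_star.
- move=> x hx e e0; have [|y Sy hy] := hx (e / 2); first by lra.
  have [|X hX] := Sy (e / 2); first by lra.
  by exists X; have := nm_tri y x (f X); lra.
have [lj mj stj] := sj.
have ji : injective j.
  by move=> x y e; apply/eqP; rewrite -subr_eq0; apply/eqP/nm0_eq0; rewrite -jn (linB _ _ lj) e subrr nm0.
have /choice[t0 ht0] : forall p : A0 * D, exists y, j y = tens (lam p.1) p.2.
  by move=> p; apply/jS; rewrite -f1.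
pose tens0 a d := t0 (a, d).
have jt a d : j (tens0 a d) = tens (lam a) d by exact: ht0.
exists T0, tens0, j; split=> //.
have [H [L [P [t [sg [rho [th [ht [rs is_] rr [rt it] [e cl]]]]]]]]] := mt.
exists H, L, P, t, (sg \o lam), rho, (th \o j); split=> //.
- split; first exact: comp_rep.
  by move=> x y /is_; exact: il.
- split; first exact: comp_rep.
  by move=> x y /it; exact: ji.
split=> [a d h l|]; first by rewrite /= jt e.
rewrite -subTset => y _; apply/closure_nm => d d0.
have [X hX] : exists X, nm (j y - f X) < d by apply: (iffRL (jS (j y))) => //; exists y.
exists (\sum_(p <- X) tens0 p.1 p.2); first by exists X.
rewrite -jn (linB _ _ lj) (linS _ _ lj) (_ : \sum_(p <- X) _ = f X) //.
by rewrite /f /tsum big_map; apply: eq_bigr => p _; rewrite jt.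
Qed.

(** Weak exactness is applied to the restriction of [pi] to the closed span of the [tens (lam m) d];
    normality on [M] comes from that of the embedding. *)
Lemma weakly_exact_embed (M N : vonNeumann R) (lam : M -> N) : weakly_exact M -> vn_embedding lam ->
  forall (D Q : cstarType R) (J : set D) (q : D -> Q), closed_ideal J -> is_quotient J q ->
  forall (T : cstarType R) (tens : N -> D -> T), is_min_tensor tens ->
  forall (T' : cstarType R) (tens' : N -> Q -> T'), is_min_tensor tens' ->
  forall (K : hilbertType R) (pi : T -> K -> K), is_rep pi ->
    closure (tensor_span tens J) `<=` [set t | forall v, pi t v = 0] ->
    uw_continuous_op (fun m => pi (tens m cone)) ->
  forall pit : N -> Q -> K -> K, (forall m c, pit m (q c) = pi (tens m c)) ->
  exists k : R, forall (s : seq (M * Q)) (v : K),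
    nm (\sum_(p <- s) pit (lam p.1) p.2 v) <= k * nm (tsum tens' [seq (lam p.1, p.2) | p <- s]) * nm v.
Proof.
move=> we [sl l1 il ul] D Q J q cJ isq T tens mt T' tens' mt' K pi rpi kJ upi pit hpit.
have [T0 [tens0 [j [mt0 sj jn jt]]]] := min_tensor_sub mt sl l1 il.
have [T0' [tens0' [j' [mt0' sj' jn' jt']]]] := min_tensor_sub mt' sl l1 il.
have [|||k hk] := we D Q J q cJ isq T0 tens0 mt0 T0' tens0' mt0' K (pi \o j) (comp_rep sj rpi) _ _ (fun m y => pit (lam m) y).
- move=> y hy v /=; apply: kJ; apply/closure_nm => e e0.
  move/closure_nm: hy => /(_ e e0)[_ [s sJ ->] hs].
  exists (\sum_(p <- s) tens (lam p.1) p.2).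
    exists [seq (lam p.1, p.2) | p <- s]; last by rewrite big_map.
    by move=> p /mapP[p' /sJ h ->].
  have [lj _ _] := sj; rewrite -jn (linB _ _ lj) (linS _ _ lj) in hs.
  by under eq_bigr do rewrite -jt.
- move=> F x FF hF; rewrite /= jt; under eq_fun do rewrite jt.
  exact: (upi (lam @ F) (lam x) _ (ul F x FF hF)).
- by move=> m c; rewrite hpit /= jt.
exists k => s v; have := hk s v.
rewrite !nmE -!rmorphM lecR /=.
congr (_ <= _ * _ * _); rewrite -jn' (star_homS _ _ sj') /tsum big_map; congr nm.
by apply: eq_bigr => p _; rewrite jt'.
Qed.

End SubTensor.

(** * Normal representations *)

Section Amplification.
Variable R : realType.
Local Notation C := R[i].
Implicit Types (H K W : hilbertType R) (N : vonNeumann R).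

Lemma id_ce N : conditional_expectation (@id N) id.
Proof. by split=> // x; exists x. Qed.

Lemma vn_rep_rep N : is_rep (@vn_rep R N). Proof. by case: (vn_rep_faithful N). Qed.

Lemma vn_cpmap N (k : nat) : cpmap (@vn_rep R N).
Proof. by apply: (ce_cpmap (iota := id) _ (@id_ce N) (vn_rep_rep N)); split. Qed.

(* The space [l^2 (x) vn_space N]; [im_br (amp N) k x h] is [x h] in the [k]-th summand. *)
Definition amp N : indmod (fun _ : nat => @vn_rep R N) :=
  inhabited_witness (indmod_ex (@vn_cpmap N)).
Definition HH N : hilbertType R := im_W (amp N).
Definition am N : N -> HH N -> HH N := im_al (amp N).
Definition aj N (k : nat) (h : vn_space N) : HH N := im_br (amp N) k cone h.

Lemma am_rep N : is_rep (@am N). Proof. exact: im_rep. Qed.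

Lemma vn1 N h : @vn_rep R N cone h = h. Proof. by rewrite vn_rep_unital. Qed.

Lemma aj_dot N k k' h h' : hdot (@aj N k h) (aj k' h') = if k == k' then hdot h h' else 0.
Proof.
case: eqP => [<-|ne]; last by rewrite /aj im_dot0.
by rewrite /aj im_dot star1 cmulr1 vn1.
Qed.

Lemma br_aj N k x h : im_br (amp N) k x h = aj k (vn_rep x h).
Proof.
apply: (total_ext (im_total (amp N))) => -[[k' x'] h'] /=; rewrite /aj.
have [->|ne] := pselect (k = k'); last by rewrite !im_dot0.
by rewrite !im_dot cmulr1 !(repM _ _ _ (vn_rep_rep N)).
Qed.

Lemma aj_total N : total (range (fun p : nat * vn_space N => aj p.1 p.2)).
Proof.
move=> w hw; apply: (im_total (amp N)) => _ [[[k x] h] _ <-] /=.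
by rewrite br_aj; apply: hw; exists (k, vn_rep x h).
Qed.

Lemma am_aj N x k h : am x (@aj N k h) = aj k (vn_rep x h).
Proof. by rewrite /am /aj im_alE cmulr1 br_aj. Qed.

Lemma aj_bop N k : bop (@aj N k).
Proof.
split; last first.
  exists 1 => h; rewrite mul1r -ler_sqr ?nnegrE ?nm_ge0 // -!Re_hdotxx aj_dot eqxx //.
move=> c x y; apply: (total_ext (@aj_total N)) => -[k' h'] /=.
by rewrite hdotDl hdotZl !aj_dot; case: eqP => _; rewrite ?hdotDl ?hdotZl // mulr0 addr0.
Qed.

Lemma am1 N v : @am N cone v = v.
Proof.
apply: (bop_ext (rep_bop cone (@am_rep N)) (bop_id _) (@aj_total N)) => _ [[k h] _ <-].
by rewrite /= am_aj vn1.
Qed.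

Lemma aj_adj N k k' h : adj (@aj N k) (aj k' h) = if k' == k then h else 0.
Proof.
apply: hdot_extr => z; rewrite -adjP; last exact: aj_bop.
by rewrite aj_dot eq_sym; case: eqP; rewrite ?hdot0r.
Qed.

Lemma aj_adj_am N k x v : adj (@aj N k) (am x v) = vn_rep x (adj (@aj N k) v).
Proof.
apply: hdot_extr => z; rewrite -adjP; last exact: aj_bop.
rewrite -(rep_starl _ _ _ (@am_rep N)) am_aj adjP; last exact: aj_bop.
by rewrite (rep_starl _ _ _ (vn_rep_rep N)).
Qed.

(** An injection of pairs of integers into the integers splits the multiplicity space, which gives
    isometries with orthogonal ranges in the commutant of [N]. *)
Lemma amp_U N : exists U : nat -> HH N -> HH N,
  [/\ forall m, linear (U m),
      forall m m' v w, hdot (U m v) (U m' w) = if m == m' then hdot v w else 0 &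
      forall m x v, am x (U m v) = U m (am x v)].
Proof.
pose U0 (m : nat) (p : nat * vn_space N) := aj (pickle (m, p.1)) p.2.
have ex m : exists T : HH N -> HH N, [/\ linear T, forall v, nm (T v) = nm v & forall p, T (aj p.1 p.2) = U0 m p].
  apply: lift_isom; first exact: aj_total.
  move=> p q; rewrite /U0 !aj_dot (inj_eq (pcan_inj pickleK)); congr (if _ then _ else _).
  by apply/eqP/eqP => [[]|->].
have /choice[U hU] := ex; have lU m : linear (U m) by case: (hU m).
have nU m v : nm (U m v) = nm v by case: (hU m).
have eU m p : U m (aj p.1 p.2) = U0 m p by case: (hU m).
have bU m : bop (U m) by split=> //; exists 1 => v; rewrite nU mul1r.
exists U; split=> // [m m' v w|m x v].
  case: eqP => [<-|ne]; first exact: isom_hdot.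
  have -> : hdot (U m v) (U m' w) = hdot v (adj (U m) (U m' w)) by rewrite adjP.
  rewrite (_ : adj (U m) (U m' w) = 0) ?hdot0r //.
  apply: (bop_ext (bop_comp (bop_adj (bU m)) (bU m')) (bop0 _ _) (@aj_total N)) => _ [p _ <-] /=.
  apply: (total_ext (@aj_total N)) => q; rewrite -adjPr // !eU hdot0l /U0 aj_dot.
  by case: eqP => // /(pcan_inj pickleK)[] e _; case: ne.
apply: (bop_ext (bop_comp (rep_bop x (@am_rep N)) (bU m)) (bop_comp (bU m) (rep_bop x (@am_rep N))) (@aj_total N)).
by move=> _ [p _ <-] /=; rewrite am_aj eU (eU m (p.1, _)) /U0 am_aj.
Qed.

Lemma ortho_sum W (u : nat -> W) (M : R) :
  (forall m n, m <> n -> hdot (u m) (u n) = 0) ->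
  (forall n, \sum_(i < n) nm (u i) ^+ 2 <= M) ->
  exists l, nlim (fun n => \sum_(i < n) u i) l.
Proof.
move=> ou bu; pose a n := \sum_(i < n) nm (u i) ^+ 2; pose s n := \sum_(i < n) u i.
have sE n k : nm (s (n + k)%N - s n) ^+ 2 = a (n + k)%N - a n.
  elim: k => [|k IH]; first by rewrite addn0 !subrr nm0 expr0n.
  rewrite addnS /s /a !big_ord_recr /= -/(s _) -/(a _) -/(s n) -/(a n).
  rewrite [_ + u _ - _]addrAC nmsqD IH.
  have o m : (m <= n + k)%N -> hdot (s m) (u (n + k)%N) = 0.
    move=> hm; rewrite /s hdot_suml big1 // => i _; apply: ou => e.
    by have := leq_trans (ltn_ord i) hm; rewrite e ltnn.
  by rewrite hdotBl !o ?leq_addr // subrr /= mulr0 addr0 addrAC.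
have am0 n k : a n <= a (n + k)%N by rewrite -subr_ge0 -sE sqr_ge0.
apply: complete_nlim => e e0.
have hs : has_sup [set a n | n in setT].
  by split; [exists (a 0), 0|exists M => _ [n _ <-]; exact: bu].
have [|_ [n0 _ <-] hn0] := sup_adherent (_ : 0 < (e / 2) ^+ 2) hs; first by rewrite exprn_gt0 //; lra.
have key m : (n0 <= m)%N -> nm (s m - s n0) < e / 2.
  move=> hm; rewrite -(subnKC hm) -ltr_sqr ?nnegrE ?nm_ge0 //; last by lra.
  rewrite sE; have : a (n0 + (m - n0))%N <= sup [set a n | n in setT].
    by apply: ub_le_sup; [exact: hs.2|exists (n0 + (m - n0))%N].
  lra.
exists n0 => m n /key h1 /key h2; have := nm_tri (s n0) (s m) (s n); rewrite (nmBC (s n0)) -/(s m) -/(s n); lra.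
Qed.

(** The sum of the [U i (xi i)], with the isometries of [amp_U], dominates the whole sequence at
    once. *)
Lemma amp_combine N (xi : nat -> HH N) (M : R) :
  (forall n, \sum_(i < n) nm (xi i) ^+ 2 <= M) ->
  exists eta : HH N, forall x n, \sum_(i < n) nm (am x (xi i)) ^+ 2 <= nm (am x eta) ^+ 2.
Proof.
have [U [lU dU cU]] := amp_U N.
have nU m v : nm (U m v) ^+ 2 = nm v ^+ 2 by rewrite -!Re_hdotxx dU eqxx.
move=> h; have [||eta heta] := @ortho_sum (HH N) (fun m => U m (xi m)) M.
- by move=> m n /eqP ne; rewrite dU (negPf ne).
- by move=> n; under eq_bigr do rewrite nU; exact: h.
exists eta => x n; set w := \sum_(i < n) U i (am x (xi i)).
have nw : \sum_(i < n) nm (am x (xi i)) ^+ 2 = nm w ^+ 2.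
  rewrite -Re_hdotxx /w hdot_suml raddf_sum; apply: eq_bigr => i _; rewrite hdot_sumr (bigD1 i) //=.
  rewrite dU eqxx big1 ?addr0 ?Re_hdotxx // => k ne; rewrite dU.
  by case: eqP => // /val_inj e; rewrite e eqxx in ne.
have e : hdot (am x eta) w = hdot w w.
  have h1 : nlim (fun m => hdot (am x (\sum_(i < m) U i (xi i))) w) (hdot (am x eta) w).
    have [k _ hk] := bop_ge0 (rep_bop x (@am_rep N)).
    apply: nlim_hdotl; apply: (@nlim_map _ _ _ (@am N x) k) heta => a b.
    by rewrite -(linB _ _ (rep_lin _ (@am_rep N))).
  apply: nlim_uniq h1 _ => d d0; exists n => m hm.
  rewrite (_ : hdot (am x _) w = hdot w w) ?subrr ?nm0 //.
  rewrite (linS _ _ (rep_lin _ (@am_rep N))) /w !hdot_sumr; apply: eq_bigr => i _.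
  rewrite !hdot_suml (bigD1 (widen_ord hm i)) //= [RHS](bigD1 i) //= cU !dU eqxx.
  rewrite !big1 // => k ne; first by rewrite dU; case: eqP => // /val_inj ee; rewrite ee eqxx in ne.
  rewrite cU dU; case: eqP => // ee; case/eqP: ne; exact: val_inj.
rewrite nw ler_sqr ?nnegrE ?nm_ge0 //; apply: nm_sq_le; first exact: nm_ge0.
by rewrite -Re_hdotxx -e; exact: Re_hdot_le.
Qed.

Lemma amp_list N (s : seq (HH N)) : exists eta : HH N, forall x,
  \sum_(v <- s) nm (am x v) ^+ 2 <= nm (am x eta) ^+ 2.
Proof.
pose xi i := nth 0 s i.
have e (F : HH N -> R) : F 0 = 0 -> forall n, (size s <= n)%N -> \sum_(i < n) F (xi i) = \sum_(v <- s) F v.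
  move=> F0 n hn; rewrite -(big_mkord xpredT (fun i => F (xi i))) (big_cat_nat (leq0n _) hn) /=.
  rewrite [X in _ + X]big_nat_cond [X in _ + X]big1 ?addr0.
    by rewrite [RHS](big_nth 0).
  by move=> i /andP[/andP[hi _] _]; rewrite /xi nth_default.
have [|eta h] := @amp_combine N xi (\sum_(v <- s) nm v ^+ 2).
  move=> n; rewrite -(e (fun v => nm v ^+ 2) _ (n + size s)%N) ?leq_addl ?nm0 ?expr0n //.
  by rewrite big_split_ord /= lerDl sumr_ge0 // => i _; exact: sqr_ge0.
exists eta => x; rewrite -(e (fun v => nm (am x v) ^+ 2) _ (size s)) //.
by rewrite (lin0 (rep_lin _ (@am_rep N))) nm0 expr0n.
Qed.

(** Square summable sequences become single vectors of the amplification, and the functionals that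
    define the ultraweak topology become its coefficients ([vector_functionalE]). *)
Lemma sq_summable_vec N (xi : nat -> vn_space N) : square_summable xi ->
  exists v : HH N, nlim (fun n => \sum_(i < n) aj i (xi i)) v.
Proof.
move=> /cvg_ex[l hl]; have {}hl := (nlim_cvg _ _).2 hl.
have nj i : nm (aj i (xi i)) ^+ 2 = nm (xi i) ^+ 2 by rewrite -!Re_hdotxx aj_dot eqxx.
have sE n : series (fun n => `|xi n| ^+ 2) n = (\sum_(i < n) nm (xi i) ^+ 2)%:C.
  rewrite /series /= big_mkord rmorph_sum; apply: eq_bigr => i _.
  by rewrite nmE -rmorphXn.
apply: (@ortho_sum (HH N) (fun i => aj i (xi i)) (complex.Re (l : C))).
  by move=> m n /eqP ne; rewrite aj_dot (negPf ne).
move=> n; under eq_bigr do rewrite nj.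
set a := \sum_(i < n) _; rewrite leNgt; apply/negP => lt.
have [|n0 h] := hl (a - complex.Re l); first by rewrite subr_gt0.
have := h _ (leq_maxl n0 n); rewrite sE; have := Re_nm ((\sum_(i < maxn n0 n) nm (xi i) ^+ 2)%:C - l).
rewrite raddfB /=; have : a <= \sum_(i < maxn n0 n) nm (xi i) ^+ 2.
  rewrite -(subnKC (leq_maxr n0 n)) big_split_ord /= lerDl sumr_ge0 // => i _; exact: sqr_ge0.
lra.
Qed.

Lemma vector_functionalE N (xi eta : nat -> vn_space N) v w (x : N) :
  nlim (fun n => \sum_(i < n) aj i (xi i)) v -> nlim (fun n => \sum_(i < n) aj i (eta i)) w ->
  vector_functional xi eta (vn_rep x) = hdot (am x v) w.
Proof.
move=> hv hw; rewrite /vector_functional; apply: cvg_lim => //.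
apply/(@nlim_cvg R C); rewrite (_ : series _ = fun n => hdot (am x (\sum_(i < n) aj i (xi i))) (\sum_(i < n) aj i (eta i))).
  apply: nlim_hdot2 hw; have [k _ hk] := bop_ge0 (rep_bop x (@am_rep N)).
  apply: (@nlim_map _ _ _ (@am N x) k) hv => a b.
  by rewrite -(linB _ _ (rep_lin _ (@am_rep N))).
apply/funext => n; rewrite /series /= big_mkord (linS _ _ (rep_lin _ (@am_rep N))) hdot_suml.
apply: eq_bigr => i _; rewrite hdot_sumr (bigD1 i) //= am_aj aj_dot eqxx big1 ?addr0 // => k ne.
by rewrite aj_dot; case: eqP => // /val_inj e; rewrite e eqxx in ne.
Qed.

Lemma uw_dominated N (f : N -> C) : linear f ->
  (forall (F : set_system N), Filter F -> vn_uw_cvg F 0 -> f @ F --> f 0) ->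
  exists xi : HH N, forall x, nm (f (star x ** x)) <= nm (am x xi) ^+ 2.
Proof.
move=> lf cf.
pose ok (p : HH N * HH N) (e : R) (x : N) := nm (hdot (am x p.1) p.2) < e.
(* The filter generated by the sets on which finitely many coefficients are small. *)
pose F : set_system N := [set A | exists (l : seq (HH N * HH N)) (e : R), 0 < e /\
  forall x, (forall p, p \in l -> ok p e x) -> A x].
have FF : Filter F.
  split; first by exists [::], 1.
    move=> A B [l [e [e0 h]]] [l' [e' [e0' h']]]; exists (l ++ l'), (Num.min e e').
    split; first by rewrite lt_min e0.
    move=> x hx; split; [apply: h|apply: h'] => p pl.
      by have := hx p; rewrite mem_cat pl /ok lt_min => /(_ isT)/andP[].
    by have := hx p; rewrite mem_cat pl orbT /ok lt_min => /(_ isT)/andP[].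
  by move=> A B AB [l [e [e0 h]]]; exists l, e; split=> // x /h/AB.
have cF : vn_uw_cvg F 0.
  move=> xi eta /sq_summable_vec[v hv] /sq_summable_vec[w hw].
  have -> : vector_functional xi eta (vn_rep (0 : N)) = 0.
    by rewrite (vector_functionalE _ hv hw) (rep0 _ (@am_rep N)) hdot0l.
  apply/cvgrPdistC_lt => e e0; have er : e \is Num.real by rewrite gtr0_real.
  have eE : e = (complex.Re e)%:C by rewrite RRe_real.
  exists [:: (v, w)], (complex.Re e); split; first by rewrite -ltcR -eE.
  move=> x /(_ (v, w)); rewrite inE eqxx => /(_ isT) h /=.
  by rewrite subr0 (vector_functionalE _ hv hw) nmE eE ltcR.
have /cvgrPdistC_lt/(_ 1 ltr01) := cf F FF cF.
case=> l [e [e0 h]]; pose S x := \sum_(p <- l) nm (hdot (am x p.1) p.2).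
have S0 x : 0 <= S x by apply: sumr_ge0 => p _; exact: nm_ge0.
have fS x : nm (f x) <= e^-1 * S x.
  (* The summand [e * d] keeps the denominator of [t] positive when [S x = 0]. *)
  apply/ler_addgt0Pr => d d0; pose t := e / (S x + e * d).
  have d1 : 0 < S x + e * d by have := mulr_gt0 e0 d0; have := S0 x; lra.
  have t0 : 0 < t by rewrite divr_gt0.
  have : nm (f (t%:C *: x)) < 1.
    rewrite -ltcR -nmE -[f _]subr0 -(lin0 lf) rmorph1; apply: h => p pl.
    rewrite /ok (repZ _ _ _ (@am_rep N)) hdotZl nmM nmR0; last exact: ltW.
    have hp : nm (hdot (am x p.1) p.2) <= S x.
      rewrite /S (big_rem p) //= lerDl sumr_ge0 // => q _; exact: nm_ge0.
    rewrite /t mulrAC ltr_pdivrMr // ltr_pM2l //; have := mulr_gt0 e0 d0; lra.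
  rewrite (linZ _ _ lf) nmM nmR0; last exact: ltW.
  rewrite mulrC -ltr_pdivlMr // mul1r /t invf_div => /ltW hh; apply: le_trans hh _.
  by rewrite mulrDl [e * d / e]mulrAC divff ?gt_eqF // mul1r mulrC.
have [eta heta] := amp_list ([seq p.1 | p <- l] ++ [seq p.2 | p <- l]).
exists ((Num.sqrt e^-1)%:C *: eta) => x.
rewrite (linZ _ _ (rep_lin _ (@am_rep N))) nmZ nmR0 ?sqrtr_ge0 // exprMn sqr_sqrtr; last by rewrite invr_ge0 ltW.
apply: le_trans (fS _) _; rewrite ler_wpM2l ?invr_ge0 ?(ltW e0) //.
apply: le_trans (heta x); rewrite big_cat !big_map /= -big_split; apply: ler_sum => p _ /=.
rewrite (repM _ _ _ (@am_rep N)) (rep_starl _ _ _ (@am_rep N)); apply: le_trans (hdot_nm _ _) _.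
have := sqr_ge0 (nm (am x p.1) - nm (am x p.2)); rewrite sqrrB mulr2n.
have := mulr_ge0 (nm_ge0 (am x p.1)) (nm_ge0 (am x p.2)).
set a := nm _; set b := nm _; move=> h1 h2; lra.
Qed.

Lemma uw_op_functional N K (f : N -> K -> K) (v w : K) : uw_continuous_op f ->
  forall (F : set_system N) x, Filter F -> vn_uw_cvg F x -> (fun x => hdot (f x v) w) @ F --> hdot (f x v) w.
Proof.
move=> cf F x FF hF; pose xi u (n : nat) : K := if n is 0 then u else 0.
have sq u : square_summable (xi u).
  apply/cvg_ex; exists (`|u| ^+ 2); apply/nlim_cvg => e e0; exists 1 => -[//|n] _.
  by rewrite /series /= big_nat_recl //= big1 ?addr0 ?subrr ?nm0 // => i _; rewrite normr0 expr0n.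
have vE (T : K -> K) : vector_functional (xi v) (xi w) T = hdot (T v) w.
  rewrite /vector_functional; apply: cvg_lim => //; apply/(@nlim_cvg R C) => e e0; exists 1 => -[//|n] _.
  by rewrite /series /= big_nat_recl //= big1 ?addr0 ?subrr ?nm0 // => i _; rewrite hdot0r.
have := cf F x FF hF (xi v) (xi w) (sq v) (sq w).
by rewrite (_ : vector_functional (xi v) (xi w) = fun T => hdot (T v) w) //; apply/funext.
Qed.

(** The working form of normality of [al] at [w]: domination by a single vector of the
    amplification. It is transported between modules more easily than ultraweak continuity. *)
Definition dom N W (al : N -> W -> W) (w : W) : Prop :=
  exists xi : HH N, forall x, nm (al x w) <= nm (am x xi).

Lemma uw_dom N K (f : N -> K -> K) : is_rep f -> uw_continuous_op f -> forall v, dom f v.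
Proof.
move=> rf cf v.
have [||xi h] := @uw_dominated N (fun x => hdot (f x v) v).
- by move=> c a b; rewrite (repL _ rf) hdotDl hdotZl.
- by move=> F FF hF; exact: (@uw_op_functional N K f v v cf F 0 FF hF).
exists xi => x; rewrite -ler_sqr ?nnegrE ?nm_ge0 //; apply: le_trans (h x).
by rewrite (repM _ _ _ rf) (rep_starl _ _ _ rf) hdotxx nmR0 ?sqr_ge0.
Qed.

(** The projection onto the closed span of the orbit of [xi] under [A] commutes with the
    self-adjoint set [G]; its matrix entries lie in the commutant of [G], so it commutes with all of
    [N]. For this it suffices that [A] is a subspace stable under [G] from the left. *)
Lemma strong_density N (G : set N) (A : set N) :
  range (@vn_rep R N) = bicommutant (@vn_rep R N @` G) ->
  (forall g, G g -> G (star g)) -> A cone -> (forall c a b, A a -> A b -> A (c *: a + b)) ->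
  (forall g a, G g -> A a -> A (g ** a)) ->
  forall x (xi : HH N) (e : R), 0 < e -> exists2 a, A a & nm (am x xi - am a xi) < e.
Proof.
move=> bc Gs A1 AD AG x xi e e0.
have rN := vn_rep_rep N; have ra := @am_rep N.
pose S := [set am a xi | a in A]; pose P := proj S.
have GS g v : G g -> cspan S v -> cspan S (am g v).
  move=> Gg hv w hw; rewrite (rep_star _ _ _ ra); apply: hv => _ [a Aa <-].
  rewrite -(rep_star _ _ _ ra) -(repM _ _ _ ra) hw //; exists (g ** a) => //; exact: AG.
have PG g v : G g -> P (am g v) = am g (P v).
  move=> Gg; apply: proj_uniq; first by apply: GS => //; exact: proj_in.
  move=> _ [a Aa <-]; rewrite -(linB _ _ (rep_lin g ra)) -(rep_starl _ _ _ ra) -(repM _ _ _ ra).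
  by rewrite (proj_perp S v) //; exists (star g ** a) => //; apply: AG => //; exact: Gs.
have bP : bop P by split; [exact: proj_lin|exists 1 => v; rewrite mul1r; exact: proj_nm].
have Px v : P (am x v) = am x (P v).
  apply: (bop_ext (bop_comp bP (rep_bop x ra)) (bop_comp (rep_bop x ra) bP) (@aj_total N)) => _ [[l h] _ <-] /=.
  apply: (total_ext (@aj_total N)) => -[k h'] /=.
  pose Pkl h := adj (@aj N k) (P (aj l h)).
  have PklE u u' : hdot (Pkl u) u' = hdot (P (aj l u)) (aj k u').
    by rewrite /Pkl -adjPr //; exact: aj_bop.
  have cP : commutant (@vn_rep R N @` G) Pkl.
    split.
      have bb := bop_comp (bop_adj (@aj_bop N k)) (bop_comp bP (@aj_bop N l)).
      by split; [exact: bb.1|apply/bop_continuous; [exact: bb.1|exact: bb.2]].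
    move=> _ [g Gg <-]; apply/funext => u /=; apply: hdot_ext => u'.
    rewrite PklE -am_aj PG // (rep_star _ _ _ ra) am_aj -PklE (rep_star _ _ _ rN) //.
  have [_ hx] : bicommutant (@vn_rep R N @` G) (vn_rep x) by rewrite -bc; exists x.
  have /(congr1 (fun f => f h)) /= hxh := hx _ cP.
  rewrite am_aj -PklE -hxh (rep_star _ _ _ rN) PklE (rep_star _ _ _ ra) am_aj //.
have hxi : cspan S xi by apply: cspan_in; exists cone => //; exact: am1.
have : cspan S (am x xi) by rewrite -(proj_id _ _ hxi) -/P -Px; exact: proj_in.
move=> /span_approx/(_ e0)[u Su hu].
suff [a Aa ea] : exists2 a, A a & u = am a xi by exists a => //; rewrite -ea.
elim: Su => [|c s v [a Aa <-] _ [b Ab ->]].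
  exists (0 : N); last by rewrite (rep0 _ ra).
  by rewrite -(addNr (cone : N)) -scaleN1r; exact: AD.
by exists (c *: a + b); [exact: AD|rewrite (repL _ ra)].
Qed.

End Amplification.

Section Dominated.
Variable R : realType.
Local Notation C := R[i].
Implicit Types (H K W : hilbertType R) (N : vonNeumann R).

Definition hom (A : cstarType R) H K (al : A -> H -> H) (be : A -> K -> K) (T : H -> K) : Prop :=
  bop T /\ forall x v, T (al x v) = be x (T v).

Lemma hom_adj (A : cstarType R) H K (al : A -> H -> H) (be : A -> K -> K) T :
  is_rep al -> is_rep be -> hom al be T -> hom be al (adj T).
Proof.
move=> ra rb [bT iT]; split; first exact: bop_adj.
by move=> x v; apply: hdot_extr => w; rewrite -adjP // -(rep_starl _ _ _ rb) -iT adjP // (rep_starl _ _ _ ra).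
Qed.

Lemma hom_comp (A : cstarType R) H K W (al : A -> H -> H) (be : A -> K -> K) (ga : A -> W -> W) S T :
  hom be ga S -> hom al be T -> hom al ga (S \o T).
Proof. by move=> [bS iS] [bT iT]; split; [exact: bop_comp|move=> x v /=; rewrite iT iS]. Qed.

(** The map from the orbit of [xi] to that of [w] is contractive by domination; it is extended by 0
    to the orthogonal complement of the orbit. *)
Lemma dom_intertwiner N W (al : N -> W -> W) w : is_rep al -> dom al w ->
  exists (S : HH N -> W) (xi : HH N), [/\ hom (@am R N) al S, forall x, S (am x xi) = al x w & forall v, nm (S v) <= nm v].
Proof.
move=> ra [xi hxi]; have rm := @am_rep R N.
pose O := range (fun x : N => am x xi); pose P := proj O.
have Pam n v : P (am n v) = am n (P v).
  apply: proj_uniq.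
    move=> u hu; rewrite (rep_star _ _ _ rm).
    have hp : perp O (am (star n) u).
      by move=> _ [b _ <-]; rewrite -(rep_star _ _ _ rm) -(repM _ _ _ rm) hu //; exists (n ** b).
    exact: (proj_in O v) hp.
  move=> _ [b _ <-]; rewrite -(linB _ _ (rep_lin n rm)) -(rep_starl _ _ _ rm) -(repM _ _ _ rm).
  by rewrite (proj_perp O v) //; exists (star n ** b).
(* One total family indexed by a sum type: the orbit, and the components orthogonal to it. *)
pose f (p : N + HH N) := match p with inl x => am x xi | inr v => v - P v end.
pose g (p : N + HH N) : W := match p with inl x => al x w | inr v => 0 end.
have tf : total (range f).
  move=> v hv; have pv : perp O v by move=> _ [x _ <-]; apply: hv; exists (inl x).
  apply: hdot_eq0; have := hv (v - P v); rewrite /P (proj_perp0 pv) subr0; apply.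
  by exists (inr v) => //=; rewrite /P (proj_perp0 pv) subr0.
have dec (L : seq (C * (N + HH N))) : exists x v, [/\ lc f L = am x xi + v, perp O v & lc g L = al x w].
  elim: L => [|[c [x|u]] L [y [v [h1 h2 h3]]]].
  - exists 0, 0; rewrite /lc !big_nil (rep0 _ rm) (rep0 _ ra) addr0; split=> // s _; exact: hdot0r.
  - exists (c *: x + y), v; rewrite /lc !big_cons -/(lc f L) -/(lc g L) h1 h3; split=> //=.
      by rewrite (repL _ rm) addrA.
    by rewrite (repL _ ra).
  - exists y, (c *: (u - P u) + v); rewrite /lc !big_cons -/(lc f L) -/(lc g L) h1 h3; split=> //=.
    + by rewrite addrCA.
    + by move=> s Os; rewrite hdotDr hdotZr (proj_perp O u) // h2 // mulr0 addr0.
    + by rewrite scaler0 add0r.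
have [|S [lS bS Sf]] := @lift _ _ _ _ f g 1 tf.
  move=> L; have [x [v [-> pv ->]]] := dec L; rewrite mul1r; apply: le_trans (hxi x) _.
  rewrite -ler_sqr ?nnegrE ?nm_ge0 // nmsqD pv; last by exists x.
  by rewrite /= mulr0 addr0 lerDl sqr_ge0.
have bS' v : nm (S v) <= nm v by rewrite -[leRHS]mul1r.
have bbS : bop S by split=> //; exists 1.
exists S, xi; split=> // [|x]; last exact: (Sf (inl x)).
split=> // x; apply: (bop_ext (bop_comp bbS (rep_bop x rm)) (bop_comp (rep_bop x ra) bbS) tf) => _ [[y|u] _ <-] /=.
  by rewrite -(repM _ _ _ rm) (Sf (inl _)) (Sf (inl _)) /= (repM _ _ _ ra).
rewrite (linB _ _ (rep_lin x rm)) -Pam.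
by rewrite (Sf (inr (am x u))) (Sf (inr u)) /= (lin0 (rep_lin x ra)).
Qed.

Lemma BH_id_rep H : is_faithful_rep (fun (f : BH H) v => (f : bopT H) v).
Proof.
split; last by move=> f g h; apply: bopT_ext => v; exact: (congr1 (fun F => F v) h).
apply: is_repP => //.
- by move=> a; exact: bopP.
- by move=> a v w; rewrite -bstarPr.
Qed.

(* The square root of [S* S] turns domination into equality. *)
Lemma dom_exact N W (al : N -> W -> W) w : is_rep al -> dom al w ->
  exists xi : HH N, forall x, nm (al x w) = nm (am x xi).
Proof.
move=> ra dw; have rm := @am_rep R N.
have [S [xi [hS Sx _]]] := dom_intertwiner ra dw; have [bS iS] := hS.
have hS' := hom_adj rm ra hS; have [bS' iS'] := hS'.
pose k : BH (HH N) := mkb (bop_comp bS' bS).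
have kE u : (k : bopT _) u = adj S (S u) by [].
have [|| h [hs hE hc]] := @pos_sqrt R (BH (HH N)) (HH N) _ k (BH_id_rep _).
- apply: bopT_ext => v; apply: hdot_extr => u.
  have -> : hdot u ((star k : BH (HH N)) v) = hdot ((k : bopT _) u) v by rewrite bstarP.
  by rewrite !kE -!adjPr // adjP // -adjPr.
- by move=> v; rewrite kE -adjPr // Re_hdotxx sqr_ge0.
have hh u : hdot ((h : bopT _) u) ((h : bopT _) u) = hdot (S u) (S u).
  rewrite bstarP.
  rewrite (hs : bstar h = h) (_ : (h : bopT _) ((h : bopT _) u) = (h ** h : BH _) u) //.
  by rewrite -hE kE adjP.
have ham x v : am x ((h : bopT _) v) = (h : bopT _) (am x v).
  have := hc (mkb (rep_bop x rm)) _; move=> /(_ _)/(congr1 (fun f : BH _ => (f : bopT _) v)); apply.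
  by apply: bopT_ext => u /=; rewrite iS iS'.
exists ((h : bopT _) xi) => x; rewrite ham.
by apply/eqP; rewrite -(@eqrXn2 _ 2) ?nm_ge0 // -!Re_hdotxx hh Sx.
Qed.

Lemma domD N W (al : N -> W -> W) v w : is_rep al -> dom al v -> dom al w -> dom al (v + w).
Proof.
move=> ra [xi hx] [et he]; have [ze hz] := amp_list [:: xi; et].
exists (2%:C *: ze) => x; have rm := @am_rep R N.
rewrite (linD _ _ (rep_lin x ra)) (linZ _ _ (rep_lin x rm)) nmZ nmR0 //.
apply: le_trans (nmD _ _) _; have := hz x; rewrite big_cons big_seq1.
have le1 (a b c : R) : 0 <= a -> 0 <= b -> 0 <= c -> a ^+ 2 + b ^+ 2 <= c ^+ 2 -> a + b <= 2 * c.
  move=> a0 b0 c0 h; have : a <= c by rewrite -ler_sqr ?nnegrE //; have := sqr_ge0 b; lra.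
  have : b <= c by rewrite -ler_sqr ?nnegrE //; have := sqr_ge0 a; lra.
  lra.
by have := hx x; have := he x; move=> h1 h2 h3; apply: le_trans (lerD h2 h1) _; apply: le1; rewrite ?nm_ge0.
Qed.

Lemma domZ N W (al : N -> W -> W) c w : is_rep al -> dom al w -> dom al (c *: w).
Proof.
move=> ra [xi hx]; exists (c *: xi) => x.
by rewrite (linZ _ _ (rep_lin x ra)) (linZ _ _ (rep_lin x (@am_rep R N))) !nmZ ler_wpM2l ?nm_ge0.
Qed.

Lemma dom0 N W (al : N -> W -> W) : is_rep al -> dom al 0.
Proof. by move=> ra; exists 0 => x; rewrite (lin0 (rep_lin x ra)) nm0 nm_ge0. Qed.

(** [w] is the sum of dominated vectors [u k] that decrease geometrically. The vectors that dominate
    the multiples of [u k] by [2 ^ k] are square summable and combine into one, so the norms of the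
    terms [al x (u k)] are summable with ratio 1/2. *)
Lemma dom_lim N W (al : N -> W -> W) w : is_rep al ->
  (forall e : R, 0 < e -> exists2 v, dom al v & nm (w - v) < e) -> dom al w.
Proof.
move=> ra hw; have rm := @am_rep R N.
(* The weights [2 ^ k] turn the ratio 1/8 into 1/4, which is still square summable. *)
pose t : R := 8^-1.
have /choice[v hv0] : forall k : nat, exists v, dom al v /\ nm (w - v) < Num.min (t ^+ k) (iv R k).
  move=> k; have [|v dv nv] := hw (Num.min (t ^+ k) (iv R k)); last by exists v.
  by rewrite lt_min iv_gt0 exprn_gt0 ?invr_gt0.
have hv k : dom al (v k) /\ nm (w - v k) < t ^+ k.
  by have [h1 h2] := hv0 k; split=> //; move: h2; rewrite lt_min => /andP[].
have vw : nlim v w.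
  move=> e /inv_small[n0 hn]; exists n0 => n /hn h; have [_] := hv0 n.
  by rewrite lt_min nmBC => /andP[_ h2]; exact: lt_trans h2 h.
pose u k := if k is k'.+1 then v k - v k' else v 0.
have ud k : dom al (u k).
  by case: k => [|k]; [case: (hv 0)|rewrite /u -scaleN1r; apply: domD => //; [case: (hv k.+1)|apply: domZ => //; case: (hv k)]].
have nu k : nm (u k.+1) <= 2 * t ^+ k.
  have := nm_tri w (v k.+1) (v k); rewrite (nmBC (v k.+1) w).
  have := (hv k.+1).2; have := (hv k).2; rewrite exprS; have : 0 <= t ^+ k by rewrite exprn_ge0 ?invr_ge0.
  by rewrite /u /t; lra.
(* Equality at [x = cone] bounds the norm of [xi k]; a vector that merely dominates could be
   long. *)
have /choice[xi hxi] : forall k, exists xi : HH N, forall x, nm (al x ((2 ^+ k)%:C *: u k)) = nm (am x xi).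
  by move=> k; apply: dom_exact => //; exact: domZ.
have nxi k : nm (xi k.+1) <= 4 * (4^-1) ^+ k.
  rewrite -(am1 (xi _)) -hxi; apply: le_trans (rep_nm1 _ ra) _; rewrite nmZ nmR0 ?exprn_ge0 //.
  apply: le_trans (ler_wpM2l _ (nu k)) _; first exact: exprn_ge0.
  rewrite (_ : 2 ^+ k.+1 * (2 * t ^+ k) = 4 * (2 * t) ^+ k); last by rewrite exprMn exprS; ring.
  by rewrite /t (_ : 2 * 8^-1 = 4^-1 :> R) //; field.
(* The squares are at most 16 times [4^-1 ^ n], and three quarters of 22 exceed 16. *)
pose M := nm (xi 0) ^+ 2 + 22.
have q0 n : 0 <= 4^-1 ^+ n :> R by rewrite exprn_ge0 // invr_ge0.
have q1 n : 4^-1 ^+ n <= 1 :> R by rewrite exprn_ile1 ?invr_ge0 //; lra.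
have [|eta heta] := @amp_combine R N xi M.
  have h n : \sum_(i < n.+1) nm (xi i) ^+ 2 <= M - 22 * (4^-1) ^+ n.
    elim: n => [|n IH]; first by rewrite big_ord1 expr0 /M; lra.
    rewrite big_ord_recr /=; have : nm (xi n.+1) ^+ 2 <= 16 * 4^-1 ^+ n.
      have := nxi n; have := nm_ge0 (xi n.+1); have := q0 n; have := q1 n.
      move: (nm _) (4^-1 ^+ n) => a q h1 h2 h3 h4; apply: le_trans (_ : (4 * q) ^+ 2 <= _).
        by rewrite ler_sqr ?nnegrE ?mulr_ge0.
      rewrite exprMn; have : q ^+ 2 <= q by rewrite expr2 -[leRHS]mulr1 ler_wpM2l.
      by rewrite (_ : 4 ^+ 2 = 16); [lra|ring].
    by rewrite (exprS 4^-1 n); have := q0 n; lra.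
  case=> [|n]; first by rewrite big_ord0 addr_ge0 ?sqr_ge0.
  by apply: le_trans (h n) _; have := q0 n; lra.
exists (2%:C *: eta) => x; rewrite (linZ _ _ (rep_lin x rm)) nmZ nmR0 //.
set B := nm (am x eta); have B0 : 0 <= B by exact: nm_ge0.
have hk k : nm (al x (u k)) <= B * 2^-1 ^+ k.
  have : nm (am x (xi k)) <= B.
    rewrite -ler_sqr ?nnegrE ?nm_ge0 //; apply: le_trans (heta x k.+1).
    by rewrite big_ord_recr /= lerDr sumr_ge0 // => i _; exact: sqr_ge0.
  rewrite -hxi (linZ _ _ (rep_lin x ra)) nmZ nmR0 ?exprn_ge0 // => h.
  by rewrite exprVn ler_pdivlMr ?exprn_gt0 // mulrC.
have vn n : nm (al x (v n)) <= B * (2 - 2^-1 ^+ n).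
  elim: n => [|n IH]; first by have := hk 0; rewrite expr0; lra.
  have -> : v n.+1 = v n + u n.+1 by rewrite /u addrC subrK.
  rewrite (linD _ _ (rep_lin x ra)); apply: le_trans (nmD _ _) _.
  by have := hk n.+1; rewrite exprS; have := lerD IH (lexx (nm (al x (u n.+1)))); lra.
have [k _ kb] := bop_ge0 (rep_bop x ra).
have lx : nlim (fun n => al x (v n)) (al x w).
  by apply: (@nlim_map _ _ _ (al x) k) vw => a b; rewrite -(linB _ _ (rep_lin _ ra)).
apply: nlim_le lx _ => n; apply: le_trans (vn n) _.
have : 0 <= 2^-1 ^+ n :> R by rewrite exprn_ge0 // invr_ge0.
by nra.
Qed.

Lemma dom_total N W (al : N -> W -> W) (S : set W) : is_rep al -> total S ->
  (forall s, S s -> dom al s) -> forall w, dom al w.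
Proof.
move=> ra tS hS w; apply: dom_lim => // e e0.
have [v Sv hv] := span_approx (total_cspan _ w tS) e0; exists v => //.
elim: Sv => [|c s u Ss _ IH]; first exact: dom0.
by apply: domD => //; apply: domZ => //; exact: hS.
Qed.

Lemma dom_range N W (al : N -> W -> W) w : is_rep al -> dom al w -> al cone w = w ->
  exists S xi, hom (@am R N) al S /\ S xi = w.
Proof.
move=> ra dw w1; have [S [xi [hS Sx _]]] := dom_intertwiner ra dw.
by exists S, xi; split=> //; rewrite -[xi]am1 Sx.
Qed.

(** The adjoint of an intertwiner with [w] in its range cannot kill [w] unless [w = 0]. *)
Lemma hom_separate N W (al : N -> W -> W) w : is_rep al -> dom al w -> al cone w = w ->
  (forall T, hom al (@am R N) T -> T w = 0) -> w = 0.
Proof.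
move=> ra dw w1 h; have [S [xi [hS Sx]]] := dom_range ra dw w1.
apply: hdot_eq0; rewrite -{2}Sx adjPr ?hS.1 //; last by case: hS.
by rewrite h ?hdot0l //; exact: hom_adj (@am_rep R N) ra hS.
Qed.

(** Commutation with the matrix units makes [y] diagonal with equal entries; commutation with the
    commutant of [N] in one corner places this entry in the bicommutant. *)
Lemma amp_bicommutant N (y : HH N -> HH N) : bop y ->
  (forall U, hom (@am R N) (@am R N) U -> forall v, y (U v) = U (y v)) ->
  exists m : N, forall v, y v = am m v.
Proof.
move=> by_ cy; have rm := @am_rep R N; have rN := @vn_rep_rep R N.
pose U (T : vn_space N -> vn_space N) k l (v : HH N) := aj k (T (adj (@aj R N l) v)).
have hU T k l : bop T -> (forall x h, T (vn_rep x h) = vn_rep x (T h)) -> hom (@am R N) (@am R N) (U T k l).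
  move=> bT cT; split; last by move=> x v; rewrite /U aj_adj_am cT am_aj.
  by apply: (bop_comp (f := @aj R N k) (g := fun v => T (adj (@aj R N l) v))); [exact: aj_bop|
     apply: bop_comp bT (bop_adj (@aj_bop R N l))].
have bid : bop (@id (vn_space N)) by exact: bop_id.
pose z0 h := adj (@aj R N 0) (y (aj 0 h)).
have yj k h : y (aj k h) = aj k (z0 h).
  have e : aj k h = U id k 0 (aj 0 h) by rewrite /U aj_adj eqxx.
  by rewrite e cy //; exact: hU.
have bz : bop z0 by apply: bop_comp (bop_adj (@aj_bop R N 0)) (bop_comp by_ (@aj_bop R N 0)).
have [m _ hm] : range (@vn_rep R N) z0.
  rewrite -vn_bicommutant; split; first by split; [exact: bz.1|apply/bop_continuous; [exact: bz.1|exact: bz.2]].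
  move=> T [[lT cT] TN]; apply/funext => h /=.
  have bT : bop T by split=> //; apply/bop_continuous.
  have cT' x u : T (vn_rep x u) = vn_rep x (T u).
    by have /(congr1 (fun f => f u)) := TN (vn_rep x) (ex_intro2 _ _ x I erefl).
  have e : aj 0 (T h) = U T 0 0 (aj 0 h) by rewrite /U aj_adj eqxx.
  by rewrite /z0 e cy; [rewrite {1}/U aj_adj eqxx|exact: hU].
exists m => v; apply: (bop_ext by_ (rep_bop m rm) (@aj_total R N)) => _ [[k h] _ <-] /=.
by rewrite yj am_aj hm.
Qed.

Lemma proj_hom (A : cstarType R) H (be : A -> H -> H) (S : set H) : is_rep be ->
  (forall a s, S s -> cspan S (be a s)) -> forall a v, proj S (be a v) = be a (proj S v).
Proof.
move=> rb hS a v.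
have inv b u : cspan S u -> cspan S (be b u).
  move=> hu w hw; rewrite (rep_star _ _ _ rb); apply: hu => s Ss.
  by rewrite -(rep_star _ _ _ rb); apply: (hS b s Ss).
apply: proj_uniq; first by apply: inv; exact: proj_in.
move=> s Ss; rewrite -(linB _ _ (rep_lin a rb)) -(rep_starl _ _ _ rb).
by apply: (hS _ s Ss); exact: proj_perp.
Qed.

(** The projection onto the closed span of these images commutes with the commutant of the
    amplification, so it is some [am z]. By [hom_separate], [z] acts as the identity on [W], and
    faithfulness gives [z = cone]. *)
Lemma hom_dense N W (al : N -> W -> W) : is_rep al -> injective al -> (forall w, al cone w = w) ->
  (forall w, dom al w) ->
  total [set v : HH N | exists T w, hom al (@am R N) T /\ v = T w].
Proof.
move=> ra ia a1 da; have rm := @am_rep R N; set S := [set v | _].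
pose q := proj S.
have bq : bop q by split; [exact: proj_lin|exists 1 => v; rewrite mul1r; exact: proj_nm].
have qU U : hom (@am R N) (@am R N) U -> forall v, q (U v) = U (q v).
  move=> hU; have inv V u : hom (@am R N) (@am R N) V -> cspan S u -> cspan S (V u).
    move=> hV hu w hw; rewrite adjP; last by case: hV.
    apply: hu => _ [T [d [hT ->]]]; rewrite -adjP; last by case: hV.
    by apply: hw; exists (V \o T), d; split=> //; exact: hom_comp hT.
  move=> v; apply: proj_uniq; first by apply: inv => //; exact: proj_in.
  move=> s Ss; have [bU _] := hU; rewrite -(linB _ _ bU.1) adjPr //.
  suff : cspan S (adj U s) by apply; exact: proj_perp.
  by apply: inv; [exact: hom_adj|exact: cspan_in].
have [z hz] := amp_bicommutant bq qU.
have z1 : z = cone.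
  apply: ia; apply/funext => w; rewrite a1.
  apply/esym/eqP; rewrite -subr_eq0 -{1}(a1 w) -(repB _ _ _ ra); apply/eqP.
  apply: (hom_separate ra (da _) (a1 _)) => T hT; have [_ iT] := hT.
  rewrite iT (repB _ _ _ rm) am1 -hz /q proj_id ?subrr //.
  by apply: cspan_in; exists T, w.
move=> w hw; rewrite -(am1 w) -z1 -hz /q; exact: proj_perp0.
Qed.

(** The bicommutant theorem in an arbitrary faithful normal module: [y] is transported to the
    amplification by [Y (T d) = T (y d)], is bounded there by [power_trick], and commutes with the
    commutant. *)
Lemma normal_bicommutant N W (al : N -> W -> W) (y : W -> W) : is_rep al -> injective al ->
  (forall w, al cone w = w) -> (forall w, dom al w) -> bop y ->
  (forall U, hom al al U -> forall v, y (U v) = U (y v)) ->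
  exists m : N, forall v, y v = al m v.
Proof.
move=> ra ia a1 da bY cy; have rm := @am_rep R N; have tS := hom_dense ra ia a1 da.
pose X := ({T : W -> HH N | hom al (@am R N) T} * W)%type.
pose f (p : X) := sval p.1 p.2; pose g (p : X) := sval p.1 (y p.2).
have bYs := bop_adj bY.
pose s (p : X) : X := (p.1, adj y (y p.2)).
have tf : total (range f).
  by move=> w hw; apply: tS => _ [T [d [hT ->]]]; apply: hw; exists (exist _ T hT, d).
have [r0 r0p hr0] := bop_ge0 (bop_comp bYs bY).
have pt L : nm (lc g L) ^+ 2 <= r0 * nm (lc f L) ^+ 2.
  apply: (power_trick (s := s) (ltW r0p)) => [[[T hT] d] [[T' hT'] d']|[[T hT] d]].
    rewrite /f /g /s /=; have [bT _] := hT; have [bT' _] := hT'.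
    have hE : hom al al (adj T \o T') by exact: hom_comp (hom_adj ra rm hT) hT'.
    by rewrite [RHS]adjP // -(adjPr _ _ bY) (cy _ hE) /= -adjP.
  have [k k0 hk] := bop_ge0 hT.1; exists (k * nm d) => n.
  rewrite /f; have -> : iter n s (exist _ T hT, d) = (exist _ T hT, iter n (adj y \o y) d) by elim: n => //= n ->.
  apply: le_trans (hk _) _; rewrite -mulrA ler_wpM2l ?(ltW k0) // mulrC.
  elim: n => [|n IH]; first by rewrite expr0 mul1r.
  by rewrite iterS exprS -mulrA; apply: le_trans (hr0 _) _; rewrite ler_wpM2l ?(ltW r0p).
have [|Y [lY bYY Yf]] := @lift _ _ _ _ f g (Num.sqrt r0) tf.
  move=> L; rewrite -ler_sqr ?nnegrE ?mulr_ge0 ?sqrtr_ge0 ?nm_ge0 // exprMn sqr_sqrtr ?(ltW r0p) //.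
have hY T d : hom al (@am R N) T -> Y (T d) = T (y d) by move=> hT; exact: (Yf (exist _ T hT, d)).
have bbY : bop Y by split=> //; exists (Num.sqrt r0).
have [|m hm] := @amp_bicommutant N Y bbY.
  move=> U hU; have [bU _] := hU.
  apply: (bop_ext (bop_comp bbY bU) (bop_comp bU bbY) tS) => _ [T [d [hT ->]]] /=.
  by rewrite (hY _ _ hT) (hY (U \o T)) //; exact: hom_comp hT.
exists m => v; apply/eqP; rewrite -subr_eq0; apply/eqP.
apply: (hom_separate ra (da _) (a1 _)) => T hT; have [bT iT] := hT.
by rewrite (linB _ _ bT.1) -hY // iT hm subrr.
Qed.

End Dominated.

Section CondDom.
Variable R : realType.
Local Notation C := R[i].
Implicit Types (H K W Z : hilbertType R) (N P : vonNeumann R).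

(** Normality of [Eh] at [z], in the form that makes [1 (x) z] a dominated vector of the induced
    module. *)
Definition dom_ce N Z (Eh : N -> Z -> Z) (z : Z) : Prop :=
  exists xi : HH N, forall x, complex.Re (hdot (Eh (star x ** x) z) z) <= nm (am x xi) ^+ 2.

Lemma ind_linr (O : Type) (A : cstarType R) Z (Eh : O -> A -> Z -> Z) (m : indmod Eh) o x :
  (forall o, cpmap (Eh o)) -> linear (im_br m o x).
Proof.
move=> cp c y z; apply: (total_ext (im_total m)) => -[[o' x'] z'] /=.
rewrite hdotDl hdotZl; have [<-|ne] := pselect (o = o'); last by rewrite !im_dot0 // mulr0 addr0.
by have [_ lx _] := cp o; rewrite !im_dot (lx _) hdotDl hdotZl.
Qed.

Lemma ind_linm (O : Type) (A : cstarType R) Z (Eh : O -> A -> Z -> Z) (m : indmod Eh) o z :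
  (forall o, cpmap (Eh o)) -> linear (fun x => im_br m o x z).
Proof.
move=> cp c y x; apply: (total_ext (im_total m)) => -[[o' x'] z'] /=.
rewrite hdotDl hdotZl; have [<-|ne] := pselect (o = o'); last by rewrite !im_dot0 // mulr0 addr0.
by have [lx _ _] := cp o; rewrite !im_dot cmulDr cmulZr (lx _) hdotDl hdotZl.
Qed.

(** In the module induced along [E] from the amplification of [P], the condition at [u] says that
    [1 (x) u] is dominated, and dominated vectors form a closed subspace. *)
Lemma ce_dom_total P N (iota : P -> N) (E : N -> P) (S : set (HH P)) :
  star_hom iota -> iota cone = cone -> conditional_expectation iota E -> total S ->
  (forall z, S z -> dom_ce (fun x => am (E x)) z) -> forall z, dom_ce (fun x => am (E x)) z.
Proof.
move=> si i1 ce tS hS z; have rP := @am_rep R P.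
have cp (o : unit) := ce_cpmap si ce rP; have [m] := indmod_ex cp.
pose b := im_br m tt cone; have lb : linear b by exact: ind_linr.
have nb x u : nm (im_al m x (b u)) ^+ 2 = complex.Re (hdot (am (E (star x ** x)) u) u).
  by rewrite -Re_hdotxx /b im_alE im_dot cmulr1.
have nb1 u : nm (b u) = nm u.
  apply/eqP; rewrite -(@eqrXn2 _ 2) ?nm_ge0 // -!Re_hdotxx /b im_dot star1 cmulr1.
  by rewrite (ce_one ce i1) am1.
have dE u : dom_ce (fun x => am (E x)) u <-> dom (im_al m) (b u).
  split=> -[xi h]; exists xi => x.
    by rewrite -ler_sqr ?nnegrE ?nm_ge0 // nb.
  by rewrite -nb ler_sqr ?nnegrE ?nm_ge0.
apply/dE; apply: dom_lim; first exact: im_rep.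
move=> e e0; have [u Su hu] := span_approx (total_cspan _ z tS) e0.
exists (b u); last by rewrite -(linB _ _ lb) nb1.
elim: Su => [|c s v Ss _ IH]; first by rewrite (lin0 lb); apply: dom0; exact: im_rep.
rewrite lb; apply: domD IH; first exact: im_rep.
by apply: domZ; [exact: im_rep|apply/dE; exact: hS].
Qed.

Lemma ce_dom_ind P N (iota : P -> N) (E : N -> P) Z (be : P -> Z -> Z) z :
  conditional_expectation iota E -> (forall u, dom_ce (fun x => am (E x)) u) -> is_rep be ->
  dom be z -> dom_ce (fun x => be (E x)) z.
Proof.
move=> [_ _ _ pE] hE rb [ze hz]; have [xi hx] := hE ze; exists xi => x.
apply: le_trans (hx x); have [q ->] := pE x.
rewrite (repM _ _ _ rb) (rep_starl _ _ _ rb) Re_hdotxx (repM _ _ _ (@am_rep R P)).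
by rewrite (rep_starl _ _ _ (@am_rep R P)) Re_hdotxx ler_sqr ?nnegrE ?nm_ge0.
Qed.

Lemma indmod_dom (O : Type) N Z (Eh : O -> N -> Z -> Z) (m : indmod Eh) :
  (forall o z, dom_ce (Eh o) z) -> forall w, dom (im_al m) w.
Proof.
move=> h; apply: (dom_total (im_rep m) (im_total m)) => _ [[[o u] z] _ <-] /=.
have [xi hx] := h o z; exists (am u xi) => x.
rewrite -ler_sqr ?nnegrE ?nm_ge0 // -Re_hdotxx im_alE im_dot -(repM _ _ _ (@am_rep R N)); exact: hx.
Qed.

End CondDom.

(** The index [fp_i0] allows statements on [B] to be read off from one of the [M i]. *)
Record fpdata (R : realType) (I : Type) : Type := FPData {
  fp_i0 : I;
  fpB : vonNeumann R; fpM : I -> vonNeumann R; fpN : vonNeumann R;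
  fp_io : forall i, fpB -> fpM i; fpE : forall i, fpM i -> fpB;
  fp_iN : fpB -> fpN; fp_lam : forall i, fpM i -> fpN; fpEN : fpN -> fpB;
  fp_io_emb : forall i, vn_embedding (fp_io i);
  fp_lam_emb : forall i, vn_embedding (@fp_lam i);
  fp_lam_io : forall i b, fp_lam (fp_io i b) = fp_iN b;
  fpE_ce : forall i, conditional_expectation (fp_io i) (@fpE i);
  fpEN_ce : faithful_normal_cond_exp fp_iN fpEN;
  fp_gen : range (@vn_rep R fpN) = bicommutant (\bigcup_i range (fun x => vn_rep (@fp_lam i x)));
  fpEN_lam : forall i x, fpEN (@fp_lam i x) = fpE x;
  fp_free : forall (n : nat) (w : 'I_n -> I) (x : forall k, fpM (w k)), (0 < n)%N ->
    (forall k l : 'I_n, l = k.+1 :> nat -> w k <> w l) ->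
    (forall k, fpE (x k) = 0) ->
    fpEN (\big[cmul/cone]_(k < n) fp_lam (x k)) = 0 }.

(** * Reduced words and Toeplitz modules *)

Section Words.
Variables (R : realType) (I : Type) (F : fpdata R I).
Local Notation C := R[i].
Local Notation B := (fpB F).
Local Notation M := (fpM F).
Local Notation N := (fpN F).
Local Notation iN := (@fp_iN R I F).
Local Notation lam := (@fp_lam R I F).
Local Notation E := (@fpE R I F).
Local Notation EN := (@fpEN R I F).
Implicit Types (H K W Z : hilbertType R).

Definition letter := {i : I & M i}.
Implicit Types (w u : seq letter) (o : option I).
Definition lv (l : letter) : N := lam (tagged l).
Definition wv w : N := foldr (fun l n => lv l ** n) cone w.

(* Words are considered relative to [o]: for [o = Some l] they are followed by a phantom letter of index [l]. *)
Definition hd_ne o (j : I) w : Prop := if w is l :: _ then tag l <> j else o <> Some j.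
Fixpoint red o w : Prop :=
  if w is l :: w' then [/\ E (tagged l) = 0, hd_ne o (tag l) w' & red o w'] else True.

Lemma lam_hom i : star_hom (@fp_lam R I F i). Proof. by case: (fp_lam_emb F i). Qed.
Lemma lam1 i : lam (cone : M i) = cone. Proof. by case: (fp_lam_emb F i). Qed.
Lemma io_hom i : star_hom (@fp_io R I F i). Proof. by case: (fp_io_emb F i). Qed.
Lemma io1 i : fp_io i (cone : B) = cone. Proof. by case: (fp_io_emb F i). Qed.
Lemma lamM i (x y : M i) : lam (x ** y) = lam x ** lam y. Proof. by case: (lam_hom i). Qed.
Lemma lamS i (x : M i) : lam (star x) = star (lam x). Proof. by case: (lam_hom i). Qed.
Lemma lam_lin i : linear (@fp_lam R I F i). Proof. by case: (lam_hom i). Qed.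

Lemma iN_hom : star_hom iN.
Proof.
have [l1 m1 s1] := lam_hom (fp_i0 F); have [l2 m2 s2] := io_hom (fp_i0 F).
split; [move=> c a b|move=> a b|move=> a]; rewrite -!(@fp_lam_io R I F (fp_i0 F)).
- by rewrite l2 l1.
- by rewrite m2 m1.
- by rewrite s2 s1.
Qed.
Lemma iN1 : iN cone = cone. Proof. by rewrite -(@fp_lam_io R I F (fp_i0 F)) io1 lam1. Qed.

Lemma E_lin i : linear (@fpE R I F i). Proof. by case: (fpE_ce F i). Qed.
Lemma EioE i b : E (fp_io i b) = b. Proof. by case: (fpE_ce F i). Qed.
Lemma Ebim i b b' (x : M i) : E (fp_io i b ** x ** fp_io i b') = b ** E x ** b'. Proof. by case: (fpE_ce F i). Qed.
Lemma E_star i (x : M i) : E (star x) = star (E x). Proof. exact: ce_star (fpE_ce F i). Qed.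
Lemma El_bim i b (x : M i) : E (fp_io i b ** x) = b ** E x.
Proof. by rewrite -[in RHS](cmulr1 (b ** _)) -Ebim io1 cmulr1. Qed.

Definition ctr i (x : M i) : M i := x - fp_io i (E x).
Lemma ctr0 i (x : M i) : E (ctr x) = 0.
Proof. by rewrite /ctr (linB _ _ (@E_lin i)) EioE subrr. Qed.
Lemma ctrE i (x : M i) : x = ctr x + fp_io i (E x). Proof. by rewrite /ctr subrK. Qed.
Lemma lam_ctr i (x : M i) : lam x = lam (ctr x) + iN (E x).
Proof. by rewrite {1}(ctrE x) (linD _ _ (@lam_lin i)) fp_lam_io. Qed.

Lemma word_free w : w <> [::] -> red None w -> EN (wv w) = 0.
Proof.
move=> w0 rw; have -> : wv w = \big[cmul/cone]_(k < size w) lam (tagged (tnth (in_tuple w) k)).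
  by rewrite -(big_tnth cone cmul w xpredT (fun l => lam (tagged l))) /wv unlock /reducebig.
apply: (@fp_free R I F (size w) (fun k => tag (tnth (in_tuple w) k)) (fun k => tagged (tnth (in_tuple w) k))).
- by case: (w) w0.
- move=> k l e; have [l0 _] : exists l0 : letter, True by exists (tnth (in_tuple w) k).
  rewrite !(tnth_nth l0) /= e; have := ltn_ord l; rewrite e; move: (nat_of_ord k) => {k l e} k.
  elim: w k rw {w0} => //= a w IH [|k] [_ h rw]; last by rewrite ltnS => hk; exact: IH.
  by case: w h {IH rw} => //= b w h _ e; apply: h.
- move=> k; have [l0 _] : exists l0 : letter, True by exists (tnth (in_tuple w) k).
  rewrite (tnth_nth l0) /=; have := ltn_ord k; move: (nat_of_ord k) => {}k.
  elim: w k rw {w0} => //= a w IH [|k] [e h rw] //=; rewrite ltnS => hk; exact: IH.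
Qed.

Definition first_ok o w : Prop := if w is l :: _ then o <> Some (tag l) else True.

(** What an induced module needs for its words to be sorted by their first letter: for [o = Some l],
    the map kills the nonempty reduced words that neither begin nor end in [M l]. *)
Record freemap Z (tB : B -> Z -> Z) (Eh : option I -> N -> Z -> Z) : Prop := FreeMap {
  fm_cp : forall o, cpmap (Eh o);
  fm_B : forall o x b z, Eh o (x ** iN b) z = Eh o x (tB b z);
  fm_free : forall o w z, w <> [::] -> red o w -> first_ok o w -> Eh o (wv w) z = 0 }.

Section EE.
Variables (Z : hilbertType R) (tB : B -> Z -> Z) (Eh : option I -> N -> Z -> Z).
Hypothesis fm : freemap tB Eh.
Variable m : indmod Eh.
Local Notation br := (im_br m).
Local Notation al := (im_al m).

(** Words that do not begin in [M j]. The phantom letter counts: [1 (x) z] in the summand [Some j]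
    is excluded. *)
Definition EEgen (j : I) : set (im_W m) :=
  [set v | exists o w z, [/\ red o w, hd_ne o j w & v = br o (wv w) z]].
Definition EE (j : I) : set (im_W m) := cspan (EEgen j).

Lemma star_lv (l : letter) : star (lv l) = lv (Tagged M (star (tagged l))).
Proof. by rewrite /lv lamS. Qed.

(** No cancellation occurs where the two words meet, as [w'] does not begin in the algebra of [l];
    the letters of [w'] are moved over one at a time. *)
Lemma red_star o w' (l : letter) w z : red o w' -> hd_ne o (tag l) w' -> red o (l :: w) ->
  Eh o (star (wv w') ** wv (l :: w)) z = 0.
Proof.
elim: w' l w => [|a w' IH] l w.
  by move=> _ h r; rewrite star1 cmul1r; apply: (fm_free fm).
move=> [Ea ha ra] /= hl r; rewrite starM star_lv -cmulA.
apply: (IH (Tagged M (star (tagged a))) (l :: w) ra) => //.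
by split=> //=; [rewrite E_star Ea star0|move=> e; apply: hl].
Qed.

(** A word that begins with a centred letter of [M j] is orthogonal to the words that do not begin
    in [M j]. Through [EE_E] this becomes the Toeplitz relation for the projection onto [EE j]. *)
Lemma EE_perp j (n : M j) v v' : E n = 0 -> EE j v -> EE j v' -> hdot (al (lam n) v) v' = 0.
Proof.
move=> En hv hv'; have ra := im_rep m; rewrite (rep_star _ _ _ ra) hdotC.
suff h : forall s, EEgen j s -> hdot (al (lam n) s) v' = 0.
  rewrite -hdotC; apply: hv => s Ss; rewrite -(rep_star _ _ _ ra); exact: h.
move=> s [o [w [z [rw hw ->]]]]; rewrite hdotC.
suff h : hdot v' (al (lam n) (br o (wv w) z)) = 0 by rewrite h conjC0.
apply: hv' => _ [o' [w' [z' [rw' hw' ->]]]]; rewrite im_alE.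
have [e|ne] := pselect (o = o'); last by rewrite im_dot0 // => e; apply: ne.
rewrite hdotC e im_dot (_ : lam n ** wv w = wv (Tagged M n :: w)) // (@red_star o' w' (Tagged M n) w) ?hdot0l ?conjC0 //.
by rewrite -e.
Qed.

Lemma EE_lam i j (n : M i) v : E n = 0 -> i <> j -> EE i v -> EE j (al (lam n) v).
Proof.
move=> En ij hv u hu; have ra := im_rep m; rewrite (rep_star _ _ _ ra).
apply: hv => s [o [w [z [rw hw ->]]]]; rewrite -(rep_star _ _ _ ra) im_alE.
by apply: hu; exists o, (Tagged M n :: w), z.
Qed.

Lemma EE_B j b v : EE j v -> EE j (al (iN b) v).
Proof.
move=> hv u hu; have ra := im_rep m; rewrite (rep_star _ _ _ ra).
apply: hv => s [o [w [z [rw hw ->]]]]; rewrite -(rep_star _ _ _ ra) im_alE.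
apply: hu; case: w rw hw => [_ h|l w [El hl rw] h].
  exists o, [::], (tB b z); split=> //=; apply: (total_ext (im_total m)) => -[[o' x'] z'] /=.
  have [<-|ne] := pselect (o = o'); last by rewrite !im_dot0.
  by rewrite !im_dot !cmulr1 (fm_B fm).
exists o, (Tagged M (fp_io (tag l) b ** tagged l) :: w), z; split=> //=.
  by split=> //=; rewrite El_bim El cmul0r.
by rewrite /lv lamM fp_lam_io cmulA.
Qed.

Lemma EE_E j (x : M j) v v' : EE j v -> EE j v' -> hdot (al (lam x) v) v' = hdot (al (iN (E x)) v) v'.
Proof.
move=> hv hv'; rewrite lam_ctr (repD _ _ _ (im_rep m)) hdotDl (EE_perp _ hv hv') ?add0r //.
exact: ctr0.
Qed.

Lemma EE_1 o j z : o <> Some j -> EE j (br o cone z).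
Proof. by move=> ne; apply: cspan_in; exists o, [::], z. Qed.

Lemma EE_1perp j z v : EE j v -> hdot v (br (Some j) cone z) = 0.
Proof.
apply=> s [o [w [z' [rw hw ->]]]]; have [e|ne] := pselect (o = Some j); last by rewrite im_dot0.
rewrite e in rw hw *; rewrite im_dot star1 cmul1r.
have w0 : w <> [::] by case: w rw hw => [_ /(_ erefl)|].
have fo : first_ok (Some j) w by case: w hw {rw w0} => //= l w ne -[] e'; apply: ne.
by rewrite (fm_free fm z' w0 rw fo) hdot0l.
Qed.

End EE.

Definition rwords : set N := [set n | exists w b, red None w /\ n = wv w ** iN b].

(** The new letter is merged with a first letter of the same index, if there is one, and centred;
    the part in [B] is absorbed by the next letter. This stability is what [strong_density]
    requires. *)
Lemma rwords_left i (n : M i) a : span rwords a -> span rwords (lam n ** a).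
Proof.
elim=> [|c s v [w [b [rw ->]]] _ IH]; first by rewrite cmul0r; exact: span0.
rewrite cmulDr cmulZr; apply: span_add IH; apply: span_scale; rewrite cmulA.
have bw b' w' : red None w' -> rwords (iN b' ** wv w' ** iN b).
  have [_ mi _] := iN_hom.
  case: w' => [_|l w' [El hl rl]].
    by exists [::], (b' ** b); split=> //=; rewrite cmulr1 cmul1r mi.
  exists (Tagged M (fp_io (tag l) b' ** tagged l) :: w'), b; split.
    by split=> //=; rewrite El_bim El cmul0r.
  by rewrite /= /lv lamM fp_lam_io !cmulA.
have key (x : M i) w' : red None w' -> hd_ne None i w' -> span rwords (lam x ** wv w' ** iN b).
  move=> rw' hw'; rewrite lam_ctr !cmulDl; apply: span_add; apply: span_in; last exact: bw.
  exists (Tagged M (ctr x) :: w'), b; split=> //=; split=> //=; exact: ctr0.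
case: w rw => [_|[j x] w [Ex hl rw]]; first exact: key.
have [e|ne] := pselect (j = i); last by apply: key => //=; split.
case: _ / e n key => /= n key; rewrite /lv /= cmulA -lamM; exact: key.
Qed.

Lemma rwords_dense x (xi : HH N) (e : R) : 0 < e ->
  exists2 a, span rwords a & nm (am x xi - am a xi) < e.
Proof.
apply: (@strong_density R N [set n | exists i (x : M i), n = lam x]).
- rewrite fp_gen; congr bicommutant; rewrite eqEsubset; split.
    by move=> _ [i _ [y _ <-]]; exists (lam y) => //; exists i, y.
  by move=> _ [_ [i [y ->]] <-]; exists i => //; exists y.
- by move=> _ [i [y ->]]; exists i, (star y); rewrite lamS.
- apply: span_in; exists [::], cone; split=> //=; by rewrite iN1 cmulr1.
- by move=> c a b ha hb; apply: span_add => //; exact: span_scale.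
- by move=> _ a [i [y ->]]; exact: rwords_left.
Qed.

End Words.

Arguments EEgen {R I F Z Eh} m j.
Arguments EE {R I F Z Eh} m j.

Section D1.
Variables (R : realType) (I : Type) (F : fpdata R I).
Local Notation C := R[i].
Local Notation B := (fpB F).
Local Notation M := (fpM F).
Local Notation N := (fpN F).
Local Notation iN := (@fp_iN R I F).
Local Notation lam := (@fp_lam R I F).
Local Notation E := (@fpE R I F).
Local Notation EN := (@fpEN R I F).
Local Notation HB := (vn_space B).
Implicit Types (H K W Z : hilbertType R).
Implicit Types (w u : seq (letter F)) (o : option I).

Lemma im_al1 (O : Type) (A : cstarType R) Z (Eh : O -> A -> Z -> Z) (m : indmod Eh) v : im_al m cone v = v.
Proof.
apply: (bop_ext (rep_bop cone (im_rep m)) (bop_id _) (im_total m)) => _ [[[o x] z] _ <-].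
by rewrite /= im_alE cmul1r.
Qed.

Lemma ENce : conditional_expectation iN EN. Proof. by case: (fpEN_ce F). Qed.
Lemma EN_lin : linear EN. Proof. by case: ENce. Qed.
Lemma EN_bim b x b' : EN (iN b ** x ** iN b') = b ** EN x ** b'. Proof. by case: ENce. Qed.
Lemma EN_faithful x : EN (star x ** x) = 0 -> x = 0.
Proof. by case: (fpEN_ce F) => _ h _; exact: h. Qed.
Lemma EN_r x b : EN (x ** iN b) = EN x ** b.
Proof. by rewrite -[in RHS](cmul1r (EN x)) -EN_bim iN1 cmul1r. Qed.
Lemma EN_l x b : EN (iN b ** x) = b ** EN x.
Proof. by rewrite -[in RHS](cmulr1 (b ** _)) -EN_bim iN1 cmulr1. Qed.
Lemma EN1 : EN cone = cone. Proof. by rewrite (ce_one ENce) // iN1. Qed.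

(** The module of [N] over [B] consists of the summand [None]; the value 0 elsewhere puts it in the
    format of [freemap]. *)
Definition Eh1 o (x : N) (h : HB) : HB := if o is None then vn_rep (EN x) h else 0.

Lemma cpmap0 (A : cstarType R) Z : cpmap (fun (_ : A) (_ : Z) => 0 : Z).
Proof.
split=> [z c a b|x c a b|]; rewrite ?scaler0 ?addr0 //.
split=> [p q|L]; first by rewrite !hdot0l conjC0.
by rewrite /kform big1 // => p _; rewrite big1 // => q _; rewrite hdot0l mulr0.
Qed.

Lemma fm1 : freemap (@vn_rep R B) Eh1.
Proof.
split.
- by case=> [l|]; [exact: cpmap0|exact: ce_cpmap (@iN_hom _ _ F) ENce (@vn_rep_rep R B)].
- by case=> [l|] x b h //=; rewrite EN_r (repM _ _ _ (@vn_rep_rep R B)).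
- by case=> [l|] w h w0 rw _ //=; rewrite word_free // (rep0 _ (@vn_rep_rep R B)).
Qed.

Definition d1 : indmod Eh1 := inhabited_witness (indmod_ex (fm_cp fm1)).
Local Notation al := (im_al d1).
Definition d1v (x : N) (h : HB) : im_W d1 := im_br d1 None x h.

Lemma d1v_dot x h x' h' : hdot (d1v x h) (d1v x' h') = hdot (vn_rep (EN (star x' ** x)) h) h'.
Proof. exact: im_dot. Qed.
Lemma al_d1v n x h : al n (d1v x h) = d1v (n ** x) h. Proof. exact: im_alE. Qed.

Lemma d1v_total : total (range (fun p => d1v p.1 p.2)).
Proof.
move=> w hw; apply: (im_total d1) => _ [[[[l|] x] z] _ <-] /=; last by apply: hw; exists (x, z).
rewrite (_ : im_br d1 (Some l) x z = 0) ?hdot0l //.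
by apply: hdot_eq0; rewrite im_dot /= hdot0l.
Qed.

Lemma d1v_B x b h : d1v (x ** iN b) h = d1v x (vn_rep b h).
Proof.
apply: (total_ext d1v_total) => -[x' h'] /=; rewrite !d1v_dot cmulA EN_r.
by rewrite (repM _ _ _ (@vn_rep_rep R B)).
Qed.

Lemma uwB_dom_ce (h : HB) : dom_ce (fun x => vn_rep (EN x)) h.
Proof.
have [_ _ uE] := fpEN_ce F; have rB := @vn_rep_rep R B.
have [||xi hx] := @uw_dominated R N (fun x => hdot (vn_rep (EN x) h) h).
- by move=> c a b; rewrite EN_lin (repL _ rB) hdotDl hdotZl.
- by move=> G FG hG; exact: (@uw_op_functional R N HB (fun x => vn_rep (EN x)) h h uE G 0 FG hG).
by exists xi => x; apply: le_trans (Re_nm _) (hx x).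
Qed.

Lemma d1_dom (v : im_W d1) : dom al v.
Proof.
apply: indmod_dom => -[l|] h; last exact: uwB_dom_ce.
by exists 0 => x; rewrite hdot0l sqr_ge0.
Qed.

Lemma d1_inj : injective al.
Proof.
move=> x y e; apply/eqP; rewrite -subr_eq0; apply/eqP/EN_faithful.
have rB := @vn_rep_rep R B; case: (vn_rep_faithful B) => _; apply; apply/funext => h.
rewrite (rep0 _ rB); apply: hdot_ext => h'; rewrite -d1v_dot hdot0l.
rewrite -[x - y]cmulr1 -!al_d1v (repB _ _ _ (im_rep d1)) e subrr hdot0l //.
Qed.

Definition domF (W : normedModType C) (f : N -> W) : Prop := exists xi : HH N, forall n, nm (f n) <= nm (am n xi).

Lemma domF_dom K (W : normedModType C) (al' : N -> K -> K) (T : K -> W) v : dom al' v -> bop T -> domF (fun n => T (al' n v)).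
Proof.
move=> [xi hx] /bop_ge0[k k0 hk]; exists (k%:C *: xi) => n.
rewrite (linZ _ _ (rep_lin n (@am_rep R N))) nmZ nmR0 ?(ltW k0) //.
by apply: le_trans (hk _) _; rewrite ler_wpM2l ?(ltW k0).
Qed.

Lemma domFB (W : normedModType C) (f g : N -> W) : domF f -> domF g -> domF (fun n => f n - g n).
Proof.
move=> [xi hx] [et he]; have [ze hz] := amp_list [:: xi; et].
exists (2%:C *: ze) => n; rewrite (linZ _ _ (rep_lin n (@am_rep R N))) nmZ nmR0 //.
apply: le_trans (nmB _ _) _; have := hz n; rewrite big_cons big_seq1 => h.
have le1 (a b c : R) : 0 <= a -> 0 <= b -> 0 <= c -> a ^+ 2 + b ^+ 2 <= c ^+ 2 -> a + b <= 2 * c.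
  move=> a0 b0 c0 h'; have : a <= c by rewrite -ler_sqr ?nnegrE //; have := sqr_ge0 b; lra.
  have : b <= c by rewrite -ler_sqr ?nnegrE //; have := sqr_ge0 a; lra.
  lra.
by apply: le_trans (lerD (hx n) (he n)) _; apply: le1; rewrite ?nm_ge0.
Qed.

(** The uniqueness principle by which identities between normal maps on [N] are checked on words. *)
Lemma domF_eq0 (W : normedModType C) (f : N -> W) : linear f -> domF f -> (forall a, rwords (F := F) a -> f a = 0) -> forall n, f n = 0.
Proof.
move=> lf [xi hx] h n; apply: nm_small => e e0.
have [a sa ha] := rwords_dense n xi e0.
have fa : f a = 0.
  by elim: sa => [|c s v Ss _ IH]; rewrite ?(lin0 lf) // lf h // IH scaler0 addr0.
rewrite -[f n]subr0 -fa -(linB _ _ lf); apply: le_lt_trans (hx _) _.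
by rewrite (repB _ _ _ (@am_rep R N)).
Qed.

Lemma d1_words : total [set v | exists w h, red None w /\ v = d1v (wv w) h].
Proof.
move=> v hv; apply: d1v_total => _ [[x h] _ <-] /=.
have := @domF_eq0 C (fun n => hdot (d1v n h) v); apply.
- by move=> c a b; rewrite {1}/d1v (ind_linm d1 None h (fm_cp fm1) c a b) hdotDl hdotZl.
- have [xi hx] := d1_dom (d1v cone h); exists (((nm v)%:C) *: xi) => n.
  rewrite (linZ _ _ (rep_lin n (@am_rep R N))) nmZ nmR0 ?nm_ge0 //.
  apply: le_trans (hdot_nm _ _) _; rewrite mulrC ler_wpM2l ?nm_ge0 //.
  by have := hx n; rewrite al_d1v cmulr1.
- by move=> _ [w [b [rw ->]]]; rewrite d1v_B; apply: hv; exists w, (vn_rep b h).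
Qed.

Lemma red_rcons o w (x : letter F) : red o (rcons w x) ->
  [/\ red (Some (tag x)) w, E (tagged x) = 0 & o <> Some (tag x)].
Proof.
elim: w => [|a w IH] /=; first by case.
case=> Ea ha /IH[r1 r2 r3]; split=> //; split=> //.
case: w ha {IH r1} => [|b w] //= h [e]; exact: h.
Qed.

Lemma red_weak o w : red o w -> red None w.
Proof.
by elim: w => //= a w IH [Ea ha /IH rw]; split=> //; case: w ha {IH rw}.
Qed.

Lemma red_last l w (x : letter F) : l <> tag x -> red None (rcons w x) -> red (Some l) (rcons w x).
Proof.
move=> ne; elim: w => [|a w IH] /=; first by case=> Ex _ _; split=> // -[].
by case=> Ea ha /IH r; split=> //; case: w ha {IH r}.
Qed.

Lemma red_app l w (x : M l) : red (Some l) w -> E x = 0 -> red None (rcons w (Tagged M x)).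
Proof.
move=> rw Ex; elim: w rw => [|a w IH] /=; first by split.
case=> Ea ha /IH r; split=> //; case: w ha {IH r} => //= h e; apply: h; by rewrite e.
Qed.

Lemma wv_rcons w (x : letter F) : wv (rcons w x) = wv w ** lv x.
Proof. by elim: w => [|a w IH] /=; rewrite ?cmul1r ?cmulr1 // IH cmulA. Qed.

Lemma word_split l w : red None w -> exists u (m : M l), red (Some l) u /\ wv w = wv u ** lam m.
Proof.
case/lastP: w => [|w x] rw; first by exists [::], cone; rewrite lam1 cmulr1.
have [rx Ex _] := red_rcons rw; have [e|ne] := pselect (tag x = l).
  case: x e rw rx Ex => i x /= e; case: _ / e => rw rx Ex.
  by exists w, x; split=> //; rewrite wv_rcons.
exists (rcons w x), cone; rewrite lam1 cmulr1; split=> //; apply: red_last => // e; exact: ne.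
Qed.

Lemma red_star_gen (Pr : N -> Prop) o w' (l : letter F) w :
  (forall w, w <> [::] -> red o w -> first_ok o w -> Pr (wv w)) ->
  red o w' -> hd_ne o (tag l) w' -> red o (l :: w) -> Pr (star (wv w') ** wv (l :: w)).
Proof.
move=> hP; elim: w' l w => [|a w' IH] l w.
  by move=> _ h r; rewrite star1 cmul1r; apply: hP.
move=> [Ea ha ra] /= hl r; rewrite starM star_lv -cmulA.
apply: (IH (Tagged M (star (tagged a))) (l :: w) ra) => //.
by split=> //=; [rewrite E_star Ea star0|move=> e; apply: hl].
Qed.

(* Toeplitz modules: [e i] stands for the projection onto the words that do not start with a letter from [M i]. *)
Record toep : Type := Toep {
  tp_Z : hilbertType R;
  tp_tB : B -> tp_Z -> tp_Z; tp_t : forall i, M i -> tp_Z -> tp_Z; tp_e : I -> tp_Z -> tp_Z;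
  tp_rB : is_rep tp_tB; tp_rep : forall i, is_rep (@tp_t i);
  tp_one : forall i z, @tp_t i cone z = z; tp_io : forall i b z, @tp_t i (fp_io i b) z = tp_tB b z;
  tp_elin : forall i, linear (tp_e i); tp_eH : forall i z z', hdot (tp_e i z) z' = hdot z (tp_e i z');
  tp_ee : forall i z, tp_e i (tp_e i z) = tp_e i z;
  tp_eB : forall i b z, tp_e i (tp_tB b z) = tp_tB b (tp_e i z);
  tp_R1 : forall i (x : M i) z z', hdot (tp_t x (tp_e i z)) (tp_e i z') = hdot (tp_tB (E x) (tp_e i z)) (tp_e i z');
  tp_R2 : forall i j z, i <> j -> tp_e j (z - tp_e i z) = z - tp_e i z }.

Lemma comp_lam_rep K (be : N -> K -> K) i : is_rep be -> is_rep (fun x : M i => be (lam x)).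
Proof. exact: comp_rep (@lam_hom _ _ F i). Qed.

Definition d1e (i : I) : im_W d1 -> im_W d1 := proj (EEgen d1 i).

Lemma d1e_word i w h : red None w -> hd_ne None i w -> d1e i (d1v (wv w) h) = d1v (wv w) h.
Proof. by move=> rw hw; rewrite /d1e proj_id //; apply: cspan_in; exists None, w, h. Qed.

Lemma d1e_word0 (l : letter F) w h : red None (l :: w) -> d1e (tag l) (d1v (wv (l :: w)) h) = 0.
Proof.
move=> [El hl rw]; rewrite /d1e proj_perp0 // => s Ss.
rewrite hdotC -[wv _]/(lv l ** wv w) -al_d1v.
by rewrite (EE_perp fm1 El _ (cspan_in _ _ Ss)) ?conjC0 //; apply: cspan_in; exists None, w, h.
Qed.

Lemma bop_proj H (S : set H) : bop (proj S).
Proof. by split; [exact: proj_lin|exists 1 => v; rewrite mul1r; exact: proj_nm]. Qed.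

Definition toep_d1 : toep.
Proof.
apply: (@Toep (im_W d1) (fun b => al (iN b)) (fun i x => al (lam x)) d1e).
- exact: comp_rep (@iN_hom _ _ F) (im_rep d1).
- by move=> i; apply: comp_lam_rep; exact: im_rep.
- by move=> i z; rewrite lam1 im_al1.
- by move=> i b z; rewrite fp_lam_io.
- by move=> i; exact: proj_lin.
- by move=> i z z'; rewrite /d1e proj_hdot.
- by move=> i z; rewrite /d1e proj_id //; exact: proj_in.
- move=> i b z; rewrite /d1e; apply: (proj_hom (be := fun b => al (iN b))).
    exact: comp_rep (@iN_hom _ _ F) (im_rep d1).
  by move=> a s Ss; apply: (EE_B fm1); exact: cspan_in.
- by move=> i x z z'; apply: (EE_E fm1); exact: proj_in.
(* On words, [1 - e i] keeps exactly those that begin in [M i], and these are fixed by [e j]. *)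
- move=> i j z ij; pose T v := v - d1e i v.
  have bT : bop T.
    rewrite (_ : T = fun v => -1 *: d1e i v + v); last by apply/funext => v; rewrite scaleN1r addrC.
    by apply: bop_comb; [exact: bop_proj|exact: bop_id].
  apply: (bop_ext (bop_comp (bop_proj _) bT) bT d1_words) => _ [w [h [rw ->]]] /=.
  rewrite /T; case: w rw => [|l w] rw.
    by rewrite d1e_word // subrr (lin0 (@proj_lin _ _ _)).
  have [e|ne] := pselect (tag l = i); last by rewrite d1e_word // subrr (lin0 (@proj_lin _ _ _)).
  rewrite -e d1e_word0 // subr0; apply: d1e_word => //= e'; apply: ij; by rewrite -e -e'.
Defined.

End D1.

(** * Conditional expectations of the free product onto its factors *)

Section El.
Variables (R : realType) (I : Type) (F : fpdata R I) (l : I).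
Local Notation C := R[i].
Local Notation B := (fpB F).
Local Notation M := (fpM F).
Local Notation N := (fpN F).
Local Notation iN := (@fp_iN R I F).
Local Notation lam := (@fp_lam R I F).
Local Notation E := (@fpE R I F).
Local Notation EN := (@fpEN R I F).
Local Notation HB := (vn_space B).
Local Notation al := (im_al (d1 F)).
Implicit Types (H K W Z : hilbertType R).
Implicit Types (w : seq (letter F)).

Let cpl (o : unit) : cpmap (fun x : M l => vn_rep (E x)).
Proof. exact: ce_cpmap (@io_hom _ _ F l) (fpE_ce F l) (@vn_rep_rep R B). Qed.

Let X : indmod (fun (_ : unit) (x : M l) => vn_rep (E x)) := inhabited_witness (indmod_ex cpl).
Let xv (m : M l) (h : HB) : im_W X := im_br X tt m h.
Let be := im_al X.

Let xv_dot m h m' h' : hdot (xv m h) (xv m' h') = hdot (vn_rep (E (star m' ** m)) h) h'.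
Proof. exact: im_dot. Qed.
Let be_xv n m h : be n (xv m h) = xv (n ** m) h. Proof. exact: im_alE. Qed.
Let be_rep : is_rep be. Proof. exact: im_rep. Qed.
Let be1 v : be cone v = v. Proof. exact: im_al1. Qed.
Let al_rep : is_rep al. Proof. exact: im_rep. Qed.
Let rB := @vn_rep_rep R B.

Let xtot : total (range (fun p => xv p.1 p.2)).
Proof. by move=> w hw; apply: (im_total X) => _ [[[[] x] z] _ <-] /=; apply: hw; exists (x, z). Qed.

(** The module of [M l] over [B] sits in that of [N], because [EN] restricts to [E]. *)
Let j_ex : exists T : im_W X -> im_W (d1 F), [/\ linear T, forall v, nm (T v) = nm v &
  forall p, T (xv p.1 p.2) = d1v (lam p.1) p.2].
Proof.
apply: (lift_isom xtot) => p q.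
by rewrite d1v_dot xv_dot -lamS -lamM fpEN_lam.
Qed.

Let j := projT1 (cid j_ex).
Let jlin : linear j. Proof. by rewrite /j; case: cid => T []. Qed.
Let jnm v : nm (j v) = nm v. Proof. by rewrite /j; case: cid => T []. Qed.
Let jxv m h : j (xv m h) = d1v (lam m) h.
Proof. by rewrite /j; case: cid => T [h1 h2 e] /=; exact: (e (m, h)). Qed.
Let jbop : bop j. Proof. by split=> //; exists 1 => v; rewrite jnm mul1r. Qed.
Let jdot v v' : hdot (j v) (j v') = hdot v v'. Proof. exact: isom_hdot. Qed.

Let jbe m v : al (lam m) (j v) = j (be m v).
Proof.
apply: (bop_ext (bop_comp (rep_bop _ al_rep) jbop) (bop_comp jbop (rep_bop _ be_rep)) xtot) => _ [p _ <-] /=.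
by rewrite be_xv !jxv al_d1v lamM.
Qed.

Let be_inj : injective be.
Proof.
move=> x y e; apply/eqP; rewrite -subr_eq0; apply/eqP; case: (fp_lam_emb F l) => _ _ il _; apply: il.
rewrite (lin0 (@lam_lin _ _ F l)); apply: EN_faithful; rewrite -lamS -lamM fpEN_lam.
case: (vn_rep_faithful B) => _; apply; apply/funext => h.
rewrite (rep0 _ rB); apply: hdot_ext => h'; rewrite -xv_dot hdot0l -[x - y]cmulr1 -!be_xv.
by rewrite (repB _ _ _ be_rep) e subrr hdot0l.
Qed.

Let be_dom v : dom be v.
Proof.
apply: indmod_dom => _ h; have [_ _ uE] := fpEN_ce F; have [_ _ _ ul] := fp_lam_emb F l.
have [||xi hx] := @uw_dominated R (M l) (fun x => hdot (vn_rep (E x) h) h).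
- by move=> c a b; rewrite (@E_lin _ _ F l) (repL _ rB) hdotDl hdotZl.
- move=> G FG hG.
  have := @uw_op_functional R N HB (fun x => vn_rep (EN x)) h h uE ((@fp_lam R I F l) @ G) (@fp_lam R I F l 0) _ (ul G 0 FG hG).
  move=> /(_ _)/(@^~ _); rewrite fpEN_lam.
  rewrite (_ : (fun x => hdot (vn_rep (E x) h) h) = (fun x => hdot (vn_rep (EN x) h) h) \o @fp_lam R I F l); first exact.
  by apply/funext => y /=; rewrite fpEN_lam.
by exists xi => x; apply: le_trans (Re_nm _) (hx x).
Qed.

(** Flanking [w] by letters of [M l] gives, after centring, nonempty reduced words, on which [EN]
    vanishes. *)
Let K1 w v v' : w <> [::] -> red (Some l) w -> first_ok (Some l) w -> hdot (al (wv w) (j v)) (j v') = 0.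
Proof.
move=> w0 rw fw.
have wf : EN (wv w) = 0 by rewrite word_free //; exact: red_weak rw.
have wr (x : M l) : E x = 0 -> EN (wv w ** lam x) = 0.
  move=> Ex; rewrite -[lam x]/(lv (Tagged M x)) -wv_rcons word_free //; first by case: (w).
  exact: red_app.
have red_l (x : M l) u : E x = 0 -> u <> [::] -> first_ok (Some l) u -> red None u -> red None (Tagged M x :: u).
  by move=> Ex; case: u => //= a u _ fa ra; split=> //= e; apply: fa; rewrite e.
have wlr (x y : M l) : E x = 0 -> E y = 0 -> EN (lam x ** (wv w ** lam y)) = 0.
  move=> Ex Ey; rewrite -[lam y]/(lv (Tagged M y)) -wv_rcons.
  rewrite -[_ ** _]/(wv (Tagged M x :: rcons w (Tagged M y))) word_free //; apply: red_l => //.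
  - by case: (w).
  - by case: (w) w0 fw.
  - exact: red_app.
have wl (x : M l) : E x = 0 -> EN (lam x ** wv w) = 0.
  move=> Ex; rewrite -[_ ** _]/(wv (Tagged M x :: w)) word_free //; apply: red_l => //; exact: red_weak rw.
have key (x y : M l) : EN (lam x ** (wv w ** lam y)) = 0.
  rewrite (lam_ctr x) (lam_ctr y) cmulDl !cmulDr !(linD _ _ (@EN_lin _ _ F)).
  rewrite wlr ?ctr0 // !EN_l wr ?ctr0 // !cmulA !EN_r wl ?ctr0 // wf.
  by rewrite !(cmul0r, cmul0l) !addr0.
have e : adj j (al (wv w) (j v)) = 0.
  apply: (bop_ext (bop_comp (bop_adj jbop) (bop_comp (rep_bop (wv w) al_rep) jbop)) (bop0 _ _) xtot) => _ [[m h] _ <-] /=.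
  apply: (total_ext xtot) => -[m' h'] /=; rewrite hdot0l -adjPr // !jxv al_d1v d1v_dot -lamS key.
  by rewrite (rep0 _ rB) hdot0l.
by rewrite adjPr // e hdot0l.
Qed.

Let K2 w v v' : w <> [::] -> red (Some l) w -> hdot (al (wv w) (j v)) (j v') = 0.
Proof.
move=> w0 rw; have [f|nf] := pselect (first_ok (Some l) w); first exact: K1.
case: w w0 rw nf => // -[i x] u _ /= [Ex hu ru] /contrapT[] e.
case: _ / e x Ex hu => x Ex hu.
rewrite /lv /= (repM _ _ _ al_rep) (rep_star _ _ _ al_rep) -lamS jbe.
by case: u hu ru => [|a u] hu ru; [case: hu|apply: K1 => //= -[e]; apply: hu].
Qed.

(** Compressing these products of words to the range of [j] yields values in [B], not just in [M l].
    Therefore intertwiners of the module of [M l] pass through the Gram matrices of words in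
    [ext]. *)
Let K w' b w v v' : red (Some l) w' -> red (Some l) w ->
  hdot (al (star (wv w') ** iN b ** wv w) (j v)) (j v') =
  hdot (be (fp_io l (EN (star (wv w') ** iN b ** wv w))) v) v'.
Proof.
pose P n := hdot (al n (j v)) (j v') = hdot (be (fp_io l (EN n)) v) v'.
have PD n n' : P n -> P n' -> P (n + n').
  rewrite /P => h h'; have [lio _ _] := io_hom F l.
  by rewrite (repD _ _ _ al_rep) (linD _ _ (@EN_lin _ _ F)) (linD _ _ lio) (repD _ _ _ be_rep) !hdotDl h h'.
have P0 w0 : w0 <> [::] -> red (Some l) w0 -> P (wv w0).
  move=> n0 rw0; rewrite /P K2 // word_free //; last exact: red_weak rw0.
  by have [lio _ _] := io_hom F l; rewrite (lin0 lio) (rep0 _ be_rep) hdot0l.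
have PB b' : P (iN b').
  have [_ hio _ _] := @ENce _ _ F; rewrite /P hio -(@fp_lam_io R I F l) jbe jdot //.
have Pst n : (forall u u', hdot (al n (j u)) (j u') = hdot (be (fp_io l (EN n)) u) u') -> P (star n).
  move=> hn; rewrite /P (rep_starl _ _ _ al_rep) (hdotC (j v)) hn (ce_star _ (@ENce _ _ F)).
  by have [_ _ sio] := io_hom F l; rewrite sio (rep_starl _ _ _ be_rep) -hdotC.
have absorb b' (a : letter F) u : E (tagged a) = 0 ->
    exists a' : letter F, [/\ tag a' = tag a, E (tagged a') = 0 & iN b' ** wv (a :: u) = wv (a' :: u)].
  move=> Ea; exists (Tagged M (fp_io (tag a) b' ** tagged a)); split=> //=.
    by rewrite El_bim Ea cmul0r.
  by rewrite /lv lamM fp_lam_io cmulA.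
rewrite -/(P _); elim: w' b w => [|a' w' IH] b w.
  move=> _ rw; rewrite star1 cmul1r; case: w rw => [_|a w [Ea ha rw]]; first by rewrite /= cmulr1; exact: PB.
  by have [a'' [e1 e2 ->]] := absorb b a w Ea; apply: P0 => //; split=> //; rewrite e1.
move=> [Ea' ha' rw']; case: w => [_|a w [Ea ha rw]].
  rewrite /= cmulr1; have -> : star (lv a' ** wv w') ** iN b = star (iN (star b) ** wv (a' :: w')).
    by have [_ _ sN] := @iN_hom _ _ F; rewrite [in RHS]starM -sN starK.
  have [a'' [e1 e2 ->]] := absorb (star b) a' w' Ea'.
  apply: Pst => u u'; have r2 : red (Some l) (a'' :: w') by split=> //; rewrite e1.
  rewrite K2 // word_free //; last exact: red_weak r2.
  by have [lio _ _] := io_hom F l; rewrite (lin0 lio) (rep0 _ be_rep) hdot0l.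
rewrite -cmulA; have [a2 [t2 E2 ->]] := absorb b a w Ea.
have rw2 : red (Some l) (a2 :: w) by split=> //; rewrite t2.
have [e|ne] := pselect (tag a2 = tag a'); last first.
  apply: (@red_star_gen _ _ F P (Some l)) => //; last by move=> e; apply: ne.
  by move=> u u0 ru _; exact: P0.
rewrite [star _]starM star_lv -!cmulA.
case: a' a2 e Ea' ha' E2 rw2 {t2} => [i x'] [i2 x] /= e; case: _ / e x' => x' Ex' hx' Ex [_ hx rx].
(* Two adjacent letters of one index merge; the centred part gives a reduced word, and the part in
   [B] is left to the induction. *)
rewrite (cmulA (lv _) (lv _)) /lv /= -lamM lam_ctr cmulDl cmulDr.
apply: PD; last by rewrite cmulA; apply: IH.
apply: (@red_star_gen _ _ F P (Some l) w' (Tagged M (ctr (star x' ** x))) w) => //.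
  by move=> u u0 ru _; exact: P0.
by split=> //=; exact: ctr0.
Qed.

Let K' w' w : red (Some l) w' -> red (Some l) w ->
  exists b : B, forall v v', hdot (al (wv w) (j v)) (al (wv w') (j v')) = hdot (be (fp_io l b) v) v'.
Proof.
move=> rw' rw; exists (EN (star (wv w') ** wv w)) => u u'.
by have := K cone u u' rw' rw; rewrite iN1 cmulr1 (repM _ _ _ al_rep) (rep_starl _ _ _ al_rep).
Qed.

Let ftot (v : im_W (d1 F)) : perp [set v | exists w u, red (Some l) w /\ v = al (wv w) (j u)] v -> v = 0.
Proof.
move=> hv; apply: (@d1_words _ _ F) => _ [w [h [rw ->]]].
have [u [m [ru ->]]] := word_split l rw.
apply: hv; exists u, (xv m h); split=> //; by rewrite jxv al_d1v.
Qed.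

Let ext U : hom be be U -> exists T : im_W (d1 F) -> im_W (d1 F),
  bop T /\ forall w u, red (Some l) w -> T (al (wv w) (j u)) = al (wv w) (j (U u)).
Proof.
move=> hU; have [bU iU] := hU; have hU' := hom_adj be_rep be_rep hU; have [bU' iU'] := hU'.
pose Y := ({w : seq (letter F) | red (Some l) w} * im_W X)%type.
pose f (p : Y) := al (wv (sval p.1)) (j p.2); pose g (p : Y) := al (wv (sval p.1)) (j (U p.2)).
pose s (p : Y) : Y := (p.1, adj U (U p.2)).
have tf : total (range f).
  by move=> v hv; apply: ftot => _ [w [u [rw ->]]]; apply: hv; exists (exist _ w rw, u).
have [r0 r0p hr0] := bop_ge0 (bop_comp bU' bU).
have pt L : nm (lc g L) ^+ 2 <= r0 * nm (lc f L) ^+ 2.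
  apply: (power_trick (s := s) (ltW r0p)) => [[[w rw] u] [[w' rw'] u']|[[w rw] u]].
    have [b hb] := K' rw' rw; by rewrite /f /g /s /= !hb adjPr // iU'.
  have [k k0 hk] := bop_ge0 (rep_bop (wv w) al_rep); exists (k * nm u) => n.
  have -> : iter n s (exist _ w rw, u) = (exist _ w rw, iter n (adj U \o U) u) by elim: n => //= n ->.
  rewrite /f /=; apply: le_trans (hk _) _; rewrite jnm -mulrA ler_wpM2l ?(ltW k0) // mulrC.
  elim: n => [|n IH]; first by rewrite expr0 mul1r.
  by rewrite iterS exprS -mulrA; apply: le_trans (hr0 _) _; rewrite ler_wpM2l ?(ltW r0p).
have [|T [lT bT Tf]] := @lift _ _ _ _ f g (Num.sqrt r0) tf.
  move=> L; rewrite -ler_sqr ?nnegrE ?mulr_ge0 ?sqrtr_ge0 ?nm_ge0 // exprMn sqr_sqrtr ?(ltW r0p) //.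
exists T; split; first by split=> //; exists (Num.sqrt r0).
by move=> w u rw; exact: (Tf (exist _ w rw, u)).
Qed.

(** The expectation is compression by [j], obtained without modular theory: the compression of [x]
    commutes with every intertwiner [U], because [U] extends to [T] on the module of [N], and
    [normal_bicommutant] places it in [M l]. *)
Let El_ex x : exists y : M l, forall v v', hdot (al x (j v)) (j v') = hdot (be y v) v'.
Proof.
pose yx v := adj j (al x (j v)).
have byx : bop yx by exact: bop_comp (bop_adj jbop) (bop_comp (rep_bop x al_rep) jbop).
have [|y hy] := normal_bicommutant be_rep be_inj be1 be_dom byx; last first.
  by exists y => v v'; rewrite -hy /yx adjPr.
move=> U hU v; have [T [bT TE]] := ext hU; have [bU iU] := hU.
have hU' := hom_adj be_rep be_rep hU; have [bU' iU'] := hU'.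
(* The identity holds on words by construction of [T], and on all of [N] by normality. *)
have Tx n u : T (al n (j u)) = al n (j (U u)).
  apply/eqP; rewrite -subr_eq0; apply/eqP; move: n.
  apply: domF_eq0.
  - move=> c a b; rewrite !(repL _ al_rep) bT.1 opprD addrACA -scalerBr //.
  - apply: domFB; first exact: (domF_dom (d1_dom (j u)) bT).
    exact: (domF_dom (d1_dom (j (U u))) (bop_id _)).
  - move=> _ [w [b [rw ->]]]; have [w1 [m [rw1 ->]]] := word_split l rw.
    rewrite -(@fp_lam_io R I F l) -cmulA -lamM !(repM _ _ _ al_rep) !jbe TE //.
    by rewrite -iU subrr.
have Tadj u : adj T (j u) = j (adj U u).
  apply/eqP; rewrite -subr_eq0; apply/eqP/ftot => _ [w [u' [rw ->]]].
  rewrite hdotBr -adjP // TE //.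
  have r0 : red (Some l) ([::] : seq (letter F)) by [].
  have [b hb] := K' r0 rw; have := hb (U u') u; have := hb u' (adj U u).
  by rewrite /= !im_al1 => -> ->; rewrite -iU adjP // subrr.
apply: hdot_ext => v'; rewrite /yx -(adjPr _ _ jbop) -Tx (adjP _ _ bT) Tadj (adjPr _ _ jbop).
by rewrite -(adjP _ _ bU).
Qed.

Definition El (x : N) : M l := projT1 (cid (El_ex x)).

Let ElP x v v' : hdot (al x (j v)) (j v') = hdot (be (El x) v) v'.
Proof. by rewrite /El; case: cid. Qed.

Let El_uniq x y : (forall v v', hdot (al x (j v)) (j v') = hdot (be y v) v') -> El x = y.
Proof. by move=> h; apply: be_inj; apply/funext => v; apply: hdot_ext => v'; rewrite -ElP h. Qed.

Lemma El_ce : conditional_expectation (@fp_lam R I F l) El.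
Proof.
split.
- move=> c a b; apply: El_uniq => v v'.
  by rewrite (repL _ al_rep) (repL _ be_rep) !hdotDl !hdotZl !ElP.
- by move=> m; apply: El_uniq => v v'; rewrite jbe jdot.
- move=> b b' x; apply: El_uniq => v v'.
  rewrite !(repM _ _ _ al_rep) jbe (rep_star _ _ _ al_rep) -lamS jbe ElP.
  by rewrite -(rep_star b _ _ be_rep) -!(repM _ _ _ be_rep) -?cmulA.
- move=> x; have [||q [qs e _]] := @pos_sqrt R (M l) _ be (El (star x ** x)) (conj be_rep be_inj).
  + apply/esym/El_uniq => v v'; rewrite (rep_starl _ _ _ be_rep) [RHS]hdotC -ElP.
    by rewrite -hdotC (rep_star _ _ _ al_rep) starM starK.
  + by move=> v; rewrite -ElP (repM _ _ _ al_rep) (rep_starl _ _ _ al_rep) Re_hdotxx sqr_ge0.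
  by exists q; rewrite e qs.
Qed.

Lemma El_word w : w <> [::] -> red (Some l) w -> El (wv w) = 0.
Proof. by move=> w0 rw; apply: El_uniq => v v'; rewrite K2 // (rep0 _ be_rep) hdot0l. Qed.

(** By [hom_dense] it suffices to treat vectors [T u] with [T] an intertwiner; there the claim
    reduces to domination of [j u] in the module of [N]. *)
Lemma El_dom z : dom_ce (fun x => am (El x)) z.
Proof.
apply: (ce_dom_total (@lam_hom _ _ F l) (lam1 F l) El_ce (hom_dense be_rep be_inj be1 be_dom)).
move=> _ [T [u [[bT iT] ->]]]; have [k k0 hk] := bop_ge0 bT; have [xi hx] := d1_dom (j u).
have [_ _ _ pE] := El_ce; have rm := @am_rep R (M l).
exists (k%:C *: xi) => x; have [q e] := pE x.
rewrite e (repM _ _ _ rm) (rep_starl _ _ _ rm) Re_hdotxx -iT.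
rewrite (linZ _ _ (rep_lin x (@am_rep R N))) nmZ nmR0 ?(ltW k0) // ler_sqr ?nnegrE ?nm_ge0 ?mulr_ge0 ?nm_ge0 ?(ltW k0) //.
apply: le_trans (hk _) _; rewrite ler_wpM2l ?(ltW k0) //; apply: le_trans (hx x).
rewrite -ler_sqr ?nnegrE ?nm_ge0 // -!Re_hdotxx -(rep_starl _ _ _ be_rep) -(repM _ _ _ be_rep) -e -ElP.
by rewrite (repM _ _ _ al_rep) (rep_starl _ _ _ al_rep).
Qed.

End El.

Section ENdom.
Variables (R : realType) (I : Type) (F : fpdata R I).

Lemma EN_dom z : dom_ce (fun x => am (@fpEN R I F x)) z.
Proof.
apply: (ce_dom_total (@iN_hom _ _ F) (iN1 F) (@ENce _ _ F) (@aj_total R (fpB F))) => _ [[k h] _ <-] /=.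
have [xi hx] := uwB_dom_ce h; exists xi => x; rewrite am_aj aj_dot eqxx; exact: hx.
Qed.

End ENdom.

(** * The dilation of a Toeplitz module *)

Section Dilation.
Variables (R : realType) (I : Type) (F : fpdata R I) (t : toep F).
Local Notation C := R[i].
Local Notation B := (fpB F).
Local Notation M := (fpM F).
Local Notation N := (fpN F).
Local Notation iN := (@fp_iN R I F).
Local Notation lam := (@fp_lam R I F).
Local Notation E := (@fpE R I F).
Local Notation EN := (@fpEN R I F).
Local Notation Z := (tp_Z t).
Local Notation tB := (@tp_tB _ _ _ t).
Local Notation tt := (@tp_t _ _ _ t).
Local Notation ee := (@tp_e _ _ _ t).

Definition EhT (o : option I) (x : N) (z : Z) : Z :=
  if o is Some l then tt (El l x) z else tB (EN x) z.

Lemma El_r l x m : El l (x ** lam m) = El l x ** m.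
Proof.
have [_ _ h _] := El_ce F l; have := h cone m x.
by rewrite lam1 !cmul1r.
Qed.

Lemma fmT : freemap tB EhT.
Proof.
split.
- case=> [l|]; first exact: ce_cpmap (@lam_hom _ _ F l) (El_ce F l) (tp_rep t l).
  exact: ce_cpmap (@iN_hom _ _ F) (@ENce _ _ F) (tp_rB t).
- case=> [l|] x b z /=; last by rewrite EN_r (repM _ _ _ (tp_rB t)).
  by rewrite -(@fp_lam_io _ _ F l) El_r (repM _ _ _ (tp_rep t l)) tp_io.
- case=> [l|] w z w0 rw _ /=; first by rewrite El_word // (rep0 _ (tp_rep t l)).
  by rewrite word_free // (rep0 _ (tp_rB t)).
Qed.

Definition nn : indmod EhT := inhabited_witness (indmod_ex (fm_cp fmT)).
Local Notation W := (im_W nn).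
Local Notation al := (im_al nn).
Local Notation EEt := (EE nn).

Definition b0 (z : Z) : W := im_br nn None cone z.
Definition bS (l : I) (z : Z) : W := im_br nn (Some l) cone z.

Let al_rep : is_rep al. Proof. exact: im_rep. Qed.

Lemma b0_lin : linear b0. Proof. exact: ind_linr (fm_cp fmT). Qed.
Lemma bS_lin l : linear (bS l). Proof. exact: ind_linr (fm_cp fmT). Qed.

Lemma b0_dot z z' : hdot (b0 z) (b0 z') = hdot z z'.
Proof.
rewrite im_dot star1 cmulr1 /= EN1 -(tp_io (fp_i0 F)) io1 tp_one //.
Qed.
Lemma bS_dot l z z' : hdot (bS l z) (bS l z') = hdot z z'.
Proof. by rewrite im_dot star1 cmulr1 /= (ce_one (El_ce F l)) ?lam1 // tp_one. Qed.
Lemma b0S l z z' : hdot (b0 z) (bS l z') = 0. Proof. exact: im_dot0. Qed.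
Lemma bS0 l z z' : hdot (bS l z) (b0 z') = 0. Proof. exact: im_dot0. Qed.
Lemma bSS l l' z z' : l <> l' -> hdot (bS l z) (bS l' z') = 0.
Proof. by move=> h; apply: im_dot0 => -[]. Qed.

Lemma al_bS l (m : M l) z : al (lam m) (bS l z) = bS l (tt m z).
Proof.
rewrite /bS im_alE cmulr1; apply: (total_ext (im_total nn)) => -[[o x'] z'] /=.
have [<-|ne] := pselect (Some l = o); last by rewrite !im_dot0.
by rewrite !im_dot cmulr1 /= El_r (repM _ _ _ (tp_rep t l)).
Qed.

Lemma al_b0 b z : al (iN b) (b0 z) = b0 (tB b z).
Proof.
rewrite /b0 im_alE cmulr1; apply: (total_ext (im_total nn)) => -[[o x'] z'] /=.
have [<-|ne] := pselect (None = o); last by rewrite !im_dot0.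
by rewrite !im_dot cmulr1 (fm_B fmT).
Qed.

Lemma al_bSB l b z : al (iN b) (bS l z) = bS l (tB b z).
Proof. by rewrite -(@fp_lam_io _ _ F l) al_bS tp_io. Qed.

Lemma b0_EE j z : EEt j (b0 z). Proof. exact: EE_1. Qed.
Lemma bS_EE l j z : l <> j -> EEt j (bS l z). Proof. by move=> h; apply: EE_1 => -[]. Qed.

Lemma EE_lin j c v v' : EEt j v -> EEt j v' -> EEt j (c *: v + v').
Proof. exact: cspanP. Qed.

Lemma lam_perp_bS j (n : M j) v x : EEt j v -> hdot (al (lam n) v) (bS j x) = 0.
Proof.
by move=> hv; rewrite (rep_star _ _ _ al_rep) -lamS al_bS; exact: (EE_1perp fmT).
Qed.

Lemma lam_perp j (n : M j) v v' : E n = 0 -> EEt j v -> EEt j v' -> hdot (al (lam n) v) v' = 0.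
Proof. exact: (EE_perp fmT). Qed.

Lemma lam_perpr j (n : M j) v v' : E n = 0 -> EEt j v -> EEt j v' -> hdot v' (al (lam n) v) = 0.
Proof. by move=> *; rewrite hdotC lam_perp // conjC0. Qed.

Lemma e_fix0 j (n : M j) z : E n = 0 -> ee j z = z -> ee j (tt n z) = 0.
Proof.
move=> En ez; apply: hdot_ext => z'; rewrite hdot0l tp_eH -{1}ez tp_R1 En.
by rewrite (rep0 _ (tp_rB t)) hdot0l.
Qed.

Lemma e_dot j (x y : M j) z z' : ee j z = z -> ee j z' = z' ->
  hdot (tt x z) (tt y z') = hdot (tB (E (star y ** x)) z) z'.
Proof.
move=> ez ez'; rewrite -{1}[y]starK -(rep_star _ _ _ (tp_rep t j)) -(repM _ _ _ (tp_rep t j)).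
by rewrite -{1}ez -{1}ez' tp_R1 ez ez'.
Qed.

Lemma p_e i j z : i <> j -> ee i z = 0 -> ee j z = z.
Proof. by move=> ij ez; have := tp_R2 z ij; rewrite ez subr0. Qed.

Lemma p_perp i j x y : i <> j -> ee i x = 0 -> ee j y = 0 -> hdot x y = 0.
Proof. by move=> ij ex ey; rewrite -(p_e ij ex) tp_eH ey hdot0r. Qed.

Lemma e_perp j x y : ee j x = x -> ee j y = 0 -> hdot x y = 0.
Proof. by move=> ex ey; rewrite -ex tp_eH ey hdot0r. Qed.

(** With [gidx], a Wold decomposition of [Z]: vectors that begin with no letter, vectors in the
    range of some [1 - e j] orthogonal to all created ones, and created vectors [n z] with [n]
    centred and [e j z = z]. *)
Definition vac (z : Z) := forall j, ee j z = z.
Definition sig (j : I) (z : Z) := ee j z = 0 /\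
  forall (n : M j) z', E n = 0 -> ee j z' = z' -> hdot (tt n z') z = 0.

Inductive gidx : Type :=
| GVac z of vac z
| GSig j z of sig j z
| GCre j (n : M j) z of E n = 0 & ee j z = z.

Definition gz (g : gidx) : Z :=
  match g with GVac z _ => z | GSig _ z _ => z | GCre j n z _ _ => tt n z end.

(** If [w] is orthogonal to all generators, each [w - e j w] lies in [sig j] and is therefore
    orthogonal to [w], hence 0; so [w] is a vacuum vector and orthogonal to itself. *)
Lemma g_total : total (range gz).
Proof.
move=> w hw.
have ew j : ee j w = w.
  have e0 : ee j (w - ee j w) = 0 by rewrite (linB _ _ (@tp_elin _ _ _ t j)) tp_ee subrr.
  have sg : sig j (w - ee j w).
    split=> // n z En ez; rewrite hdotBr -[hdot _ (ee j w)]tp_eH e_fix0 // hdot0l subr0.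
    by apply: hw; exists (GCre En ez).
  apply/esym/eqP; rewrite -subr_eq0; apply/eqP/hdot_eq0.
  rewrite hdotBr -[hdot _ (ee j w)]tp_eH e0 hdot0l subr0; apply: hw; by exists (GSig sg).
by apply: hdot_eq0; apply: hw; exists (GVac ew).
Qed.

(** Orthogonality to the vectors [n z'] extends from centred [n] to all [n], as [B] preserves the
    range of [e j]. *)
Lemma sigP j (m : M j) z : sig j z -> sig j (tt m z).
Proof.
move=> [ez pz]; have rj := tp_rep t j.
have key (n : M j) z' : ee j z' = z' -> hdot (tt n z') z = 0.
  move=> ez'; rewrite (ctrE n) (repD _ _ _ rj) hdotDl pz ?ctr0 // add0r tp_io.
  by apply: (@e_perp j) => //; rewrite tp_eB ez'.
split; last first.
  by move=> n z' En ez'; rewrite -{1}[m]starK -(rep_star _ _ _ rj) -(repM _ _ _ rj) key.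
apply: hdot_ext => z'; rewrite hdot0l tp_eH (rep_star _ _ _ rj) hdotC key ?conjC0 //.
by rewrite tp_ee.
Qed.

Section Step.
Variable s : R.
Hypothesis (s0 : 0 < s) (s1 : s < 1).
(** The weights satisfy [a^2 + r^2 = 1] and [a^2 + g^2 + s^2 = 1], which make the recursion
    isometric, and [g^2 + s^2 = s], which produces one factor [s] per letter in [dil_word]. *)
Let a : C := (Num.sqrt (1 - s))%:C.
Let r : C := (Num.sqrt s)%:C.
Let g : C := (Num.sqrt (s * (1 - s)))%:C.
Let sc : C := s%:C.

Let aa : a * a = 1 - sc. 
Proof. by rewrite /a -rmorphM /= -expr2 sqr_sqrtr ?subr_ge0 ?ltW // rmorphB rmorph1. Qed.
Let rr : r * r = sc.
Proof. by rewrite /r -rmorphM /= -expr2 sqr_sqrtr // ltW. Qed.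
Let gg : g * g = sc * (1 - sc).
Proof.
rewrite /g -rmorphM /= -expr2 sqr_sqrtr; first by rewrite rmorphM rmorphB rmorph1.
by rewrite mulr_ge0 ?subr_ge0 // ltW.
Qed.

(* The vectors [V h] for [h] in the generators of [Z], in terms of the value [T z] of [V] on the shorter [z]. *)
Definition gV (T : Z -> W) (x : gidx) : W :=
  match x with
  | GVac z _ => b0 z
  | GSig j z _ => a *: b0 z + r *: bS j z
  | GCre j n z _ _ => a *: b0 (tt n z) + g *: bS j (tt n z) + sc *: al (lam n) (T z)
  end.

(** What the recursion needs of one stage and reproduces at the next: the last two clauses let inner
    products of created vectors be computed through the expectation onto [B]. *)
Definition pre (T : Z -> W) : Prop :=
  [/\ bop T, forall b z, T (tB b z) = al (iN b) (T z) & forall j z, ee j z = z -> EEt j (T z)].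

Lemma gV_EE T x j : pre T -> ee j (gz x) = gz x -> gz x = 0 \/ EEt j (gV T x).
Proof.
move=> [bT _ eT]; case: x => [z _|i z [ez _]|i n z En ez] /= h.
- by right; exact: b0_EE.
- have [ij|ij] := pselect (i = j); first by left; rewrite -h -ij.
  by right; apply: EE_lin; [exact: b0_EE|rewrite -[_ *: _]addr0; apply: EE_lin; [exact: bS_EE|exact: cspan0]].
- have [ij|ij] := pselect (i = j); first by left; rewrite -h -ij e_fix0.
  right; rewrite addrC; apply: EE_lin; first by apply: (EE_lam _ ij) => //; exact: eT.
  by apply: EE_lin; [exact: b0_EE|rewrite -[_ *: _]addr0; apply: EE_lin; [exact: bS_EE|exact: cspan0]].
Qed.

Lemma pre_dot T j (n n' : M j) z z' : pre T -> (forall z z', hdot (T z) (T z') = hdot z z') ->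
  ee j z = z -> ee j z' = z' ->
  hdot (al (lam n) (T z)) (al (lam n') (T z')) = hdot (tt n z) (tt n' z').
Proof.
move=> [bT BT eT] iT ez ez'; rewrite -{1}[n']starK lamS -(rep_star _ _ _ al_rep) -(repM _ _ _ al_rep) -lamM.
by rewrite (EE_E fmT _ (eT _ _ ez) (eT _ _ ez')) -BT iT e_dot.
Qed.

Lemma gV_dot T x y : pre T -> (forall z z', hdot (T z) (T z') = hdot z z') ->
  hdot (gV T x) (gV T y) = hdot (gz x) (gz y).
Proof.
move=> pT iT; have [bT BT eT] := pT.
have sym u v : hdot (gV T u) (gV T v) = hdot (gz u) (gz v) -> hdot (gV T v) (gV T u) = hdot (gz v) (gz u).
  by move=> h; rewrite hdotC h -hdotC.
have cJ : [/\ a^* = a, r^* = r, g^* = g & sc^* = sc] by split; exact: conjR.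
case: cJ => aJ rJ gJ sJ.
have vs z j z' (hz : vac z) (hz' : sig j z') : hdot (gV T (GVac hz)) (gV T (GSig hz')) = hdot z z'.
  by rewrite /= hdotDr !hdotZr b0_dot b0S (@e_perp j) ?mulr0 ?addr0 //; case: hz'.
have vc z j (n : M j) z' (hz : vac z) (En : E n = 0) (ez' : ee j z' = z') :
    hdot (gV T (GVac hz)) (gV T (GCre En ez')) = hdot z (tt n z').
  rewrite /= !hdotDr !hdotZr b0_dot b0S (lam_perpr En (eT _ _ ez') (@b0_EE j z)).
  by rewrite (@e_perp j) ?mulr0 ?addr0 // e_fix0.
have b0c j (n : M j) x0 z' : E n = 0 -> ee j z' = z' -> hdot (b0 x0) (al (lam n) (T z')) = 0.
  by move=> En ez'; exact: lam_perpr En (eT _ _ ez') (@b0_EE _ _).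
have bSc j i (n : M j) x0 z' : E n = 0 -> ee j z' = z' -> hdot (bS i x0) (al (lam n) (T z')) = 0.
  move=> En ez'; have [e|ne] := pselect (i = j).
    by rewrite e hdotC (lam_perp_bS _ _ (eT _ _ ez')) conjC0.
  exact: lam_perpr En (eT _ _ ez') (@bS_EE _ _ _ ne).
have ss j z i z' (hz : sig j z) (hz' : sig i z') : hdot (gV T (GSig hz)) (gV T (GSig hz')) = hdot z z'.
  rewrite /= !hdotDl !hdotDr !hdotZl !hdotZr b0_dot b0S bS0 aJ rJ !mulr0 addr0 add0r !mulrA.
  have [ij|ij] := pselect (j = i).
    by case: _ / ij hz' => hz'; rewrite bS_dot aa rr; ring.
  by rewrite bSS // (@p_perp j i) ?mulr0 ?addr0 //; [case: hz|case: hz'].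
have sC j z i (n : M i) z' (hz : sig j z) (En : E n = 0) (ez' : ee i z' = z') :
    hdot (gV T (GSig hz)) (gV T (GCre En ez')) = hdot z (tt n z').
  rewrite /= !hdotDl !hdotDr !hdotZl !hdotZr b0_dot b0S bS0 b0c // bSc //.
  have h0 : hdot z (tt n z') = 0.
    have [ij|ij] := pselect (j = i); last by apply: (@p_perp j i) => //; [case: hz|rewrite e_fix0].
    by case: _ / ij n z' En ez' => n z' En ez'; case: hz => _ h; rewrite hdotC h // conjC0.
  rewrite h0; have [ij|ij] := pselect (j = i); last by rewrite bSS // !(mulr0, addr0).
  by rewrite -[in bS i](ij) bS_dot h0 !(mulr0, addr0).
case: x y => [z hz|j z hz|j n z En ez] [z' hz'|i z' hz'|i n' z' En' ez'] //; try by apply: sym.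
- by rewrite /= b0_dot.
- rewrite /= !hdotDl !hdotDr !hdotZl !hdotZr b0_dot b0S bS0 (b0c i) // (bSc i) //.
  rewrite [hdot (al (lam n) _) (b0 _)]hdotC (b0c j) // [hdot (al (lam n) _) (bS _ _)]hdotC (bSc j) // conjC0.
  rewrite aJ gJ sJ !(mulr0, addr0, add0r) !mulrA.
  have [ij|ij] := pselect (j = i); last first.
    have o : hdot (al (lam n) (T z)) (al (lam n') (T z')) = 0.
      by apply: (lam_perp En (eT _ _ ez)); apply: (EE_lam En') (eT _ _ ez') => e; apply: ij.
    by rewrite bSS // (@p_perp j i) ?e_fix0 // o !(mulr0, addr0).
  (* Here [a^2 + g^2 + s^2 = 1] enters. *)
  case: _ / ij n' z' En' ez' => n' z' En' ez'; rewrite bS_dot pre_dot // aa gg; ring.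
Qed.

Lemma gV_B b x : exists y, gz y = tB b (gz x) /\ forall T, pre T -> gV T y = al (iN b) (gV T x).
Proof.
have rB := tp_rB t; case: x => [z hz|j z hz|j n z En ez].
- have h : vac (tB b z) by move=> j; rewrite tp_eB hz.
  by exists (GVac h); split=> // T _ /=; rewrite al_b0.
- have h : sig j (tB b z) by rewrite -(tp_io j); exact: sigP.
  exists (GSig h); split=> // T _ /=.
  by rewrite (linD _ _ (rep_lin _ al_rep)) !(linZ _ _ (rep_lin _ al_rep)) al_b0 al_bSB.
- have En' : E (fp_io j b ** n) = 0 by rewrite El_bim En cmul0r.
  exists (GCre En' ez); have e : tt (fp_io j b ** n) z = tB b (tt n z).
    by rewrite (repM _ _ _ (tp_rep t j)) tp_io.
  split=> // T pT /=; rewrite e !(linD _ _ (rep_lin _ al_rep)) !(linZ _ _ (rep_lin _ al_rep)) al_b0 al_bSB.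
  by rewrite lamM fp_lam_io (repM _ _ _ al_rep).
Qed.

Lemma step_pre T T' : pre T -> bop T' -> (forall x, T' (gz x) = gV T x) -> pre T'.
Proof.
move=> pT bT' hT'; split=> // [b z|j z ez].
  apply: (bop_ext (bop_comp bT' (rep_bop b (tp_rB t))) (bop_comp (rep_bop _ al_rep) bT') g_total) => _ [x _ <-] /=.
  by have [y [e1 e2]] := gV_B b x; rewrite -e1 !hT' e2.
move=> w hw; rewrite adjP //; set y := adj T' w.
(* It suffices that [e j y] is orthogonal to every generator; the generators not fixed by [e j] are
   killed by it. *)
rewrite -ez tp_eH (g_total (w := ee j y)) ?hdot0r // => _ [x _ <-].
have [ex|nex] := pselect (ee j (gz x) = gz x).
  rewrite -tp_eH ex /y -adjP // hT'; have [z0|h] := gV_EE pT ex; last exact: h.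
  by rewrite -hT' z0 (lin0 bT'.1) hdot0l.
rewrite -tp_eH; case: x nex => [z' hz|i z' hz|i n z' En ez'] /= nex; first by rewrite hz in nex.
  have [e|ne] := pselect (i = j); first by rewrite -e (proj1 hz) hdot0l.
  by case: nex; apply: p_e ne _; case: hz.
have [e|ne] := pselect (i = j); first by rewrite -e e_fix0 // hdot0l.
by case: nex; apply: p_e ne _; rewrite e_fix0.
Qed.

Lemma step T : pre T -> (forall z z', hdot (T z) (T z') = hdot z z') ->
  exists T', [/\ pre T', forall z z', hdot (T' z) (T' z') = hdot z z' & forall x, T' (gz x) = gV T x].
Proof.
move=> pT iT; have [|T' [lT' nT' hT']] := @lift_isom _ _ _ _ gz (gV T) g_total.
  by move=> x y; exact: gV_dot.
have bT' : bop T' by split=> //; exists 1 => v; rewrite nT' mul1r.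
exists T'; split=> //; first exact: step_pre hT'.
exact: isom_hdot.
Qed.

(** [D] is a difference of solutions or of stages of the recursion: only created vectors survive,
    with the factor [s]. As created vectors of one index are not orthogonal, the norm is found by
    [power_trick], where [q j], the operator [adj D' \o D'] cut by [e j] and scaled by [s ^ 2], acts
    behind the letter. *)
Lemma delta_bound D D' (d : R) : pre D' -> 0 <= d -> (forall z, nm (D' z) <= d * nm z) -> bop D ->
  (forall z, vac z -> D z = 0) -> (forall j z, sig j z -> D z = 0) ->
  (forall j (n : M j) z, E n = 0 -> ee j z = z -> D (tt n z) = sc *: al (lam n) (D' z)) ->
  forall v, nm (D v) <= s * d * nm v.
Proof.
move=> pD d0 hd bD D0 DS DC v; have [bD' BD' eD'] := pD.
have h0 : vac 0 by move=> j; rewrite (lin0 (@tp_elin _ _ _ t j)).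
pose q j z := (s ^+ 2)%:C *: ee j (adj D' (D' z)).
have hq j z : ee j (q j z) = q j z by rewrite /q (linZ _ _ (@tp_elin _ _ _ t j)) tp_ee.
pose sx x := match x with GCre j n z En _ => GCre En (hq j z) | _ => GVac h0 end.
have pt L : nm (lc (D \o gz) L) ^+ 2 <= (s * d) ^+ 2 * nm (lc gz L) ^+ 2.
  apply: (power_trick (s := sx)) (sqr_ge0 _) _ _ L.
    case=> [z hz|j z hz|j n z En ez] y /=; [by rewrite (D0 z hz) !hdot0l|by rewrite (DS _ _ hz) !hdot0l|].
    rewrite DC //; case: y => [z' hz'|i z' hz'|i n' z' En' ez'] /=.
    - by rewrite (D0 _ hz') hdot0r hdotC (@e_perp j z' _ (hz' j) (e_fix0 En (hq j z))) conjC0.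
    - rewrite (DS _ _ hz') hdot0r; have [ij|ij] := pselect (i = j); last first.
        by rewrite (@p_perp j i _ _ (fun e => ij (esym e)) (e_fix0 En (hq j z)) (proj1 hz')).
      by case: _ / ij n En z ez => n En z ez; case: hz' => _ ->.
    - rewrite DC // hdotZl hdotZr; have [ij|ij] := pselect (j = i); last first.
        have o : hdot (al (lam n) (D' z)) (al (lam n') (D' z')) = 0.
          by apply: (lam_perp En (eD' _ _ ez)); apply: (EE_lam En') (eD' _ _ ez') => e; apply: ij.
        by rewrite (@p_perp j i _ _ ij (e_fix0 En (hq j z)) (e_fix0 En' ez')) o !mulr0.
      case: _ / ij n' z' En' ez' => n' z' En' ez'.
      rewrite -{1}[n']starK lamS -(rep_star _ _ _ al_rep) -(repM _ _ _ al_rep) -lamM.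
      rewrite (EE_E fmT _ (eD' _ _ ez) (eD' _ _ ez')) e_dot //.
      rewrite /q (linZ _ _ (rep_lin _ (tp_rB t))) hdotZl conjR mulrA -rmorphM -expr2; congr (_ * _).
      rewrite -tp_eB tp_eH ez'.
      by rewrite (rep_star _ _ _ (tp_rB t)) -(adjPr _ _ bD') BD' (rep_star _ _ _ al_rep); case: (iN_hom F) => _ _ ->.
  case=> [z hz|j z hz|j n z En ez].
  - exists (nm z) => -[|k]; first by rewrite expr0 mulr1.
    rewrite (_ : iter k.+1 sx (GVac hz) = GVac h0); last by elim: k => //= k ->.
    by rewrite nm0 mulr_ge0 ?nm_ge0 // exprn_ge0 // sqr_ge0.
  - exists (nm z) => -[|k]; first by rewrite expr0 mulr1.
    rewrite (_ : iter k.+1 sx (GSig hz) = GVac h0); last by elim: k => //= k ->.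
    by rewrite nm0 mulr_ge0 ?nm_ge0 // exprn_ge0 // sqr_ge0.
  have [y [ey hy]] : exists y : nat -> Z, (forall k, ee j (y k) = y k) /\
      (forall k, gz (iter k sx (GCre En ez)) = tt n (y k) /\ nm (y k) <= ((s * d) ^+ 2) ^+ k * nm z).
    exists (fun k => iter k (q j) z); split=> [[|k]|k]; rewrite ?iterS //.
    suff h : (exists h, iter k sx (GCre En ez) = GCre En (h : ee j (iter k (q j) z) = iter k (q j) z)) /\
        nm (iter k (q j) z) <= ((s * d) ^+ 2) ^+ k * nm z.
      by case: h => -[h ->].
    elim: k => [|k [[h e] hn]]; first by split; [exists ez|rewrite expr0 mul1r].
    rewrite !iterS e; split; first by exists (hq j _).
    rewrite exprS -mulrA; apply: le_trans (_ : (s * d) ^+ 2 * nm (iter k (q j) z) <= _); last first.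
      by rewrite ler_wpM2l ?sqr_ge0.
    set x := iter k (q j) z; rewrite /q nmZ nmR0 ?sqr_ge0 //.
    rewrite (_ : (s * d) ^+ 2 * nm x = s ^+ 2 * (d ^+ 2 * nm x)); last by ring.
    apply: ler_wpM2l; first exact: sqr_ge0.
    have ne u : nm (ee j u) <= nm u.
      apply: nm_sq_le; first exact: nm_ge0.
      by rewrite -Re_hdotxx tp_eH tp_ee; exact: Re_hdot_le.
    apply: le_trans (ne _) _; apply: nm_sq_le; first by rewrite mulr_ge0 ?sqr_ge0 ?nm_ge0.
    rewrite -[leLHS]Re_hdotxx -adjP //; apply: le_trans (Re_hdot_le _ _) _.
    apply: le_trans (ler_pM (nm_ge0 _) (nm_ge0 _) (hd _) (hd _)) _.
    by rewrite le_eqVlt; apply/orP; left; apply/eqP; ring.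
  have [k k0 hk] := bop_ge0 (rep_bop n (tp_rep t j)); exists (k * nm z) => m.
  have [-> h] := hy m; apply: le_trans (hk _) _; rewrite mulrAC -mulrA ler_wpM2l ?(ltW k0) //.
have [|T [lT bT hT]] := @lift _ _ _ _ gz (D \o gz) (s * d) g_total.
  move=> L; rewrite -ler_sqr ?nnegrE ?nm_ge0 ?mulr_ge0 ?nm_ge0 ?(ltW s0) // exprMn; exact: pt.
have bbT : bop T by split=> //; exists (s * d).
rewrite (bop_ext bD bbT g_total) //.
by move=> _ [x _ <-]; rewrite hT.
Qed.

Definition dilation (V : Z -> W) : Prop :=
  [/\ pre V, forall z z', hdot (V z) (V z') = hdot z z' & forall x, V (gz x) = gV V x].

Lemma pre_b0 : pre b0.
Proof.
split; last by move=> j z _; exact: b0_EE.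
  split; first exact: b0_lin.
  by exists 1 => z; rewrite mul1r -ler_sqr ?nnegrE ?nm_ge0 // -!Re_hdotxx b0_dot.
by move=> b z; rewrite al_b0.
Qed.

Lemma pre_lin T T' c : pre T -> pre T' -> pre (fun z => c *: T z + T' z).
Proof.
move=> [bT BT eT] [bT' BT' eT']; split; first exact: bop_comb.
  by move=> b z; rewrite BT BT' (rep_lin _ al_rep).
by move=> j z ez; apply: EE_lin; [exact: eT|exact: eT'].
Qed.

Lemma pow_small (e : R) : 0 < e -> exists k, s ^+ k < e.
Proof.
move=> e0; pose q := s^-1 - 1; have q0 : 0 < q by rewrite subr_gt0 invf_gt1.
have sq : s^-1 = 1 + q by rewrite /q addrC subrK.
have bern n : 1 + n%:R * q <= s^-1 ^+ n.
  elim: n => [|n IH]; first by rewrite mul0r addr0 expr0.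
  rewrite exprS sq; rewrite sq in IH; apply: le_trans (ler_wpM2l _ IH); last by rewrite addr_ge0 // ltW.
  have : 0 <= n%:R * q ^+ 2 by rewrite mulr_ge0 // sqr_ge0.
  by rewrite -natr1; lra.
exists (Num.bound (e^-1 / q)).
have := archi_boundP (_ : 0 <= e^-1 / q); rewrite divr_ge0 ?invr_ge0 ?(ltW e0) ?(ltW q0) // => /(_ isT).
set n := Num.bound _; rewrite ltr_pdivrMr // => h.
have h' : e^-1 < s^-1 ^+ n by apply: lt_le_trans (bern n); lra.
by rewrite -(invrK (s ^+ n)) -exprVn invf_plt ?posrE // exprn_gt0 // invr_gt0.
Qed.

(** [V] is the fixed point of the recursion [gV], reached from [b0]; by [delta_bound] consecutive
    stages approach each other with the factor [s]. *)
Lemma dilation_ex : exists V, dilation V.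
Proof.
pose good T := pre T /\ forall z z', hdot (T z) (T z') = hdot z z'.
have /choice[st hst] : forall T : {T | good T}, exists T' : {T | good T}, forall x, sval T' (gz x) = gV (sval T) x.
  by case=> T [pT iT]; have [T' [h1 h2 h3]] := step pT iT; exists (exist _ T' (conj h1 h2)).
have g0 : good b0 by split; [exact: pre_b0|exact: b0_dot].
pose Vk k := iter k st (exist _ b0 g0); pose V k := sval (Vk k).
have pV k : pre (V k) by case: (proj2_sig (Vk k)).
have iV k z z' : hdot (V k z) (V k z') = hdot z z' by have [_ h] := proj2_sig (Vk k); exact: h.
have nV k z : nm (V k z) = nm z.
  by apply/eqP; rewrite -(@eqrXn2 _ 2) ?nm_ge0 // -!Re_hdotxx iV.
have eV k x : V k.+1 (gz x) = gV (V k) x by rewrite /V /Vk iterS hst.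
have bV k : bop (V k) by case: (pV k).
pose D k z := -1 *: V k z + V k.+1 z.
have pD k : pre (D k) by exact: pre_lin.
have sk k : 0 <= s ^+ k by rewrite exprn_ge0 // ltW.
have bD k z : nm (D k z) <= s ^+ k * 2 * nm z.
  elim: k z => [|k IH] z.
    rewrite /D expr0 mul1r; apply: le_trans (nmD _ _) _.
    by rewrite nmZ !nV nmN (_ : nm (1 : C) = 1) ?mul1r; [lra|rewrite -[1]/(1%:C) nmR0].
  rewrite (_ : s ^+ k.+1 * 2 = s * (s ^+ k * 2)); last by rewrite exprS mulrA.
  apply: (@delta_bound (D k.+1) (D k) (s ^+ k * 2) (pD k)) => //.
  - by rewrite mulr_ge0.
  - by case: (pD k.+1).
  - by move=> z' hz; rewrite /D !(eV _ (GVac hz)) /= scaleN1r addNr.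
  - by move=> j z' hz; rewrite /D !(eV _ (GSig hz)) /= scaleN1r addNr.
  - move=> j n z' En ez; rewrite /D !(eV _ (GCre En ez)) /= scaleN1r opprD addrACA addNr add0r.
    by rewrite (rep_lin _ al_rep) scaleN1r addrC -scalerBr addrC.
have /choice[L hL] : forall z, exists l, nlim (fun k => V k z) l.
  move=> z; apply: complete_nlim => e e0.
  (* A geometric series of ratio [s], whose first term is at most [2 |z|] because all stages are
     isometric. *)
  have tail k m : nm (V (m + k)%N z - V k z) <= 2 * nm z * s ^+ k / (1 - s).
    suff h : nm (V (m + k)%N z - V k z) <= 2 * nm z * s ^+ k * ((1 - s ^+ m) / (1 - s)).
      apply: le_trans h _; apply: ler_wpM2l; first by rewrite !mulr_ge0 ?nm_ge0.
      rewrite -[leRHS]mul1r; apply: ler_wpM2r; first by rewrite invr_ge0 subr_ge0 ltW.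
      by rewrite lerBlDr lerDl.
    elim: m => [|m IH]; first by rewrite subrr nm0 expr0 subrr mul0r mulr0.
    have := nm_tri (V (m + k)%N z) (V (m.+1 + k)%N z) (V k z).
    have -> : V (m.+1 + k)%N z - V (m + k)%N z = D (m + k)%N z by rewrite /D scaleN1r addrC addSn.
    have := bD (m + k)%N z; rewrite exprD exprS => h1 h2.
    apply: le_trans h2 _; apply: le_trans (lerD h1 IH) _.
    by rewrite le_eqVlt; apply/orP; left; apply/eqP; field; rewrite subr_eq0 gt_eqF.
  have c0 : 0 < 1 - s by rewrite subr_gt0.
  have c1 : 0 < 2 * nm z + 1 by have := nm_ge0 z; lra.
  have [k0 hk0] : exists k, s ^+ k < e / 2 * (1 - s) / (2 * nm z + 1).
    by apply: pow_small; rewrite divr_gt0 // mulr_gt0 // divr_gt0.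
  exists k0 => m n hm hn.
  have key p : (k0 <= p)%N -> nm (V p z - V k0 z) < e / 2.
    move=> hp; rewrite -(subnK hp); apply: le_lt_trans (tail _ _) _.
    rewrite ltr_pdivrMr //; move: hk0; rewrite ltr_pdivlMr //.
    by have := sk k0; have := nm_ge0 z; lra.
  have := nm_tri (V k0 z) (V m z) (V n z); rewrite (nmBC (V k0 z)).
  by have := key m hm; have := key n hn; lra.
have iL z z' : hdot (L z) (L z') = hdot z z'.
  by apply: nlim_uniq (nlim_hdot2 (hL z) (hL z')) _; under eq_fun do rewrite iV; exact: nlim_cst.
have lL : linear L.
  move=> c x y; apply: nlim_uniq (hL _) _; under eq_fun do rewrite (bV _).1.
  by apply: nlimD (hL y); exact: nlim_scale.
have bL : bop L.
  by split=> //; exists 1 => z; rewrite mul1r -ler_sqr ?nnegrE ?nm_ge0 // -!Re_hdotxx iL.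
have lim_al x (u : nat -> W) v : nlim u v -> nlim (fun k => al x (u k)) (al x v).
  have [c _ hc] := bop_ge0 (rep_bop x al_rep).
  by apply: (@nlim_map _ _ _ (al x) c) => y y'; rewrite -(linB _ _ (rep_lin _ al_rep)).
exists L; split=> //; first split=> //.
- move=> b z; apply: nlim_uniq (hL _) _; have BV k : V k (tB b z) = al (iN b) (V k z) by case: (pV k).
  by under eq_fun do rewrite BV; exact: lim_al.
- by move=> j z ez; apply: cspan_lim (hL z) => k; case: (pV k) => _ _ h; exact: h.
- move=> x; have h : nlim (fun k => V k.+1 (gz x)) (L (gz x)).
    by move=> e /(hL (gz x))[n0 hn]; exists n0 => n h; apply: hn; exact: leqW.
  apply: nlim_uniq h _; under eq_fun do rewrite eV.
  case: x => [z hz|j z hz|j n z En ez] /=; try exact: nlim_cst.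
  by apply: nlimD; [exact: nlim_cst|apply: nlim_scale; exact: lim_al].
Qed.

Variable V : Z -> W.
Hypothesis dV : dilation V.

Lemma dil_bop : bop V. Proof. by case: dV => -[]. Qed.
Lemma dil_B b z : V (tB b z) = al (iN b) (V z). Proof. by case: dV => -[]. Qed.
Lemma dil_EE j z : ee j z = z -> EEt j (V z). Proof. by case: dV => -[_ _ h] _ _; exact: h. Qed.
Lemma dil_dot z z' : hdot (V z) (V z') = hdot z z'. Proof. by case: dV. Qed.
Lemma dil_vac z : vac z -> V z = b0 z. Proof. by move=> hz; case: dV => _ _ h; exact: (h (GVac hz)). Qed.
Lemma dil_sig j z : sig j z -> V z = a *: b0 z + r *: bS j z.
Proof. by move=> hz; case: dV => _ _ h; exact: (h (GSig hz)). Qed.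
Lemma dil_cre j (n : M j) z : E n = 0 -> ee j z = z ->
  V (tt n z) = a *: b0 (tt n z) + g *: bS j (tt n z) + sc *: al (lam n) (V z).
Proof. by move=> En ez; case: dV => _ _ h; exact: (h (GCre En ez)). Qed.
Lemma dil_adj z : adj V (V z) = z.
Proof. by apply: hdot_ext => z'; rewrite -(adjPr _ _ dil_bop) dil_dot. Qed.
Lemma dil_adjB b v : adj V (al (iN b) v) = tB b (adj V v).
Proof.
apply: hdot_ext => z'; rewrite -(adjPr _ _ dil_bop) (rep_star _ _ _ al_rep) (rep_star _ _ _ (tp_rB t)).
by rewrite -(adjPr _ _ dil_bop) dil_B; case: (iN_hom F) => _ _ ->.
Qed.

(** Uniqueness of the solution of the recursion: the defect [D] satisfies the hypotheses of
    [delta_bound] with itself as predecessor, so it is bounded by [s ^ k * d0] for every [k]. *)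
Lemma dil_com (rho rho' : Z -> Z) (be : W -> W) : bop rho -> bop be ->
  (forall x y, hdot (rho x) y = hdot x (rho' y)) ->
  (forall i (m : M i) z, tt m (rho' z) = rho' (tt m z)) -> (forall i z, ee i (rho' z) = rho' (ee i z)) ->
  (forall o x z, be (im_br nn o x z) = im_br nn o x (rho z)) ->
  (forall i (m : M i) z, tt m (rho z) = rho (tt m z)) -> (forall i z, ee i (rho z) = rho (ee i z)) ->
  (forall x v, be (al x v) = al x (be v)) -> (forall j v, EEt j v -> EEt j (be v)) ->
  forall z, V (rho z) = be (V z).
Proof.
move=> br_ bbe adjr ct' ce' hbe ct ce cbe eEE.
pose D z := -1 *: be (V z) + V (rho z).
have aT : (forall j z, ee j z = z -> ee j (rho z) = rho z) by move=> j z ez; rewrite ce ez.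
have [lb _] := bbe; have [lr _] := br_; have [lV _] := dil_bop.
have pD : pre D.
  split.
  - exact: bop_comb _ (bop_comp bbe dil_bop) (bop_comp dil_bop br_).
  - move=> b z; rewrite /D -(tp_io (fp_i0 F)) -ct tp_io (tp_io (fp_i0 F)) !dil_B cbe.
    by rewrite (rep_lin _ al_rep).
  - by move=> j z ez; apply: EE_lin; [exact/eEE/dil_EE|apply: dil_EE; exact: aT].
have [d0 dp hd0] := bop_ge0 (let: And3 h _ _ := pD in h).
have D0 z : vac z -> D z = 0.
  move=> hz; rewrite /D !dil_vac //; last by move=> j; apply: aT.
  by rewrite /b0 hbe scaleN1r addNr.
have DS j z : sig j z -> D z = 0.
  move=> [ez hz]; have hr : sig j (rho z).
    split; first by rewrite ce ez (lin0 lr).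
    move=> n z' En ez'; rewrite hdotC adjr -ct' hdotC conjCK.
    by apply: hz => //; rewrite ce' ez'.
  by rewrite /D (dil_sig (conj ez hz)) (dil_sig hr) lb (linZ _ _ lb) /b0 /bS !hbe scaleN1r addNr.
have DC j (n : M j) z : E n = 0 -> ee j z = z -> D (tt n z) = sc *: al (lam n) (D z).
  move=> En ez; rewrite /D -ct (dil_cre En ez) (dil_cre En (aT _ _ ez)) !(linD _ _ lb) !(linZ _ _ lb).
  rewrite /b0 /bS !hbe ct cbe scaleN1r opprD addrACA addNr add0r.
  by rewrite (rep_lin _ al_rep) scaleN1r addrC -scalerBr addrC.
have key k z : nm (D z) <= s ^+ k * d0 * nm z.
  elim: k z => [|k IH] z; first by rewrite expr0 mul1r.
  rewrite (_ : s ^+ k.+1 * d0 = s * (s ^+ k * d0)); last by rewrite exprS mulrA.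
  apply: (@delta_bound D D (s ^+ k * d0) pD) => //; last by case: pD.
  by rewrite mulr_ge0 ?exprn_ge0 // ltW.
move=> z; apply/esym/eqP; rewrite -subr_eq0 -oppr_eq0 opprB addrC -scaleN1r; apply/eqP; rewrite -/(D z).
apply: nm_small => e e0.
have [k hk] : exists k, s ^+ k < e / (d0 * nm z + 1).
  apply: pow_small; rewrite divr_gt0 //; have := mulr_ge0 (ltW dp) (nm_ge0 z); lra.
apply: le_lt_trans (key k z) _; move: hk; rewrite ltr_pdivlMr; last by have := mulr_ge0 (ltW dp) (nm_ge0 z); lra.
apply: le_lt_trans; rewrite -mulrA ler_wpM2l ?exprn_ge0 ?(ltW s0) //; lra.
Qed.

Fixpoint tw (w : seq (letter F)) (z : Z) : Z := if w is x :: w' then tt (tagged x) (tw w' z) else z.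

(** Tested on the generators: only those created by [M j] pair with [al (lam n) k], and there both
    sides reduce to the expectation onto [B]. *)
Lemma dil_V3 j (n : M j) k h : E n = 0 -> EEt j k -> ee j h = h -> adj V k = h ->
  adj V (al (lam n) k) = sc *: tt n h.
Proof.
move=> En hk eh kh; apply: (total_ext g_total) => x; rewrite -(adjPr _ _ dil_bop) hdotZl.
have other i y : i <> j -> ee i (gz y) = 0 -> hdot (al (lam n) k) (V (gz y)) = sc * hdot (tt n h) (gz y).
  move=> ij ey; rewrite lam_perp //; last by apply: dil_EE; exact: p_e ij ey.
  by rewrite (@p_perp j i) ?mulr0 ?e_fix0 // => e; apply: ij.
case: x => [z hz|i z hz|i n' z En' ez].
- rewrite /= dil_vac // lam_perp //; last exact: b0_EE.
  by rewrite hdotC (@e_perp j) ?conjC0 ?mulr0 // e_fix0.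
- have [ij|ij] := pselect (i = j); last by apply: (other i) => //; case: hz.
  case: _ / ij n k h En hk eh kh other => n k h En hk eh kh other /=.
  rewrite (dil_sig hz) hdotDr !hdotZr lam_perp //; last exact: b0_EE.
  by rewrite lam_perp_bS // (proj2 hz) // !mulr0 addr0.
- have [ij|ij] := pselect (i = j); last by apply: (other i) => //=; rewrite e_fix0.
  case: _ / ij n k h En hk eh kh other => n k h En hk eh kh other /=.
  rewrite (dil_cre En' ez) !hdotDr !hdotZr lam_perp //; last exact: b0_EE.
  rewrite lam_perp_bS // !mulr0 !add0r conjR; congr (_ * _).
  rewrite -{1}[n']starK lamS -(rep_star _ _ _ al_rep) -(repM _ _ _ al_rep) -lamM.
  by rewrite (EE_E fmT _ hk (dil_EE ez)) (adjPr _ _ dil_bop) dil_adjB kh e_dot.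
Qed.

(** [dil_V3] along a word, from right to left: a letter moves the vector into [EE i] for all [i]
    other than its own index, which is the hypothesis for the next letter. *)
Lemma dil_chain j w k h : red (Some j) w -> (forall i, i <> j -> EEt i k /\ ee i h = h) -> adj V k = h ->
  adj V (al (wv w) k) = sc ^+ size w *: tw w h /\
  forall i, hd_ne (Some j) i w -> EEt i (al (wv w) k) /\ ee i (tw w h) = tw w h.
Proof.
move=> rw hi kh; elim: w rw => [_|x w IH [Ex hx rw]].
  rewrite /= im_al1 expr0 scale1r kh; split=> // i ij; apply: hi => e; apply: ij; by rewrite e.
have [IH1 IH2] := IH rw; have [h1 h2] := IH2 _ hx; split.
  rewrite /= (repM _ _ _ al_rep) (dil_V3 Ex h1 (h := sc ^+ size w *: tw w h)) //.
    by rewrite (linZ _ _ (rep_lin _ (tp_rep t _))) scalerA exprS.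
  by rewrite (linZ _ _ (@tp_elin _ _ _ t _)) h2.
move=> i /= ij; rewrite (repM _ _ _ al_rep); split; first exact: (EE_lam _ ij).
by apply: p_e ij _; rewrite e_fix0.
Qed.

Lemma dil_b0 j h : ee j h = 0 -> adj V (b0 h) = a *: h.
Proof.
move=> eh; apply: (total_ext g_total) => x; rewrite -(adjPr _ _ dil_bop) hdotZl.
case: x => [z hz|i z hz|i n z En ez].
- by rewrite /= dil_vac // b0_dot hdotC (@e_perp j) ?conjC0 ?mulr0.
- by rewrite /= (dil_sig hz) hdotDr !hdotZr b0_dot b0S mulr0 addr0 conjR.
- rewrite /= (dil_cre En ez) !hdotDr !hdotZr b0_dot b0S (lam_perpr En (dil_EE ez) (@b0_EE _ _)).
  by rewrite !mulr0 !addr0 conjR.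
Qed.

Lemma dil_bS j h : ee j h = 0 -> forall i z, ee i z = z -> forall (n : M i), E n = 0 ->
  hdot (bS j h) (V (tt n z)) = g * hdot h (tt n z).
Proof.
move=> eh i z ez n En; rewrite (dil_cre En ez) !hdotDr !hdotZr bS0 mulr0 add0r.
have -> : hdot (bS j h) (al (lam n) (V z)) = 0.
  have [ij|ij] := pselect (i = j).
    by rewrite hdotC -ij lam_perp_bS ?conjC0 //; exact: dil_EE.
  by apply: (lam_perpr En (dil_EE ez)); apply: bS_EE => e; apply: ij.
rewrite mulr0 addr0 conjR; have [ij|ij] := pselect (j = i); last by rewrite bSS // (@p_perp j i) ?e_fix0 ?mulr0.
by rewrite -[in bS i](ij) bS_dot.
Qed.

Lemma dil_bS_sig j z : sig j z -> adj V (bS j z) = r *: z.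
Proof.
move=> hz; apply: (total_ext g_total) => x; rewrite -(adjPr _ _ dil_bop) hdotZl.
case: x => [z' hz'|i z' hz'|i n z' En ez].
- by rewrite /= dil_vac // bS0 hdotC (@e_perp j) ?conjC0 ?mulr0 //; case: hz.
- rewrite /= (dil_sig hz') hdotDr !hdotZr bS0 mulr0 add0r conjR.
  have [ij|ij] := pselect (j = i); last by rewrite bSS // (@p_perp j i) ?mulr0 //; [case: hz|case: hz'].
  by rewrite -[in bS i](ij) bS_dot.
- rewrite /= (dil_bS (proj1 hz) ez En); suff -> : hdot z (tt n z') = 0 by rewrite !mulr0.
  have [ij|ij] := pselect (i = j); last first.
    by rewrite (@p_perp j i) ?e_fix0 //; [move=> e; apply: ij|case: hz].
  by case: _ / ij hz => hz; rewrite hdotC (proj2 hz) // conjC0.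
Qed.

Lemma dil_bS_cre j (n : M j) z : E n = 0 -> ee j z = z -> adj V (bS j (tt n z)) = g *: tt n z.
Proof.
move=> En ez; have e0 := e_fix0 En ez.
apply: (total_ext g_total) => x; rewrite -(adjPr _ _ dil_bop) hdotZl.
case: x => [z' hz'|i z' hz'|i n' z' En' ez'].
- by rewrite /= dil_vac // bS0 hdotC (@e_perp j) ?conjC0 ?mulr0.
- rewrite /= (dil_sig hz') hdotDr !hdotZr bS0 mulr0 add0r conjR.
  have [ij|ij] := pselect (i = j); last first.
    have ji : j <> i by move=> e; apply: ij.
    by rewrite bSS // (p_perp ji e0 (proj1 hz')) !mulr0.
  case: _ / ij n En z ez e0 => n En z ez e0; rewrite bS_dot (proj2 hz') // !mulr0 //.
- by rewrite /= (dil_bS e0 ez' En').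
Qed.

Lemma dil_bS_e j z : ee j z = z -> adj V (bS j z) = 0.
Proof.
move=> ez; apply: (total_ext g_total) => x; rewrite -(adjPr _ _ dil_bop) hdot0l.
case: x => [z' hz'|i z' hz'|i n z' En ez'].
- by rewrite /= dil_vac // bS0.
- rewrite /= (dil_sig hz') hdotDr !hdotZr bS0 mulr0 add0r.
  have [ij|ij] := pselect (j = i); last by rewrite bSS // mulr0.
  by case: _ / ij hz' => hz'; rewrite bS_dot (e_perp ez) ?mulr0 //; case: hz'.
- rewrite /= (dil_cre En ez') !hdotDr !hdotZr bS0 mulr0 add0r.
  have -> : hdot (bS j z) (al (lam n) (V z')) = 0.
    have [ij|ij] := pselect (i = j).
      by rewrite hdotC -ij lam_perp_bS ?conjC0 //; exact: dil_EE.
    by apply: (lam_perpr En (dil_EE ez')); apply: bS_EE => e; apply: ij.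
  rewrite mulr0 addr0; have [ij|ij] := pselect (j = i); last by rewrite bSS // mulr0.
  by case: _ / ij n En ez' => n En ez'; rewrite bS_dot (e_perp ez) ?mulr0 // e_fix0.
Qed.

(** A total set adapted to one index, that of the last letter of a word. *)
Lemma ej_total j : total [set z | [\/ ee j z = z, sig j z | exists (n : M j) z', [/\ E n = 0, ee j z' = z' & z = tt n z']]].
Proof.
move=> w hw; have ew : ee j w = 0.
  apply: hdot_eq0; rewrite tp_eH tp_ee hdotC; rewrite (hw (ee j w)) ?conjC0 //; apply: Or31; exact: tp_ee.
apply: hdot_eq0; apply: (hw w); apply: Or32; split=> // n z' En ez'.
by apply: hw; apply: Or33; exists n, z'.
Qed.

Lemma dil_lam_b0 j (n : M j) z : E n = 0 -> ee j z = 0 -> adj V (al (lam n) (b0 z)) = 0.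
Proof.
move=> En ez; apply: (total_ext g_total) => x; rewrite -(adjPr _ _ dil_bop) hdot0l.
have other i y : i <> j -> ee i (gz y) = 0 -> hdot (al (lam n) (b0 z)) (V (gz y)) = 0.
  by move=> ij ey; apply: (lam_perp En (@b0_EE _ _)); apply: dil_EE; exact: p_e ij ey.
case: x => [z' hz|i z' hz|i n' z' En' ez'].
- by rewrite /= dil_vac //; exact: (lam_perp En (@b0_EE _ _) (@b0_EE _ _)).
- have [ij|ij] := pselect (i = j); last by apply: (other i) => //; case: hz.
  case: _ / ij n z En ez other => n z En ez other /=.
  rewrite (dil_sig hz) hdotDr !hdotZr (lam_perp En (@b0_EE _ _) (@b0_EE _ _)).
  by rewrite (lam_perp_bS _ _ (@b0_EE _ _)) !mulr0 addr0.
- have [ij|ij] := pselect (i = j); last by apply: (other i) => //=; rewrite e_fix0.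
  case: _ / ij n z En ez other => n z En ez other /=.
  rewrite (dil_cre En' ez') !hdotDr !hdotZr (lam_perp En (@b0_EE _ _) (@b0_EE _ _)).
  rewrite (lam_perp_bS _ _ (@b0_EE _ _)) !mulr0 !add0r.
  rewrite -{1}[n']starK lamS -(rep_star _ _ _ al_rep) -(repM _ _ _ al_rep) -lamM.
  rewrite (EE_E fmT _ (@b0_EE _ _) (dil_EE ez')) al_b0 (adjPr _ _ dil_bop).
  have e0 : ee i (tB (E (star n' ** n)) z) = 0 by rewrite tp_eB ez (lin0 (rep_lin _ (tp_rB t))).
  by rewrite (dil_b0 e0) hdotZl hdotC (e_perp ez' e0) conjC0 !mulr0.
Qed.

(** The last letter [n] meets [V z]. If [z] is fixed by [e j] or lies in [sig j], one factor [s]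
    appears and [dil_chain] does the rest. If [z = n' z'] is created, the product of [n] and [n']
    has a centred part and a part in [B]; the latter leaves a shorter word, hence the induction on
    the length. *)
Lemma dil_word w z : red None w -> adj V (al (wv w) (V z)) = sc ^+ size w *: tw w z.
Proof.
move: z; have [m] := ubnP (size w); elim: m w => // m IH w; rewrite ltnS => hs z rw.
case/lastP: w hs rw => [_ _|w [j n]]; first by rewrite /= im_al1 dil_adj expr0 scale1r.
rewrite size_rcons => hs rw; have [rj En _] := red_rcons rw; rewrite /= in rj En.
have twr u h : tw (rcons u (Tagged M n)) h = tw u (tt n h) by elim: u => //= x u ->.
have twlin u : bop (tw u).
  by elim: u => [|x u IHu]; [exact: bop_id|apply: bop_comp IHu; exact: rep_bop (tp_rep t _)].
rewrite wv_rcons; set T := fun z => adj V (al (wv w ** lv (Tagged M n)) (V z)).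
have bT : bop T by apply: bop_comp (bop_adj dil_bop) (bop_comp (rep_bop _ al_rep) dil_bop).
have bT' : bop (fun z => sc ^+ (size w).+1 *: tw (rcons w (Tagged M n)) z).
  have := bop_comb (sc ^+ (size w).+1) (twlin (rcons w (Tagged M n))) (bop0 _ _).
  by rewrite (_ : (fun v => _) = fun z => sc ^+ (size w).+1 *: tw (rcons w (Tagged M n)) z) //; apply/funext => v; rewrite addr0.
apply: (bop_ext bT bT' (@ej_total j)) => {}z hz; rewrite /T (repM _ _ _ al_rep) /lv /= twr.
have fin k h : (forall i, i <> j -> EEt i k /\ ee i h = h) -> adj V k = sc *: h ->
    adj V (al (wv w) k) = sc ^+ (size w).+1 *: tw w h.
  move=> hi kh; have [|-> _] := @dil_chain j w k (sc *: h) rj _ kh.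
    by move=> i /hi[h1 h2]; split=> //; rewrite (linZ _ _ (@tp_elin _ _ _ t i)) h2.
  by rewrite (linZ _ _ (twlin w).1) scalerA -exprSr.
case: hz => [ez|hz|[n' [z' [En' ez' ->]]]].
- apply: fin; last by rewrite (dil_V3 En (dil_EE ez) ez (dil_adj z)).
  move=> i ij; split; first by apply: (EE_lam En) (dil_EE ez) => e; apply: ij.
  by apply: (@p_e j) => [e|]; [apply: ij|exact: e_fix0].
- have hz' := sigP n hz; rewrite (dil_sig hz) (linD _ _ (rep_lin _ al_rep)) !(linZ _ _ (rep_lin _ al_rep)) al_bS.
  apply: fin.
    move=> i ij; split; last by apply: (@p_e j) => [e|]; [apply: ij|case: hz'].
    apply: EE_lin; first by apply: (EE_lam En) (@b0_EE _ _) => e; apply: ij.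
    rewrite -[_ *: _]addr0; apply: EE_lin; [apply: bS_EE => e; exact: ij|exact: cspan0].
  have bA := bop_adj dil_bop; rewrite (linD _ _ bA.1) !(linZ _ _ bA.1) (dil_bS_sig hz') scalerA rr.
  by rewrite (dil_lam_b0 En (proj1 hz)) scaler0 add0r.
- have ra := tp_rep t j; have la := rep_lin _ al_rep; have eu := e_fix0 En' ez'; have rw0 := red_weak rj.
  set x := n ** n'; have Ec := ctr0 x; set b := E x.
  (* [k0] is all of [al (lam n) (V z)] except the part of [x] in [B], which gives again a value of
     [V]. *)
  pose k0 := a *: al (lam n) (b0 (tt n' z')) + g *: bS j (tt x z') + sc *: al (lam (ctr x)) (V z').
  have -> : al (lam n) (V (tt n' z')) = k0 + sc *: V (tB b z').
    rewrite (dil_cre En' ez') !(linD _ _ (la _)) !(linZ _ _ (la _)) al_bS -(repM _ _ _ al_rep) -lamM.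
    rewrite -(repM _ _ _ ra) -/x (lam_ctr x) (repD _ _ _ al_rep) -dil_B scalerDr /k0 -/b.
    by rewrite !addrA.
  have xE : tt x z' = tt (ctr x) z' + tB b z' by rewrite {1}(ctrE x) (repD _ _ _ ra) tp_io.
  have bA := bop_adj dil_bop.
  have k0h : adj V k0 = sc *: tt (ctr x) z'.
    rewrite /k0 !(linD _ _ bA.1) !(linZ _ _ bA.1) (dil_lam_b0 En eu) scaler0 add0r.
    rewrite xE (linD _ _ (@bS_lin j)) (linD _ _ bA.1) (dil_bS_cre Ec ez') dil_bS_e ?tp_eB ?ez' // addr0.
    (* The identity [g^2 + s^2 = s]. *)
    rewrite (dil_V3 Ec (dil_EE ez') ez' (dil_adj z')) !scalerA -scalerDl gg; congr (_ *: _); ring.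
  have f0 : adj V (al (wv w) k0) = sc ^+ (size w).+1 *: tw w (tt (ctr x) z').
    apply: fin k0h => i ij; have ji : j <> i by move=> e; apply: ij.
    split; last by apply: p_e ji _; exact: e_fix0.
    rewrite /k0 -addrA; apply: EE_lin; first exact: (EE_lam En ji (@b0_EE _ _)).
    apply: EE_lin; first exact: bS_EE.
    by rewrite -[_ *: _]addr0; apply: EE_lin; [exact: (EE_lam Ec ji (dil_EE ez'))|exact: cspan0].
  rewrite (linD _ _ (la _)) (linD _ _ bA.1) f0 (linZ _ _ (la _)) (linZ _ _ bA.1) (IH _ hs _ rw0) scalerA -exprS.
  by rewrite -scalerDr -(linD _ _ (twlin w).1) -xE /x (repM _ _ _ ra).
Qed.

End Step.
End Dilation.

Section StrongLim.
Variable R : realType.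
Implicit Types (H K : hilbertType R).

Lemma strong_lim H K (T : nat -> H -> K) (T0 : H -> K) (S : set H) :
  (forall n, linear (T n)) -> linear T0 -> (forall n v, nm (T n v) = nm v) -> (forall v, nm (T0 v) = nm v) ->
  total S -> (forall v, S v -> nlim (fun n => T n v) (T0 v)) -> forall v, nlim (fun n => T n v) (T0 v).
Proof.
move=> lT lT0 nT nT0 tS hS v e e0.
have [w sw hw] := span_approx (total_cspan _ v tS) (divr_gt0 e0 (ltr0n _ 3)).
have [n0 hn0] : exists n0, forall n, (n0 <= n)%N -> nm (T n w - T0 w) < e / 3.
  have : nlim (fun n => T n w) (T0 w); last by apply; rewrite divr_gt0.
  elim: sw => [|c x y Sx _ IH].
    by rewrite (lin0 lT0); under eq_fun do rewrite (lin0 (lT _)); exact: nlim_cst.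
  by rewrite lT0; under eq_fun do rewrite lT; apply: nlimD => //; apply: nlim_scale; exact: hS.
exists n0 => n hn; have := hn0 n hn.
have := nm_tri (T n w) (T n v) (T0 v); have := nm_tri (T0 w) (T n w) (T0 v).
rewrite -!(linB _ _ (lT n)) -!(linB _ _ lT0) nT nT0 nmBC [nm (w - v)]nmBC; lra.
Qed.

End StrongLim.

(** Normality of the embedding on [vn_space M] passes to the amplification of [M], which is spanned
    by copies of that space, and domination is transitive. *)
Lemma emb_dom (R : realType) (P M : vonNeumann R) (f : P -> M) (W : hilbertType R) (al : M -> W -> W) w :
  vn_embedding f -> dom al w -> dom (fun x => al (f x)) w.
Proof.
move=> [hf f1 _ uf] [xi hx]; have rm := @am_rep R M.
have [|ze hz] := @dom_total R P (HH M) (fun x => am (f x)) _ (comp_rep hf rm) (@aj_total R M) _ xi.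
  move=> _ [[k h] _ <-] /=; have [ze hz] := uw_dom (comp_rep hf (@vn_rep_rep R M)) uf h.
  exists ze => x; apply: le_trans (hz x).
  by rewrite -ler_sqr ?nnegrE ?nm_ge0 // -!Re_hdotxx am_aj aj_dot eqxx.
by exists ze => x; exact: le_trans (hx _) (hz x).
Qed.

Section RightAction.
Variables (R : realType) (I : Type) (F : fpdata R I) (t : toep F).
Local Notation B := (fpB F).
Local Notation M := (fpM F).
Local Notation N := (fpN F).
Local Notation iN := (@fp_iN R I F).
Local Notation lam := (@fp_lam R I F).
Local Notation EN := (@fpEN R I F).
Local Notation Z := (tp_Z t).
Local Notation tB := (@tp_tB _ _ _ t).
Local Notation tt := (@tp_t _ _ _ t).
Local Notation ee := (@tp_e _ _ _ t).
Local Notation al := (im_al (nn t)).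

Lemma nn_dom : (forall l z, dom (@tp_t _ _ _ t l) z) -> forall w, dom al w.
Proof.
move=> ht; apply: indmod_dom => -[l|] z /=.
  exact: ce_dom_ind (El_ce F l) (@El_dom _ _ F l) (tp_rep t l) (ht l z).
apply: ce_dom_ind (@ENce _ _ F) (@EN_dom _ _ F) (tp_rB t) _.
have [xi hx] := emb_dom (fp_io_emb F (fp_i0 F)) (ht (fp_i0 F) z).
by exists xi => b; rewrite -(tp_io (fp_i0 F)).
Qed.

Variables (Q T' : cstarType R) (tens' : N -> Q -> T') (rho : Q -> Z -> Z).
Hypotheses (mt : is_min_tensor tens') (rr : is_rep rho).
Hypothesis ct : forall l (m : M l) y z, tt m (rho y z) = rho y (tt m z).
Hypothesis ce : forall l y z, ee l (rho y z) = rho y (ee l z).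
Hypothesis nice : forall l (X : seq (M l * Q)) z,
  nm (lact (@tp_t _ _ _ t l) rho X z) <= nm (tsum tens' [seq (lam p.1, p.2) | p <- X]) * nm z.

(** The coefficients of [1 (x) z] see a list through an expectation onto [M l] or [B], contractive
    by [ce_tens]; [B] is treated inside [M fp_i0]. Dilations commute with the action of [Q] by
    [dil_com]. *)
Lemma nn_right : exists be : Q -> im_W (nn t) -> im_W (nn t),
  [/\ is_rep be, forall X w, nm (lact al be X w) <= nm (tsum tens' X) * nm w,
      forall a y w, al a (be y w) = be y (al a w) &
      forall s (V : Z -> im_W (nn t)), 0 < s -> s < 1 -> dilation s V -> forall y z, V (rho y z) = be y (V z)].
Proof.
have cB b y z : tB b (rho y z) = rho y (tB b z) by rewrite -!(tp_io (fp_i0 F)) ct.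
have cE o x y z : EhT o x (rho y z) = rho y (EhT o x z) by case: o => [l|] /=; rewrite ?ct ?cB.
have [be [rb bb cb]] := indmod_right (nn t) (fm_cp (fmT t)) rr cE.
exists be; split=> //.
  apply: (indmod_nice mt rb bb cb) => o z; exists (nm z ^+ 2) => X.
  have key l Y : [seq (lam p.1, p.2) | p <- Y] = [seq (if o is Some l then lam (El l p.1) else iN (EN p.1), p.2) | p <- X] ->
      \sum_(p <- X) hdot (EhT o p.1 (rho p.2 z)) z = hdot (lact (@tp_t _ _ _ t l) rho Y z) z ->
      complex.Re (\sum_(p <- X) hdot (EhT o p.1 (rho p.2 z)) z) <= nm z ^+ 2 * nm (tsum tens' X).
    move=> e1 ->; apply: le_trans (Re_hdot_le _ _) _.
    apply: le_trans (ler_wpM2r (nm_ge0 _) (nice Y z)) _.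
    rewrite -mulrA -expr2 mulrC ler_wpM2l ?sqr_ge0 // e1.
    case: (o) => [i|]; first exact: (ce_tens mt (@lam_hom _ _ F i) (lam1 F i) (El_ce F i)).
    exact: (ce_tens mt (@iN_hom _ _ F) (iN1 F) (@ENce _ _ F)).
  case: o key => [l|] key.
    apply: (key l [seq (El l p.1, p.2) | p <- X]); first by rewrite -map_comp.
    by rewrite /lact big_map hdot_suml.
  apply: (key (fp_i0 F) [seq (fp_io (fp_i0 F) (EN p.1), p.2) | p <- X]).
    by rewrite -map_comp; apply: eq_map => p /=; rewrite fp_lam_io.
  by rewrite /lact big_map hdot_suml; apply: eq_bigr => p _; rewrite tp_io.
move=> s V s0 s1 dV y z.
apply: (dil_com s0 s1 dV (rho' := rho (star y)) (be := be y)) => //; try exact: rep_bop.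
- by move=> u v; rewrite (rep_star _ _ _ rr).
- move=> j v hv u hu; rewrite (rep_star _ _ _ rb); apply: hv => _ [o [w [z' [rw hw ->]]]].
  by rewrite -(rep_star _ _ _ rb) bb; apply: hu; exists o, w, (rho y z').
Qed.

End RightAction.

(** * Strong convergence of the dilations on the module of the free product *)

Section Limit.
Variables (R : realType) (I : Type) (F : fpdata R I).
Local Notation N := (fpN F).
Local Notation D := (im_W (d1 F)).
Local Notation t1 := (toep_d1 F).
Local Notation al := (im_al (nn t1)).

Lemma d1_nn_dom w : dom al w.
Proof.
by apply: nn_dom => l z; exact: emb_dom (fp_lam_emb F l) (d1_dom (z : D)).
Qed.

Let vacv h : tp_Z t1 := d1v cone h.

Lemma d1_vac h : vac (vacv h).
Proof. by move=> j; have := @d1e_word _ _ F j [::] h Logic.I; apply. Qed.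

Lemma dil_lim : exists (s : nat -> R) (V : nat -> tp_Z t1 -> im_W (nn t1)) (J : tp_Z t1 -> im_W (nn t1)),
  [/\ forall k, [/\ 0 < s k, s k < 1 & dilation (s k) (V k)],
      forall x y, hdot (J x) (J y) = hdot x y,
      forall n x, al n (J x) = J (im_al (d1 F) n x) &
      forall x, nlim (fun k => V k x) (J x)].
Proof.
have ra := im_rep (nn t1).
have jd (p q : N * vn_space (fpB F)) : hdot (al p.1 (b0 (vacv p.2))) (al q.1 (b0 (vacv q.2))) = hdot (d1v p.1 p.2) (d1v q.1 q.2).
  rewrite /b0 !im_alE !cmulr1 im_dot /= /vacv al_d1v !d1v_dot star1 cmul1r cmulr1.
  by have [_ hE _ _] := @ENce _ _ F; rewrite hE.
have [J [lJ nJ hJ]] := lift_isom (@d1v_total _ _ F) jd.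
have bJ : bop J by split=> //; exists 1 => v; rewrite nJ mul1r.
(* Halving keeps [s 0] positive. *)
pose s k : R := 1 - iv R k / 2.
have sP k : 0 < s k /\ s k < 1.
  have h := iv_gt0 R k; have h1 : iv R k <= 1 by rewrite /iv invf_le1 ?ler1n.
  by rewrite /s; split; lra.
have /choice[V dV] : forall k, exists V : tp_Z t1 -> im_W (nn t1), dilation (s k) V.
  by move=> k; have [h1 h2] := sP k; exact: dilation_ex.
have bV k : bop (V k) by exact: dil_bop (dV k).
have nV k z : nm (V k z) = nm z.
  by apply/eqP; rewrite -(@eqrXn2 _ 2) ?nm_ge0 // -!Re_hdotxx (dil_dot (dV k)).
have nJ' x y : hdot (J x) (J y) = hdot x y by exact: isom_hdot.
have cJ n x : al n (J x) = J (im_al (d1 F) n x).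
  have rd := im_rep (d1 F).
  apply: (bop_ext (bop_comp (rep_bop _ ra) bJ) (bop_comp bJ (rep_bop _ rd)) (@d1v_total _ _ F)) => _ [p _ <-] /=.
  by rewrite al_d1v (hJ p) (hJ (n ** p.1, p.2)) /= (repM _ _ _ ra).
exists s, V, J; split=> //; first by move=> k; have [] := sP k.
have small (W : normedModType R[i]) (u : nat -> W) : (exists K, forall k, nm (u k) ^+ 2 <= K * iv R k) -> nlim u 0.
  move=> [K hK] e e0; have K0 : 0 <= K.
    by have := le_trans (sqr_ge0 _) (hK 0%N); rewrite pmulr_lge0 // iv_gt0.
  have [n0 hn] : exists N, forall n, (N <= n)%N -> iv R n < e ^+ 2 / (K + 1).
    by apply: inv_small; rewrite divr_gt0 ?exprn_gt0 //; lra.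
  exists n0 => n /hn; rewrite ltr_pdivlMr; last by lra.
  rewrite subr0 => h; rewrite -ltr_sqr ?nnegrE ?nm_ge0 ?(ltW e0) //.
  by apply: le_lt_trans (hK n) _; have := iv_gt0 R n; lra.
apply: (strong_lim (fun k => (bV k).1) lJ nV nJ (@d1_words _ _ F)) => _ [w [h [rw ->]]].
elim: w rw => [_|[j n] w IH rw].
  rewrite (hJ (cone, h)) /= im_al1; under eq_fun do rewrite (dil_vac (dV _) (d1_vac h)).
  exact: nlim_cst.
have [En hw rw'] := rw; set z := d1v (wv w) h; have ez : tp_e (t := t1) j z = z by exact: d1e_word.
have -> : d1v (wv (Tagged (fpM F) n :: w)) h = tp_t (t := t1) n z by rewrite /= al_d1v.
have -> : J (tp_t (t := t1) n z) = 0 + al (fp_lam n) (J z) by rewrite add0r cJ.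
have eV k : V k (tp_t (t := t1) n z) = ((Num.sqrt (1 - s k))%:C *: b0 (tp_t (t := t1) n z) +
    (Num.sqrt (s k * (1 - s k)))%:C *: bS j (tp_t (t := t1) n z) + (s k - 1)%:C *: al (fp_lam n) (V k z)) +
    al (fp_lam n) (V k z).
  have es (r : R) : (r - 1)%:C = r%:C - 1 :> R[i] by rewrite rmorphB rmorph1.
  by rewrite (dil_cre (dV k) En ez) (es (s k)) scalerBl scale1r -[RHS]addrA subrK.
under eq_fun do rewrite eV.
have [c c0 hc] := bop_ge0 (rep_bop (fp_lam n) ra).
apply: nlimD; last first.
  apply: (@nlim_map _ _ _ (al (fp_lam n)) c) (IH rw') => x y.
  by rewrite -(linB _ _ (rep_lin _ ra)).
have iv1 k : iv R k <= 1 by rewrite /iv invf_le1 ?ler1n.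
have iv0 k := iv_gt0 R k.
rewrite -[X in nlim _ X](addr0 0); apply: nlimD.
  rewrite -[X in nlim _ X](addr0 0); apply: nlimD.
    apply: small; exists (nm (b0 (tp_t (t := t1) n z)) ^+ 2) => k.
    rewrite nmZ nmR0 ?sqrtr_ge0 // exprMn sqr_sqrtr /s; last by have := iv0 k; lra.
    by rewrite mulrC ler_wpM2l ?sqr_ge0 //; have := iv0 k; lra.
  apply: small; exists (nm (bS j (tp_t (t := t1) n z)) ^+ 2) => k.
  rewrite nmZ nmR0 ?sqrtr_ge0 // exprMn sqr_sqrtr; last by have [h1 h2] := sP k; apply: mulr_ge0; lra.
  rewrite mulrC ler_wpM2l ?sqr_ge0 //; have [h1 h2] := sP k.
  by apply: le_trans (ler_piMl _ (ltW h2)) _; rewrite /s; have := iv0 k; lra.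
apply: small; exists ((c * nm z) ^+ 2) => k.
rewrite nmZ nmR exprMn mulrC -normrX ger0_norm ?sqr_ge0 //.
apply: ler_pM; rewrite ?sqr_ge0 //.
  rewrite ler_sqr ?nnegrE ?nm_ge0 ?mulr_ge0 ?nm_ge0 ?(ltW c0) //.
  by apply: le_trans (hc _) _; rewrite nV.
by rewrite /s; have := iv0 k; have := iv1 k; nra.
Qed.

End Limit.

(** * Extension of vector states *)

Section HahnBanach.
Variables (R : realType) (V : lmodType R[i]) (p : V -> R).
Hypothesis pD : forall x y, p (x + y) <= p x + p y.
Hypothesis pZ : forall (r : R) x, 0 <= r -> p (r%:C *: x) = r * p x.

Let eN : (-1)%:C = -1 :> R[i]. Proof. by rewrite rmorphN rmorph1. Qed.

(** Partial functionals are represented by graphs; that they are single-valued is a consequence of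
    domination by [p], as [p 0 = 0]. *)
Let gr (G : set (V * R)) : Prop :=
  [/\ G (0, 0), forall (r : R) q q', G q -> G q' -> G (r%:C *: q.1 + q'.1, r * q.2 + q'.2) &
      forall q, G q -> q.2 <= p q.1].

Let gr_ext (G : set (V * R)) x0 : gr G -> exists G', [/\ gr G', G `<=` G' & exists c, G' (x0, c)].
Proof.
move=> [G0 GL Gp]; pose A := [set q.2 - p (q.1 - x0) | q in G].
have key q q' : G q -> G q' -> q.2 - p (q.1 - x0) <= p (q'.1 + x0) - q'.2.
  move=> h h'; have := Gp _ (GL 1 _ _ h h'); rewrite /= scale1r mul1r.
  have := pD (q.1 - x0) (q'.1 + x0); rewrite addrACA addNr addr0; lra.
have A0 : A !=set0 by exists (0 - p (0 - x0)), (0, 0).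
have Aub q' : G q' -> ubound A (p (q'.1 + x0) - q'.2) by move=> h' _ [q h <-]; exact: key.
pose c := sup A.
have c1 q : G q -> q.2 - p (q.1 - x0) <= c.
  by move=> h; apply: ub_le_sup; [exists (p (0 + x0) - 0); exact: (Aub (0, 0))|exists q].
have c2 q : G q -> c <= p (q.1 + x0) - q.2 by move=> h; apply: ge_sup => //; exact: Aub.
have Gs (r : R) q : G q -> G (r%:C *: q.1, r * q.2).
  by move=> h; have := GL r _ _ h G0; rewrite /= !addr0.
exists [set q | exists q1 (t : R), G q1 /\ q = (q1.1 + t%:C *: x0, q1.2 + t * c)]; split; first split.
- by exists (0, 0), 0; split=> //=; rewrite scale0r mul0r !addr0.
- move=> r _ _ [q [t [h ->]]] [q' [t' [h' ->]]]; exists (r%:C *: q.1 + q'.1, r * q.2 + q'.2), (r * t + t').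
  split; first exact: GL.
  by rewrite /= rmorphD rmorphM /= scalerDr scalerDl scalerA addrACA; congr (_, _); ring.
- move=> _ [q [t [h ->]]] /=; have [t0|t0|->] := ltgtP t 0; last first.
  + by rewrite scale0r mul0r !addr0; exact: Gp.
  + have ti : 0 < t^-1 by rewrite invr_gt0.
    have := c2 _ (Gs t^-1 _ h); rewrite /= => h2.
    have : p (t^-1%:C *: q.1 + x0) = t^-1 * p (q.1 + t%:C *: x0).
      by rewrite -pZ ?(ltW ti) // scalerDr scalerA -rmorphM /= mulVf ?gt_eqF // scale1r.
    move=> e; move: h2; rewrite e -mulrBr mulrC ler_pdivlMr //; lra.
  + have ti : 0 < (- t)^-1 by rewrite invr_gt0 oppr_gt0.
    have := c1 _ (Gs (- t)^-1 _ h); rewrite /= => h2.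
    have : p ((- t)^-1%:C *: q.1 - x0) = (- t)^-1 * p (q.1 + t%:C *: x0).
      rewrite -pZ ?(ltW ti) // scalerDr scalerA -rmorphM /= invrN mulNr mulVf ?lt_eqF //.
      by rewrite eN scaleN1r.
    move=> e; move: h2; rewrite e -mulrBr mulrC ler_pdivrMr ?oppr_gt0 //; lra.
- by move=> q h; exists q, 0; split=> //; rewrite scale0r mul0r !addr0; case: (q).
- by exists c, (0, 0), 1; split=> //=; rewrite scale1r mul1r !add0r.
Qed.

Lemma hahn_banach (G0 : set (V * R)) : G0 (0, 0) ->
  (forall (r : R) q q', G0 q -> G0 q' -> G0 (r%:C *: q.1 + q'.1, r * q.2 + q'.2)) ->
  (forall q, G0 q -> q.2 <= p q.1) ->
  exists f : V -> R, [/\ forall (r : R) x y, f (r%:C *: x + y) = r * f x + f y,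
    forall x, f x <= p x & forall q, G0 q -> f q.1 = q.2].
Proof.
move=> g0 g1 g2; have gG0 : gr G0 by [].
(* The union with [G0] takes care of the empty chain. *)
have [Fs tot|A [gA mA]] := @Zorn_bigcup (V * R)%type (fun A => gr (A `|` G0)).
  move=> totF; have two q q' : (\bigcup_(X in Fs) X `|` G0) q -> (\bigcup_(X in Fs) X `|` G0) q' ->
      exists X, [/\ gr X, X q, X q' & X `<=` \bigcup_(X in Fs) X `|` G0].
    have sub X : Fs X -> X `|` G0 `<=` \bigcup_(X in Fs) X `|` G0.
      by move=> FX x [Xx|Gx]; [left; exists X|right].
    move=> [[X FX Xq]|Gq] [[Y FY Yq]|Gq'].
    - have [XY|YX] := totF _ _ FX FY.
        by exists (Y `|` G0); split; [exact: tot|left; exact: XY|left|exact: sub].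
      by exists (X `|` G0); split; [exact: tot|left|left; exact: YX|exact: sub].
    - by exists (X `|` G0); split; [exact: tot|left|right|exact: sub].
    - by exists (Y `|` G0); split; [exact: tot|right|left|exact: sub].
    - by exists G0; split=> // x; right.
  split; first by right.
    by move=> r q q' h h'; have [X [[_ XL _] Xq Xq' sX]] := two _ _ h h'; apply: sX; exact: XL.
  by move=> q h; have [X [[_ _ Xp] Xq _ _]] := two _ _ h h; exact: Xp.
set G := A `|` G0 in gA; have [h0 GL Gp] := gA.
have dom x : exists r, G (x, r).
  apply: contrapT => nx; have [G' [gG' sG [c hc]]] := gr_ext x gA.
  apply: (mA G'); last by rewrite setUidl // => q Gq; apply: sG; right.
  split; first by move=> q Aq; apply: sG; left.
  by move=> sA; apply: nx; exists c; left; exact: sA.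
have uniq x r r' : G (x, r) -> G (x, r') -> r = r'.
  have le r1 r2 : G (x, r1) -> G (x, r2) -> r1 <= r2.
    move=> h1 h2; have := Gp _ (GL (-1) _ _ h2 h1); rewrite /= eN scaleN1r addNr.
    rewrite mulN1r; have := pZ 0 (lexx 0); rewrite scale0r mul0r => -> ; lra.
  by move=> h1 h2; apply/eqP; rewrite eq_le !le.
have [f hf] := choice dom.
exists f; split=> [r x y|x|q Gq]; last by apply: (uniq q.1) => //; right; rewrite -surjective_pairing.
  by apply: (uniq (r%:C *: x + y)) => //; exact: (GL r _ _ (hf x) (hf y)).
exact: (Gp _ (hf x)).
Qed.

End HahnBanach.

Section GNS.
Variable R : realType.
Local Notation C := R[i].
Implicit Types (H K D L : hilbertType R) (A : cstarType R).

Let ReN (z : C) : complex.Re (- z) = - complex.Re z. Proof. by case: z. Qed.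
Let ReB (z w : C) : complex.Re (z - w) = complex.Re z - complex.Re w. Proof. by case: z w => ? ? []. Qed.
Let ReD (z w : C) : complex.Re (z + w) = complex.Re z + complex.Re w. Proof. by case: z w => ? ? []. Qed.

Definition ev D (f : BH D) (v : D) : D := (f : bopT D) v.

Lemma ev_rep D : is_rep (@ev D). Proof. by case: (@BH_id_rep R D). Qed.

Lemma ev_inj D : injective (@ev D). Proof. by case: (@BH_id_rep R D). Qed.

Section State.
Variables (D : hilbertType R) (U : set D) (G0 : set (BH D * R)) (c0 : R).
Hypotheses (U0 : U 0) (UZ : forall c d, U d -> U (c *: d)) (c00 : 0 <= c0) (g0 : G0 (0, 0)).
Hypothesis gL : forall (r : R) q q', G0 q -> G0 q' -> G0 (r%:C *: q.1 + q'.1, r * q.2 + q'.2).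
Hypothesis gp : forall q k, G0 q -> (forall d, U d -> complex.Re (hdot (ev q.1 d) d) <= k * nm d ^+ 2) -> q.2 <= c0 * k.

Let A (x : BH D) := [set complex.Re (hdot (ev x d) d) | d in [set d | U d /\ nm d <= 1]].
Let P x := sup (A x).

Let Aub x : ubound (A x) (nm x).
Proof.
move=> _ [d [_ d1] <-]; apply: le_trans (Re_hdot_le _ _) _.
apply: le_trans (ler_wpM2r (nm_ge0 _) (BH_le x d)) _; rewrite -mulrA -[leRHS]mulr1 ler_wpM2l ?nm_ge0 //.
by have := nm_ge0 d; nra.
Qed.

Let A0 x : A x !=set0.
Proof. by exists (complex.Re (hdot (ev x 0) 0)), 0 => //; split=> //; rewrite nm0. Qed.

Let Pub x d : U d -> nm d <= 1 -> complex.Re (hdot (ev x d) d) <= P x.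
Proof. by move=> ud d1; apply: ub_le_sup; [exists (nm x); exact: Aub|exists d]. Qed.

Let Ple x k : (forall d, U d -> nm d <= 1 -> complex.Re (hdot (ev x d) d) <= k) -> P x <= k.
Proof. by move=> h; apply: ge_sup => // _ [d [ud d1] <-]; exact: h. Qed.

Let evD (x y : BH D) d : ev (x + y) d = ev x d + ev y d. Proof. exact: repD _ _ _ (@ev_rep D). Qed.
Let evZ c (x : BH D) d : ev (c *: x) d = c *: ev x d. Proof. exact: repZ _ _ _ (@ev_rep D). Qed.

Let PD x y : P (x + y) <= P x + P y.
Proof. by apply: Ple => d ud d1; rewrite evD hdotDl ReD lerD // Pub. Qed.

Let PZ (r : R) x : 0 <= r -> P (r%:C *: x) = r * P x.
Proof.
have le (r' : R) y : 0 <= r' -> P (r'%:C *: y) <= r' * P y.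
  by move=> h; apply: Ple => d ud d1; rewrite evZ hdotZl Re_real_mul ler_wpM2l // Pub.
rewrite le_eqVlt => /orP[/eqP <-|r0].
  apply/eqP; rewrite eq_le le //= mul0r scale0r.
  by have := @Pub 0 0 U0; rewrite nm0 hdot0r => ->.
apply/eqP; rewrite eq_le le ?(ltW r0) //=.
have := le r^-1 (r%:C *: x); rewrite scalerA -rmorphM /= mulVf ?gt_eqF // scale1r invr_ge0 (ltW r0) => /(_ isT).
by rewrite mulrC ler_pdivlMr // mulrC.
Qed.

Let Pnm x d : U d -> complex.Re (hdot (ev x d) d) <= P x * nm d ^+ 2.
Proof.
move=> ud; have [d0|d0] := eqVneq (nm d) 0.
  by rewrite d0 (nm0_eq0 d0) hdot0r expr0n mulr0.
have dp : 0 < nm d by rewrite lt_neqAle eq_sym d0 nm_ge0.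
have := @Pub x ((nm d)^-1%:C *: d) (UZ _ ud).
rewrite nmZ nmR0 ?invr_ge0 ?nm_ge0 // mulVf // lexx => /(_ isT).
rewrite (linZ _ _ (rep_lin x (@ev_rep D))) hdotZl hdotZr conjR !Re_real_mul mulrA -expr2 exprVn.
by rewrite mulrC ler_pdivrMr // exprn_gt0.
Qed.

Let i0 : C := 0 +i* 1.

(** Hahn-Banach extends the functional under the bound [c0 * P x]; this bound makes the extension
    positive and hermitian, and the GNS construction applies. The set [U] allows for representations
    whose unit acts as a proper projection. *)
Lemma state_gns : exists K (Pi : BH D -> K -> K) (Om : K),
  [/\ is_rep Pi, forall v, Pi cone v = v & forall q, G0 q -> complex.Re (hdot (Pi q.1 Om) Om) = q.2].
Proof.
have [|||f [fL fp fG]] := @hahn_banach R (BH D) (fun x => c0 * P x) _ _ G0 g0 gL.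
- by move=> x y; rewrite -mulrDr ler_wpM2l.
- by move=> r x r0; rewrite PZ // mulrCA.
- by move=> q Gq; apply: gp => // d; exact: Pnm.
have f0 : f 0 = 0 by have := fL 1 0 0; rewrite scaler0 addr0; lra.
have fD x y : f (x + y) = f x + f y by have := fL 1 x y; rewrite scale1r mul1r.
have fZ (r : R) x : f (r%:C *: x) = r * f x by have := fL r x 0; rewrite !addr0 f0 addr0.
have fN x : f (- x) = - f x by have := fD x (- x); rewrite subrr f0; lra.
have fle x : (forall d, complex.Re (hdot (ev x d) d) <= 0) -> f x <= 0.
  by move=> h; apply: le_trans (fp x) _; rewrite mulr_ge0_le0 //; apply: Ple => d *; exact: h.
have fS x : f (star x) = f x.
  have z y : (forall d, complex.Re (hdot (ev y d) d) = 0) -> f y = 0.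
    move=> h; apply/eqP; rewrite eq_le fle /=; last by move=> d; rewrite h.
    rewrite -oppr_le0 -fN; apply: fle => d; by rewrite -scaleN1r evZ hdotZl mulN1r ReN h oppr0.
  apply/eqP; rewrite -subr_eq0 -fN -fD; apply/eqP/z => d.
  rewrite (repB _ _ _ (@ev_rep D)) hdotBl (rep_starl _ _ _ (@ev_rep D)) ReB /=.
  by rewrite hdotC ReJ subrr.
have i00 : i0 * i0 = -1 by apply/eqP; rewrite eq_complex /=; apply/andP; split; apply/eqP; ring.
(* The complex-linear functional with real part [f]. *)
pose phi x : C := f x +i* (- f (i0 *: x)).
have phiL : linear phi.
  move=> c x y; have ce : c *: x = (complex.Re c)%:C *: x + (complex.Im c)%:C *: (i0 *: x).
    rewrite scalerA -scalerDl; congr (_ *: _); case: (c) => a b.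
    by apply/eqP; rewrite eq_complex /=; apply/andP; split; apply/eqP; ring.
  have ice : i0 *: (c *: x) = (complex.Re c)%:C *: (i0 *: x) + (- complex.Im c)%:C *: x.
    rewrite ce scalerDr; congr (_ + _); rewrite !scalerA; first by rewrite mulrC.
    by rewrite mulrAC i00 mulN1r -rmorphN.
  apply/eqP; rewrite eq_complex /phi scalerDr !fD ice ce !fD !fZ; case: (c) => a b /=.
  by apply/andP; split; apply/eqP; ring.
have phiS x : phi (star x) = (phi x)^*.
  have e : i0 *: star x = - star (i0 *: x).
    rewrite starZ -scaleNr; congr (_ *: _).
    by apply/eqP; rewrite eq_complex /=; apply/andP; split; apply/eqP; ring.
  by rewrite /phi e fN !fS; apply/eqP; rewrite eq_complex /= !eqxx.
pose k (x y : BH D) := phi (star y ** x).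
have psd : psd_kernel k.
  split=> [x y|L]; first by rewrite /k -phiS starM starK.
  set s := lc id L; have -> : kform k L L = phi (star s ** s).
    rewrite /s /lc cmul_sumr (linS _ _ phiL); apply: eq_bigr => p _.
    rewrite star_sum cmul_suml (linS _ _ phiL); apply: eq_bigr => r _.
    by rewrite starZ cmulZr cmulZl !(linZ _ _ phiL) -[LHS]mulrA.
  change (0 <= f (star s ** s)); rewrite -oppr_le0 -fN; apply: fle => d.
  rewrite -scaleN1r evZ hdotZl mulN1r ReN oppr_le0 (repM _ _ _ (@ev_rep D)) (rep_starl _ _ _ (@ev_rep D)).
  by rewrite Re_hdotxx sqr_ge0.
have [K [g [gd gt]]] := kernel_space psd.
have [||| Pi [rP hP]] := @rep_ext R (BH D) K (BH D) g (fun a x => a ** x) gt.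
- move=> x c a b; apply: (total_ext gt) => y.
  by rewrite hdotDl hdotZl !gd /k cmulDl cmulZl cmulDr cmulZr phiL.
- by move=> a b x; rewrite cmulA.
- by move=> a x y; rewrite !gd /k starM starK cmulA.
exists K, Pi, (g cone); split=> // [v|q Gq].
  apply: (bop_ext (rep_bop cone rP) (bop_id _) gt) => _ [x _ <-] /=.
  by rewrite hP cmul1r.
by rewrite hP cmulr1 gd /k star1 cmul1r /= fG.
Qed.

End State.

(* With [M = |k - X|], the inequality [Re (k - X) >= 0] is encoded by the norm inequalities
   [|c - (k - X)| <= c + M ^ 2 / 2c] for all [c > 0]. *)
Lemma comp_pos A (D T : cstarType R) (tens : A -> D -> T) (dat : mtdata tens) H1 (P1 : hilbertType R) (t1 : H1 -> md_L dat -> P1) (sg1 : A -> H1 -> H1)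
    (al1 : A -> P1 -> P1) (be1 : D -> P1 -> P1) K (pi : T -> K -> K) v X (k : R) :
  tact t1 sg1 (md_rho dat) al1 be1 -> injective sg1 -> is_rep pi -> pi cone v = v ->
  (forall d, al1 cone (be1 cone d) = d -> complex.Re (hdot (lact al1 be1 X d) d) <= k * nm d ^+ 2) ->
  complex.Re (hdot (pi (tsum tens X) v) v) <= k * nm v ^+ 2.
Proof.
move=> ta isg rp pv hX; have [_ _ _ [ra rb] _] := ta; have com := tact_com ta.
pose u d := al1 cone (be1 cone d).
have uu d : u (u d) = u d by rewrite /u -com -(repM _ _ _ rb) -(repM _ _ _ ra) !cmul1r.
have ul Y d : lact al1 be1 Y (u d) = lact al1 be1 Y d.
  by apply: eq_bigr => p _; rewrite /u -com -(repM _ _ _ rb) -(repM _ _ _ ra) !cmulr1.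
have nu d : nm (u d) <= nm d by apply: le_trans (rep_nm1 _ ra) (rep_nm1 _ rb).
pose Zl := (k%:C *: cone, cone) :: [seq (- p.1, p.2) | p <- X].
have Ze d : u d = d -> lact al1 be1 Zl d = k%:C *: d - lact al1 be1 X d.
  move=> ud; rewrite /lact big_cons big_map (repZ _ _ _ ra) -/(u d) ud; congr (_ + _).
  by rewrite -sumrN; apply: eq_bigr => p _ /=; rewrite -[- p.1]scaleN1r (repZ _ _ _ ra) scaleN1r.
have [M M0 hM] := bop_ge0 (lact_bop Zl ra rb).
have key (c : R) : 0 < c -> nm (c%:C *: cone - tsum tens Zl) <= c + M ^+ 2 / (2 * c).
  move=> c0; pose Y := (c%:C *: cone, cone) :: [seq (- p.1, p.2) | p <- Zl].
  have -> : c%:C *: cone - tsum tens Zl = tsum tens Y.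
    rewrite [RHS]/tsum big_cons big_map (linZ _ _ (@md_linl _ _ _ _ _ dat cone)) (md_one dat); congr (_ + _).
    rewrite /tsum -sumrN; apply: eq_bigr => p _ /=.
    by rewrite -[- p.1]scaleN1r (linZ _ _ (@md_linl _ _ _ _ _ dat p.2)) scaleN1r.
  have b0 : 0 <= c + M ^+ 2 / (2 * c) by rewrite addr_ge0 ?divr_ge0 ?sqr_ge0 ?mulr_ge0 ?(ltW c0).
  apply/(md_nm dat) => //; apply: (tact_transfer ta (md_tact dat) isg b0) => d.
  rewrite -(ul Y d); apply: le_trans (_ : _ <= (c + M ^+ 2 / (2 * c)) * nm (u d)) _; last by rewrite ler_wpM2l.
  move: (u d) (uu d) => {}d ud.
  have -> : lact al1 be1 Y d = c%:C *: d - lact al1 be1 Zl d.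
    rewrite /Y /lact big_cons big_map (repZ _ _ _ ra) -/(u d) ud; congr (_ + _).
    by rewrite -sumrN; apply: eq_bigr => p _ /=; rewrite -[- p.1]scaleN1r (repZ _ _ _ ra) scaleN1r.
  rewrite -ler_sqr ?nnegrE ?nm_ge0 ?mulr_ge0 ?nm_ge0 //.
  rewrite nmsqB nmZ nmR0 ?(ltW c0) // hdotZl Re_real_mul hdotC ReJ {2}(Ze d ud) hdotBl hdotZl ReB /= Re_real_mul Re_hdotxx.
  have h1 := hX d ud; have h2 : nm (lact al1 be1 Zl d) ^+ 2 <= M ^+ 2 * nm d ^+ 2.
    by rewrite -exprMn ler_sqr ?nnegrE ?nm_ge0 ?mulr_ge0 ?nm_ge0 ?(ltW M0).
  have h3 := mulr_ge0 (ltW c0) (_ : 0 <= k * nm d ^+ 2 - complex.Re (hdot (lact al1 be1 X d) d)).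
  have h4 : (c + M ^+ 2 / (2 * c)) ^+ 2 = c ^+ 2 + M ^+ 2 + (M ^+ 2 / (2 * c)) ^+ 2 by field; rewrite gt_eqF.
  rewrite !exprMn h4; have h5 := mulr_ge0 (sqr_ge0 (M ^+ 2 / (2 * c))) (sqr_ge0 (nm d)).
  have h6 : 0 <= k * nm d ^+ 2 - complex.Re (hdot (lact al1 be1 X d) d) by rewrite subr_ge0.
  move: h5 (h3 h6) h2; move: (complex.Re _) (nm d ^+ 2) (nm (lact _ _ _ _) ^+ 2) ((M ^+ 2 / (2 * c)) ^+ 2) => x y z q.
  by nra.
have tZ : complex.Re (hdot (pi (tsum tens Zl) v) v) = k * nm v ^+ 2 - complex.Re (hdot (pi (tsum tens X) v) v).
  rewrite {1}/tsum big_cons big_map (linZ _ _ (@md_linl _ _ _ _ _ dat cone)) (md_one dat) (repD _ _ _ rp) (repZ _ _ _ rp) pv.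
  rewrite hdotDl hdotZl ReD /= Re_real_mul Re_hdotxx; congr (_ + _).
  rewrite -ReN -hdotNl -scaleN1r -(repZ _ _ _ rp); congr (complex.Re (hdot (pi _ _) _)).
  rewrite scaleN1r /tsum -sumrN; apply: eq_bigr => p _ /=.
  by rewrite -[- p.1]scaleN1r (linZ _ _ (@md_linl _ _ _ _ _ dat p.2)) scaleN1r.
rewrite leNgt; apply/negP => hlt; set e := complex.Re (hdot (pi (tsum tens X) v) v) - k * nm v ^+ 2.
have e0 : 0 < e by rewrite subr_gt0.
(* This [c] makes the error [M ^ 2 |v| ^ 2 / 2c] smaller than the excess [e]. *)
pose c := (M ^+ 2 * nm v ^+ 2 + 1) / e.
have Mv : 0 <= M ^+ 2 * nm v ^+ 2 by rewrite mulr_ge0 ?sqr_ge0.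
have c0 : 0 < c by rewrite divr_gt0 //; lra.
have h1 : complex.Re (hdot (pi (c%:C *: cone - tsum tens Zl) v) v) <= (c + M ^+ 2 / (2 * c)) * nm v ^+ 2.
  apply: le_trans (Re_hdot_le _ _) _; rewrite expr2 mulrA ler_wpM2r ?nm_ge0 //.
  by apply: le_trans (rep_contr _ _ rp) _; rewrite ler_wpM2r ?nm_ge0 // key.
move: h1; rewrite (repB _ _ _ rp) (repZ _ _ _ rp) pv hdotBl hdotZl ReB /= Re_real_mul Re_hdotxx tZ mulrDl.
have -> : M ^+ 2 / (2 * c) * nm v ^+ 2 = (M ^+ 2 * nm v ^+ 2) / (2 * c) by ring.
suff : M ^+ 2 * nm v ^+ 2 / (2 * c) < e by rewrite /e; lra.
rewrite ltr_pdivrMr; last by lra.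
by rewrite (_ : e * (2 * c) = 2 * (M ^+ 2 * nm v ^+ 2 + 1)); [lra|rewrite /c; field; rewrite gt_eqF].
Qed.

(** The closed span of [S] as a space of its own, from the kernel given by the inner product of [H].
    The last clause lets operators that preserve [S] be restricted. *)
Lemma subspace_ex H (S : set H) : exists L (j : L -> H),
  [/\ bop j, forall x y, hdot (j x) (j y) = hdot x y, forall x, S x -> j (adj j x) = x,
      total [set l | S (j l)] &
      forall T, bop T -> (forall x, S x -> S (T x)) -> forall l, j (adj j (T (j l))) = T (j l)].
Proof.
pose X := {x | S x}; pose k (x y : X) := hdot (sval x) (sval y).
have psd : psd_kernel k.
  split=> [x y|l]; first exact: hdotC.
  by rewrite /kform -(lc_hdot (fun x : X => sval x) (fun x : X => sval x)) Re_hdotxx sqr_ge0.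
have [L [g [gd gt]]] := kernel_space psd.
have [j [lj nj jg]] := @lift_isom R X L H g (fun x => sval x) gt (fun x y => esym (gd x y)).
have bj : bop j by split=> //; exists 1 => v; rewrite nj mul1r.
have jd x y : hdot (j x) (j y) = hdot x y by exact: isom_hdot.
have ja l : adj j (j l) = l by apply: hdot_ext => z; rewrite -adjPr // jd.
have jS x : S x -> j (adj j x) = x by move=> Sx; rewrite -[x in LHS]/(sval (exist _ x Sx)) -jg ja jg.
exists L, j; split=> //.
  by move=> w hw; apply: gt => _ [[x Sx] _ <-]; apply: hw => /=; rewrite jg.
move=> T bT ST; apply: (bop_ext (bop_comp bj (bop_comp (bop_adj bj) (bop_comp bT bj))) (bop_comp bT bj) gt).
by move=> _ [[x Sx] _ <-] /=; rewrite jg /= jS //; exact: ST.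
Qed.

Lemma rep_hom A H (pi : A -> H -> H) (rp : is_rep pi) : star_hom (fun a => mkb (rep_bop a rp) : BH H).
Proof.
split=> [c a b|a b|a]; apply: bopT_ext => v /=.
- exact: (repL _ rp).
- exact: (repM _ _ _ rp).
- apply: hdot_ext => w; have := rep_starl a v w rp; rewrite /= => ->.
  by rewrite (adjPr _ _ (rep_bop a rp)).
Qed.

End GNS.

(** * Toeplitz modules in the GNS space *)

Section Push.
Variables (R : realType) (I : Type) (F : fpdata R I).
Local Notation C := R[i].
Implicit Types (H K L : hilbertType R).

Section PushDef.
Variables (t : toep F) (K : hilbertType R) (Psi : BH (tp_Z t) -> K -> K).
Hypotheses (rP : is_rep Psi) (P1 : forall v, Psi cone v = v).
Local Notation Z := (tp_Z t).

Lemma tp_ebop i : bop (@tp_e _ _ _ t i).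
Proof.
split; first exact: tp_elin.
exists 1 => v; rewrite mul1r; apply: nm_sq_le; first exact: nm_ge0.
by rewrite -Re_hdotxx tp_eH tp_ee; exact: Re_hdot_le.
Qed.

Let mb f (h : bop f) : BH Z := mkb h.
Let pM f g (hf : bop f) (hg : bop g) v : Psi (mb hf) (Psi (mb hg) v) = Psi (mb (bop_comp hf hg)) v.
Proof. by rewrite -(repM _ _ _ rP); congr (Psi _ v); apply: bopT_ext. Qed.
Let pE f g (hf : bop f) (hg : bop g) v : (forall z, f z = g z) -> Psi (mb hf) v = Psi (mb hg) v.
Proof. by move=> e; congr (Psi _ v); apply: bopT_ext. Qed.
Let eH i : star (mb (tp_ebop i)) = mb (tp_ebop i).
Proof.
by apply: bopT_ext => z /=; rewrite (bop_uadj (tp_ebop i) (g := @tp_e _ _ _ t i)) // => x y; rewrite tp_eH.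
Qed.

(** The Toeplitz relations are identities between operators, so they survive in every unital
    representation of [BH]. *)
Definition toep_push : toep F.
Proof.
apply: (@Toep _ _ F K (fun b => Psi (mb (rep_bop b (tp_rB t)))) (fun i m => Psi (mb (rep_bop m (tp_rep t i)))) (fun i => Psi (mb (tp_ebop i)))).
- exact: comp_rep (rep_hom (tp_rB t)) rP.
- by move=> i; exact: comp_rep (rep_hom (tp_rep t i)) rP.
- by move=> i z; rewrite -[RHS]P1; congr (Psi _ z); apply: bopT_ext => v /=; exact: tp_one.
- by move=> i b z; apply: pE => v; exact: tp_io.
- by move=> i; exact: rep_lin rP.
- by move=> i z z'; rewrite (rep_star _ _ _ rP) eH.
- by move=> i z; rewrite pM; apply: pE => v /=; exact: tp_ee.
- by move=> i b z; rewrite !pM; apply: pE => v /=; exact: tp_eB.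
- move=> i x z z'; have sE u v : hdot u (Psi (mb (tp_ebop i)) v) = hdot (Psi (mb (tp_ebop i)) u) v.
    by rewrite (rep_star _ _ _ rP) eH.
  rewrite !sE !pM; apply: (congr1 (fun v => hdot v z')); apply: pE => v /=; apply: hdot_ext => v'; by rewrite !tp_eH tp_R1.
- move=> i j z ij; have [li _] := tp_ebop i.
  have bT : bop (fun v => -1 *: tp_e (t := t) i v + v) by apply: bop_comb; [exact: tp_ebop|exact: bop_id].
  have -> : z - Psi (mb (tp_ebop i)) z = Psi (mb bT) z.
    rewrite -[X in X - _]P1 -(repB _ _ _ rP); congr (Psi _ z); apply: bopT_ext => v /=.
    by rewrite scaleN1r addrC.
  by rewrite pM; apply: pE => v /=; rewrite scaleN1r addrC tp_R2.
Defined.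

End PushDef.

Section Sub.
Variables (H L : hilbertType R) (S : set H) (j : L -> H).
Hypotheses (bj : bop j) (jd : forall x y, hdot (j x) (j y) = hdot x y).
Hypothesis jT : forall T, bop T -> (forall x, S x -> S (T x)) -> forall l, j (adj j (T (j l))) = T (j l).

Definition hat (T : H -> H) (l : L) : L := adj j (T (j l)).

Lemma adj_j l : adj j (j l) = l.
Proof. by apply: hdot_ext => z; rewrite -adjPr // jd. Qed.

Lemma j_inj x y : j x = j y -> x = y.
Proof. by move=> e; rewrite -(adj_j x) e adj_j. Qed.

Lemma hat_bop T : bop T -> bop (hat T).
Proof. by move=> bT; apply: bop_comp (bop_adj bj) (bop_comp bT bj). Qed.

Lemma hat_rep (A : cstarType R) (pi : A -> H -> H) : is_rep pi -> (forall a x, S x -> S (pi a x)) ->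
  is_rep (fun a => hat (pi a)).
Proof.
move=> rp Sp; have jh a l : j (hat (pi a) l) = pi a (j l) by apply: jT; [exact: rep_bop rp|exact: Sp].
apply: is_repP => [a|v|a b v|a v w]; first exact/hat_bop/rep_bop.
- by move=> c a b; apply: j_inj; rewrite bj.1 !jh (repL _ rp).
- by apply: j_inj; rewrite !jh (repM _ _ _ rp).
- by rewrite -jd jh (rep_starl _ _ _ rp) -jh jd.
Qed.

End Sub.

Section SubToep.
Variables (t : toep F) (L : hilbertType R) (S : set (tp_Z t)) (j : L -> tp_Z t).
Hypotheses (bj : bop j) (jd : forall x y, hdot (j x) (j y) = hdot x y).
Hypothesis jT : forall T, bop T -> (forall x, S x -> S (T x)) -> forall l, j (adj j (T (j l))) = T (j l).
Hypotheses (St : forall i (m : fpM F i) x, S x -> S (tp_t m x)) (Se : forall i x, S x -> S (tp_e i x)).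

Let SB b x : S x -> S (tp_tB b x). Proof. by rewrite -(tp_io (fp_i0 F)); exact: St. Qed.

Lemma hat_t i (m : fpM F i) l : j (hat j (tp_t m) l) = tp_t m (j l).
Proof. by apply: jT; [exact: rep_bop (tp_rep t i)|exact: St]. Qed.
Lemma hat_B b l : j (hat j (tp_tB (t := t) b) l) = tp_tB b (j l).
Proof. by apply: jT; [exact: rep_bop (tp_rB t)|exact: SB]. Qed.
Lemma hat_e i l : j (hat j (tp_e (t := t) i) l) = tp_e i (j l).
Proof. by apply: jT; [exact: tp_ebop|exact: Se]. Qed.

Definition toep_sub : toep F.
Proof.
apply: (@Toep _ _ F L (fun b => hat j (tp_tB b)) (fun i m => hat j (tp_t m)) (fun i => hat j (tp_e i))).
- by apply: (hat_rep bj jd jT (tp_rB t)) => b; exact: SB.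
- by move=> i; apply: (hat_rep bj jd jT (tp_rep t i)) => m; exact: St.
- by move=> i z; apply: (j_inj bj jd); rewrite hat_t tp_one.
- by move=> i b z; apply: (j_inj bj jd); rewrite hat_t hat_B tp_io.
- by move=> i; case: (hat_bop bj (tp_ebop t i)).
- by move=> i z z'; rewrite -!jd !hat_e tp_eH.
- by move=> i z; apply: (j_inj bj jd); rewrite !hat_e tp_ee.
- by move=> i b z; apply: (j_inj bj jd); rewrite !(hat_e, hat_B) tp_eB.
- by move=> i x z z'; rewrite -!jd !(hat_t, hat_B, hat_e) tp_R1.
- by move=> i k z ik; apply: (j_inj bj jd); rewrite hat_e !(linB _ _ bj.1) hat_e tp_R2.
Defined.

End SubToep.
End Push.

(** * The hull of a set of vectors under letters and projections *)

Section Good.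
Variables (R : realType) (I : Type) (F : fpdata R I) (t : toep F).
Local Notation C := R[i].
Local Notation B := (fpB F).
Local Notation M := (fpM F).
Local Notation N := (fpN F).
Local Notation io := (@fp_io R I F).
Local Notation iN := (@fp_iN R I F).
Local Notation lam := (@fp_lam R I F).
Local Notation E := (@fpE R I F).
Local Notation EN := (@fpEN R I F).
Local Notation Z := (tp_Z t).
Local Notation tB := (@tp_tB _ _ _ t).
Local Notation tt := (@tp_t _ _ _ t).
Local Notation ee := (@tp_e _ _ _ t).

Variable K0 : set Z.

(** Letters are applied only to vectors fixed by [e i], where norms are computed through [E]. The
    hull is nevertheless stable under all letters and projections ([gen_t], [gen_e]), because
    [1 - e i] maps into the vectors fixed by the other projections. *)
Inductive gen : Z -> Prop :=
| gen0 : gen 0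
| genD c x y : gen x -> gen y -> gen (c *: x + y)
| genK k : K0 k -> gen k
| genE i k : K0 k -> gen (ee i k)
| genM i (m : M i) z : gen z -> ee i z = z -> gen (tt m z).

Hypothesis Kt : forall i (m : M i) k, K0 k -> K0 (tt m k).

Let genB x y : gen x -> gen y -> gen (x - y).
Proof. by move=> gx gy; rewrite addrC -scaleN1r; exact: genD. Qed.

Let genA x y : gen x -> gen y -> gen (x + y).
Proof. by move=> gx; rewrite -[x]scale1r; exact: genD. Qed.

Let lt i (m : M i) : linear (tt m). Proof. exact: rep_lin (tp_rep t i). Qed.
Let le i : linear (ee i). Proof. exact: tp_elin. Qed.

Let ctrt i (m : M i) z : tt m z = tt (ctr m) z + tB (E m) z.
Proof. by rewrite {1}(ctrE m) (repD _ _ _ (tp_rep t i)) tp_io. Qed.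

Let ctr_e i l (m : M i) z : i <> l -> ee i z = z -> ee l (tt (ctr m) z) = tt (ctr m) z.
Proof. by move=> il ez; apply: (p_e il); rewrite e_fix0 // ctr0. Qed.

Let p_e0 i l z : i <> l -> ee l (z - ee i z) = z - ee i z. Proof. exact: tp_R2. Qed.

Lemma gen_t l (m : M l) z : gen z -> gen (tt m z).
Proof.
move=> gz; elim: gz l m => [|c x y _ IHx _ IHy|k Kk|i k Kk|i n {}z gz IH ez] l m.
- by rewrite (lin0 (lt m)); exact: gen0.
- by rewrite lt; exact: genD.
- by apply: genK; exact: Kt.
- have [il|il] := pselect (i = l).
    by case: _ / il m => m; apply: genM; [exact: genE|exact: tp_ee].
  rewrite -[ee i k](subKr k) (linB _ _ (lt m)); apply: genB; first by apply: genK; exact: Kt.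
  by apply: genM; [apply: genB; [exact: genK|exact: genE]|exact: p_e0].
have [il|il] := pselect (i = l).
  by case: _ / il m => m; rewrite -(repM _ _ _ (tp_rep t i)); exact: genM.
rewrite (ctrt n) (linD _ _ (lt m)); apply: genA.
  by apply: genM; [exact: genM|exact: ctr_e].
by rewrite -(tp_io l) -(repM _ _ _ (tp_rep t l)).
Qed.

Lemma gen_e l z : gen z -> gen (ee l z).
Proof.
elim=> [|c x y _ IHx _ IHy|k Kk|i k Kk|i n {}z gz IH ez].
- by rewrite (lin0 (le l)); exact: gen0.
- by rewrite le; exact: genD.
- exact: genE.
- have [<-|il] := pselect (i = l); first by rewrite tp_ee; exact: genE.
  rewrite -{1}[ee i k](subKr k) (linB _ _ (le l)) (p_e0 _ il).
  by apply: genB; [exact: genE|apply: genB; [exact: genK|exact: genE]].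
rewrite (ctrt n) (linD _ _ (le l)); apply: genA.
  have [il|il] := pselect (i = l); first by rewrite -il e_fix0 ?ctr0 //; exact: gen0.
  by rewrite ctr_e //; exact: genM.
by rewrite tp_eB -(tp_io l); exact: gen_t.
Qed.

(** [P (Some l)] stands for regularity with respect to [M l], and [P None] for regularity with
    respect to [B]. A vector created by [M i] is, up to a part in [B], fixed by [e l] for the other
    [l], and there regularity for [B] suffices. *)
Lemma gen_ind_good (P : option I -> Z -> Prop) :
  (forall o, P o 0) -> (forall o c x y, P o x -> P o y -> P o (c *: x + y)) ->
  (forall l z, P (Some l) z -> P None z) ->
  (forall l z, ee l z = z -> P None z -> P (Some l) z) ->
  (forall l (m : M l) z, P (Some l) z -> P (Some l) (tt m z)) ->
  (forall i z, P None z -> P None (ee i z)) ->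
  (forall l k, K0 k -> P (Some l) k) -> forall z, gen z -> forall l, P (Some l) z.
Proof.
move=> P0 PD Pb Pc Pd Pe Pf.
have PB' o x y : P o x -> P o y -> P o (x - y) by move=> hx hy; rewrite addrC -scaleN1r; exact: PD.
have PA o x y : P o x -> P o y -> P o (x + y) by move=> hx; rewrite -[x]scale1r; exact: PD.
move=> z; elim=> [|c x y _ IHx _ IHy|k Kk|i k Kk|i n {}z gz IH ez] l //; [exact: PD|exact: Pf| |].
  have pn : P None (ee i k) by apply: Pe; apply: (Pb i); exact: Pf.
  have [<-|il] := pselect (i = l); first by apply: Pc => //; exact: tp_ee.
  rewrite -[ee i k](subKr k); apply: (PB' (Some l)); first exact: Pf.
  by apply: Pc; [exact: p_e0|apply: (PB' None) => //; apply: (Pb i); exact: Pf].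
have [il|il] := pselect (i = l); first by rewrite -il; apply: Pd.
rewrite ctrt; apply: PA; last by rewrite -(tp_io l); apply: Pd.
by apply: Pc; [exact: ctr_e|apply: (Pb i); apply: Pd].
Qed.

Lemma nm_tt l (m : M l) z : ee l z = z -> nm (tt m z) ^+ 2 = complex.Re (hdot (tB (E (star m ** m)) z) z).
Proof.
by move=> ez; rewrite -Re_hdotxx e_dot.
Qed.

Lemma nm_ee i z : nm (ee i z) <= nm z.
Proof. by apply: nm_sq_le; [exact: nm_ge0|rewrite -Re_hdotxx tp_eH tp_ee; exact: Re_hdot_le]. Qed.

Lemma E_dom l u : dom_ce (fun x : M l => am (E x)) u.
Proof.
have [xi hx] := @EN_dom _ _ F u.
have [ze hz] : dom (fun x : M l => am (lam x)) xi by apply: (emb_dom (fp_lam_emb F l)); exists xi.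
exists ze => x; rewrite -fpEN_lam lamM lamS; apply: le_trans (hx _) _.
by rewrite ler_sqr ?nnegrE ?nm_ge0.
Qed.

Lemma gen_dom : (forall l k, K0 k -> dom (@tp_t _ _ _ t l) k) -> forall z, gen z -> forall l, dom (@tp_t _ _ _ t l) z.
Proof.
move=> h z gz; pose P o z := if o is Some l then dom (@tp_t _ _ _ t l) z else dom tB z.
apply: (@gen_ind_good P) gz => [[l|]|[l|] c x y|l x|l x ex|l m x|i x|] //=.
- exact: dom0 (tp_rep t l).
- exact: dom0 (tp_rB t).
- by move=> hx hy; apply: domD hy; [exact: tp_rep|apply: domZ => //; exact: tp_rep].
- by move=> hx hy; apply: domD hy; [exact: tp_rB|apply: domZ => //; exact: tp_rB].
- move=> hx; have [xi hxi] := emb_dom (fp_io_emb F l) hx.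
  by exists xi => b; rewrite -(tp_io l).
- move=> hx; have [xi hxi] := ce_dom_ind (fpE_ce F l) (@E_dom l) (tp_rB t) hx.
  by exists xi => m; rewrite -ler_sqr ?nnegrE ?nm_ge0 // nm_tt.
- move=> [xi hx]; exists (am m xi) => y.
  by rewrite -(repM _ _ _ (tp_rep t l)) -(repM _ _ _ (@am_rep R (M l))).
- by move=> [xi hx]; exists xi => b; rewrite -tp_eB; apply: le_trans (hx b); exact: nm_ee.
Qed.

Definition mp (A A' D D' : Type) (f : A -> A') (q : D -> D') (X : seq (A * D)) := [seq (f p.1, q p.2) | p <- X].

Lemma mp_lmul (A A' D D' : cstarType R) (f : A -> A') (q : D -> D') X Y : star_hom f -> star_hom q ->
  mp f q (lmul X Y) = lmul (mp f q X) (mp f q Y).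
Proof.
move=> [_ fM _] [_ qM _]; rewrite /mp /lmul map_allpairs allpairs_mapl allpairs_mapr.
by apply: eq_allpairs => x y /=; rewrite fM qM.
Qed.

Lemma mp_lstar (A A' D D' : cstarType R) (f : A -> A') (q : D -> D') X : star_hom f -> star_hom q ->
  mp f q (lstar X) = lstar (mp f q X).
Proof.
move=> [_ _ fS] [_ _ qS]; rewrite /mp /lstar -!map_comp; apply: eq_map => p /=; by rewrite fS qS.
Qed.

Variables (D Q T' : cstarType R) (q : D -> Q) (tens' : N -> Q -> T') (ga : D -> Z -> Z).
Hypotheses (hq : star_hom q) (q1 : q cone = cone) (mt : is_min_tensor tens') (rg : is_rep ga).
Hypothesis ct : forall l (m : M l) y z, tt m (ga y z) = ga y (tt m z).
Hypothesis ce : forall l y z, ee l (ga y z) = ga y (ee l z).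

Lemma gen_ga : (forall y k, K0 k -> K0 (ga y k)) -> forall y z, gen z -> gen (ga y z).
Proof.
move=> Kg y z; elim=> [|c u v _ IHx _ IHy|k Kk|i k Kk|i n {}z gz IH ez].
- by rewrite (lin0 (rep_lin y rg)); exact: gen0.
- by rewrite (rep_lin y rg); exact: genD.
- by apply: genK; exact: Kg.
- by rewrite -ce; apply: genE; exact: Kg.
- by rewrite -ct; apply: genM => //; rewrite ce ez.
Qed.

(** The constant depends on [z]. The norm is taken after passing to [Q], so the estimate forces [ga]
    to factor through [q] on such vectors when [a cone] acts as the identity. *)
Definition crude (A : cstarType R) (f : A -> N) (a : A -> Z -> Z) z : Prop :=
  exists k, forall X : seq (A * D), nm (lact a ga X z) <= k * nm (tsum tens' (mp f q X)).

Lemma gen_nice : (forall l k, K0 k -> crude (@fp_lam R I F l) (@tp_t _ _ _ t l) k) ->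
  forall z, gen z -> forall l, crude (@fp_lam R I F l) (@tp_t _ _ _ t l) z.
Proof.
move=> h z gz; have [dat] := min_tensor_data mt; have rt := tp_rep t; have rb := tp_rB t.
have cB b y x : tB b (ga y x) = ga y (tB b x) by rewrite -!(tp_io (fp_i0 F)) ct.
pose P o z := if o is Some l then crude (@fp_lam R I F l) (@tp_t _ _ _ t l) z else crude iN tB z.
have c0 (A : cstarType R) (f : A -> N) (a : A -> Z -> Z) : is_rep a -> crude f a 0.
  by move=> ra; exists 0 => X; rewrite (lin0 (lact_bop X ra rg).1) nm0 mul0r.
have cD (A : cstarType R) (f : A -> N) (a : A -> Z -> Z) c x y : is_rep a -> crude f a x -> crude f a y -> crude f a (c *: x + y).
  move=> ra [k hk] [k' hk']; exists (nm c * k + k') => X; rewrite (lact_bop X ra rg).1.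
  apply: le_trans (nmD _ _) _; rewrite nmZ mulrDl -mulrA lerD //.
  by rewrite ler_wpM2l ?nm_ge0.
apply: (@gen_ind_good P) gz => [[l|]|[l|] c x y|l x|l x ex|l m x|i x|] //=; try exact: c0; try exact: cD.
- move=> [k hk]; exists k => X; have := hk [seq (io l p.1, p.2) | p <- X].
  rewrite /lact big_map /mp -map_comp.
  have -> : \sum_(p <- X) tt (io l p.1) (ga p.2 x) = \sum_(p <- X) tB p.1 (ga p.2 x).
    by apply: eq_bigr => p _; rewrite tp_io.
  by congr (_ <= _ * nm (tsum _ _)); apply: eq_map => p /=; rewrite fp_lam_io.
(* For [e l x = x], the squared norm is a coefficient of the expectation of [lstar X] times [X],
   which is contractive by [ce_tens]; hence the square root. *)
- move=> [k hk]; exists (Num.sqrt (`|k| * nm x)) => X; set Y := mp _ _ X.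
  have kx : 0 <= `|k| * nm x by rewrite mulr_ge0 ?nm_ge0.
  rewrite -ler_sqr ?nnegrE ?nm_ge0 ?mulr_ge0 ?sqrtr_ge0 ?nm_ge0 // exprMn sqr_sqrtr //.
  rewrite -Re_hdotxx -(lact_star _ _ _ (rt l) rg (@ct l)) -(lact_mul _ _ _ (rt l) rg (@ct l)).
  have -> : hdot (lact (@tp_t _ _ _ t l) ga (lmul (lstar X) X) x) x =
      hdot (lact tB ga [seq (E p.1, p.2) | p <- lmul (lstar X) X] x) x.
    rewrite /lact big_map !hdot_suml; apply: eq_bigr => p _ /=.
    have -> : ga p.2 x = ee l (ga p.2 x) by rewrite ce ex.
    by rewrite -{2}ex tp_R1 ex.
  apply: le_trans (Re_hdot_le _ _) _.
  apply: le_trans (ler_wpM2r (nm_ge0 _) (hk _)) _.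
  rewrite mulrAC -[leRHS]mulrA; apply: le_trans (_ : `|k| * nm x * nm (tsum tens' (mp iN q [seq (E p.1, p.2) | p <- lmul (lstar X) X])) <= _).
    by rewrite ler_wpM2r ?nm_ge0 // ler_wpM2r ?nm_ge0 // ler_norm.
  rewrite mulrA ler_wpM2l //.
  have -> : mp iN q [seq (E p.1, p.2) | p <- lmul (lstar X) X] = [seq (iN (EN p.1), p.2) | p <- lmul (lstar Y) Y].
    rewrite -(mp_lstar _ (lam_hom F l) hq) -(mp_lmul _ _ (lam_hom F l) hq) /mp -!map_comp.
    by apply: eq_map => p /=; rewrite fpEN_lam.
  apply: le_trans (ce_tens mt (@iN_hom _ _ F) (iN1 F) (@ENce _ _ F) _) _.
  by rewrite (md_mul dat) (md_star dat) nmCS.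
- move=> [k hk]; exists (`|k| * nm (tens' (lam m) cone)) => X.
  have -> : lact (@tp_t _ _ _ t l) ga X (tt m x) = lact (@tp_t _ _ _ t l) ga (lmul X [:: (m, cone)]) x.
    rewrite /lact (@big_allpairs_ R _ _ _ (fun p => tt p.1 (ga p.2 x))); apply: eq_bigr => p _.
    by rewrite big_seq1 /= cmulr1 (repM _ _ _ (rt l)) -ct.
  apply: le_trans (hk _) _; rewrite (mp_lmul _ _ (lam_hom F l) hq) (md_mul dat) {2}/mp /= tsum1 q1.
  apply: le_trans (ler_wpM2r (nm_ge0 _) (ler_norm k)) _; rewrite -mulrA ler_wpM2l // mulrC; exact: nmCM.
- move=> [k hk]; exists k => X.
  have -> : lact tB ga X (ee i x) = ee i (lact tB ga X x).
    rewrite /lact (linS _ _ (le i)); apply: eq_bigr => p _; by rewrite tp_eB ce.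
  exact: le_trans (nm_ee _ _) (hk X).
Qed.

End Good.

Section Dilate.
Variables (R : realType) (I : Type) (F : fpdata R I).
Local Notation C := R[i].
Local Notation B := (fpB F).
Local Notation M := (fpM F).
Local Notation N := (fpN F).
Local Notation iN := (@fp_iN R I F).
Local Notation lam := (@fp_lam R I F).
Local Notation D1 := (im_W (d1 F)).

Lemma mp_lpow (A A' D D' : cstarType R) (f : A -> A') (g : D -> D') X n : star_hom f -> star_hom g ->
  mp f g (lpow X n) = lpow (mp f g X) n.
Proof. by move=> hf hg; elim: n => //= n IH; rewrite mp_lmul // IH. Qed.

Lemma id_hom (A : cstarType R) : star_hom (@id A). Proof. by []. Qed.

Variables (D Q : cstarType R) (q : D -> Q) (T : cstarType R) (tens : N -> D -> T) (dat : mtdata tens).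
Variables (T' : cstarType R) (tens' : N -> Q -> T') (K : hilbertType R) (pi : T -> K -> K) (pit : N -> Q -> K -> K).
Hypotheses (hq : star_hom q) (qs : forall y, exists x, q x = y) (mt : is_min_tensor tens') (rp : is_rep pi).
Hypothesis pitE : forall m c, pit m (q c) = pi (tens m c).
Hypothesis weak : forall l, exists k : R, forall (s : seq (M l * Q)) v,
  nm (\sum_(p <- s) pit (lam p.1) p.2 v) <= k * nm (tsum tens' [seq (lam p.1, p.2) | p <- s]) * nm v.
Hypothesis sdom : forall v, dom (fun n => pi (tens n cone)) v.

Lemma q_one : q cone = cone.
Proof.
have [x qx] := qs cone; have [_ qM _] := hq.
by rewrite -[RHS]qx -[in RHS](cmul1r x) qM qx cmulr1.
Qed.

(** The real part of the vector functional is real-linear on combinations of operators [n (x) d],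
    and [comp_pos] bounds it by the numerical range. Its extension lives on all operators, so the
    projections [d1e] act in the GNS space. *)
Lemma state_dilation v : pi cone v = v -> exists (Kt : hilbertType R) (Psi : BH D1 -> Kt -> Kt) (ga : D -> Kt -> Kt) (Om : Kt),
  let tau n := Psi (mkb (rep_bop n (im_rep (d1 F)))) in
  [/\ is_rep Psi, forall x, Psi cone x = x, is_rep ga, forall x c z, Psi x (ga c z) = ga c (Psi x z) &
      forall X, hdot (lact tau ga X Om) Om = hdot (pi (tsum tens X) v) v].
Proof.
move=> pv; have [P1 [t1 ht]] := hilbert_tensor_ex D1 (md_L dat).
pose rd := im_rep (d1 F); have [_ _ rr _ _] := md_tact dat.
have [aB [be ta0]] := tact_ex ht (@ev_rep R D1) rr; have [_ _ _ [raB rbe] [aBE beE]] := ta0.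
pose nb n : BH D1 := mkb (rep_bop n rd); have hnb : star_hom nb := rep_hom rd.
pose al1 n := aB (nb n); have ral : is_rep al1 := comp_rep hnb raB.
have ta : tact t1 (im_al (d1 F)) (md_rho dat) al1 be by split=> //; split=> // a h l; rewrite /al1 aBE.
pose LX X : BH P1 := mkb (lact_bop X ral rbe).
have evLX Y d : ev (LX Y) d = lact al1 be Y d by [].
pose U := [set d | al1 cone (be cone d) = d].
pose G0 := [set p : BH P1 * R | exists X, p.1 = LX X /\ p.2 = complex.Re (hdot (pi (tsum tens X) v) v)].
have [|||||| Kt [Pi [Om [rPi Pi1 hPi]]]] := @state_gns R P1 U G0 (nm v ^+ 2).
- by rewrite /U /= (lin0 (rep_lin _ rbe)) (lin0 (rep_lin _ ral)).
- by move=> c d; rewrite /U /= (linZ _ _ (rep_lin _ rbe)) (linZ _ _ (rep_lin _ ral)) => ->.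
- exact: sqr_ge0.
- exists [::]; split; first by apply: bopT_ext => d; rewrite /= /lact big_nil.
  by rewrite /tsum big_nil (rep0 _ rp) hdot0l.
- move=> r [_ _] [_ _] [X [/= -> ->]] [X' [/= -> ->]]; exists ([seq (r%:C *: p.1, p.2) | p <- X] ++ X'); split.
    apply: (@ev_inj R P1); apply/funext => d; rewrite -[LHS]/(ev (r%:C *: LX X + LX X') d) (repL d (@ev_rep R P1)) !evLX /lact big_cat big_map /= scaler_sumr; congr (_ + _).
    by apply: eq_bigr => p _; rewrite (repZ _ _ _ ral).
  have -> : tsum tens ([seq (r%:C *: p.1, p.2) | p <- X] ++ X') = r%:C *: tsum tens X + tsum tens X'.
    rewrite /tsum big_cat big_map /= scaler_sumr; congr (_ + _); apply: eq_bigr => p _.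
    by rewrite (linZ _ _ (@md_linl _ _ _ _ _ dat p.2)).
  by rewrite [LHS]/= (repL _ rp) hdotDl hdotZl -Re_real_mul; case: (_ * _) => ? ?; case: (hdot _ _).
- move=> [_ _] k [X [/= -> ->]] hk; rewrite mulrC; exact: (comp_pos ta (@d1_inj _ _ F) rp pv hk).
pose j1 x : BH P1 := mkb (rep_bop x raB); have hj1 : star_hom j1 := rep_hom raB.
pose gb c : BH P1 := mkb (rep_bop c rbe); have hgb : star_hom gb := rep_hom rbe.
exists Kt, (fun x => Pi (j1 x)), (fun c => Pi (gb c)), Om; move=> tau.
have key X : complex.Re (hdot (lact tau (fun c => Pi (gb c)) X Om) Om) = complex.Re (hdot (pi (tsum tens X) v) v).
  apply: etrans (hPi (LX X, complex.Re (hdot (pi (tsum tens X) v) v)) _); last by exists X.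
  congr (complex.Re (hdot _ _)); rewrite /lact /=.
  have -> : LX X = \sum_(p <- X) (j1 (nb p.1) ** gb p.2).
    by apply: (@ev_inj R P1); apply/funext => d; rewrite (rep_sum _ _ _ (@ev_rep R P1)).
  apply: etrans (esym (rep_sum _ _ Om rPi)); apply: eq_bigr => p _.
  by rewrite (repM _ _ _ rPi).
split.
- exact: comp_rep hj1 rPi.
- move=> x; rewrite -[RHS]Pi1; congr (Pi _ x); apply: bopT_ext => d /=.
  have [_ tt] := ht; apply: (bop_ext (rep_bop cone raB) (bop_id _) tt) => _ [p _ <-] /=.
  by rewrite aBE.
- exact: comp_rep hgb rPi.
- move=> x c z; rewrite -!(repM _ _ _ rPi); congr (Pi _ z); apply: bopT_ext => d /=.
  exact: (tact_com ta0).
- move=> X; pose i0 : C := 0 +i* 1; have rt : is_rep tau by exact: comp_rep hnb (comp_rep hj1 rPi).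
  have e2 := key [seq (i0 *: p.1, p.2) | p <- X]; have e1 := key X.
  have tE : tsum tens [seq (i0 *: p.1, p.2) | p <- X] = i0 *: tsum tens X.
    rewrite /tsum big_map /= scaler_sumr; apply: eq_bigr => p _.
    by rewrite (linZ _ _ (@md_linl _ _ _ _ _ dat p.2)).
  have lE : lact tau (fun c => Pi (gb c)) [seq (i0 *: p.1, p.2) | p <- X] Om = i0 *: lact tau (fun c => Pi (gb c)) X Om.
    rewrite /lact big_map /= scaler_sumr; apply: eq_bigr => p _; by rewrite (repZ _ _ _ rt).
  move: e1 e2; rewrite tE lE (repZ _ _ _ rp) !hdotZl.
  case: (hdot _ Om) (hdot _ v) => a b [c d] /= -> h; congr Complex; move: h; lra.
Qed.

Lemma dilate v : pi cone v = v -> exists (t : toep F) (rho : Q -> tp_Z t -> tp_Z t) (Om : tp_Z t),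
  [/\ is_rep rho,
      (forall l (m : M l) y z, tp_t m (rho y z) = rho y (tp_t m z)) /\
        (forall l y z, tp_e l (rho y z) = rho y (tp_e l z)),
      forall l (X : seq (M l * Q)) z,
        nm (lact (@tp_t _ _ _ t l) rho X z) <= nm (tsum tens' [seq (lam p.1, p.2) | p <- X]) * nm z,
      forall l z, dom (@tp_t _ _ _ t l) z &
      nm Om = nm v /\ forall w b y, red None w ->
        hdot (tw w (tp_tB b (rho y Om))) Om = hdot (pit (wv w ** iN b) y v) v].
Proof.
move=> pv; have [Kt [Psi [ga [Om0 [rPsi Psi1 rga cPg hOm]]]]] := state_dilation pv.
pose rd := im_rep (d1 F); have [dat'] := min_tensor_data mt.
pose nb n : BH D1 := mkb (rep_bop n rd); have hnb : star_hom nb := rep_hom rd.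
pose tau n := Psi (nb n); have rt : is_rep tau := comp_rep hnb rPsi.
have com n c z : tau n (ga c z) = ga c (tau n z) by exact: cPg.
have tau1 z : tau cone z = z.
  by rewrite -[RHS]Psi1; congr (Psi _ z); apply: bopT_ext => d /=; rewrite im_al1.
have nOm X : nm (lact tau ga X Om0) = nm (pi (tsum tens X) v).
  apply/eqP; rewrite -(@eqrXn2 _ 2) ?nm_ge0 // -!Re_hdotxx; apply/eqP; congr complex.Re.
  rewrite -(lact_star _ _ _ rt rga com) -(lact_mul _ _ _ rt rga com) hOm (md_mul dat) (md_star dat).
  by rewrite (repM _ _ _ rp) (rep_starl _ _ _ rp).
pose t0 : toep F := @toep_push R I F (toep_d1 F) Kt Psi rPsi Psi1.
have ttE l (m : M l) z : tp_t (t := t0) m z = tau (lam m) z by congr (Psi _ z); exact: bopT_ext.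
have tBE b z : tp_tB (t := t0) b z = tau (iN b) z by congr (Psi _ z); exact: bopT_ext.
have ct l (m : M l) c z : tp_t (t := t0) m (ga c z) = ga c (tp_t (t := t0) m z) by exact: cPg.
have ce l c z : tp_e (t := t0) l (ga c z) = ga c (tp_e (t := t0) l z) by exact: cPg.
pose K0 : set (tp_Z t0) := [set k | exists X, k = lact tau ga X Om0].
have tauK n X : tau n (lact tau ga X Om0) = lact tau ga (lmul [:: (n, cone)] X) Om0.
  rewrite /lact (linS _ _ (rep_lin n rt)) (@big_allpairs_ R _ _ _ (fun p => tau p.1 (ga p.2 Om0))) big_seq1.
  by apply: eq_bigr => p _; rewrite /= cmul1r (repM _ _ _ rt).
have gaK c X : ga c (lact tau ga X Om0) = lact tau ga (lmul [:: (cone, c)] X) Om0.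
  rewrite /lact (linS _ _ (rep_lin c rga)) (@big_allpairs_ R _ _ _ (fun p => tau p.1 (ga p.2 Om0))) big_seq1.
  by apply: eq_bigr => p _; rewrite /= cmul1r (repM _ _ _ rga) -com.
have Kt0 l (m : M l) k : K0 k -> K0 (tp_t (t := t0) m k).
  by move=> [X ->]; rewrite ttE tauK; eexists.
have Kg c k : K0 k -> K0 (ga c k) by move=> [X ->]; rewrite gaK; eexists.
have Kn l k : K0 k -> crude (t := t0) q tens' ga (@fp_lam R I F l) (@tp_t _ _ _ t0 l) k.
  move=> [Y ->]; have [k' hk'] := weak l; exists (k' * nm (pi (tsum tens Y) v)) => X.
  have -> : lact (@tp_t _ _ _ t0 l) ga X (lact tau ga Y Om0) = lact tau ga (lmul (mp (@fp_lam R I F l) id X) Y) Om0.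
    rewrite (lact_mul _ _ _ rt rga com) /lact big_map; apply: eq_bigr => p _; exact: ttE.
  rewrite nOm (md_mul dat) (repM _ _ _ rp) mulrAC.
  have := hk' (mp id q X) (pi (tsum tens Y) v).
  have -> : \sum_(p <- mp id q X) pit (lam p.1) p.2 (pi (tsum tens Y) v) =
      pi (tsum tens (mp (@fp_lam R I F l) id X)) (pi (tsum tens Y) v).
    move: (pi _ v) => u; rewrite /tsum (rep_sum _ _ _ rp) !big_map; apply: eq_bigr => p _; by rewrite /= pitE.
  by rewrite /mp -map_comp.
have Kd l k : K0 k -> dom (@tp_t _ _ _ t0 l) k.
  move=> [Y ->]; have [xi hx] := emb_dom (fp_lam_emb F l) (sdom (pi (tsum tens Y) v)); exists xi => m.
  by rewrite ttE tauK nOm (md_mul dat) tsum1 (repM _ _ _ rp).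
pose S := gen K0; have [L [j [bj jd jS tS jT]]] := subspace_ex S.
have St l (m : M l) x : S x -> S (tp_t (t := t0) m x) by exact: gen_t.
have Se l x : S x -> S (tp_e (t := t0) l x) by exact: gen_e.
have Sg c x : S x -> S (ga c x) by move=> Sx; exact: (@gen_ga _ _ _ t0 K0 D ga rga ct ce Kg c x Sx).
have Sn x l : S x -> crude (t := t0) q tens' ga (@fp_lam R I F l) (@tp_t _ _ _ t0 l) x.
  by move=> Sx; exact: (@gen_nice _ _ _ t0 K0 D Q T' q tens' ga hq q_one mt rga ct ce Kn x Sx).
have Sd x l : S x -> dom (@tp_t _ _ _ t0 l) x by move=> Sx; exact: (@gen_dom _ _ _ t0 K0 Kd x Sx).
pose t : toep F := @toep_sub R I F t0 L S j bj jd jT St Se.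
have ji := j_inj bj jd.
have jt l (m : M l) z : j (tp_t (t := t) m z) = tp_t (t := t0) m (j z) by exact: (hat_t jT St).
have je l z : j (tp_e (t := t) l z) = tp_e (t := t0) l (j z) by exact: (hat_e jT Se).
have jB b z : j (tp_tB (t := t) b z) = tp_tB (t := t0) b (j z) by exact: (hat_B jT St).
have nj z : nm (j z) = nm z by apply/eqP; rewrite -(@eqrXn2 _ 2) ?nm_ge0 // -!Re_hdotxx jd.
have [sec hsec] := choice qs.
pose rho y := hat j (ga (sec y)).
have jr0 c l : j (hat j (ga c) l) = ga c (j l) by exact: (jT _ (rep_bop c rga) (Sg c) l).
have [lq qM qS] := hq.
have qgr c c' l : q c = q c' -> ga c (j l) = ga c' (j l).
  move=> e; apply: (bop_ext (bop_comp (rep_bop c rga) bj) (bop_comp (rep_bop c' rga) bj) tS) => {}l /= Sl.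
  apply/eqP; rewrite -subr_eq0 -(repB _ _ _ rga); apply/eqP/nm0_eq0/eqP; rewrite eq_le nm_ge0 andbT.
  have [k hk] := Sn _ (fp_i0 F) Sl; have := hk [:: (cone, c - c')].
  rewrite /lact big_seq1 (_ : tp_t (t := t0) _ _ = ga (c - c') (j l)); last exact: (@tp_one _ _ _ t0).
  rewrite /mp /= tsum1 (linB _ _ lq) e subrr (lin0 (@md_linr _ _ _ _ _ dat' _)) nm0 mulr0.
  exact.
have jr y l : j (rho y l) = ga (sec y) (j l) by exact: jr0.
have rr : is_rep rho.
  apply: is_repP => [y|z|y y' z|y z w]; first exact: hat_bop (rep_bop _ rga).
  - move=> c y y'; apply: ji; rewrite bj.1 !jr -(repL _ rga); apply: qgr.
    by rewrite lq !hsec.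
  - by apply: ji; rewrite !jr -(repM _ _ _ rga); apply: qgr; rewrite qM !hsec.
  - rewrite -!jd !jr -(rep_starl _ _ _ rga); congr (hdot _ _); apply: qgr; by rewrite qS !hsec.
have ct' l (m : M l) y z : tp_t (t := t) m (rho y z) = rho y (tp_t (t := t) m z).
  by apply: ji; rewrite jt !jr jt ct.
pose Om1 := lact tau ga [:: (cone, cone)] Om0; have S1 : S Om1 by apply: genK; eexists.
have hOm1 X : hdot (lact tau ga X Om1) Om1 = hdot (pi (tsum tens X) v) v.
  rewrite /Om1 -(lact_mul _ _ _ rt rga com) -(lact_star _ _ _ rt rga com) -(lact_mul _ _ _ rt rga com) hOm.
  by rewrite !(md_mul dat) (md_star dat) tsum1 (md_one dat) star1 cmul1r cmulr1.
exists t, rho, (adj j Om1); split=> //.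
- by split=> // l y z; apply: ji; rewrite je !jr je ce.
- move=> l X; set c := nm _.
  apply: (lact_bound (S := [set z | S (j z)]) (tp_rep t l) rr (@ct' l)) => // [|z Sz]; first exact: nm_ge0.
  have [k hk] := Sn _ l Sz; exists `|k| => n; set Y := lpow _ _.
  have := hk (mp id sec Y); have -> : mp (@fp_lam R I F l) q (mp id sec Y) = mp (@fp_lam R I F l) id Y.
    by rewrite /mp -map_comp; apply: eq_map => p /=; rewrite hsec.
  have -> : lact (@tp_t _ _ _ t0 l) ga (mp id sec Y) (j z) = j (lact (@tp_t _ _ _ t l) rho Y z).
    by rewrite /lact (linS _ _ bj.1) big_map; apply: eq_bigr => p _ /=; rewrite jt jr.
  rewrite nj => h; apply: le_trans h _; apply: le_trans (ler_wpM2r (nm_ge0 _) (ler_norm k)) _.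
  rewrite ler_wpM2l // /Y mp_lpow; [|exact: lam_hom|exact: id_hom].
  rewrite mp_lmul ?mp_lstar; try exact: lam_hom; try exact: id_hom.
  exact: (nm_lpow dat').
- move=> l; apply: (@dom_total R (M l) _ _ [set z | S (j z)] (tp_rep t l)) => // z Sz; have [xi hx] := Sd _ l Sz.
  by exists xi => m; rewrite -nj jt.
split.
  rewrite -nj jS // /Om1 nOm tsum1 (md_one dat) pv //.
move=> w b y rw; rewrite -jd jS // -(hsec y) pitE hsec -[tens _ _]tsum1 -hOm1; congr (hdot _ _).
rewrite /lact big_seq1 /= (repM _ _ _ rt).
elim: w {rw} => [|x w IH] /=; first by rewrite jB tBE jr jS // tau1.
by rewrite jt IH ttE (repM _ _ _ rt).
Qed.

End Dilate.

(** * The norm estimate *)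

Section Final.
Variables (R : realType) (I : Type) (F : fpdata R I).
Local Notation C := R[i].
Local Notation B := (fpB F).
Local Notation M := (fpM F).
Local Notation N := (fpN F).
Local Notation iN := (@fp_iN R I F).
Local Notation lam := (@fp_lam R I F).
Local Notation D1 := (im_W (d1 F)).
Local Notation al1 := (im_al (d1 F)).

Lemma domF_hdot (K : hilbertType R) (al : N -> K -> K) (v w : K) : dom al v -> domF (fun n => hdot (al n v) w).
Proof.
move=> dv; apply: (domF_dom (T := fun u => hdot u w) dv); split=> [c x y|]; first by rewrite hdotDl hdotZl.
by exists (nm w) => u; rewrite mulrC; exact: hdot_nm.
Qed.

Lemma domF_sum (W : normedModType C) (Y : Type) (s : seq Y) (f : Y -> N -> W) :
  (forall y, domF (f y)) -> domF (fun n => \sum_(y <- s) f y n).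
Proof.
move=> hf; elim: s => [|y s IH].
  by exists 0 => n; rewrite big_nil nm0 nm_ge0.
have hN : domF (fun n => - \sum_(y <- s) f y n) by case: IH => xi h; exists xi => n; rewrite nmN.
have [xi hx] := domFB (hf y) hN.
by exists xi => n; rewrite big_cons; have := hx n; rewrite opprK.
Qed.

Lemma md_rep_left (A D T : cstarType R) (tens : A -> D -> T) (dat : mtdata tens) (K : hilbertType R) (pi : T -> K -> K) :
  is_rep pi -> is_rep (fun a => pi (tens a cone)).
Proof.
apply: (comp_rep (iota := fun a => tens a cone)); split=> [|a b|a].
- exact: md_linl dat _.
- by rewrite (md_mul1 dat) cmul1r.
- by rewrite (md_star1 dat) star1.
Qed.

Lemma tw_d1 w (x : tp_Z (toep_d1 F)) : tw w x = al1 (wv w) x.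
Proof.
elim: w => [|l w IH] /=; first by rewrite im_al1.
by rewrite IH (repM _ _ _ (im_rep (d1 F))).
Qed.

Variables (D Q : cstarType R) (q : D -> Q) (T : cstarType R) (tens : N -> D -> T) (dat : mtdata tens).
Variables (T' : cstarType R) (tens' : N -> Q -> T') (K : hilbertType R) (pi : T -> K -> K) (pit : N -> Q -> K -> K).
Hypotheses (hq : star_hom q) (qs : forall y, exists x, q x = y) (mt : is_min_tensor tens') (rp : is_rep pi).
Hypothesis pitE : forall m c, pit m (q c) = pi (tens m c).
Hypothesis weak : forall l, exists k : R, forall (s : seq (M l * Q)) v,
  nm (\sum_(p <- s) pit (lam p.1) p.2 v) <= k * nm (tsum tens' [seq (lam p.1, p.2) | p <- s]) * nm v.
Let sg n := pi (tens n cone).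
Hypothesis sdom : forall v, dom sg v.

Let rsg : is_rep sg. Proof. exact (md_rep_left dat rp). Qed.

Let sg1 v : sg cone v = pi cone v. Proof. by rewrite /sg (md_one dat). Qed.

Local Notation Y := ({S : D1 -> K | hom al1 sg S} * D1)%type.
Local Notation comb L := (\sum_(p <- L) sval p.1 p.2).

Lemma quad_bound (L : seq Y) (X : seq (N * Q)) :
  nm (\sum_(p <- X) hdot (pit p.1 p.2 (comb L)) (comb L)) <= nm (tsum tens' X) * nm (comb L) ^+ 2.
Proof.
set v := comb L; have rd := im_rep (d1 F); have ra1 := im_rep (nn (toep_d1 F)).
have bS (S : {S : D1 -> K | hom al1 sg S}) : bop (sval S) by case: S => S [].
have hS (S : {S : D1 -> K | hom al1 sg S}) n x : sval S (al1 n x) = sg n (sval S x) by case: S => S [_ h] /=.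
have pv : pi cone v = v.
  rewrite -sg1 /v (linS _ _ (rep_lin _ rsg)); apply: eq_bigr => p _; by rewrite -hS im_al1.
have [t [rho [Om [rr [ct ce] nice dm [nO hO]]]]] := dilate dat hq qs mt rp pitE weak sdom pv.
have [be [rbe nbe cbe Vbe]] := nn_right mt rr ct ce nice.
have [s [V1 [J [hV1 Jd Jal Jlim]]]] := dil_lim F.
have [sec hsec] := choice qs; pose vy y := pi (tens cone (star (sec y))) v.
have pitv n y : hdot (pit n y v) v = hdot (sg n v) (vy y).
  rewrite -{1}(hsec y) pitE; have -> : tens n (sec y) = tens cone (sec y) ** tens n cone.
    by rewrite (md_mul1 dat) cmul1r cmulr1.
  by rewrite (repM _ _ _ rp) (rep_star _ _ _ rp) (md_star1 dat) star1.
pose G k n y := \sum_(p <- L) hdot (im_al (nn (toep_d1 F)) n (V1 k p.2)) (V1 k (adj (sval p.1) (vy y))).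
have Glim n y : nlim (fun k => G k n y) (hdot (pit n y v) v).
  have [c _ hc] := bop_ge0 (rep_bop n ra1).
  have -> : hdot (pit n y v) v = \sum_(p <- L) hdot (im_al (nn (toep_d1 F)) n (J p.2)) (J (adj (sval p.1) (vy y))).
    rewrite pitv {1}/v (linS _ _ (rep_lin _ rsg)) hdot_suml; apply: eq_bigr => p _.
    by rewrite Jal Jd -hS (adjP _ _ (bS _)).
  apply: nlim_sum => p; apply: nlim_hdot2 (Jlim _).
  apply: (@nlim_map _ _ _ (im_al (nn (toep_d1 F)) n) c) (Jlim _) => x x'.
  by rewrite -(linB _ _ (rep_lin n ra1)).
have key k : nm (\sum_(p <- X) G k p.1 p.2) <= nm (tsum tens' X) * nm v ^+ 2.
  have [s0 s1 dV1] := hV1 k; have [V dV] := dilation_ex t s0 s1.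
  have ral := im_rep (nn t); have bV := dil_bop dV; have bV1 := dil_bop dV1.
  have GE n y : hdot (im_al (nn t) n (be y (V Om))) (V Om) = G k n y.
    apply/eqP; rewrite -subr_eq0; apply/eqP; move: n.
    apply: (@domF_eq0 _ _ F C (fun n => hdot (im_al (nn t) n (be y (V Om))) (V Om) - G k n y)).
    - move=> c a b; rewrite (repL _ ral) hdotDl hdotZl.
      have -> : G k (c *: a + b) y = c * G k a y + G k b y.
        rewrite /G mulr_sumr -big_split; apply: eq_bigr => p _.
        by rewrite (repL _ ra1) hdotDl hdotZl.
      by rewrite opprD addrACA -mulrBr.
    - apply: domFB; first exact: domF_hdot (nn_dom dm _).
      by apply: domF_sum => p; exact: domF_hdot (d1_nn_dom _).
    - move=> _ [w [b [rw ->]]]; rewrite /G.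
      have -> : \sum_(p <- L) hdot (im_al (nn (toep_d1 F)) (wv w ** iN b) (V1 k p.2)) (V1 k (adj (sval p.1) (vy y))) =
          (s k)%:C ^+ size w * hdot (pit (wv w ** iN b) y v) v.
        rewrite pitv {1}/v (linS _ _ (rep_lin _ rsg)) hdot_suml mulr_sumr; apply: eq_bigr => p _.
        rewrite (repM _ _ _ ra1) -(dil_B dV1) (adjPr _ _ bV1) (dil_word s0 s1 dV1 _ rw) hdotZl tw_d1.
        by rewrite -hS (adjP _ _ (bS _)) (repM _ _ _ rd).
      rewrite (repM _ _ _ ral) -(Vbe _ _ s0 s1 dV) -(dil_B dV) (adjPr _ _ bV) (dil_word s0 s1 dV _ rw).
      by rewrite hdotZl hO // subrr.
  have -> : \sum_(p <- X) G k p.1 p.2 = hdot (lact (im_al (nn t)) be X (V Om)) (V Om).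
    by rewrite /lact hdot_suml; apply: eq_bigr => p _; rewrite -GE.
  have nV : nm (V Om) = nm v.
    by rewrite -nO; apply/eqP; rewrite -(@eqrXn2 _ 2) ?nm_ge0 // -!Re_hdotxx (dil_dot dV).
  apply: le_trans (hdot_nm _ _) _; apply: le_trans (ler_wpM2r (nm_ge0 _) (nbe X _)) _.
  by rewrite nV expr2 mulrA.
apply: (nlim_le (u := fun k => \sum_(p <- X) G k p.1 p.2)) key.
by apply: nlim_sum => p; exact: Glim.
Qed.

Lemma op_bound (X : seq (N * Q)) v : nm (\sum_(p <- X) pit p.1 p.2 v) <= nm (tsum tens' X) * nm v.
Proof.
have rd := im_rep (d1 F); have [dat'] := min_tensor_data mt; have [sec hsec] := choice qs.
have pits (Z : seq (N * Q)) u : \sum_(p <- Z) pit p.1 p.2 u = pi (tsum tens (mp id sec Z)) u.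
  by rewrite /tsum (rep_sum _ _ _ rp) big_map; apply: eq_bigr => p _; rewrite -pitE hsec.
have pitm (Z : seq (N * D)) u : \sum_(p <- mp id q Z) pit p.1 p.2 u = pi (tsum tens Z) u.
  by rewrite /tsum (rep_sum _ _ _ rp) big_map; apply: eq_bigr => p _; rewrite /= pitE.
have mpq (Z : seq (N * Q)) : mp id q (mp id sec Z) = Z.
  by rewrite /mp -map_comp -[RHS]map_id; apply: eq_map => -[a b] /=; rewrite hsec.
set c := nm (tsum tens' X); pose Op u := \sum_(p <- X) pit p.1 p.2 u.
have bOp : bop Op.
  by rewrite (_ : Op = pi (tsum tens (mp id sec X))); [exact: rep_bop rp|apply/funext => u; exact: pits].
have onL (L : seq Y) : nm (Op (comb L)) <= c * nm (comb L).
  set u := comb L; rewrite -ler_sqr ?nnegrE ?mulr_ge0 ?nm_ge0 // exprMn.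
  have := quad_bound L (lmul (lstar X) X); rewrite -/u (md_mul dat') (md_star dat') nmCS.
  apply: le_trans; rewrite -Re_hdotxx /Op pits; set x := mp id sec X.
  rewrite -(rep_starl _ _ _ rp) -(repM _ _ _ rp) -(md_star dat) -(md_mul dat) -pitm.
  rewrite mp_lmul ?mp_lstar ?mpq; try exact: id_hom; try exact: hq.
  by rewrite hdot_suml; exact: Re_nm.
have on1 u : sg cone u = u -> nm (Op u) <= c * nm u.
  move=> su; have [S [xi [[bS iS] <-]]] := dom_range rsg (sdom u) su.
  have [k k0 hk] := bop_ge0 (bop_comp bOp bS); have [k' k0' hk'] := bop_ge0 bS.
  apply/ler_addgt0Pr => e e0; have c0 : 0 <= c := nm_ge0 _.
  have d0 : 0 < k + c * k' + 1 by have := mulr_ge0 c0 (ltW k0'); lra.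
  have tot := hom_dense rd (@d1_inj _ _ F) (fun w : D1 => im_al1 w) (@d1_dom _ _ F).
  have [eta se he] := span_approx (total_cspan _ xi tot) (divr_gt0 e0 d0).
  have [L hL] : exists L : seq Y, S eta = comb L.
    elim: se => [|a x y [V [w [hV ->]]] _ [L hL]]; first by exists [::]; rewrite big_nil (lin0 bS.1).
    have hV' : hom al1 sg (S \o V) by exact: hom_comp hV.
    exists ((exist _ _ hV', a *: w) :: L); rewrite big_cons /= bS.1 hL.
    by have [bV _] := hV; rewrite (linZ _ _ bV.1) (linZ _ _ bS.1).
  have h1 := onL L; rewrite -hL in h1.
  have h2 := hk (xi - eta); rewrite /= (linB _ _ bS.1) (linB _ _ bOp.1) in h2.
  have h3 := hk' (xi - eta); rewrite (linB _ _ bS.1) in h3.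
  have h4 : nm (Op (S xi)) <= nm (Op (S xi) - Op (S eta)) + nm (Op (S eta)).
    by rewrite -{1}[Op (S xi)](subrK (Op (S eta))); exact: nmD.
  have h5 : nm (S eta) <= nm (S xi - S eta) + nm (S xi).
    by rewrite nmBC -{1}[S eta](subrK (S xi)); exact: nmD.
  have h6 : (k + c * k') * nm (xi - eta) <= e.
    have := ltW he; rewrite ler_pdivlMr // => h; apply: le_trans h; rewrite mulrC.
    by have := nm_ge0 (xi - eta); have := mulr_ge0 c0 (ltW k0'); nra.
  have h7 := ler_wpM2l c0 h5; have h8 := ler_wpM2l c0 h3.
  by move: h7 h8 h6; rewrite mulrDr mulrDl mulrA; lra.
have OpE : Op v = Op (sg cone v) by rewrite /Op !pits sg1 -(repM _ _ _ rp) cmulr1.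
rewrite -/(Op v) OpE; apply: le_trans (on1 _ _) _; first by rewrite -(repM _ _ _ rsg) cmul1r.
by apply: ler_wpM2l; [exact: nm_ge0|exact: rep_nm1 rsg].
Qed.

End Final.

Theorem theorem1p1 (R : realType) (I : Type) (I_nonempty : inhabited I)
    (B : vonNeumann R) (phi : B -> complex R)
    (phiP : faithful_normal_state phi)
    (M : I -> vonNeumann R)
    (M_weakly_exact : forall i, weakly_exact (M i))
    (M_sigma_finite : forall i, sigma_finite_vn (M i))
    (iota : forall i, B -> M i) (iotaP : forall i, vn_embedding (iota i))
    (E : forall i, M i -> B)
    (EP : forall i, faithful_normal_cond_exp (iota i) (E i))
    (N : vonNeumann R) (iotaN : B -> N) (lambda : forall i, M i -> N)
    (EN : N -> B)
    (NP : is_amalgamated_free_product iota E iotaN lambda EN) :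
  weakly_exact N.
Proof.
have [i0] := I_nonempty; have [[lamP lam_io] ENP gen ENlam free] := NP.
have Ece i : conditional_expectation (iota i) (E i) by case: (EP i).
pose F : fpdata R I := FPData i0 iotaP lamP lam_io Ece ENP gen ENlam free.
move=> D Q J q cJ qJ T tens mT T' tens' mT' K pi rp kJ uw pit pitE.
have [dat] := min_tensor_data mT; have [hq qs _] := qJ.
have weak l := weakly_exact_embed (M_weakly_exact l) (lamP l) cJ qJ mT mT' rp kJ uw pitE.
exists 1 => s v; rewrite !nmE -!rmorphM /= lecR mul1r.
apply: (@op_bound R I F D Q q T tens dat T' tens' K pi pit hq qs mT' rp pitE weak).
exact: uw_dom (md_rep_left dat rp) uw.
Qed.
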